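(* If $\delta$ and $\nu_1$ are sufficiently small, then for all $t\ge0$: $$\|{\bf J}_1\|_{H^1(\Omega)}\lesssim(\delta+\nu)\|\nabla z^{\neq},\nabla{\bf w}^{\neq}\|_{L^2(\Omega)},$$ $$\|{\bf h}_1^{\neq}\|_{L^2(\Omega)}\lesssim(\delta+\nu)\|\nabla{\bf w}^{\neq}\|_{L^2(\Omega)},\qquad \|{\bf h}_1^{\neq}\|_{H^1(\Omega)}\lesssim(\delta+\nu)\|\nabla{\bf w}^{\neq},\nabla^2{\bf w}^{\neq}\|_{L^2(\Omega)},$$ $$\|{\bf h}_2^{\neq}\|_{H^1(\Omega)}\lesssim\delta\|\nabla z^{\neq},\nabla{\bf w}^{\neq}\|_{L^2(\Omega)},\qquad \|{\bf h}_2^{\neq}\|_{H^2(\Omega)}\lesssim\delta\|\nabla z^{\neq},\nabla{\bf w}^{\neq}\|_{H^1(\Omega)},$$ $$\|N_2^{\neq}\|_{H^1(\Omega)}\lesssim(\delta+\nu)\|\nabla H^{\neq}\|_{L^2(\Omega)},\qquad \|N_2^{\neq}\|_{H^2(\Omega)}\lesssim(\delta+\nu)\|\nabla H^{\neq}\|_{H^1(\Omega)},$$ $$\|N_{2t}^{\neq}\|_{L^2(\Omega)}\lesssim(\delta+\nu)\|\nabla H^{\neq},\nabla H_t^{\neq}\|_{L^2(\Omega)}.$$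
   Context: Setting: $\Omega=\mathbb R\times\mathbb T^2$, $\mathbb T^2=(\mathbb R/\mathbb Z)^2$, $x=(x_1,x')$, $x'=(x_2,x_3)$, $\partial_i=\partial_{x_i}$; $T>0$ is a constant. $\|f_1,\dots,f_k\|_X$ is the norm in $X$ of the tuple $(f_1,\dots,f_k)$, and $\nabla^k f$ is the collection of all $k$-th order $x$-derivatives. $A\lesssim B$ means $A\le CB$ with a constant $C>0$ independent of $t,\delta,\nu$ and of the solution. Planar shock: $\rho_\pm>0$, $u_{1\pm},s\in\mathbb R$ satisfy $-s(\rho_+-\rho_-)+\rho_+u_{1+}-\rho_-u_{1-}=0$, $-s(\rho_+u_{1+}-\rho_-u_{1-})+\rho_+u_{1+}^2-\rho_-u_{1-}^2+(T+1)(\rho_+-\rho_-)=0$, and $u_{1+}+\sqrt{T+1}<s<u_{1-}+\sqrt{T+1}$, $s>u_{1-}-\sqrt{T+1}$; $|\rho_+-\rho_-|\le\delta$ with $\rho_-$ fixed; by a Galilean change of frame one normalizes $u_{1-}=-u_{1+}>0$. $(\tilde\rho,\tilde m_1,\tilde E)(x_1-st)$, with $\tilde u_1=\tilde m_1/\tilde\rho$, is the (known to exist for small $\delta$, unique up to shift, fixed) traveling wave of $\partial_t\tilde\rho+\partial_1\tilde m_1=0$, $\partial_t\tilde m_1+\partial_1(\tilde m_1^2/\tilde\rho)+T\partial_1\tilde\rho=\partial_1^2\tilde u_1-\tilde\rho\partial_1\tilde E$, $-\partial_1^2\tilde E=\tilde\rho-e^{\tilde E}$, with limits $(\rho_\pm,\rho_\pm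 u_{1\pm},\ln\rho_\pm)$ at $x_1\to\pm\infty$; $\tilde{\bf u}=(\tilde u_1,0,0)^T$, $\tilde{\bf m}=\tilde\rho\tilde{\bf u}$. Perturbation: $(\rho,{\bf m}=\rho{\bf u},E)$ is a solution, periodic in $x'$, of $\partial_t\rho+\operatorname{div}{\bf m}=0$, $\partial_t{\bf m}+\operatorname{div}({\bf m}\otimes{\bf m}/\rho)+T\nabla\rho=\Delta{\bf u}-\rho\nabla E$, $-\Delta E=\rho-e^E$ on $\Omega$, and $z=\rho-\tilde\rho$, ${\bf w}={\bf u}-\tilde{\bf u}=(w_1,w_2,w_3)^T$, $H=E-\tilde E$, ${\bf r}={\bf m}-\tilde{\bf m}=(r_1,r_2,r_3)^T$, all vanishing as $x_1\to\pm\infty$. Modes: $\bar f(x_1)=\int_{\mathbb T^2}f(x_1,x')dx'$, $f^{\neq}=f-\bar f$. Antiderivatives: $(Z,R)(x_1,t)=\int_{-\infty}^{x_1}(\bar z,\bar r_1)(y_1,t)dy_1$. Global solution: initial data satisfy $\int_\Omega z(x,0)dx=0$, $\int_\Omega{\bf r}(x,0)dx={\bf 0}$ and $\nu_0:=\|(z,{\bf r})(\cdot,0)\|_{H^4(\Omega)}+\|(Z,R)(\cdot,0)\|_{L^2(\mathbb R)}\le\nu_1$. For $\delta,\nu_1$ small the solution is global. With $\mathbb N(t)=\sup_{\tau\in[0,t]}(\|Z,R\|_{L^2(\mathbb R)}+\|z,{\bf w},H_t\|_{H^4(\Omega)}+\|H\|_{H^5(\Omega)})(\tau)$, one has $\mathbb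 N(0)\lesssim\nu_0$, and $\nu:=c_1\mathbb N(0)\ll1$, where $c_1$ is a fixed large constant such that $\sup_{t\ge0}\mathbb N(t)\le\nu/2$. Nonlinear terms (here $\rho=\tilde\rho+z$): ${\bf J}_1=(z^{\neq}{\bf w}^{\neq})^{\neq}+\bar z{\bf w}^{\neq}+\bar{\bf w}z^{\neq}+\tilde{\bf u}z^{\neq}$; ${\bf h}_1={\bf u}\cdot\nabla{\bf w}$, so ${\bf h}_1^{\neq}=\tilde{\bf u}\cdot\nabla{\bf w}^{\neq}+({\bf w}^{\neq}\cdot\nabla{\bf w}^{\neq})^{\neq}+{\bf w}^{\neq}\cdot\nabla\bar{\bf w}+\bar{\bf w}\cdot\nabla{\bf w}^{\neq}$; ${\bf h}_2=(\frac1\rho-\frac1{\tilde\rho})(T\nabla\tilde\rho-\Delta\tilde{\bf u})+w_1\partial_1\tilde{\bf u}$, so ${\bf h}_2^{\neq}=\frac{\Delta\tilde{\bf u}-T\nabla\tilde\rho}{\tilde\rho}(\frac z\rho)^{\neq}+w_1^{\neq}\partial_1\tilde{\bf u}$; $N_2=e^{\tilde E}(e^H-1-H)$, so $N_2^{\neq}=e^{\tilde E}(e^H-1-H)^{\neq}$, and $N_{2t}^{\neq}=\partial_tN_2^{\neq}$. *)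

(* Defs.v *)
From HB Require Import structures.
From mathcomp Require Import all_boot all_order all_algebra.
From mathcomp Require Import all_classical all_reals all_analysis.
Set Implicit Arguments.
Unset Strict Implicit.
Unset Printing Implicit Defensive.
Import Order.TTheory GRing.Theory Num.Theory.
Import numFieldNormedType.Exports.
Local Open Scope classical_set_scope.
Local Open Scope ring_scope.

(** A function on Omega = R x T^2 is a function on R^3 that is 1-periodic in each
    component of x'; points are written x = (x1, x') with x' = (x2, x3), and
    integrals over T^2 and Omega are taken over a fundamental cell. *)

Definition T2 {R : realType} : set (R * R) := `[0, 1] `*` `[0, 1].
Definition Omega {R : realType} : set (R * (R * R)) := setT `*` T2.

(** The library declares no sigma-finite structure on [m1 \x m2] that canonical
    inference can find; it is attached here to [mu2] and [mu3]. *)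
Lemma sigma_finite_prod d1 d2 (T1 : measurableType d1) (T2 : measurableType d2)
    (R : realType) (m1 : {sigma_finite_measure set T1 -> \bar R})
    (m2 : {sigma_finite_measure set T2 -> \bar R}) :
  sigma_finite setT (m1 \x m2)%E.
Proof.
have /sigma_finiteP[F [TF ndF Foo]] := sigma_finiteT m1.
have /sigma_finiteP[G [TG ndG Goo]] := sigma_finiteT m2.
exists (fun n => F n `*` G n).
  rewrite -setXTT TF TG predeqE => -[x y]; split.
    move=> [/= [n _ Fnx] [k _ Gky]]; exists (maxn n k) => //; split.
    - by move: x Fnx; exact/subsetPset/ndF/leq_maxl.
    - by move: y Gky; exact/subsetPset/ndG/leq_maxr.
  by move=> [n _ []/= ? ?]; split; exists n.
move=> k; have [? ?] := Foo k; have [? ?] := Goo k.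
split; first exact: measurableX.
by rewrite product_measure1E// lte_mul_pinfty// ge0_fin_numE.
Qed.

Definition mu2 {R : realType}
  : set (measurableTypeR R * measurableTypeR R) -> \bar R :=
  (@lebesgue_measure R \x @lebesgue_measure R)%E.
HB.instance Definition _ (R : realType) := Measure.on (@mu2 R).
HB.instance Definition _ (R : realType) :=
  Measure_isSigmaFinite.Build _ _ _ (@mu2 R)
    (sigma_finite_prod (@lebesgue_measure R) (@lebesgue_measure R)).

Definition mu3 {R : realType}
  : set (measurableTypeR R * (measurableTypeR R * measurableTypeR R))
    -> \bar R :=
  (@lebesgue_measure R \x @mu2 R)%E.
HB.instance Definition _ (R : realType) := Measure.on (@mu3 R).
HB.instance Definition _ (R : realType) :=
  Measure_isSigmaFinite.Build _ _ _ (@mu3 R)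
    (sigma_finite_prod (@lebesgue_measure R) (@mu2 R)).

Definition torus_periodic {R : realType} (f : R * (R * R) -> R) : Prop :=
  forall x1 x2 x3 : R, f (x1, (x2 + 1, x3)) = f (x1, (x2, x3)) /\
                       f (x1, (x2, x3 + 1)) = f (x1, (x2, x3)).

(** The indices 0, 1, 2 of 'I_3 stand for the directions x_1, x_2, x_3. *)
Definition unitv {R : realType} (i : 'I_3) : R * (R * R) :=
  ((i == 0%N :> nat)%:R, ((i == 1%N :> nat)%:R, (i == 2%N :> nat)%:R)).

Definition pd {R : realType} (i : 'I_3) (f : R * (R * R) -> R)
  : R * (R * R) -> R := fun x => 'D_(unitv i) f x.

Definition pdn {R : realType} (s : seq 'I_3) (f : R * (R * R) -> R)
  : R * (R * R) -> R := foldr pd f s.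

Definition Cn {R : realType} (n : nat) (f : R * (R * R) -> R) : Prop :=
  (forall s, (size s <= n)%N -> continuous (pdn s f)) /\
  (forall s i x, (size s < n)%N -> derivable (pdn s f) x (unitv i)).

Definition laplacian {R : realType} (f : R * (R * R) -> R)
  : R * (R * R) -> R := fun x => \sum_(i < 3) pd i (pd i f) x.

Definition test_fun {R : realType} (phi : R * (R * R) -> R) : Prop :=
  [/\ torus_periodic phi, forall n, Cn n phi
    & exists a : R, forall x, a < `|x.1| -> phi x = 0].

Definition loc_integrable {R : realType} (f : R * (R * R) -> R) : Prop :=
  measurable_fun setT f /\
  forall a : R, mu3.-integrable (`[- a, a] `*` T2) (EFin \o f).

(** [g] is the weak derivative of [f] along the directions listed in [s]. *)
Definition weak_deriv {R : realType} (s : seq 'I_3)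
    (f g : R * (R * R) -> R) : Prop :=
  [/\ loc_integrable f, loc_integrable g
    & forall phi, test_fun phi ->
      \int[mu3]_(x in Omega) (f x * pdn s phi x) =
      (-1) ^+ size s * \int[mu3]_(x in Omega) (g x * phi x)].

Definition L2sq {R : realType} (f : R * (R * R) -> R) : \bar R :=
  (\int[mu3]_(x in Omega) ((f x) ^+ 2)%:E)%E.

(** Squared L^2 norm of a weak derivative. The latter is unique up to null
    sets, so the infimum ranges over at most one value; it is +oo when there is
    no weak derivative. *)
Definition weak_derivsq {R : realType} (s : seq 'I_3)
    (f : R * (R * R) -> R) : \bar R :=
  ereal_inf [set L2sq g | g in [set g | weak_deriv s f g]].

Definition Hsq {R : realType} (k : nat) (f : R * (R * R) -> R) : \bar R :=
  (\sum_(j < k.+1) \sum_(s : j.-tuple 'I_3) weak_derivsq s f)%E.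

(** Norms of a tuple of functions, given as a list. *)
Definition L2norm {R : realType} (fs : seq (R * (R * R) -> R)) : \bar R :=
  sqrte (\sum_(f <- fs) L2sq f)%E.

Definition Hnorm {R : realType} (k : nat) (fs : seq (R * (R * R) -> R))
  : \bar R := sqrte (\sum_(f <- fs) Hsq k f)%E.

Definition L2norm1 {R : realType} (fs : seq (R -> R)) : \bar R :=
  sqrte (\sum_(f <- fs) \int[lebesgue_measure]_x ((f x) ^+ 2)%:E)%E.

Definition grad {R : realType} (fs : seq (R * (R * R) -> R))
  : seq (R * (R * R) -> R) := [seq pd i f | f <- fs, i <- enum 'I_3].

Definition comps {R : realType} (v : 'I_3 -> R * (R * R) -> R)
  : seq (R * (R * R) -> R) := [seq v i | i <- enum 'I_3].

Definition mean {R : realType} (f : R * (R * R) -> R) (x1 : R) : R :=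
  \int[mu2]_(x' in T2) f (x1, x').

Definition bar {R : realType} (f : R * (R * R) -> R) : R * (R * R) -> R :=
  fun x => mean f x.1.

Definition neq {R : realType} (f : R * (R * R) -> R) : R * (R * R) -> R :=
  fun x => f x - mean f x.1.

(** The integral over ]-oo, x1] is an improper one: L^1 integrability of the
    zero modes is only prescribed initially. *)
Definition partial_int {R : realType} (f : R -> R) (x1 a : R) : R :=
  \int[lebesgue_measure]_(y in `[a, x1]) f y.

Definition antideriv {R : realType} (f : R -> R) (x1 : R) : R :=
  lim (partial_int f x1 a @[a --> -oo]).

Definition has_antideriv {R : realType} (f : R -> R) : Prop :=
  forall x1, cvg (partial_int f x1 a @[a --> -oo]).

(** Time derivatives are relative to [0, +oo[, hence one-sided at t = 0. *)
Definition quott {R : realType} (f : R -> R) (t h : R) : R :=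
  (f (t + h) - f t) / h.

Definition derivable_t {R : realType} (f : R -> R) (t : R) : Prop :=
  cvg (quott f t @ within [set h | 0 <= t + h] 0^').

Definition dt {R : realType} (f : R -> R * (R * R) -> R) (t : R)
  : R * (R * R) -> R :=
  fun x => lim (quott (f ^~ x) t @ within [set h | 0 <= t + h] 0^').

Record shock (R : realType) := Shock {
  rhom : R; rhop : R; um : R; up : R; speed : R }.

Definition is_shock {R : realType} (T : R) (S : shock R) : Prop :=
  let: Shock rm rp um up s := S in
  [/\ 0 < rm, 0 < rp,
      - s * (rp - rm) + rp * up - rm * um = 0,
      - s * (rp * up - rm * um) + rp * up ^+ 2 - rm * um ^+ 2
        + (T + 1) * (rp - rm) = 0
    & [/\ up + Num.sqrt (T + 1) < s, s < um + Num.sqrt (T + 1),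
          um - Num.sqrt (T + 1) < s
        & um = - up /\ 0 < um]].

(** Profiles as functions of the variable x_1 - s t. *)
Record wave (R : realType) := Wave { wrho : R -> R; wm : R -> R; wE : R -> R }.

Definition wu {R : realType} (W : wave R) (y : R) : R := wm W y / wrho W y.

Definition smooth1 {R : realType} (f : R -> R) : Prop :=
  forall n y, derivable (derive1n n f) y 1.

Definition is_profile {R : realType} (T : R) (S : shock R) (W : wave R)
  : Prop :=
  let s := speed S in let r := wrho W in let m := wm W in let E := wE W in
  [/\ [/\ smooth1 r, smooth1 m, smooth1 E & forall y, 0 < r y],
      forall y, - s * derive1 r y + derive1 m y = 0,
      forall y, - s * derive1 m y + derive1 (fun y => m y ^+ 2 / r y) y
                + T * derive1 r y
                = derive1n 2 (wu W) y - r y * derive1 E y,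
      forall y, - derive1n 2 E y = r y - expR (E y)
    & [/\ r y @[y --> -oo] --> rhom S /\ r y @[y --> +oo] --> rhop S,
          m y @[y --> -oo] --> rhom S * um S /\
            m y @[y --> +oo] --> rhop S * up S
        & E y @[y --> -oo] --> ln (rhom S) /\
            E y @[y --> +oo] --> ln (rhop S)]].

Record flow (R : realType) := Flow {
  frho : R -> R * (R * R) -> R;
  fu : R -> 'I_3 -> R * (R * R) -> R;
  fE : R -> R * (R * R) -> R }.

Definition mom {R : realType} (F : flow R) (t : R) (i : 'I_3)
  : R * (R * R) -> R := fun x => frho F t x * fu F t i x.

(** The regularity in x is that of the H^4 representatives, H^4 being embedded
    in C^2. *)
Definition is_solution {R : realType} (T : R) (F : flow R) : Prop :=
  forall t : R, 0 <= t ->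
  [/\ [/\ torus_periodic (frho F t), torus_periodic (fE F t)
        & forall i, torus_periodic (fu F t i)],
      [/\ Cn 2 (frho F t), Cn 2 (fE F t), Cn 2 (dt (fE F) t)
        & forall i, Cn 2 (fu F t i)],
      forall x, [/\ 0 < frho F t x, derivable_t (frho F ^~ x) t,
                    derivable_t (fE F ^~ x) t
                  & forall i, derivable_t (fun t => mom F t i x) t]
    & forall x,
      [/\ dt (frho F) t x + \sum_(j < 3) pd j (mom F t j) x = 0,
          forall i, dt (fun t => mom F t i) t x
                    + \sum_(j < 3) pd j (fun y => mom F t i y * mom F t j y
                                                  / frho F t y) x
                    + T * pd i (frho F t) x
                    = laplacian (fu F t i) x - frho F t x * pd i (fE F t) x
        & - laplacian (fE F t) x = frho F t x - expR (fE F t x)]].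

Section Perturbation.
Context {R : realType}.
Variables (T s : R) (W : wave R) (F : flow R).
Implicit Types (t : R) (x : R * (R * R)) (i : 'I_3).

Definition trho t x : R := wrho W (x.1 - s * t).
Definition tE t x : R := wE W (x.1 - s * t).
Definition tu t i x : R := if i == 0 then wu W (x.1 - s * t) else 0.
Definition tm t i x : R := trho t x * tu t i x.

Definition z t x : R := frho F t x - trho t x.
Definition w t i x : R := fu F t i x - tu t i x.
Definition H t x : R := fE F t x - tE t x.
Definition r t i x : R := mom F t i x - tm t i x.
Definition Ht : R -> R * (R * R) -> R := dt H.

Definition Z t : R -> R := antideriv (mean (z t)).
Definition Rr t : R -> R := antideriv (mean (r t 0)).

Definition vanishing (f : R * (R * R) -> R) : Prop :=
  forall x' : R * R, f (x1, x') @[x1 --> -oo] --> 0 /\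
             f (x1, x') @[x1 --> +oo] --> 0.

Definition is_perturbation : Prop :=
  forall t : R, 0 <= t ->
  [/\ vanishing (z t), vanishing (H t),
      forall i, vanishing (w t i) /\ vanishing (r t i)
    & has_antideriv (mean (z t)) /\ has_antideriv (mean (r t 0))].

(** In mathcomp-analysis +oo - oo = -oo, so these equalities entail that the
    integrals converge absolutely. *)
Definition zero_mass : Prop :=
  (\int[mu3]_(x in Omega) (z 0 x)%:E = 0)%E /\
  forall i, (\int[mu3]_(x in Omega) (r 0 i x)%:E = 0)%E.

Definition nu0 : \bar R :=
  (Hnorm 4 (z 0 :: comps (r 0)) + L2norm1 [:: Z 0; Rr 0])%E.

Definition NN t : \bar R :=
  ereal_sup [set (L2norm1 [:: Z tau; Rr tau]
                  + Hnorm 4 (z tau :: rcons (comps (w tau)) (Ht tau))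
                  + Hnorm 5 [:: H tau])%E | tau in `[0, t]].

Definition J1 t i x : R :=
  neq (fun y => neq (z t) y * neq (w t i) y) x
  + bar (z t) x * neq (w t i) x + bar (w t i) x * neq (z t) x
  + tu t i x * neq (z t) x.

Definition h1 t i x : R := \sum_(j < 3) fu F t j x * pd j (w t i) x.

Definition h2 t i x : R :=
  ((frho F t x)^-1 - (trho t x)^-1)
    * (T * pd i (trho t) x - laplacian (tu t i) x)
  + w t 0 x * pd 0 (tu t i) x.

Definition N2 t x : R := expR (tE t x) * (expR (H t x) - 1 - H t x).
Definition N2neq t : R * (R * R) -> R := neq (N2 t).
Definition N2neqt : R -> R * (R * R) -> R := dt N2neq.

Definition zneq t : R * (R * R) -> R := neq (z t).
Definition wneq t i : R * (R * R) -> R := neq (w t i).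
Definition Hneq t : R * (R * R) -> R := neq (H t).
Definition Htneq t : R * (R * R) -> R := neq (Ht t).
Definition h1neq t i : R * (R * R) -> R := neq (h1 t i).
Definition h2neq t i : R * (R * R) -> R := neq (h2 t i).

End Perturbation.

(* Main.v *)
(** The shock is weak, so the derivatives of its profile are O(delta): along a profile, an entropy has
    derivative [p ^+ 2 / j], hence its total variation is the jump across the shock, which is cubic in
    delta, and this confines the profile to an O(delta)-neighbourhood of its end states. By the Sobolev
    embedding, z, w, H, H_t and their gradients are O(nu) in sup norm. Each nonlinear term is therefore
    a function of x_1 plus a remainder bounded pointwise by delta + nu times fluctuations of the unknowns and
    of their gradients. Removing the zero mode cancels the function of x_1, and the Poincare inequality
    on T^2 absorbs undifferentiated fluctuations in gradients. Second derivatives of the unknowns are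
    only square integrable: their zero modes, functions of x_1 alone, are multiplied by fluctuations
    whose L^2 norms on the slices x_1 = const are bounded by the one-dimensional Sobolev embedding. *)
Require Import Defs.
From HB Require Import structures.
From mathcomp Require Import all_boot all_order all_algebra.
From mathcomp Require Import all_classical all_reals all_analysis.
From mathcomp Require Import ring lra.
Import Order.TTheory GRing.Theory Num.Theory.
Import numFieldNormedType.Exports.
Local Open Scope classical_set_scope.
Local Open Scope ring_scope.
From mathcomp Require Import measurable_realfun.

(** * Integration over the fundamental cell *)

(** The profile is controlled without monotonicity. Two first integrals express the departure [G]
    from quasineutrality and the squared field through [r], [p] and the entropy. By the cubic
    entropy jump, every unit interval has a point where [p] is of order [delta^(3/2)]. A deviation
    of [r] by [K delta] from its end state would then cost a potential energy of order [K^3 delta^3]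
    against remainders of order [delta^3], which a large power [K] of the data excludes: above [rm]
    this contradicts the sign of a square, below it the slow variation of [E]. Higher derivatives
    follow from an ODE system closed under differentiation. The norms are infima over weak
    derivatives, while the solution is only [C^2]. Mollification identifies weak and classical
    derivatives up to order two; orders three and four are used only by duality, in the Sobolev
    embedding. Constants have to be uniform in time and in the solution, so every estimate is stated
    for a family indexed by configurations, with the constant chosen before the index. *)

Notation mR R := (measurableTypeR R).

(** The product sigma-algebra is generated by rectangles, so an open set has to be written as a
    countable union of boxes with rational centres and radii [1/(n+1)]. *)
Lemma open_measurable3 {R : realType} (A : set (R * (R * R))) :
  open A -> measurable (A : set (mR R * (mR R * mR R))).
Proof.
move=> oA.
pose c (k : (rat * (rat * rat)) * nat) : R * (R * R) :=
  (ratr k.1.1, (ratr k.1.2.1, ratr k.1.2.2)).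
pose F (k : (rat * (rat * rat)) * nat) : set (R * (R * R)) :=
  if `[< ball (c k) (k.2.+1%:R^-1 : R) `<=` A >] then ball (c k) (k.2.+1%:R^-1 : R) else set0.
have -> : A = \bigcup_k F k.
  apply/seteqP; split=> [x Ax|x [k _]]; last first.
    by rewrite /F; case: asboolP => // kA; exact: kA.
  have /nbhs_ballP[e /= e0 eA] : nbhs x A by exact: open_nbhs_nbhs.
  have [n /= ne] : exists n : nat, n.+1%:R^-1 < e / 2.
    have e20 : 0 < e / 2 by rewrite divr_gt0.
    have [n _ /(_ n (leqnn _))] := near_infty_natSinv_lt (PosNum e20).
    by exists n.
  have n0 : (0 : R) < n.+1%:R^-1 by rewrite invr_gt0.
  have near (y : R) : exists q : rat, `|ratr q - y| < n.+1%:R^-1.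
    have /rat_in_itvoo[q] : (y - n.+1%:R^-1 < y + n.+1%:R^-1)%R.
      by rewrite ltrBlDr -addrA ltrDl addr_gt0.
    rewrite in_itv /= => /andP[h1 h2]; exists q.
    by rewrite ltr_distl h1 h2.
  move: x Ax eA => [x1 [x2 x3]] Ax eA.
  have [q1 hq1] := near x1; have [q2 hq2] := near x2; have [q3 hq3] := near x3.
  exists ((q1, (q2, q3)), n) => //.
  have cx : ball (c ((q1, (q2, q3)), n)) (n.+1%:R^-1 : R) (x1, (x2, x3)).
    by split => //; split.
  rewrite /F; case: asboolP => //= -[] y ycy; apply: eA.
  apply: (@le_ball _ _ _ (n.+1%:R^-1 + n.+1%:R^-1)).
    by rewrite (splitr e) lerD ?ltW.
  by apply: (@ball_triangle _ _ (c ((q1, (q2, q3)), n))) => //; exact: ball_sym.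
apply: countable_bigcupT_measurable; first exact: countableP.
move=> k; rewrite /F; case: asboolP => // _.
have -> : ball (c k) (k.2.+1%:R^-1 : R) = ball (ratr k.1.1 : R) k.2.+1%:R^-1 `*`
   (ball (ratr k.1.2.1 : R) k.2.+1%:R^-1 `*` ball (ratr k.1.2.2 : R) k.2.+1%:R^-1).
  by [].
by apply: measurableX; [|apply: measurableX]; exact: measurable_ball.
Qed.

Lemma continuous_measurable3 {R : realType} (f : R * (R * R) -> R) :
  continuous f -> measurable_fun setT f.
Proof.
move=> cf.
apply: (measurability _ (RGenOpens.measurableE R)).
move=> _ [A [a [b ->]] <-]; rewrite setTI.
apply: open_measurable3.
by apply: open_comp => // x _; exact: cf.
Qed.

Lemma continuous_measurable2 {R : realType} (f : R * R -> R) :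
  continuous f -> measurable_fun setT f.
Proof.
move=> cf.
have cg : continuous ((fun x => f x.2) : R * (R * R) -> R).
  by move=> x; apply: continuous_comp; [exact: cvg_snd| exact: cf].
have mg := @continuous_measurable3 R (fun x => f x.2) cg.
exact: (measurable_fun_pair2 (0 : R) mg).
Qed.

Lemma measurable_T2 {R : realType} : measurable (@T2 R : set (R * R)).
Proof. exact: measurableX. Qed.

Lemma measurable_Omega {R : realType} : measurable (@Omega R : set (R * (R * R))).
Proof. by apply: measurableX => //; exact: measurable_T2. Qed.

Lemma mu2_T2 {R : realType} : mu2 (@T2 R) = 1%E.
Proof.
rewrite /mu2 /T2 product_measure1E//= lebesgue_measure_itv/= lte_fin ltr01.
by rewrite oppr0 adde0 mule1.
Qed.

(** The integrand is extended by zero outside the rectangle, so that Tonelli on the whole product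
    applies. *)
Lemma tonelli_setX {R : realType} d1 d2 (X : measurableType d1) (Y : measurableType d2)
    (m1 : {sigma_finite_measure set X -> \bar R})
    (m2 : {sigma_finite_measure set Y -> \bar R}) (A : set X) (B : set Y)
    (F : X * Y -> \bar R) :
  measurable A -> measurable B ->
  measurable_fun setT F -> (forall x, 0 <= F x)%E ->
  (\int[(m1 \x m2)%E]_(x in A `*` B) F x = \int[m1]_(x in A) \int[m2]_(y in B) F (x, y))%E /\
  (\int[(m1 \x m2)%E]_(x in A `*` B) F x = \int[m2]_(y in B) \int[m1]_(x in A) F (x, y))%E.
Proof.
move=> mA mB mF F0.
have mX : measurable_fun setT (F \_ (A `*` B)).
  apply: (measurable_restrictT F (measurableX mA mB)).1.
  exact: measurable_funTS.
have F0X x : (0 <= (F \_ (A `*` B)) x)%E by rewrite erestrict_ge0.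
rewrite integral_mkcond; split.
- rewrite fubini_tonelli1 //= [in RHS]integral_mkcond.
  apply: eq_integral => x _; rewrite /fubini_F patchE.
  case: ifPn => xA.
    rewrite [in RHS]integral_mkcond; apply: eq_integral => y _.
    rewrite !patchE; congr (if _ then _ else _).
    by rewrite in_setX /= xA.
  rewrite integral0_eq// => y _; rewrite patchE ifF//.
  by apply/negP; rewrite inE => -[/= h _]; move: xA; rewrite notin_setE.
- rewrite fubini_tonelli2 //= [in RHS]integral_mkcond.
  apply: eq_integral => y _; rewrite /fubini_G patchE.
  case: ifPn => yB.
    rewrite [in RHS]integral_mkcond; apply: eq_integral => x _.
    rewrite !patchE; congr (if _ then _ else _).
    by rewrite in_setX /= yB andbT.
  rewrite integral0_eq// => x _; rewrite patchE ifF//.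
  by apply/negP; rewrite inE => -[/= _ h]; move: yB; rewrite notin_setE.
Qed.

Lemma tonelli_Omega {R : realType} (F : R * (R * R) -> \bar R) :
  measurable_fun setT F -> (forall x, 0 <= F x)%E ->
  (\int[mu3]_(x in Omega) F x =
   \int[lebesgue_measure]_x1 \int[mu2]_(x' in T2) F (x1, x'))%E.
Proof.
move=> mF F0.
have := @tonelli_setX R _ _ (mR R) _ lebesgue_measure mu2 setT T2 F measurableT measurable_T2 mF F0.
by case.
Qed.

Lemma tonelli_Omega_sym {R : realType} (F : R * (R * R) -> \bar R) :
  measurable_fun setT F -> (forall x, 0 <= F x)%E ->
  (\int[mu3]_(x in Omega) F x =
   \int[mu2]_(x' in T2) \int[lebesgue_measure]_x1 F (x1, x'))%E.
Proof.
move=> mF F0.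
have := @tonelli_setX R _ _ (mR R) _ lebesgue_measure mu2 setT T2 F measurableT measurable_T2 mF F0.
by case.
Qed.

Lemma tonelli_T2 {R : realType} (F : R * R -> \bar R) :
  measurable_fun setT F -> (forall x, 0 <= F x)%E ->
  (\int[mu2]_(x in T2) F x =
   \int[lebesgue_measure]_(x in `[0%R, 1%R]) \int[lebesgue_measure]_(y in `[0%R, 1%R]) F (x, y))%E /\
  (\int[mu2]_(x in T2) F x =
   \int[lebesgue_measure]_(y in `[0%R, 1%R]) \int[lebesgue_measure]_(x in `[0%R, 1%R]) F (x, y))%E.
Proof.
move=> mF F0.
exact: (@tonelli_setX R _ _ (mR R) (mR R) lebesgue_measure lebesgue_measure _ _ F (measurable_itv _) (measurable_itv
  _) mF F0).
Qed.

Lemma continuous_pair1 {T U V : topologicalType} (f : T * U -> V) (a : T) :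
  continuous f -> continuous (fun y => f (a, y)).
Proof.
move=> cf y; apply: (continuous_comp (f := fun y => (a, y))); last exact: cf.
by apply: cvg_pair; [exact: cvg_cst|exact: cvg_id].
Qed.

Lemma continuous_pair2 {T U V : topologicalType} (f : T * U -> V) (b : U) :
  continuous f -> continuous (fun x => f (x, b)).
Proof.
move=> cf y; apply: (continuous_comp (f := fun y => (y, b))); last exact: cf.
by apply: cvg_pair; [exact: cvg_id|exact: cvg_cst].
Qed.

Lemma compact_T2 {R : realType} : compact (@T2 R).
Proof. by apply: compact_setX; exact: segment_compact. Qed.

Lemma continuous_compact_bounded {R : realType} {T : topologicalType} (K : set T) (f : T -> R) :
  compact K -> continuous f -> exists M, 0 <= M /\ forall x, K x -> `|f x| <= M.
Proof.
move=> cK cf.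
have : compact (f @` K) by apply: continuous_compact => //; exact: continuous_subspaceT.
move/compact_bounded => [M [_ hM]].
exists (`|M| + 1); split; first by rewrite addr_ge0.
move=> x Kx; apply: (hM (`|M| + 1)); last by exists x.
by rewrite (le_lt_trans (ler_norm _))// ltrDl.
Qed.

Lemma integrable_T2 {R : realType} (g : R * R -> R) :
  continuous g -> mu2.-integrable T2 (EFin \o g).
Proof.
move=> cg.
apply: measurable_bounded_integrable.
- exact: measurable_T2.
- by rewrite [ltLHS]mu2_T2 ltry.
- by apply: measurable_funTS; exact: continuous_measurable2.
- have [M [M0 hM]] := continuous_compact_bounded T2 g compact_T2 cg.
  exists M; split; first exact: num_real.
  by move=> x Mx y /hM /le_trans; apply; exact: ltW.
Qed.

Lemma avgE {R : realType} (g : R * R -> R) : continuous g ->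
  ((\int[mu2]_(x in T2) g x)%:E = \int[mu2]_(x in T2) (g x)%:E)%E.
Proof.
move=> cg; rewrite /Rintegral fineK//.
by apply: integrable_fin_num; [exact: measurable_T2|exact: integrable_T2].
Qed.

Lemma avg_cst {R : realType} (c : R) : \int[mu2]_(x in T2) (cst c x : R) = c.
Proof. rewrite Rintegral_cst; last exact: measurable_T2. by rewrite [X in fine X]mu2_T2 mulr1. Qed.

Lemma avgD {R : realType} (f g : R * R -> R) : continuous f -> continuous g ->
  \int[mu2]_(x in T2) (f x + g x) = \int[mu2]_(x in T2) f x + \int[mu2]_(x in T2) g x.
Proof. by move=> cf cg; rewrite RintegralD//; [exact: measurable_T2|exact: integrable_T2..]. Qed.

Lemma avgB {R : realType} (f g : R * R -> R) : continuous f -> continuous g ->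
  \int[mu2]_(x in T2) (f x - g x) = \int[mu2]_(x in T2) f x - \int[mu2]_(x in T2) g x.
Proof. by move=> cf cg; rewrite RintegralB//; [exact: measurable_T2|exact: integrable_T2..]. Qed.

Lemma avgZ {R : realType} (c : R) (g : R * R -> R) : continuous g ->
  \int[mu2]_(x in T2) (c * g x) = c * \int[mu2]_(x in T2) g x.
Proof. by move=> cg; rewrite RintegralZl//; [exact: measurable_T2|exact: integrable_T2]. Qed.

Lemma le_avg {R : realType} (f g : R * R -> R) : continuous f -> continuous g ->
  (forall x, T2 x -> f x <= g x) ->
  \int[mu2]_(x in T2) f x <= \int[mu2]_(x in T2) g x.
Proof.
move=> cf cg fg; apply: le_Rintegral => //; [exact: measurable_T2|exact: integrable_T2..].
Qed.

Lemma norm_avg_le {R : realType} (g : R * R -> R) (M : R) : continuous g ->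
  (forall x, T2 x -> `|g x| <= M) -> `|\int[mu2]_(x in T2) g x| <= M.
Proof.
move=> cg gM; rewrite ler_norml -{1}(avg_cst (- M)) -{2}(avg_cst M).
have cM (c : R) : continuous (cst c : R * R -> R) by move=> ?; exact: cvg_cst.
apply/andP; split; apply: le_avg => // x /gM; by rewrite ler_norml => /andP[].
Qed.

Lemma continuous_sqr {R : realType} {T : topologicalType} (g : T -> R) :
  continuous g -> continuous (fun x => g x ^+ 2).
Proof. by move=> cg x; apply: cvgM; exact: cg. Qed.

(** The mean is the best constant in L2: [g - c] is [g - m] plus a constant, and the cross term
    integrates to zero. *)
Lemma var_min {R : realType} (g : R * R -> R) (c : R) : continuous g ->
  \int[mu2]_(x in T2) (g x - \int[mu2]_(y in T2) g y) ^+ 2 <= \int[mu2]_(x in T2) (g x - c) ^+ 2.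
Proof.
move=> cg; set m := \int[mu2]_(y in T2) g y.
have cM (k : R) : continuous (cst k : R * R -> R) by move=> ?; exact: cvg_cst.
have cgk k : continuous (fun x => g x - k) by move=> x; apply: cvgB; [exact: cg|exact: cvg_cst].
have -> : (fun x => (g x - c) ^+ 2) =
   (fun x => (g x - m) ^+ 2 + (2 * (m - c) * (g x - m) + (m - c) ^+ 2)).
  by apply/funext => x; ring.
rewrite (avgD _ (fun x => 2 * (m - c) * (g x - m) + (m - c) ^+ 2)); last 2 first.
- exact: continuous_sqr.
- by move=> x; apply: cvgD; [apply: cvgM; [exact: cvg_cst|exact: cgk]|exact: cvg_cst].
rewrite (avgD (fun x => 2 * (m - c) * (g x - m)) (cst ((m - c) ^+ 2))) //; last first.
  by move=> x; apply: cvgM; [exact: cvg_cst|exact: cgk].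
rewrite avgZ// (avgB g (cst m)) // !avg_cst -/m subrr mulr0 add0r lerDl.
exact: sqr_ge0.
Qed.

(** Expansion of the nonnegative variance; the cell has measure one. *)
Lemma jensen_avg {R : realType} (g : R * R -> R) : continuous g ->
  (\int[mu2]_(x in T2) g x) ^+ 2 <= \int[mu2]_(x in T2) (g x ^+ 2).
Proof.
move=> cg; set m := \int[mu2]_(y in T2) g y.
have : 0 <= \int[mu2]_(x in T2) (g x - m) ^+ 2 by apply: Rintegral_ge0 => x _; exact: sqr_ge0.
have cgk k : continuous (fun x => g x - k) by move=> x; apply: cvgB; [exact: cg|exact: cvg_cst].
have cM (k : R) : continuous (cst k : R * R -> R) by move=> ?; exact: cvg_cst.
have -> : (fun x => (g x - m) ^+ 2) =
   (fun x => g x ^+ 2 - (2 * m * g x - m ^+ 2)).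
  by apply/funext => x; ring.
have cmg : continuous (fun x => 2 * m * g x).
  by move=> x; apply: cvgM; [exact: cvg_cst|exact: cg].
rewrite (avgB (fun x => g x ^+ 2) (fun x => 2 * m * g x - m ^+ 2)); last 2 first.
- exact: continuous_sqr.
- by move=> x; apply: cvgB; [exact: cmg|exact: cvg_cst].
rewrite (avgB (fun x => 2 * m * g x) (cst (m ^+ 2))) // avg_cst avgZ// -/m.
by rewrite subr_ge0; apply: le_trans; rewrite le_eqVlt; apply/orP; left; apply/eqP; ring.
Qed.

(** * Partial derivatives and classes C^k *)

Definition coord {R : realType} (i : 'I_3) (x : R * (R * R)) : R :=
  match val i with 0%N => x.1 | 1%N => x.2.1 | _ => x.2.2 end.

(** Moving one coordinate turns [pd] into a one-variable derivative along an axis line, to which the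
    one-dimensional calculus applies. *)
Definition upd {R : realType} (i : 'I_3) (x : R * (R * R)) (t : R) : R * (R * R) :=
  match val i with 0%N => (t, x.2) | 1%N => (x.1, (t, x.2.2)) | _ => (x.1, (x.2.1, t)) end.

Lemma upd_coord {R : realType} (i : 'I_3) (x : R * (R * R)) : upd i x (coord i x) = x.
Proof. by case: x => [a [b c]]; case: i => -[|[|[|]]]. Qed.

Lemma coord_upd {R : realType} (i : 'I_3) (x : R * (R * R)) t : coord i (upd i x t) = t.
Proof. by case: x => [a [b c]]; case: i => -[|[|[|]]]. Qed.

Lemma upd_upd {R : realType} (i : 'I_3) (x : R * (R * R)) t u : upd i (upd i x t) u = upd i x u.
Proof. by case: x => [a [b c]]; case: i => -[|[|[|]]]. Qed.

Lemma shift_unitv {R : realType} (i : 'I_3) (x : R * (R * R)) (h : R) :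
  h *: unitv i + x = upd i x (h + coord i x).
Proof.
have E (a b c : R) : h *: (a, (b, c)) = (h * a, (h * b, h * c)) by [].
have D (a b c a' b' c' : R) : (a, (b, c)) + (a', (b', c')) = (a + a', (b + b', c + c')) by [].
case: x => [a [b c]]; rewrite /unitv E D /upd /coord.
by case: i => -[|[|[|//]]] hi /=; rewrite ?mulr1 ?mulr0 ?add0r.
Qed.

Lemma diff_quot_upd {R : realType} (i : 'I_3) (f : R * (R * R) -> R) (x : R * (R * R)) :
  (fun h : R => h^-1 *: ((f \o shift x) (h *: unitv i) - f x)) =
  (fun h : R => h^-1 *: (((fun t => f (upd i x t)) \o shift (coord i x)) (h *: (1 : R)) - f (upd i x (coord i x)))).
Proof.
apply/funext => h /=.
by rewrite shift_unitv upd_coord; congr (_ *: (f (upd i x (_ + _)) - _)); rewrite [RHS]mulr1.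
Qed.

Lemma derivable_upd {R : realType} (i : 'I_3) (f : R * (R * R) -> R) (x : R * (R * R)) :
  derivable f x (unitv i) = derivable (fun t : R => f (upd i x t)) (coord i x) 1.
Proof. by rewrite /derivable diff_quot_upd. Qed.

Lemma pd_upd {R : realType} (i : 'I_3) (f : R * (R * R) -> R) (x : R * (R * R)) :
  pd i f x = derive1 (fun t : R => f (upd i x t)) (coord i x).
Proof. by rewrite /pd derive1E /derive diff_quot_upd. Qed.

Lemma continuous_pairl {T U : topologicalType} (a : T) : continuous (fun y : U => (a, y)).
Proof. by move=> y; apply: cvg_pair; [exact: cvg_cst|exact: cvg_id]. Qed.

Lemma continuous_pairr {T U : topologicalType} (b : U) : continuous (fun y : T => (y, b)).
Proof. by move=> y; apply: cvg_pair; [exact: cvg_id|exact: cvg_cst]. Qed.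

Lemma continuous_upd {R : realType} (i : 'I_3) (x : R * (R * R)) : continuous (upd i x).
Proof.
case: x => [a [b c]]; case: i => -[|[|[|//]]] hi t; rewrite /upd /=.
- exact: continuous_pairr.
- by apply: (continuous_comp (f := fun t : R => (t, c)) (g := fun y => (a, y))); [exact: continuous_pairr|exact:
  continuous_pairl].
- by apply: (continuous_comp (f := fun t : R => (b, t)) (g := fun y => (a, y))); exact: continuous_pairl.
Qed.

(** Recursive form of [Cn]. It peels off the innermost derivative, the first one applied, which
    makes closure under sums, products and composition an induction on [n]. *)
Fixpoint Ck {R : realType} n (f : R * (R * R) -> R) : Prop :=
  continuous f /\ (if n is m.+1 then
     forall i, (forall x, derivable f x (unitv i)) /\ Ck m (pd i f) else True).

Lemma Ck_cont {R : realType} n (f : R * (R * R) -> R) : Ck n f -> continuous f.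
Proof. by case: n => [|n] []. Qed.

Lemma pdn_cat {R : realType} s1 s2 (f : R * (R * R) -> R) : pdn (s1 ++ s2) f = pdn s1 (pdn s2 f).
Proof. by rewrite /pdn foldr_cat. Qed.

Lemma CkP {R : realType} n (f : R * (R * R) -> R) : Cn n f <-> Ck n f.
Proof.
elim: n f => [|n IH] f; split.
- by move=> [cf _]; split => //; exact: (cf [::]).
- move=> [cf _]; split; last by move=> ? ?.
  by case.
- move=> [cf df]; split; first exact: (cf [::]).
  move=> i; split; first by move=> x; exact: (df [::]).
  apply/IH; split => [s sn|s j x sn].
    by have := cf (s ++ [:: i]); rewrite pdn_cat; apply; rewrite size_cat /= addn1.
  by have := df (s ++ [:: i]) j x; rewrite pdn_cat; apply; rewrite size_cat /= addn1.
- move=> [cf df]; split.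
    move=> s; elim/last_ind: s => // s i _; rewrite size_rcons ltnS => sn.
    rewrite -cats1 pdn_cat; have [_ /IH[h _]] := df i; exact: h.
  move=> s j x; elim/last_ind: s => [_|s i _]; first exact: (df j).1.
  rewrite size_rcons ltnS => sn.
  rewrite -cats1 pdn_cat; have [_ /IH[_ h]] := df i; exact: h.
Qed.

Lemma CkS {R : realType} n (f : R * (R * R) -> R) : Ck n.+1 f -> Ck n f.
Proof.
elim: n f => [|n IH] f [cf df]; split => //.
move=> i; have [h1 h2] := df i; split => //; exact: IH.
Qed.

Lemma Ck_le {R : realType} m n (f : R * (R * R) -> R) : (m <= n)%N -> Ck n f -> Ck m f.
Proof.
move=> mn; rewrite -(subnK mn); elim: (n - m)%N => // k IH.
by rewrite addSn => /CkS.
Qed.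

Lemma Ck_der {R : realType} n (f : R * (R * R) -> R) i x : Ck n.+1 f -> derivable f x (unitv i).
Proof. by move=> [_ /(_ i)[]]. Qed.

Lemma Ck_pd {R : realType} n (f : R * (R * R) -> R) i : Ck n.+1 f -> Ck n (pd i f).
Proof. by move=> [_ /(_ i)[]]. Qed.

Lemma pdD {R : realType} i (f g : R * (R * R) -> R) :
  (forall x, derivable f x (unitv i)) -> (forall x, derivable g x (unitv i)) ->
  (forall x, derivable (fun x => f x + g x) x (unitv i)) /\
  pd i (fun x => f x + g x) = (fun x => pd i f x + pd i g x).
Proof.
move=> df dg; split => [x|]; first exact: derivableD.
by apply/funext => x; rewrite /pd; exact: deriveD.
Qed.

Lemma pdN {R : realType} i (f : R * (R * R) -> R) :
  (forall x, derivable f x (unitv i)) ->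
  (forall x, derivable (fun x => - f x) x (unitv i)) /\
  pd i (fun x => - f x) = (fun x => - pd i f x).
Proof.
move=> df; split => [x|]; first exact: derivableN.
by apply/funext => x; rewrite /pd; exact: deriveN.
Qed.

Lemma pdM {R : realType} i (f g : R * (R * R) -> R) :
  (forall x, derivable f x (unitv i)) -> (forall x, derivable g x (unitv i)) ->
  (forall x, derivable (fun x => f x * g x) x (unitv i)) /\
  pd i (fun x => f x * g x) = (fun x => pd i f x * g x + f x * pd i g x).
Proof.
move=> df dg; split => [x|]; first exact: derivableM.
apply/funext => x; rewrite /pd.
by rewrite [LHS]deriveM// addrC; congr (_ + _); exact: mulrC.
Qed.

Lemma pd_cst {R : realType} i (c : R) :
  (forall x, derivable (fun _ : R * (R * R) => c) x (unitv i)) /\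
  pd i (fun _ : R * (R * R) => c) = (fun _ => 0).
Proof.
split => [x|]; first exact: derivable_cst.
by apply/funext => x; rewrite /pd; exact: derive_cst.
Qed.

Lemma is_derive_derive1 {R : realType} (f : R -> R) (x : R) :
  derivable f x 1 -> is_derive x (1 : R) f (derive1 f x).
Proof. by move=> df; rewrite derive1E; apply: DeriveDef. Qed.

Lemma pd_comp {R : realType} i (phi : R -> R) (f : R * (R * R) -> R) :
  (forall x, derivable f x (unitv i)) -> (forall x, derivable phi (f x) 1) ->
  (forall x, derivable (fun x => phi (f x)) x (unitv i)) /\
  pd i (fun x => phi (f x)) = (fun x => derive1 phi (f x) * pd i f x).
Proof.
move=> df dphi.
have key x : is_derive (coord i x) (1 : R) (phi \o (fun t => f (upd i x t))) (derive1 phi (f x) * pd i f x).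
  rewrite pd_upd.
  have h1 : is_derive (coord i x) (1 : R) (fun t => f (upd i x t)) (derive1 (fun t => f (upd i x t)) (coord i x)).
    by apply: is_derive_derive1; rewrite -derivable_upd; exact: df.
  have h2 : is_derive (f (upd i x (coord i x))) 1 phi (derive1 phi (f x)).
    by rewrite upd_coord; apply: is_derive_derive1.
  exact: (@is_derive1_comp _ phi (fun t => f (upd i x t)) (coord i x) _ _ h2 h1).
split=> [x|].
  by rewrite derivable_upd; have [] := key x.
by apply/funext => x; rewrite pd_upd derive1E; have [_ ->] := key x.
Qed.

Lemma pd_fst {R : realType} i (g : R -> R) : (forall y, derivable g y 1) ->
  (forall x, derivable (fun x : R * (R * R) => g x.1) x (unitv i)) /\
  pd i (fun x => g x.1) = (fun x => if val i is 0%N then derive1 g x.1 else 0).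
Proof.
move=> dg; split=> [x|].
  rewrite derivable_upd; case: i => -[|[|[|//]]] hi; rewrite /upd /=.
  - exact: dg.
  - exact: derivable_cst.
  - exact: derivable_cst.
apply/funext => x; rewrite pd_upd; case: i => -[|[|[|//]]] hi; rewrite /upd /=.
- by [].
- by rewrite derive1_cst.
- by rewrite derive1_cst.
Qed.

Lemma CkD {R : realType} n (f g : R * (R * R) -> R) : Ck n f -> Ck n g -> Ck n (fun x => f x + g x).
Proof.
elim: n f g => [|n IH] f g [cf df] [cg dg]; (split; first by move=> x; apply: cvgD; [exact: cf|exact: cg]) => //.
move=> i; have [h1 h2] := df i; have [h3 h4] := dg i.
have [h ->] := pdD i f g h1 h3.
by split => //; exact: IH.
Qed.

Lemma CkN {R : realType} n (f : R * (R * R) -> R) : Ck n f -> Ck n (fun x => - f x).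
Proof.
elim: n f => [|n IH] f [cf df]; (split; first by move=> x; apply: cvgN; exact: cf) => //.
move=> i; have [h1 h2] := df i.
have [h ->] := pdN i f h1.
by split => //; exact: IH.
Qed.

Lemma CkM {R : realType} n (f g : R * (R * R) -> R) : Ck n f -> Ck n g -> Ck n (fun x => f x * g x).
Proof.
elim: n f g => [|n IH] f g Cf Cg.
  by move: Cf Cg => [cf _] [cg _]; split => // x; apply: cvgM; [exact: cf|exact: cg].
have [[cf df] [cg dg]] := (Cf, Cg).
split; first by move=> x; apply: cvgM; [exact: cf|exact: cg].
move=> i; have [h1 h2] := df i; have [h3 h4] := dg i.
have [h ->] := pdM i f g h1 h3.
by split => //; apply: CkD; apply: IH => //; exact: CkS.
Qed.

Lemma Ck_cst {R : realType} n (c : R) : Ck n (fun _ : R * (R * R) => c).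
Proof.
elim: n c => [|n IH] c; (split; first by move=> x; exact: cvg_cst) => //.
move=> i; have [h ->] := pd_cst i c; split => //; exact: IH.
Qed.

Lemma smooth1_derive {R : realType} (phi : R -> R) : smooth1 phi -> smooth1 (derive1 phi).
Proof. by move=> sphi k y; have := sphi k.+1 y; rewrite /derive1n iterSr. Qed.

Lemma smooth1_continuous {R : realType} (phi : R -> R) : smooth1 phi -> continuous phi.
Proof.
move=> sphi x.
by apply: differentiable_continuous; apply/derivable1_diffP; exact: (sphi 0%N).
Qed.

Lemma Ck_comp {R : realType} n (phi : R -> R) (f : R * (R * R) -> R) :
  smooth1 phi -> Ck n f -> Ck n (fun x => phi (f x)).
Proof.
elim: n phi f => [|n IH] phi f sphi Cf.
  have [cf _] := Cf; split => // x; apply: (continuous_comp (f := f)); first exact: cf.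
  exact: smooth1_continuous.
have [cf df] := Cf; split.
  move=> x; apply: (continuous_comp (f := f)); first exact: cf.
  exact: smooth1_continuous.
move=> i; have [h1 h2] := df i.
have [h ->] := pd_comp i phi f h1 (fun x => sphi 0%N (f x)).
split => //; apply: CkM => //; apply: IH; last exact: CkS.
exact: smooth1_derive.
Qed.

Lemma pd_inv {R : realType} i (f : R * (R * R) -> R) :
  (forall x, derivable f x (unitv i)) -> (forall x, 0 < f x) ->
  (forall x, derivable (fun x => (f x)^-1) x (unitv i)) /\
  pd i (fun x => (f x)^-1) = (fun x => - ((f x)^-1 * (f x)^-1) * pd i f x).
Proof.
move=> df f0.
have dinv x : is_derive (f x) 1 (@GRing.inv R) (- ((f x)^-1 * (f x)^-1)).
  have fx : f x != 0 by exact: lt0r_neq0.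
  suff -> : - ((f x)^-1 / f x) = - f x ^- 2 *: (1 : R).
    exact: (@is_deriveV R id (f x) 1 1 fx (is_derive_id _ _)).
  by rewrite [RHS]mulr1 expr2 invfM.
have [h1 h2] := pd_comp i (@GRing.inv R) f df (fun x => @ex_derive _ _ _ _ _ _ _ (dinv x)).
split => //; rewrite h2; apply/funext => x; congr (_ * _).
by rewrite derive1E; have [_ ->] := dinv x.
Qed.

Lemma Ck_inv {R : realType} n (f : R * (R * R) -> R) : (forall x, 0 < f x) -> Ck n f ->
  Ck n (fun x => (f x)^-1).
Proof.
move=> f0.
elim: n => [|n IH] Cf; have [cf df] := Cf.
  by split => // x; apply: cvgV; [exact: lt0r_neq0|exact: cf].
split; first by move=> x; apply: cvgV; [exact: lt0r_neq0|exact: cf].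
move=> i; have [h1 h2] := df i; have [h ->] := pd_inv i f h1 f0.
split => //; apply: CkM => //; apply: CkN; apply: CkM; exact/IH/CkS.
Qed.

Lemma pd_line {R : realType} i (f : R * (R * R) -> R) x (t : R) :
  pd i f (upd i x t) = derive1 (fun u : R => f (upd i x u)) t.
Proof.
rewrite pd_upd coord_upd (_ : (fun u : R => f (upd i (upd i x t) u)) = (fun u : R => f (upd i x u))) //.
by apply/funext => u; rewrite upd_upd.
Qed.

Lemma derivable_line {R : realType} i (f : R * (R * R) -> R) x (t : R) :
  (forall x, derivable f x (unitv i)) -> derivable (fun u : R => f (upd i x u)) t 1.
Proof.
move=> df; have := df (upd i x t); rewrite derivable_upd coord_upd.
rewrite (_ : (fun u : R => f (upd i (upd i x t) u)) = (fun u : R => f (upd i x u))) //.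
by apply/funext => u; rewrite upd_upd.
Qed.

Lemma pair3D {R : realType} (a b c a' b' c' : R) :
  (a, (b, c)) + (a', (b', c')) = (a + a', (b + b', c + c')).
Proof. by []. Qed.

(** * Zero modes *)

(** The claim is local in [x1]: on [[x - 1, x + 1]] times the cell, compactness gives a constant
    bound, which dominates on a cell of finite measure. *)
Lemma mean_continuous {R : realType} (f : R * (R * R) -> R) :
  continuous f -> continuous (mean f).
Proof.
move=> cf x.
have cK : compact (`[x - 1, x + 1] `*` T2 : set (R * (R * R))).
  by apply: compact_setX; [exact: segment_compact|exact: compact_T2].
have [M [M0 hM]] := continuous_compact_bounded _ f cK cf.
have cM : continuous (cst M : R * R -> R) by move=> ?; exact: cvg_cst.
have xI : x \in (`]x - 1, x + 1[%classic : set R).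
  by rewrite inE /= in_itv /=; apply/andP; split; lra.
have := @continuity_under_integral R _ _ mu2 (fun a y => f (a, y)) T2 measurable_T2 (x - 1) (x + 1)
  (fun a _ => integrable_T2 (fun y => f (a, y)) (continuous_pair1 f a cf)) _ (cst M) (integrable_T2 _ cM) _ x xI.
apply.
- apply: aeW => y _ a _; exact: (continuous_pair2 f y cf).
- move=> a Ia; apply: aeW => y Ty; apply: hM; split => //=.
  by move: Ia; rewrite /= !in_itv /= => /andP[h1 h2]; apply/andP; split; exact: ltW.
Qed.

(** Same domination as for continuity, applied to [pd ord0 f]. *)
Lemma mean_derive {R : realType} (f : R * (R * R) -> R) : Ck 1 f ->
  forall x, derivable (mean f) x 1 /\ derive1 (mean f) x = mean (pd ord0 f) x.
Proof.
move=> Cf x.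
have cf : continuous f by exact: Ck_cont Cf.
have cdf : continuous (pd ord0 f) by exact: (Ck_cont 0 _ (Ck_pd _ _ _ Cf)).
have cK : compact (`[x - 1, x + 1] `*` T2 : set (R * (R * R))).
  by apply: compact_setX; [exact: segment_compact|exact: compact_T2].
have [M [M0 hM]] := continuous_compact_bounded _ _ cK cdf.
have cM : continuous (cst M : R * R -> R) by move=> ?; exact: cvg_cst.
have xI : (`]x - 1, x + 1[%classic : set R) x.
  by rewrite /= in_itv /=; apply/andP; split; lra.
have pE a y : partial1of2 (fun a y => f (a, y)) a y = pd ord0 f (a, y).
  by rewrite pd_upd.
have dfI a y : (`]x - 1, x + 1[%classic : set R) a -> T2 y -> derivable (fun a => f (a, y)) a 1.
  by move=> _ _; have := Ck_der 0 f ord0 (a, y) Cf; rewrite derivable_upd.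
have bI a y : (`]x - 1, x + 1[%classic : set R) a -> T2 y -> `|partial1of2 (fun a y => f (a, y)) a y| <= cst M y.
  move=> Ia Ty; rewrite pE; apply: hM; split => //=.
  by move: Ia; rewrite /= !in_itv /= => /andP[h1 h2]; apply/andP; split; exact: ltW.
split.
  exact: (@derivable_under_integral R _ _ mu2 (fun a y => f (a, y)) T2 measurable_T2 x (x - 1) (x + 1) xI
  (fun a _ => integrable_T2 (fun y => f (a, y)) (continuous_pair1 f a cf)) dfI (cst M) (fun=> M0)
   (integrable_T2 _ cM) bI).
rewrite (@differentiation_under_integral R _ _ mu2 (fun a y => f (a, y)) T2 measurable_T2 x (x - 1) (x + 1) xI
  (fun a _ => integrable_T2 (fun y => f (a, y)) (continuous_pair1 f a cf)) dfI (cst M) (fun=> M0)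
   (integrable_T2 _ cM) bI).
by apply: eq_Rintegral => y _; exact: pE.
Qed.

Lemma ftc2 {R : realType} (g : R -> R) (a b : R) : a <= b ->
  (forall x, derivable g x 1) -> continuous (derive1 g) ->
  (\int[lebesgue_measure]_(x in `[a, b]) (derive1 g x)%:E = (g b - g a)%:E)%E.
Proof.
rewrite le_eqVlt => /orP[/eqP ->|ab] dg cg.
  by rewrite set_itv1 integral_set1 subrr.
have cg0 : continuous g.
  by move=> x; apply: differentiable_continuous; apply/derivable1_diffP.
have H1 : {within `[a, b], continuous (derive1 g)} by exact: continuous_subspaceT.
have H2 : derivable_oo_LRcontinuous g a b.
  by split; [move=> x _; exact: dg|apply: cvg_at_right_filter; exact: cg0|apply: cvg_at_left_filter; exact: cg0].
have H3 : {in `]a, b[, derive1 g =1 derive1 g} by [].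
by rewrite (continuous_FTC2 ab H1 H2 H3).
Qed.

Lemma continuous_itv_integrable {R : realType} (g : R -> R) (a b : R) : continuous g ->
  lebesgue_measure.-integrable `[a, b] (EFin \o g).
Proof.
move=> cg; apply: continuous_compact_integrable; first exact: segment_compact.
exact: continuous_subspaceT.
Qed.

(** [g] has no sign, so Tonelli is applied to [g + M], where [M] bounds [g] on the cell; the
    absolute value changes nothing there and makes the integrand nonnegative everywhere. The
    vanishing iterated integral leaves the mass of the constant [M]. *)
Lemma avg_eq0 {R : realType} (g : R * R -> R) : continuous g ->
  (forall x, \int[lebesgue_measure]_(y in `[0%R, 1%R]) (g (x, y))%:E = 0)%E \/
  (forall y, \int[lebesgue_measure]_(x in `[0%R, 1%R]) (g (x, y))%:E = 0)%E ->
  \int[mu2]_(x in T2) g x = 0.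
Proof.
move=> cg H.
have [M [M0 hM]] := continuous_compact_bounded _ _ compact_T2 cg.
have cM : continuous (cst M : R * R -> R) by move=> ?; exact: cvg_cst.
have cgM : continuous (fun x => g x + M) by move=> x; apply: cvgD; [exact: cg|exact: cvg_cst].
have caM : continuous (fun x => `|g x + M|).
  by move=> x; apply: (@cvg_norm _ R); exact: cgM.
have gM0 x : T2 x -> `|g x + M| = g x + M.
  by move=> /hM; rewrite ler_norml => /andP[h _]; rewrite ger0_norm; lra.
suff : \int[mu2]_(x in T2) (g x + M) = M.
  rewrite (avgD g (cst M))// avg_cst => /eqP; rewrite -subr_eq0 addrK => /eqP //.
have iM : (\int[lebesgue_measure]_(x in `[0%R, 1%R]) (cst M%:E x : \bar R) = M%:E)%E.
  rewrite integral_cst//= lebesgue_measure_itv /= lte_fin ltr01.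
  by rewrite oppr0 adde0 mule1.
have T2I x y : x \in `[0, 1] -> y \in `[0, 1] -> T2 (x, y) :> Prop by [].
apply: EFin_inj; rewrite avgE//.
transitivity (\int[mu2]_(x in T2) (`|g x + M|)%:E)%E.
  by apply: eq_integral => x /set_mem Tx; rewrite gM0.
have mF : measurable_fun setT (fun x : R * R => (`|g x + M|)%:E).
  by apply/measurable_EFinP; exact: continuous_measurable2.
have F0 : forall x : R * R, (0 <= (`|g x + M|)%:E)%E by move=> x; rewrite lee_fin.
have [E1 E2] := tonelli_T2 _ mF F0.
case: H => H.
- rewrite E1 -[RHS]iM; apply: eq_integral => x /set_mem /= Ix.
  rewrite -[RHS]iM.
  transitivity (\int[lebesgue_measure]_(y in `[0%R, 1%R]) ((g (x, y))%:E + cst M%:E y))%E.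
    by apply: eq_integral => y /set_mem /= Iy; rewrite gM0 // EFinD.
  rewrite integralD//=.
  + by rewrite H add0e.
  + by apply: (@continuous_itv_integrable _ (fun y => g (x, y))); exact: continuous_pair1.
  + by apply: (@continuous_itv_integrable _ (cst M)) => ?; exact: cvg_cst.
- rewrite E2 -[RHS]iM; apply: eq_integral => y /set_mem /= Iy.
  rewrite -[RHS]iM.
  transitivity (\int[lebesgue_measure]_(x in `[0%R, 1%R]) ((g (x, y))%:E + cst M%:E x))%E.
    by apply: eq_integral => x /set_mem /= Ix; rewrite gM0 // EFinD.
  rewrite integralD//=.
  + by rewrite H add0e.
  + by apply: (@continuous_itv_integrable _ (fun x => g (x, y))); exact: continuous_pair2.
  + by apply: (@continuous_itv_integrable _ (cst M)) => ?; exact: cvg_cst.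
Qed.

Lemma periodic_upd {R : realType} (f : R * (R * R) -> R) i x t :
  torus_periodic f -> val i != 0%N -> f (upd i x (t + 1)) = f (upd i x t).
Proof.
move=> pf; case: x => [a [b c]]; case: i => -[|[|[|//]]] hi //= _; rewrite /upd /=.
- exact: (pf a t c).1.
- exact: (pf a b t).2.
Qed.

(** Along a periodic direction the integral of a derivative over one period is a difference of equal
    values. *)
Lemma mean_pd0 {R : realType} (f : R * (R * R) -> R) i x1 : Ck 1 f -> torus_periodic f ->
  val i != 0%N -> mean (pd i f) x1 = 0.
Proof.
move=> Cf pf.
have key x : val i != 0%N -> (\int[lebesgue_measure]_(t in `[0%R, 1%R]) (pd i f (upd i x t))%:E = 0)%E.
  move=> i0.
  have cdf : continuous (pd i f) by exact: (Ck_cont 0 _ (Ck_pd _ _ _ Cf)).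
  have E t := pd_line i f x t.
  under eq_integral do rewrite E.
  rewrite ftc2//.
  - by rewrite -[1%R]add0r periodic_upd // subrr.
  - by move=> t; apply: derivable_line => y; exact: Ck_der Cf.
  - rewrite (_ : derive1 _ = fun t => pd i f (upd i x t)); last by apply/funext => t; rewrite E.
    move=> t; apply: (continuous_comp (f := upd i x)); [exact: continuous_upd|exact: cdf].
move=> i0; apply: avg_eq0.
  by apply: continuous_pair1; exact: (Ck_cont 0 _ (Ck_pd _ _ _ Cf)).
case: i key i0 => -[//|[|[|//]]] hi key i0.
- by right => y; have := key (x1, (0, y)) i0.
- by left => x; have := key (x1, (x, 0)) i0.
Qed.

Lemma periodic_pd {R : realType} (f : R * (R * R) -> R) i : torus_periodic f -> torus_periodic (pd i f).
Proof.
have key (v : R * (R * R)) : (forall x, f (x + v) = f x) -> forall x, pd i f (x + v) = pd i f x.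
  move=> H x; rewrite /pd /derive.
  rewrite (_ : (fun h : R => _) = (fun h : R => h^-1 *: ((f \o shift x) (h *: unitv i) - f x))) //.
  by apply/funext => h /=; rewrite addrA !H.
move=> pf x1 x2 x3; split.
- have := key (0, (1, 0)) _ (x1, (x2, x3)).
  rewrite pair3D !addr0; apply.
  move=> [a [b c]]; have := (pf a b c).1; by rewrite pair3D !addr0.
- have := key (0, (0, 1)) _ (x1, (x2, x3)).
  rewrite pair3D !addr0; apply.
  move=> [a [b c]]; have := (pf a b c).2; by rewrite pair3D !addr0.
Qed.

Definition Cper {R : realType} n (f : R * (R * R) -> R) := Ck n f /\ torus_periodic f.

(** For [x1] this is differentiation under the integral; for the two periodic directions both sides
    vanish. *)
Lemma bar_pd {R : realType} (f : R * (R * R) -> R) i : Cper 1 f ->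
  (forall x, derivable (bar f) x (unitv i)) /\ pd i (bar f) = bar (pd i f).
Proof.
move=> [Cf pf].
have [h1 h2] := pd_fst i (mean f) (fun y => (mean_derive f Cf y).1).
split => //.
rewrite /bar [LHS]h2; apply/funext => x.
have i0 : val i != 0%N \/ i = ord0.
  by case: i {h1 h2} => -[|m] hi; [right; exact: val_inj|left].
case: i0 => [i0|->].
  by rewrite mean_pd0 //; case: i i0 {h1 h2} => -[].
by rewrite /= (mean_derive f Cf _).2.
Qed.

Lemma Cper_pd {R : realType} n (f : R * (R * R) -> R) i : Cper n.+1 f -> Cper n (pd i f).
Proof. by move=> [Cf pf]; split; [exact: Ck_pd|exact: periodic_pd]. Qed.

Lemma Ck_bar {R : realType} n (f : R * (R * R) -> R) : Cper n f -> Ck n (bar f).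
Proof.
elim: n f => [|n IH] f Cf.
  split=> // x; apply: (continuous_comp (f := fst)); first exact: cvg_fst.
  by apply: mean_continuous; exact: (Ck_cont _ _ Cf.1).
split.
  move=> x; apply: (continuous_comp (f := fst)); first exact: cvg_fst.
  by apply: mean_continuous; exact: (Ck_cont _ _ Cf.1).
move=> i; have C1 : Cper 1 f by split; [exact: Ck_le Cf.1|exact: Cf.2].
have [h ->] := bar_pd f i C1; split => //; apply: IH; exact: Cper_pd.
Qed.

Lemma Ck_neq {R : realType} n (f : R * (R * R) -> R) : Cper n f -> Ck n (neq f).
Proof. by move=> Cf; apply: CkD; [exact: Cf.1|apply: CkN; exact: Ck_bar]. Qed.

Lemma neq_pd {R : realType} (f : R * (R * R) -> R) i : Cper 1 f -> pd i (neq f) = neq (pd i f).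
Proof.
move=> Cf; have [h hb] := bar_pd f i Cf.
have df x := Ck_der 0 f i x Cf.1.
have [h1 h2] := pdN i (bar f) h.
have [_ h3] := pdD i f (fun x => - bar f x) df h1.
by rewrite /neq [LHS]h3 h2 hb.
Qed.

Lemma periodic_neq {R : realType} (f : R * (R * R) -> R) : torus_periodic f -> torus_periodic (neq f).
Proof.
move=> pf a b c; have [h1 h2] := pf a b c.
by rewrite /neq /= h1 h2.
Qed.

Lemma Cper_neq {R : realType} n (f : R * (R * R) -> R) : Cper n f -> Cper n (neq f).
Proof. by move=> Cf; split; [exact: Ck_neq|apply: periodic_neq; exact: Cf.2]. Qed.

(** * L^2 bounds for fluctuations *)

(** Cauchy-Schwarz on an interval of length at most one. With [c = g y - g x], the inequality
    [(g' - c)^2 >= 0] gives [g'^2 >= 2 c g' - c^2], and the right side, whose primitive is [G],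
    integrates to [c^2 (2 - (y - x)) >= c^2]. *)
Lemma osc_le {R : realType} (g : R -> R) (a b x y : R) :
  (forall x, derivable g x 1) -> continuous (derive1 g) ->
  x \in `[a, b] -> y \in `[a, b] -> b <= a + 1 ->
  (((g y - g x) ^+ 2)%:E <= \int[lebesgue_measure]_(t in `[a, b]) ((derive1 g t) ^+ 2)%:E)%E.
Proof.
move=> dg cg.
wlog xy : x y / x <= y.
  move=> H xI yI b1; have [xy|yx] := leP x y; first exact: H.
  have -> : (g y - g x) ^+ 2 = (g x - g y) ^+ 2 by ring.
  by apply: H => //; exact: ltW.
rewrite !in_itv /= => /andP[ax xb] /andP[ay yb] b1.
set c := g y - g x.
pose G t := 2 * c * g t - c ^+ 2 * t.
have dG t : is_derive t (1 : R) G (2 * c * derive1 g t - c ^+ 2).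
  rewrite /G; have := is_derive_derive1 g t (dg t) => dgt.
  have -> : 2 * c * derive1 g t - c ^+ 2 = (2 * c) *: derive1 g t - c ^+ 2 *: (1 : R) by rewrite [c ^+ 2 *: 1]mulr1.
  exact: (@is_deriveB R R R (fun t => 2 * c * g t) (fun t => c ^+ 2 * t)).
have EG : derive1 G = fun t => 2 * c * derive1 g t - c ^+ 2.
  by apply/funext => t; rewrite derive1E; have [_ ->] := dG t.
have cG : continuous (derive1 G).
  rewrite EG => t; apply: cvgB; last exact: cvg_cst.
  by apply: cvgM; [exact: cvg_cst|exact: cg].
have F := ftc2 G x y xy (fun t => @ex_derive _ _ _ _ _ _ _ (dG t)) cG.
have cg2 : continuous (fun t => derive1 g t ^+ 2) by exact: continuous_sqr.
apply: (@le_trans _ _ (\int[lebesgue_measure]_(t in `[x, y]) ((derive1 g t) ^+ 2)%:E)%E); last first.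
  apply: ge0_subset_integral => //.
  - apply: measurable_funTS; apply/measurable_EFinP; exact: continuous_measurable_fun.
  - by move=> t _; rewrite lee_fin sqr_ge0.
  - by move=> t /=; rewrite !in_itv /= => /andP[h1 h2]; rewrite (le_trans ax h1) (le_trans h2 yb).
apply: (@le_trans _ _ (\int[lebesgue_measure]_(t in `[x, y]) (derive1 G t)%:E)%E).
  rewrite F lee_fin /G.
  have -> : 2 * c * g y - c ^+ 2 * y - (2 * c * g x - c ^+ 2 * x) = c ^+ 2 + c ^+ 2 * (1 - (y - x)).
    by rewrite /c; ring.
  by rewrite lerDl mulr_ge0 ?sqr_ge0//; lra.
apply: le_integral => //.
- exact: continuous_itv_integrable.
- exact: continuous_itv_integrable.
- move=> t _; rewrite lee_fin EG -subr_ge0.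
  have -> : derive1 g t ^+ 2 - (2 * c * derive1 g t - c ^+ 2) = (derive1 g t - c) ^+ 2 by ring.
  exact: sqr_ge0.
Qed.

(** Average over [t] in a unit interval of [g x ^ 2 <= 2 g t ^ 2 + 2 (g x - g t) ^ 2], the
    difference being bounded by [osc_le]. *)
Lemma sqr_le_itv {R : realType} (g : R -> R) (a b x : R) :
  (forall x, derivable g x 1) -> continuous (derive1 g) ->
  x \in `[a, b] -> b = a + 1 ->
  (((g x) ^+ 2)%:E <= 2%:E * \int[lebesgue_measure]_(t in `[a, b]) (g t ^+ 2)%:E
     + 2%:E * \int[lebesgue_measure]_(t in `[a, b]) ((derive1 g t) ^+ 2)%:E)%E.
Proof.
move=> dg cg xI ba.
have cg0 : continuous g by move=> t; apply: differentiable_continuous; apply/derivable1_diffP.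
have cg02 : continuous (fun t => 2 * g t ^+ 2).
  by move=> t; apply: cvgM; [exact: cvg_cst|exact: continuous_sqr].
set D := (\int[lebesgue_measure]_(t in `[a, b]) ((derive1 g t) ^+ 2)%:E)%E.
have lab : (lebesgue_measure (`[a, b]%classic : set R) = 1)%E.
  rewrite lebesgue_measure_itv /= lte_fin ba ltrDl ltr01.
  by rewrite -EFinD; congr (_ %:E); ring.
have D0 : (0 <= D)%E by apply: integral_ge0 => t _; rewrite lee_fin sqr_ge0.
have mg : measurable_fun `[a, b] (fun t => (g t ^+ 2)%:E).
  by apply: measurable_funTS; apply/measurable_EFinP; apply: continuous_measurable_fun; exact: continuous_sqr.
have -> : (((g x) ^+ 2)%:E = \int[lebesgue_measure]_(t in `[a, b]) ((g x) ^+ 2)%:E)%E.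
  by rewrite integral_cst//= [X in (_ * X)%E]lab mule1.
have -> : (2%:E * D = \int[lebesgue_measure]_(t in `[a, b]) (2%:E * D))%E.
  by rewrite integral_cst//= -[LHS]mule1; congr (_ * _)%E; exact/esym/lab.
rewrite -ge0_integralZl//; last by move=> t _; rewrite lee_fin sqr_ge0.
rewrite -ge0_integralD//; last 3 first.
- by move=> t _; rewrite mule_ge0// lee_fin sqr_ge0.
- by apply: measurable_funTS; apply/measurable_EFinP; apply: continuous_measurable_fun.
- by move=> t _; rewrite mule_ge0.
apply: ge0_le_integral => //.
- by move=> t _; rewrite lee_fin sqr_ge0.
- apply: emeasurable_funD => //.
  by apply: measurable_funTS; apply/measurable_EFinP; apply: continuous_measurable_fun.
- move=> t tI.
  apply: (@le_trans _ _ (2%:E * (g t ^+ 2)%:E + 2%:E * ((g x - g t) ^+ 2)%:E)%E).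
    rewrite -!EFinM -EFinD lee_fin -subr_ge0.
    have -> : 2 * g t ^+ 2 + 2 * (g x - g t) ^+ 2 - g x ^+ 2 = (g x - 2 * g t) ^+ 2 by ring.
    exact: sqr_ge0.
  rewrite leeD2l//; apply: lee_pmul => //; first by rewrite lee_fin sqr_ge0.
  by apply: osc_le => //; rewrite ba.
Qed.

Lemma L2sq_ge0 {R : realType} (f : R * (R * R) -> R) : (0 <= L2sq f)%E.
Proof. by apply: integral_ge0 => x _; rewrite lee_fin sqr_ge0. Qed.

Lemma measurable_EFin3 {R : realType} (f : R * (R * R) -> R) : continuous f ->
  measurable_fun setT (fun x => (f x)%:E).
Proof. by move=> cf; apply/measurable_EFinP; exact: continuous_measurable3. Qed.

Lemma L2sq_slice {R : realType} (f : R * (R * R) -> R) : continuous f ->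
  (L2sq f = \int[lebesgue_measure]_x1 (\int[mu2]_(x' in T2) (f (x1, x') ^+ 2))%:E)%E.
Proof.
move=> cf; rewrite /L2sq (tonelli_Omega (fun x => (f x ^+ 2)%:E)).
- by apply: eq_integral => x _; rewrite avgE//; apply: continuous_sqr; exact: continuous_pair1.
- by apply: measurable_EFin3; exact: continuous_sqr.
- by move=> x; rewrite lee_fin sqr_ge0.
Qed.

Lemma measurable_mean {R : realType} (f : R * (R * R) -> R) : continuous f ->
  measurable_fun setT (fun x1 => (\int[mu2]_(x' in T2) f (x1, x'))%:E).
Proof.
move=> cf; apply/measurable_EFinP; apply: continuous_measurable_fun; exact: mean_continuous.
Qed.

Lemma neq_continuous {R : realType} (f : R * (R * R) -> R) : continuous f -> continuous (neq f).
Proof.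
move=> cf x; apply: cvgB; first exact: cf.
apply: (continuous_comp (f := fst)); first exact: cvg_fst.
exact: mean_continuous.
Qed.

(** On each slice the mean minimises the square distance to constants, so any function [c] of [x1]
    may stand for the zero mode. Zero modes are thereby cancelled without being computed. *)
Lemma L2sq_neq_le {R : realType} (F B : R * (R * R) -> R) (c : R -> R) :
  continuous F -> continuous B -> (forall x, Omega x -> `|F x - c x.1| <= B x) ->
  (L2sq (neq F) <= L2sq B)%E.
Proof.
move=> cF cB FB.
have cn := neq_continuous F cF.
rewrite !L2sq_slice//; apply: ge0_le_integral => //.
- by move=> x _; rewrite lee_fin; apply: Rintegral_ge0 => y _; exact: sqr_ge0.
- by apply: (measurable_mean (fun x => neq F x ^+ 2)); exact: continuous_sqr.
- by apply: (measurable_mean (fun x => B x ^+ 2)); exact: continuous_sqr.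
- move=> x _; rewrite lee_fin.
  apply: le_trans (var_min (fun y => F (x, y)) (c x) (continuous_pair1 _ _ cF)) _.
  apply: le_avg.
  + apply: continuous_sqr => y; apply: cvgB; last exact: cvg_cst.
    exact: continuous_pair1.
  + by apply: continuous_sqr; exact: continuous_pair1.
  + move=> y Ty; rewrite -real_normK ?num_real// lerXn2r// ?nnegrE//.
    * exact: le_trans (normr_ge0 _) (FB (x, y) _).
    * exact: (FB (x, y)).
Qed.

Lemma le_L2sq {R : realType} (F B : R * (R * R) -> R) :
  continuous F -> continuous B -> (forall x, Omega x -> `|F x| <= `|B x|) ->
  (L2sq F <= L2sq B)%E.
Proof.
move=> cF cB FB.
apply: ge0_le_integral => //.
- exact: measurable_Omega.
- by move=> x _; rewrite lee_fin sqr_ge0.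
- by apply: measurable_funTS; apply: (measurable_EFin3 (fun x => F x ^+ 2)); exact: continuous_sqr.
- by apply: measurable_funTS; apply: (measurable_EFin3 (fun x => B x ^+ 2)); exact: continuous_sqr.
- move=> x Ox; rewrite lee_fin -[F x ^+ 2]real_normK ?num_real// -[B x ^+ 2]real_normK ?num_real//.
  by rewrite lerXn2r ?nnegrE// FB.
Qed.

Lemma sqr_sum_le {R : realType} {I : Type} (fs : seq I) (F : I -> R) :
  (\sum_(f <- fs) F f) ^+ 2 <= (size fs)%:R * \sum_(f <- fs) F f ^+ 2.
Proof.
elim: fs => [|f fs IH]; first by rewrite !big_nil mul0r expr2 mul0r.
rewrite !big_cons /=; set S := \sum_(j <- fs) F j; set Q := \sum_(j <- fs) _.
have IH' : S ^+ 2 <= (size fs)%:R * Q by exact: IH.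
have Q0 : 0 <= Q by apply: sumr_ge0 => i _; exact: sqr_ge0.
rewrite sqrrD -natr1 mulrDl mul1r mulrDr.
(* Young's inequality with weight [n], multiplied by [n] to clear the division; the empty tail is
   separate because [n] would be [0]. *)
have key : F f * S *+ 2 <= (size fs)%:R * F f ^+ 2 + Q.
  case: fs @S @Q IH' Q0 {IH} => [|g fs] S Q; first by rewrite /S /Q !big_nil /=; lra.
  set n := (size (g :: fs))%:R => SQ Q0.
  have n0 : 0 < n by rewrite ltr0n.
  rewrite -(ler_pM2l n0) [X in _ <= X]mulrDr.
  apply: (@le_trans _ _ (n * (n * F f ^+ 2) + S ^+ 2)); last by rewrite lerD2l.
  rewrite -subr_ge0.
  have -> : n * (n * F f ^+ 2) + S ^+ 2 - n * (F f * S *+ 2) = (n * F f - S) ^+ 2 by ring.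
  exact: sqr_ge0.
nra.
Qed.

Lemma continuous_abs {R : realType} {T : topologicalType} (f : T -> R) : continuous f ->
  continuous (fun x => `|f x|).
Proof. by move=> cf x; apply: (@cvg_norm _ R); exact: cf. Qed.

Definition all_cont {R : realType} (fs : seq (R * (R * R) -> R)) :=
  foldr (fun f P => continuous f /\ P) True fs.

Definition sum_abs {R : realType} (fs : seq (R * (R * R) -> R)) (x : R * (R * R)) : R :=
  \sum_(f <- fs) `|f x|.

Lemma sum_abs_continuous {R : realType} (fs : seq (R * (R * R) -> R)) :
  all_cont fs -> continuous (sum_abs fs).
Proof.
move=> cfs x; rewrite /sum_abs; elim: fs cfs => [|i fs IH] /=.
  by move=> _; under eq_fun do rewrite big_nil; exact: cvg_cst.
move=> [ci cfs]; under eq_fun do rewrite big_cons.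
by apply: cvgD; [exact: continuous_abs|exact: IH].
Qed.

Lemma L2sq_sum_abs {R : realType} (C : R) (fs : seq (R * (R * R) -> R)) :
  all_cont fs ->
  (L2sq (fun x => (C * sum_abs fs x)%R) <= (C ^+ 2 * (size fs)%:R)%:E * \sum_(f <- fs) L2sq f)%E.
Proof.
move=> cfs.
have S2 : (forall f, List.In f fs -> continuous f).
  elim: fs cfs => [//|g fs IH] /= [cg cfs] f [<-//|]; exact: IH.
have cS : continuous (fun x => \sum_(f <- fs) f x ^+ 2).
  move=> x; elim: fs cfs {S2} => [|i fs IH] /=.
    by move=> _; under eq_fun do rewrite big_nil; exact: cvg_cst.
  move=> [ci cfs]; under eq_fun do rewrite big_cons.
  by apply: cvgD; [exact: continuous_sqr|exact: IH].
have E : (\sum_(f <- fs) L2sq f = \int[mu3]_(x in Omega) (\sum_(f <- fs) f x ^+ 2)%:E)%E.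
  elim: fs cfs {S2 cS} => [|g fs IH] /=.
    by rewrite big_nil => _; rewrite integral0_eq// => x _; rewrite big_nil.
  move=> [cg cfs]; rewrite big_cons IH// /L2sq -ge0_integralD//.
  - by apply: eq_integral => x _; rewrite big_cons EFinD.
  - exact: measurable_Omega.
  - by move=> x _; rewrite lee_fin sqr_ge0.
  - by apply: measurable_funTS; apply: (measurable_EFin3 (fun x => g x ^+ 2)); exact: continuous_sqr.
  - by move=> x _; rewrite lee_fin; apply: sumr_ge0 => i _; exact: sqr_ge0.
  - apply: measurable_funTS; apply: (measurable_EFin3 (fun x => \sum_(f <- fs) f x ^+ 2)).
    move=> x; elim: fs cfs {IH} => [|i fs IH] /=.
      by move=> _; under eq_fun do rewrite big_nil; exact: cvg_cst.
    move=> [ci cfs]; under eq_fun do rewrite big_cons.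
    by apply: cvgD; [exact: continuous_sqr|exact: IH].
have cB : continuous (fun x => C * sum_abs fs x).
  by move=> x; apply: cvgM; [exact: cvg_cst|exact: sum_abs_continuous].
rewrite E -ge0_integralZl//; last 4 first.
- exact: measurable_Omega.
- by apply: measurable_funTS; exact: (measurable_EFin3 (fun x => \sum_(f <- fs) f x ^+ 2)).
- by move=> x _; rewrite lee_fin; apply: sumr_ge0 => i _; exact: sqr_ge0.
- by rewrite lee_fin mulr_ge0 // sqr_ge0.
apply: ge0_le_integral => //.
- exact: measurable_Omega.
- by move=> x _; rewrite lee_fin sqr_ge0.
- by apply: measurable_funTS; apply: (measurable_EFin3 (fun x => (C * sum_abs fs x) ^+ 2)); exact: continuous_sqr.
- apply: measurable_funTS; under eq_fun do rewrite -EFinM.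
  apply: (measurable_EFin3 (fun x => C ^+ 2 * (size fs)%:R * \sum_(f <- fs) f x ^+ 2)).
  by move=> x; apply: cvgM; [exact: cvg_cst|exact: cS].
- move=> x _; rewrite -EFinM lee_fin exprMn -(mulrA (C ^+ 2)); apply: ler_wpM2l; first exact: sqr_ge0.
  apply: le_trans (sqr_sum_le fs (fun f => `|f x|)) _.
  rewrite le_eqVlt; apply/orP; left; apply/eqP; congr (_ * _).
  by apply: eq_bigr => f _; rewrite real_normK ?num_real.
Qed.

(** [fs] carries the small factor [C], while [gs] receives terms whose size is already contained in
    the functions, such as products of a fluctuation with a zero mode that is only square
    integrable. *)
Lemma neq_L2_bound {R : realType} (F : R * (R * R) -> R) (fs gs : seq (R * (R * R) -> R)) (C : R) (c : R -> R) :
  continuous F -> all_cont fs -> all_cont gs -> 0 <= C ->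
  (forall x, Omega x -> `|F x - c x.1| <= C * sum_abs fs x + sum_abs gs x) ->
  (L2sq (neq F) <= (2 * C ^+ 2 * (size fs)%:R)%:E * \sum_(f <- fs) L2sq f
     + (2 * (size gs)%:R)%:E * \sum_(g <- gs) L2sq g)%E.
Proof.
move=> cF cfs cgs C0 H.
have cA : continuous (fun x => C * sum_abs fs x).
  by move=> x; apply: cvgM; [exact: cvg_cst|exact: sum_abs_continuous].
have cB : continuous (fun x => 1 * sum_abs gs x).
  by move=> x; apply: cvgM; [exact: cvg_cst|exact: sum_abs_continuous].
have cAB : continuous (fun x => C * sum_abs fs x + 1 * sum_abs gs x).
  by move=> x; apply: cvgD; [exact: cA|exact: cB].
apply: le_trans.
  apply: (L2sq_neq_le F (fun x => C * sum_abs fs x + 1 * sum_abs gs x) c) => // x Ox.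
  by rewrite mul1r H.
have h1 := L2sq_sum_abs C fs cfs; have h2 := L2sq_sum_abs 1 gs cgs.
pose hs := [:: (fun x => C * sum_abs fs x); (fun x => 1 * sum_abs gs x)].
have h3 := L2sq_sum_abs 1 hs (conj cA (conj cB I)).
apply: (@le_trans _ _ (L2sq (fun x => (1 * sum_abs hs x)%R))).
  apply: le_L2sq => //.
    by move=> x; apply: cvgM; [exact: cvg_cst|apply: sum_abs_continuous].
  move=> x _; have -> : 1 * sum_abs hs x = `|C * sum_abs fs x| + `|1 * sum_abs gs x|.
    by rewrite mul1r /sum_abs !big_cons big_nil addr0.
  by rewrite [X in _ <= X]ger0_norm ?ler_normD// addr_ge0.
apply: le_trans h3 _; rewrite !big_cons big_nil adde0 /=.
rewrite ge0_muleDr ?L2sq_ge0//.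
apply: leeD.
- apply: le_trans (lee_pmul _ _ (lexx _) h1) _ => //; first exact: L2sq_ge0.
  rewrite muleA -EFinM; have -> : 1 ^+ 2 * 2%:R * (C ^+ 2 * (size fs)%:R) = 2 * C ^+ 2 * (size fs)%:R :> R by ring.
  exact: lexx.
- apply: le_trans (lee_pmul _ _ (lexx _) h2) _ => //; first exact: L2sq_ge0.
  rewrite muleA -EFinM; have -> : 1 ^+ 2 * 2%:R * (1 ^+ 2 * (size gs)%:R) = 2 * (size gs)%:R :> R by ring.
  exact: lexx.
Qed.

Lemma T2_integral_cst {R : realType} (c : \bar R) : (\int[mu2]_(x in @T2 R) c = c)%E.
Proof.
rewrite integral_cst; last exact: measurable_T2.
by rewrite -[RHS]mule1; congr (_ * _)%E; exact: mu2_T2.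
Qed.

Lemma I01_integral_cst {R : realType} (c : \bar R) :
  (\int[lebesgue_measure]_(x in `[0%R, 1%R]%classic : set R) c = c)%E.
Proof.
rewrite integral_cst//= lebesgue_measure_itv /= lte_fin ltr01.
by rewrite oppr0 adde0 mule1.
Qed.

Lemma T2_integral_fst {R : realType} (A : R -> \bar R) :
  measurable_fun setT A -> (forall x, 0 <= A x)%E ->
  (\int[mu2]_(x in T2) A x.1 = \int[lebesgue_measure]_(x in `[0%R, 1%R]) A x)%E /\
  (\int[mu2]_(x in T2) A x.2 = \int[lebesgue_measure]_(x in `[0%R, 1%R]) A x)%E.
Proof.
move=> mA A0; split.
- rewrite (tonelli_T2 (fun x => A x.1) (measurableT_comp mA measurable_fst) (fun x => A0 x.1)).1.
  by apply: eq_integral => y _ /=; exact: I01_integral_cst.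
- rewrite (tonelli_T2 (fun x => A x.2) (measurableT_comp mA measurable_snd) (fun x => A0 x.2)).2.
  by apply: eq_integral => y _ /=; exact: I01_integral_cst.
Qed.

Lemma measurable_int_I01 {R : realType} (F : R * R -> \bar R) :
  measurable_fun setT F -> (forall x, 0 <= F x)%E ->
  measurable_fun setT (fun x => \int[lebesgue_measure]_(y in `[0%R, 1%R]) F (x, y))%E /\
  measurable_fun setT (fun y => \int[lebesgue_measure]_(x in `[0%R, 1%R]) F (x, y))%E.
Proof.
move=> mF F0; split.
- have := @measurable_fun_fubini_tonelli_F _ _ R (mR R) R lebesgue_measure (F \_ (setT `*` `[0%R, 1%R]%classic)).
  have H1 : measurable_fun setT (F \_ (setT `*` `[0%R, 1%R]%classic)).
    apply: (measurable_restrictT F _).1; first exact: measurableX.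
    exact: measurable_funTS.
  have H2 x : (0 <= (F \_ (setT `*` `[0%R, 1%R]%classic)) x)%E by rewrite erestrict_ge0.
  move=> /(_ H1 H2); congr (measurable_fun _ _); apply/funext => x; rewrite /fubini_F.
  rewrite [RHS]integral_mkcond; apply: eq_integral => y _; rewrite !patchE; congr (if _ then _ else _).
  by rewrite in_setX /= in_setT.
- have := @measurable_fun_fubini_tonelli_G _ _ (mR R) R R lebesgue_measure (F \_ (`[0%R, 1%R]%classic `*` setT)).
  have H1 : measurable_fun setT (F \_ (`[0%R, 1%R]%classic `*` setT)).
    apply: (measurable_restrictT F _).1; first exact: measurableX.
    exact: measurable_funTS.
  have H2 x : (0 <= (F \_ (`[0%R, 1%R]%classic `*` setT)) x)%E by rewrite erestrict_ge0.
  move=> /(_ H1 H2); congr (measurable_fun _ _); apply/funext => x; rewrite /fubini_G.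
  rewrite [RHS]integral_mkcond; apply: eq_integral => y _; rewrite !patchE; congr (if _ then _ else _).
  by rewrite in_setX /= in_setT andbT.
Qed.

(** The path from [x] to [y] changes the second coordinate at height [x3], then the third at
    abscissa [y2]. Its legs are bounded by [A] at [x3] and by [B] at [y2], so averaging over [y] and
    then over [x] separates into full integrals over the cell. *)
Lemma poincare_dirs {R : realType} (f : R * (R * R) -> R) (i1 i2 : 'I_3) :
  val i1 = 1%N -> val i2 = 2%N -> Ck 1 f ->
  (L2sq (neq f) <= 2%:E * (L2sq (pd i1 f) + L2sq (pd i2 f)))%E.
Proof.
move=> v1 v2 Cf.
have cf : continuous f by exact: Ck_cont Cf.
have c1 : continuous (pd i1 f) by exact: (Ck_cont 0 _ (Ck_pd _ _ _ Cf)).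
have c2 : continuous (pd i2 f) by exact: (Ck_cont 0 _ (Ck_pd _ _ _ Cf)).
have m1 := measurable_EFin3 (fun x => pd i1 f x ^+ 2) (continuous_sqr _ c1).
have m2 := measurable_EFin3 (fun x => pd i2 f x ^+ 2) (continuous_sqr _ c2).
have sq0 (g : R * (R * R) -> R) x : (0 <= (g x ^+ 2)%:E)%E by rewrite lee_fin sqr_ge0.
rewrite (L2sq_slice _ (neq_continuous _ cf)).
rewrite {1}/L2sq (tonelli_Omega _ m1 (sq0 _)).
rewrite {1}/L2sq (tonelli_Omega _ m2 (sq0 _)).
have mS (g : R * (R * R) -> R) : continuous g -> measurable_fun setT (fun x1 : R => \int[mu2]_(x' in T2) (g (x1, x')
  ^+ 2)%:E)%E.
  move=> cg; rewrite (_ : (fun x1 => _) = (fun x1 => (\int[mu2]_(x' in T2) (g (x1, x') ^+ 2))%:E)).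
    apply: (measurable_mean (fun x => g x ^+ 2)); exact: continuous_sqr.
  by apply/funext => x1; rewrite avgE//; apply: continuous_sqr; exact: continuous_pair1.
have iS (g : R * (R * R) -> R) x1 : (0 <= \int[mu2]_(x' in T2) (g (x1, x') ^+ 2)%:E)%E.
  by apply: integral_ge0 => x _; rewrite lee_fin sqr_ge0.
rewrite -ge0_integralD; [|exact: measurableT|by move=> x _; exact: iS|exact: (mS _ c1)|by move=> x _; exact:
  iS|exact: (mS _ c2)].
rewrite -ge0_integralZl; [|exact: measurableT|by apply: emeasurable_funD; [exact: (mS _ c1)|exact: (mS _ c2)]|by
  move=> x _; apply: adde_ge0; exact: iS|by []].
apply: ge0_le_integral => //.
- by move=> x _; rewrite lee_fin; apply: Rintegral_ge0 => y _; exact: sqr_ge0.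
- by apply: (measurable_mean (fun x => neq f x ^+ 2)); apply: continuous_sqr; exact: neq_continuous.
- apply: emeasurable_funM; first exact: measurable_cst.
  by apply: emeasurable_funD; [exact: (mS _ c1)|exact: (mS _ c2)].
move=> x1 _.
pose A x3 := (\int[lebesgue_measure]_(t in `[0%R, 1%R]) (pd i1 f (x1, (t, x3)) ^+ 2)%:E)%E.
pose B y2 := (\int[lebesgue_measure]_(t in `[0%R, 1%R]) (pd i2 f (x1, (y2, t)) ^+ 2)%:E)%E.
have mp (g : R * (R * R) -> R) : continuous g -> measurable_fun setT (fun x : R * R => (g (x1, x) ^+ 2)%:E).
  move=> cg; apply/measurable_EFinP; apply: continuous_measurable2; apply: continuous_sqr.
  exact: continuous_pair1.
have mA : measurable_fun setT A by exact: (measurable_int_I01 _ (mp _ c1) (fun x => sq0 (pd i1 f) (x1, x))).2.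
have mB : measurable_fun setT B by exact: (measurable_int_I01 _ (mp _ c2) (fun x => sq0 (pd i2 f) (x1, x))).1.
have A0 y : (0 <= A y)%E by apply: integral_ge0 => x _; rewrite lee_fin sqr_ge0.
have B0 y : (0 <= B y)%E by apply: integral_ge0 => x _; rewrite lee_fin sqr_ge0.
have EA : (\int[mu2]_(x in T2) A x.2 = \int[mu2]_(x' in T2) (pd i1 f (x1, x') ^+ 2)%:E)%E.
  by rewrite (T2_integral_fst A mA A0).2 (tonelli_T2 _ (mp _ c1) (fun x => sq0 (pd i1 f) (x1, x))).2.
have EB : (\int[mu2]_(x in T2) B x.1 = \int[mu2]_(x' in T2) (pd i2 f (x1, x') ^+ 2)%:E)%E.
  by rewrite (T2_integral_fst B mB B0).1 (tonelli_T2 _ (mp _ c2) (fun x => sq0 (pd i2 f) (x1, x))).1.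
have D1 (x y : R * R) : T2 x -> T2 y ->
   (((f (x1, x) - f (x1, y)) ^+ 2)%:E <= 2%:E * (A x.2 + B y.1))%E.
  move: x y => [x2 x3] [y2 y3] [/= X2 X3] [/= Y2 Y3].
  apply: (@le_trans _ _ (2%:E * (((f (x1, (x2, x3)) - f (x1, (y2, x3))) ^+ 2)%:E
     + ((f (x1, (y2, x3)) - f (x1, (y2, y3))) ^+ 2)%:E))%E).
    rewrite -EFinD -EFinM lee_fin -subr_ge0.
    set a := f (x1, (x2, x3)); set b := f (x1, (y2, x3)); set c := f (x1, (y2, y3)).
    have -> : 2 * ((a - b) ^+ 2 + (b - c) ^+ 2) - (a - c) ^+ 2 = (a - 2 * b + c) ^+ 2 by ring.
    exact: sqr_ge0.
  apply: lee_pmul => //; first by rewrite -EFinD lee_fin addr_ge0 ?sqr_ge0.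
  have E1 t : upd i1 (x1, (0, x3)) t = (x1, (t, x3)) by rewrite /upd v1.
  have E2 t : upd i2 (x1, (y2, 0)) t = (x1, (y2, t)) by rewrite /upd v2.
  apply: leeD.
  - have := @osc_le R (fun t => f (upd i1 (x1, (0, x3)) t)) 0 1 y2 x2.
    rewrite !E1 /A; under [in X in _ -> X]eq_integral do rewrite -E1 pd_line.
    apply => //.
    + by move=> t; apply: derivable_line => y; exact: Ck_der Cf.
    + rewrite (_ : derive1 _ = fun t => pd i1 f (upd i1 (x1, (0, x3)) t)).
        by move=> t; apply: (continuous_comp (f := upd i1 (x1, (0, x3)))); [exact: continuous_upd|exact: c1].
      by apply/funext => t; rewrite pd_line.
    + by rewrite add0r.
  - have := @osc_le R (fun t => f (upd i2 (x1, (y2, 0)) t)) 0 1 y3 x3.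
    rewrite !E2 /B; under [in X in _ -> X]eq_integral do rewrite -E2 pd_line.
    apply => //.
    + by move=> t; apply: derivable_line => y; exact: Ck_der Cf.
    + rewrite (_ : derive1 _ = fun t => pd i2 f (upd i2 (x1, (y2, 0)) t)).
        by move=> t; apply: (continuous_comp (f := upd i2 (x1, (y2, 0)))); [exact: continuous_upd|exact: c2].
      by apply/funext => t; rewrite pd_line.
    + by rewrite add0r.
have cfx : continuous (fun y => f (x1, y)) by exact: continuous_pair1.
pose IA := (\int[mu2]_(x' in T2) (pd i1 f (x1, x') ^+ 2)%:E)%E.
pose IB := (\int[mu2]_(x' in T2) (pd i2 f (x1, x') ^+ 2)%:E)%E.
have IB0 : (0 <= IB)%E by exact: iS.
have {}EA : (\int[mu2]_(x in T2) A x.2 = IA)%E by exact: EA.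
have {}EB : (\int[mu2]_(x in T2) B x.1 = IB)%E by exact: EB.
suff : ((\int[mu2]_(x' in T2) (neq f (x1, x') ^+ 2))%:E <= 2%:E * (IA + IB))%E by [].
clearbody A B IA IB.
have mB1 : measurable_fun T2 (fun y : R * R => B y.1) by apply: measurable_funTS; apply: (measurableT_comp mB
  measurable_fst).
have mA2 : measurable_fun T2 (fun y : R * R => A y.2) by apply: measurable_funTS; apply: (measurableT_comp mA
  measurable_snd).
have key (x : R * R) : T2 x -> ((neq f (x1, x) ^+ 2)%:E <= 2%:E * (A x.2 + IB))%E.
  move=> Tx.
  have cd : continuous (fun y => f (x1, x) - f (x1, y)).
    by move=> y; apply: cvgB; [exact: cvg_cst|exact: cfx].
  (* The fluctuation is the average of the differences to all other points of the slice, so that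
     Jensen applies. *)
  have -> : neq f (x1, x) = \int[mu2]_(y in T2) (f (x1, x) - f (x1, y)).
    rewrite (avgB (cst (f (x1, x))) (fun y => f (x1, y)))//; first by rewrite avg_cst.
    by move=> ?; exact: cvg_cst.
  apply: (@le_trans _ _ (\int[mu2]_(y in T2) ((f (x1, x) - f (x1, y)) ^+ 2))%:E).
    by rewrite lee_fin; exact: jensen_avg.
  rewrite avgE; last exact: continuous_sqr.
  have -> : (A x.2 + IB = \int[mu2]_(y in T2) (A x.2 + B y.1))%E.
    rewrite ge0_integralD; [|exact: measurable_T2|by move=> y _; exact: A0|exact: measurable_cst|by move=> y _;
      exact: B0|exact: mB1].
    by rewrite T2_integral_cst EB.
  rewrite -ge0_integralZl; [|exact: measurable_T2|by apply: emeasurable_funD; [exact: measurable_cst|exact: mB1]|by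
    move=> y _; apply: adde_ge0|by []].
  apply: ge0_le_integral => //.
  - exact: measurable_T2.
  - by move=> y _; rewrite lee_fin sqr_ge0.
  - apply: measurable_funTS; apply/measurable_EFinP; apply: continuous_measurable2.
    exact: continuous_sqr.
  - apply: emeasurable_funM; first exact: measurable_cst.
    by apply: emeasurable_funD; [exact: measurable_cst|exact: mB1].
  - by move=> y Ty; exact: D1.
have cn : continuous (fun y => neq f (x1, y)) by apply: continuous_pair1; exact: neq_continuous.
rewrite avgE; last exact: continuous_sqr.
have -> : (IA + IB = \int[mu2]_(y in T2) (A y.2 + IB))%E.
  rewrite ge0_integralD; [|exact: measurable_T2|by move=> y _; exact: A0|exact: mA2|by []|exact: measurable_cst].
  by rewrite T2_integral_cst EA.
rewrite -ge0_integralZl; [|exact: measurable_T2|by apply: emeasurable_funD; [exact: mA2|exact: measurable_cst]|by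
  move=> y _; apply: adde_ge0|by []].
apply: ge0_le_integral => //.
- exact: measurable_T2.
- apply: measurable_funTS; apply/measurable_EFinP; apply: continuous_measurable2.
  exact: continuous_sqr.
- apply: emeasurable_funM; first exact: measurable_cst.
  by apply: emeasurable_funD; [exact: mA2|exact: measurable_cst].
Qed.

Lemma poincare {R : realType} (f : R * (R * R) -> R) : Ck 1 f ->
  (L2sq (neq f) <= 2%:E * (L2sq (pd (inord 1) f) + L2sq (pd (inord 2) f)))%E.
Proof. by apply: poincare_dirs; rewrite /= inordK. Qed.

(** The embedding [sqr_le_itv] on [[x1, x1 + 1]] for each [x'], integrated over [x']. The bound does
    not depend on [x1]. *)
Lemma slice_sup {R : realType} (a : R * (R * R) -> R) (x1 : R) : Ck 1 a ->
  ((\int[mu2]_(x' in T2) (a (x1, x') ^+ 2))%:E <= 2%:E * (L2sq a + L2sq (pd ord0 a)))%E.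
Proof.
move=> Ca.
have ca : continuous a by exact: Ck_cont Ca.
have c1 : continuous (pd ord0 a) by exact: (Ck_cont 0 _ (Ck_pd _ _ _ Ca)).
have m0 := measurable_EFin3 (fun x => a x ^+ 2) (continuous_sqr _ ca).
have m1 := measurable_EFin3 (fun x => pd ord0 a x ^+ 2) (continuous_sqr _ c1).
have sq0 (g : R * (R * R) -> R) x : (0 <= (g x ^+ 2)%:E)%E by rewrite lee_fin sqr_ge0.
rewrite {1}/L2sq (tonelli_Omega_sym _ m0 (sq0 _)).
rewrite {1}/L2sq (tonelli_Omega_sym _ m1 (sq0 _)).
have mS (g : R * (R * R) -> R) : continuous g -> measurable_fun setT (fun x' : R * R => \int[lebesgue_measure]_x (g
  (x, x') ^+ 2)%:E)%E.
  move=> cg; have := @measurable_fun_fubini_tonelli_G _ _ (mR R) _ R lebesgue_measure (fun x => (g x ^+ 2)%:E).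
  by apply; [exact: (measurable_EFin3 (fun x => g x ^+ 2) (continuous_sqr _ cg))|move=> x; rewrite lee_fin sqr_ge0].
have iS (g : R * (R * R) -> R) x' : (0 <= \int[lebesgue_measure]_x (g (x, x') ^+ 2)%:E)%E.
  by apply: integral_ge0 => x _; rewrite lee_fin sqr_ge0.
rewrite -ge0_integralD; [|exact: measurable_T2|by move=> x _; exact: iS|by apply: measurable_funTS; exact: (mS _
  ca)|by move=> x _; exact: iS|by apply: measurable_funTS; exact: (mS _ c1)].
rewrite -ge0_integralZl; [|exact: measurable_T2|by apply: measurable_funTS; apply: emeasurable_funD; [exact: (mS _
  ca)|exact: (mS _ c1)]|by move=> x _; apply: adde_ge0; exact: iS|by []].
rewrite avgE; last by apply: continuous_sqr; exact: continuous_pair1.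
apply: ge0_le_integral => //.
- exact: measurable_T2.
- apply: measurable_funTS; apply/measurable_EFinP; apply: continuous_measurable2.
  by apply: continuous_sqr; exact: continuous_pair1.
- apply: measurable_funTS; apply: emeasurable_funM; first exact: measurable_cst.
  by apply: emeasurable_funD; [exact: (mS _ ca)|exact: (mS _ c1)].
move=> x' _.
have E t : upd ord0 (0, x') t = (t, x') by [].
have := @sqr_le_itv R (fun t => a (upd ord0 (0, x') t)) x1 (x1 + 1) x1.
rewrite !E => H; apply: le_trans (H _ _ _ erefl) _.
- by move=> t; apply: derivable_line => y; exact: Ck_der Ca.
- rewrite (_ : derive1 _ = fun t => pd ord0 a (upd ord0 (0, x') t)).
    by move=> t; apply: (continuous_comp (f := upd ord0 (0, x'))); [exact: continuous_upd|exact: c1].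
  by apply/funext => t; rewrite pd_line.
- by rewrite in_itv /= lexx lerDl ler01.
rewrite (ge0_muleDr _ (iS a x') (iS (pd ord0 a) x')).
have A1 : (\int[lebesgue_measure]_(t in `[x1, (x1 + 1)%R]) (a (upd ord0 (0, x') t) ^+ 2)%:E
    <= \int[lebesgue_measure]_x (a (x, x') ^+ 2)%:E)%E.
  apply: ge0_subset_integral.
  - exact: measurable_itv.
  - exact: measurableT.
  - apply: measurable_funTS; apply/measurable_EFinP; apply: continuous_measurable_fun.
    by apply: continuous_sqr; exact: (continuous_pair2 a x').
  - by move=> t _; rewrite lee_fin sqr_ge0.
  - exact: subsetT.
have A2 : (\int[lebesgue_measure]_(t in `[x1, (x1 + 1)%R]) (derive1 (fun t : R => a (upd ord0 (0, x') t)) t ^+ 2)%:E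
    <= \int[lebesgue_measure]_x (pd ord0 a (x, x') ^+ 2)%:E)%E.
  under eq_integral do rewrite -pd_line.
  apply: ge0_subset_integral.
  - exact: measurable_itv.
  - exact: measurableT.
  - apply: measurable_funTS; apply/measurable_EFinP; apply: continuous_measurable_fun.
    by apply: continuous_sqr; exact: (continuous_pair2 (pd ord0 a) x').
  - by move=> t _; rewrite lee_fin sqr_ge0.
  - exact: subsetT.
have two : (0 <= 2%:E :> \bar R)%E by [].
exact: (leeD (lee_wpmul2l two A1) (lee_wpmul2l two A2)).
Qed.

(** The zero mode of [b] depends on [x1] alone and leaves the slice integral. The slice norm of
    [neq a] is bounded uniformly in [x1] by [slice_sup], so [b] enters only through its L2 norm. *)
Lemma L2sq_neq_bar {R : realType} (a b : R * (R * R) -> R) : Cper 1 a -> continuous b ->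
  (L2sq (fun x => (neq a x * bar b x)%R) <= 2%:E * (L2sq (neq a) + L2sq (neq (pd ord0 a))) * L2sq b)%E.
Proof.
move=> Ca cb.
have Cn := Ck_neq _ _ Ca.
have cn : continuous (neq a) by exact: Ck_cont Cn.
have cbb : continuous (bar b).
  move=> x; apply: (continuous_comp (f := fst)); first exact: cvg_fst.
  exact: mean_continuous.
rewrite -neq_pd//.
set K := (2%:E * _)%E.
have K0 : (0 <= K)%E by rewrite mule_ge0// adde_ge0// L2sq_ge0.
rewrite L2sq_slice; last by move=> x; apply: cvgM; [exact: cn|exact: cbb].
rewrite (L2sq_slice b)// -ge0_integralZl//; last 2 first.
- by apply: (measurable_mean (fun x => b x ^+ 2)); exact: continuous_sqr.
- by move=> x _; rewrite lee_fin; apply: Rintegral_ge0 => y _; exact: sqr_ge0.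
apply: ge0_le_integral => //.
- by move=> x _; rewrite lee_fin; apply: Rintegral_ge0 => y _; exact: sqr_ge0.
- apply: (measurable_mean (fun x => (neq a x * bar b x) ^+ 2)); apply: continuous_sqr.
  by move=> x; apply: cvgM; [exact: cn|exact: cbb].
- apply: emeasurable_funM; first exact: measurable_cst.
  by apply: (measurable_mean (fun x => b x ^+ 2)); exact: continuous_sqr.
move=> x1 _.
have cnx : continuous (fun y => neq a (x1, y)) by exact: continuous_pair1.
rewrite (_ : (fun x' => (neq a (x1, x') * bar b (x1, x')) ^+ 2) = (fun x' => mean b x1 ^+ 2 * neq a (x1, x') ^+ 2));
  last first.
  by apply/funext => x'; rewrite /bar /= exprMn mulrC.
rewrite avgZ; last exact: continuous_sqr.
rewrite mulrC EFinM; apply: lee_pmul.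
- by rewrite lee_fin; apply: Rintegral_ge0 => y _; exact: sqr_ge0.
- by rewrite lee_fin sqr_ge0.
- exact: slice_sup.
- by rewrite lee_fin; apply: jensen_avg; exact: continuous_pair1.
Qed.

(** * Calculus of one variable *)

Definition hder {R : realType} (f : R -> R) (x a : R) : Prop := is_derive x (1 : R) f a.

Lemma hder_eq {R : realType} (f : R -> R) (x a b : R) : hder f x a -> a = b -> hder f x b.
Proof. by move=> h <-. Qed.

Lemma dD {R : realType} (f g : R -> R) (x a b : R) : hder f x a -> hder g x b ->
  hder (fun y => f y + g y) x (a + b).
Proof. by move=> hf hg; exact: is_deriveD hf hg. Qed.

Lemma dB {R : realType} (f g : R -> R) (x a b : R) : hder f x a -> hder g x b ->
  hder (fun y => f y - g y) x (a - b).
Proof. by move=> hf hg; exact: is_deriveB hf hg. Qed.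

Lemma dM {R : realType} (f g : R -> R) (x a b : R) : hder f x a -> hder g x b ->
  hder (fun y => f y * g y) x (a * g x + f x * b).
Proof.
move=> hf hg; have -> : a * g x + f x * b = f x *: b + g x *: a by rewrite addrC [g x *: a]mulrC.
exact: is_deriveM hf hg.
Qed.

Lemma dcst {R : realType} (c x : R) : hder (fun _ : R => c) x 0.
Proof. exact: is_derive_cst. Qed.

Lemma did {R : realType} (x : R) : hder (fun y : R => y) x 1.
Proof. exact: is_derive_id. Qed.

Lemma dZ {R : realType} (c : R) (f : R -> R) (x a : R) : hder f x a -> hder (fun y => c * f y) x (c * a).
Proof. by move=> hf; have := dM (fun=> c) f x 0 a (dcst c x) hf; rewrite mul0r add0r. Qed.

Lemma dcomp {R : realType} (f g : R -> R) (x a b : R) : hder f (g x) a -> hder g x b ->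
  hder (fun y => f (g y)) x (a * b).
Proof. by move=> hf hg; exact: (is_derive1_comp hf hg). Qed.

Lemma dinv {R : realType} (f : R -> R) (x a : R) : f x != 0 -> hder f x a ->
  hder (fun y => (f y)^-1) x (- (a * ((f x)^-1) ^+ 2)).
Proof.
move=> f0 hf; have -> : - (a * ((f x)^-1) ^+ 2) = - f x ^- 2 *: a.
  by rewrite exprVn [RHS]mulNr mulrC.
exact: is_deriveV f0 hf.
Qed.

Lemma dln {R : realType} (f : R -> R) (x a : R) : 0 < f x -> hder f x a ->
  hder (fun y => ln (f y)) x ((f x)^-1 * a).
Proof. by move=> f0 hf; apply: dcomp => //; exact: is_derive1_ln. Qed.

Lemma dexp {R : realType} (f : R -> R) (x a : R) : hder f x a ->
  hder (fun y => expR (f y)) x (expR (f x) * a).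
Proof. by move=> hf; apply: dcomp => //; exact: is_derive_expR. Qed.

Lemma dsqr {R : realType} (f : R -> R) (x a : R) : hder f x a ->
  hder (fun y => f y ^+ 2) x (2 * f x * a).
Proof. by move=> hf; have := dM f f x a a hf hf; rewrite (_ : a * f x + f x * a = 2 * f x * a) //; ring. Qed.

Lemma hder_continuous {R : realType} (f : R -> R) (x a : R) : hder f x a -> {for x, continuous f}.
Proof.
move=> hf; apply: differentiable_continuous; apply/derivable1_diffP.
by have [] := hf.
Qed.

Lemma MVT_seg {R : realType} (f f' : R -> R) (a b : R) : a < b ->
  (forall x, a <= x <= b -> hder f x (f' x)) ->
  exists c, a < c < b /\ f b - f a = f' c * (b - a).
Proof.
move=> ab hf; have [||c cI E] := @MVT R f f' a b ab.
- by move=> x; rewrite in_itv /= => /andP[h1 h2]; apply: hf; rewrite !ltW.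
- apply: derivable_within_continuous => x; rewrite in_itv /= => h.
  by have [] := hf x h.
- by exists c; move: cI; rewrite in_itv.
Qed.

Lemma mono_seg {R : realType} (f f' : R -> R) (a b : R) : a <= b ->
  (forall x, a <= x <= b -> hder f x (f' x)) ->
  (forall x, a <= x <= b -> 0 <= f' x) -> f a <= f b.
Proof.
rewrite le_eqVlt => /orP[/eqP-> //|ab] hf f0.
have [c [/andP[ac cb] E]] := MVT_seg f f' a b ab hf.
rewrite -subr_ge0 E; apply: mulr_ge0; last by rewrite subr_ge0 ltW.
by apply: f0; rewrite !ltW.
Qed.

Lemma mono_lim_Ny {R : realType} (f : R -> R) (l : R) : (forall x y, x <= y -> f x <= f y) ->
  f y @[y --> -oo] --> l -> forall y, l <= f y.
Proof.
move=> mf fl y; apply: (cvgr_to_le fl).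
by near=> x; apply: mf; near: x; apply: nbhs_ninfty_le; exact: num_real.
Unshelve. all: by end_near. Qed.

Lemma mono_lim_y {R : realType} (f : R -> R) (l : R) : (forall x y, x <= y -> f x <= f y) ->
  f y @[y --> +oo] --> l -> forall y, f y <= l.
Proof.
move=> mf fl y; apply: (cvgr_to_ge fl).
by near=> x; apply: mf; near: x; apply: nbhs_pinfty_ge; exact: num_real.
Unshelve. all: by end_near. Qed.

(** From [expR (- x) >= 1 - x] one gets [expR x <= 1 / (1 - x)], and this is at most [1 + x + 2 x^2]
    as long as [x <= 1/2]. *)
Lemma expR_quad {R : realType} (x : R) : x <= 2^-1 -> expR x - 1 - x <= 2 * x ^+ 2.
Proof.
move=> x2.
have h := expR_ge1Dx (- x).
have e0 := expR_gt0 x.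
have x1 : 0 < 1 - x by lra.
have : expR x * (1 - x) <= 1.
  rewrite -[leRHS](expRxMexpNx_1 x) ler_pM2l//.
move=> H.
have : expR x <= 1 + x + 2 * x ^+ 2.
  rewrite -(ler_pM2r x1); apply: le_trans H _.
  rewrite -subr_ge0.
  have -> : (1 + x + 2 * x ^+ 2) * (1 - x) - 1 = x ^+ 2 * (1 - 2 * x) by ring.
  by rewrite mulr_ge0 ?sqr_ge0//; lra.
lra.
Qed.

Lemma ln_diff_le {R : realType} (x y : R) : 0 < x -> 0 < y -> ln x - ln y <= (x - y) / y.
Proof.
move=> x0 y0; rewrite -ln_div//.
have -> : x / y = 1 + (x - y) / y by field; rewrite gt_eqF.
apply: le_ln1Dx.
have : 0 < x / y by rewrite divr_gt0.
have -> : x / y = 1 + (x - y) / y by field; rewrite gt_eqF.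
lra.
Qed.

(** [B >= 4] absorbs numerical constants into powers of [B]: [16 <= B^2], [64 <= B^3], [400 <= B^5].
    The barrier height [K d] dominates [d] and the variation [48 B^8 sg], and is itself small. *)
Lemma barrier_sizes {R : realType} (B K d sg : R) : 4 <= B -> K = B ^+ 14 -> 0 < d ->
  B ^+ 63 * d <= 1 -> 0 < sg -> sg <= d ->
  [/\ 1 <= K, 400 * B ^+ 4 * (K * d) <= 1, 60 * B ^+ 8 * sg <= 1, 48 * B ^+ 8 * sg <= K * d & 4 * d <= K * d].
Proof.
move=> B4 KE d0 dK s0 sd.
have B1 : 1 <= B by lra.
have Bn n : 1 <= B ^+ n by rewrite exprn_ege1.
have Bd n : (n <= 63)%N -> B ^+ n * d <= 1.
  by move=> n9; apply: le_trans dK; apply: ler_wpM2r; [exact: ltW|exact: ler_weXn2l].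
have Bc (c : R) k n : c <= B ^+ k -> c * B ^+ n <= B ^+ (k + n).
  by move=> h; rewrite exprD ler_wpM2r// exprn_ge0//; lra.
have b2 : 16 <= B ^+ 2 by rewrite expr2; nra.
have b3 : 64 <= B ^+ 3 by rewrite exprS; nra.
have b5 : 400 <= B ^+ 5 by rewrite (exprD B 2 3); nra.
split.
- by rewrite KE.
- have -> : 400 * B ^+ 4 * (K * d) = 400 * B ^+ 18 * d by rewrite KE; ring.
  by apply: le_trans (Bd 23%N isT); rewrite (ler_wpM2r (ltW d0))//; exact: (Bc 400 5%N 18%N b5).
- apply: le_trans (Bd 11%N isT).
  apply: ler_pM => //; [by rewrite mulr_ge0// exprn_ge0//; lra|exact: ltW|].
  by apply: (Bc 60 3%N 8%N); lra.
- rewrite KE; apply: ler_pM => //; [by rewrite mulr_ge0// exprn_ge0//; lra|exact: ltW|].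
  apply: (@le_trans _ _ (B ^+ 11)); last by rewrite ler_weXn2l.
  by apply: (Bc 48 3%N 8%N); lra.
- rewrite (ler_wpM2r (ltW d0))// KE; apply: (@le_trans _ _ (B ^+ 2)); first lra.
  by rewrite ler_weXn2l.
Qed.

(** [th] is the excess of the density over its left state. [pr] is of order [sg], and [fr], [DP] are
    at most of order [(K d)^2], hence [G] is of order [sg] and [Th] of order [sg^2 = d^3]. The sign
    condition then bounds [DP] by a multiple of [d^3], against the cubic lower bound
    [K^3 d^3 / (192 B^4)] with [K^3 = B^42]. *)
Lemma upper_barrier_absurd {R : realType} (B K d sg th pr fr DP q Th G : R) :
  4 <= B -> K = B ^+ 14 -> 0 < d -> B ^+ 63 * d <= 1 -> 0 < sg -> sg <= d -> sg ^+ 2 = d ^+ 3 ->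
  `|th - K * d| <= 24 * B ^+ 8 * sg -> `|pr| <= 6 * B ^+ 4 * sg ->
  0 <= fr <= 4 * B ^+ 3 * th * (th + d) -> th ^+ 3 / (24 * B ^+ 4) <= DP ->
  DP <= 8 * B ^+ 4 * th ^+ 2 * (th + d) -> 0 <= q <= 8 * B ^+ 4 * d ^+ 3 ->
  G = pr - fr - DP + q -> (G <= 2^-1 -> Th <= 2 * G ^+ 2) -> 0 <= Th - DP + q -> False.
Proof.
move=> B4 KE d0 dK s0 sd sE hth hpr /andP[fr0 hfr] hDP1 hDP2 /andP[q0 hq] GE hTh hpos.
have [K1 f1 f2 f3 f4] := barrier_sizes B K d sg B4 KE d0 dK s0 sd.
have B1 : 1 <= B by lra.
set X := K * d in f1 f3 f4 hth.
have X0 : 0 < X by rewrite mulr_gt0//; lra.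
have Bn n : 1 <= B ^+ n by rewrite exprn_ege1.
have B0 : 0 <= B by exact: le_trans B1.
have X00 : 0 <= X by exact: ltW.
have Bn0 n : 0 <= B ^+ n by exact: exprn_ge0.
have b2 : 16 <= B ^+ 2 by rewrite expr2; clear -B4; nra.
have b3 : 64 <= B ^+ 3 by rewrite exprS; clear -B4 b2; nra.
have b4 : 256 <= B ^+ 4 by rewrite (exprD B 2 2); clear -b2; nra.
move: hth; rewrite ler_norml => /andP[th1 th2].
have th3 : X / 2 <= th by clear -th1 f3; lra.
have th4 : th <= 2 * X by clear -th2 f3 X0; lra.
have thd : th + d <= 3 * X by clear -th4 f4 X0 d0; lra.
have th0 : 0 <= th by clear -th3 X0; lra.
have thd0 : 0 <= th + d by clear -th0 d0; lra.
have fr2 : fr <= 24 * B ^+ 3 * X ^+ 2.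
  apply: le_trans hfr _.
  have -> : 24 * B ^+ 3 * X ^+ 2 = 4 * B ^+ 3 * (2 * X) * (3 * X) by ring.
  apply: ler_pM => //.
  - by rewrite !mulr_ge0.
  - by rewrite ler_wpM2l// mulr_ge0.
have DP0 : 0 <= DP.
  by apply: le_trans hDP1; rewrite divr_ge0 ?exprn_ge0// mulr_ge0.
have DP2 : DP <= 24 * B ^+ 3 * X ^+ 2.
  apply: le_trans hDP2 _.
  apply: (@le_trans _ _ (8 * B ^+ 4 * (2 * X) ^+ 2 * (3 * X))).
    apply: ler_pM => //.
    - by rewrite mulr_ge0 ?exprn_ge0// mulr_ge0.
    - rewrite ler_wpM2l//; first by rewrite mulr_ge0.
      by rewrite lerXn2r// nnegrE mulr_ge0.
  have -> : 8 * B ^+ 4 * (2 * X) ^+ 2 * (3 * X) = 24 * B ^+ 3 * X ^+ 2 * (4 * B * X) by ring.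
  have A : 0 <= 24 * B ^+ 3 * X ^+ 2 by rewrite mulr_ge0 ?exprn_ge0// mulr_ge0.
  rewrite ler_piMr//.
  have : 4 * B <= 400 * B ^+ 4.
    rewrite exprSr; move: (B ^+ 3) b3 => b; clear -B4; nra.
  move=> h; have := ler_wpM2r (ltW X0) h; clear -f1; lra.
(* [(K d)^2] is compared with [sg] after squaring, which needs [B^62 d <= 1]: this is the origin of
   the large exponent in the smallness assumption. *)
have Xs : 48 * B ^+ 3 * X ^+ 2 <= B ^+ 3 * sg.
  have -> : 48 * B ^+ 3 * X ^+ 2 = B ^+ 3 * (48 * X ^+ 2) by ring.
  rewrite ler_pM2l; last by clear -b3; lra.
  apply: (@le_trans _ _ (B ^+ 3 * X ^+ 2)); first by rewrite ler_wpM2r ?sqr_ge0//; clear -b3; lra.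
  have A : 0 <= B ^+ 3 * X ^+ 2 by rewrite mulr_ge0 ?sqr_ge0.
  rewrite -(@ler_pXn2r _ 2)// ?nnegrE//; last exact: ltW.
  rewrite sE.
  have -> : (B ^+ 3 * X ^+ 2) ^+ 2 = B ^+ 62 * d * d ^+ 3 by rewrite /X KE; ring.
  rewrite ler_piMl ?exprn_ge0//; first exact: ltW.
  apply: le_trans dK; rewrite ler_wpM2r//; first exact: ltW.
  by rewrite ler_weXn2l.
have q2 : q <= B ^+ 4 * sg.
  apply: le_trans hq _; rewrite -sE expr2.
  have s8 : 8 * sg <= 1.
    have h : 8 <= 60 * B ^+ 8 by have := Bn 8%N; clear; lra.
    have := ler_wpM2r (ltW s0) h; clear -f2; lra.
  have -> : 8 * B ^+ 4 * (sg * sg) = B ^+ 4 * sg * (8 * sg) by ring.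
  by rewrite ler_piMr// mulr_ge0// ltW.
have b34 : B ^+ 3 <= B ^+ 4 by rewrite ler_weXn2l.
have Gb : `|G| <= 8 * B ^+ 4 * sg.
  move: hpr; rewrite !ler_norml GE => /andP[p1 p2].
  have : B ^+ 3 * sg <= B ^+ 4 * sg by rewrite ler_wpM2r// ltW.
  move=> h; clear -h p1 p2 fr0 fr2 DP0 DP2 q0 q2 Xs; apply/andP; split; lra.
have b48 : B ^+ 4 <= B ^+ 8 by rewrite ler_weXn2l.
have Gh : G <= 2^-1.
  apply: le_trans (ler_norm _) _; apply: le_trans Gb _.
  have := ler_wpM2r (ltW s0) b48; clear -f2; lra.
have G2 : G ^+ 2 <= 64 * B ^+ 8 * d ^+ 3.
  rewrite -[G ^+ 2]real_normK ?num_real//.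
  have -> : 64 * B ^+ 8 * d ^+ 3 = (8 * B ^+ 4 * sg) ^+ 2 by rewrite -sE; ring.
  by rewrite lerXn2r// nnegrE; apply: le_trans Gb.
have {}hTh := hTh Gh.
have d3 : 0 < d ^+ 3 by rewrite exprn_gt0.
have DPl : K ^+ 3 * d ^+ 3 / (192 * B ^+ 4) <= DP.
  apply: le_trans hDP1.
  have -> : K ^+ 3 * d ^+ 3 / (192 * B ^+ 4) = (X / 2) ^+ 3 / (24 * B ^+ 4).
    by rewrite /X; field; rewrite gt_eqF//; clear -B4; lra.
  rewrite ler_wpM2r// ?invr_ge0; first by rewrite mulr_ge0.
  by rewrite lerXn2r// nnegrE divr_ge0.
have : K ^+ 3 * d ^+ 3 / (192 * B ^+ 4) <= 136 * B ^+ 8 * d ^+ 3.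
  apply: le_trans DPl _.
  have := ler_wpM2r (ltW d3) b48; clear -hTh G2 hpos hq q0; lra.
rewrite ler_pdivrMr; last by clear -b4; lra.
have -> : 136 * B ^+ 8 * d ^+ 3 * (192 * B ^+ 4) = 136 * 192 * B ^+ 12 * d ^+ 3 by ring.
rewrite ler_pM2r//.
have -> : K ^+ 3 = B ^+ 42 by rewrite KE -exprM.
have : 136 * 192 * B ^+ 12 < B ^+ 4 * B ^+ 4 * B ^+ 12.
  rewrite ltr_pM2r; last by have := Bn 12%N; clear; lra.
  move: (B ^+ 4) b4 => b; clear; nra.
rewrite -!exprD => h1 h2.
have b12 : B ^+ 20 <= B ^+ 42 by rewrite ler_weXn2l.
move: h1; rewrite [(4 + 4 + 12)%N]/=; clear -h2 b12; lra.
Qed.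

(** The squared field [E1s] is at least of order [K^3 d^3 / B^5], while the increment [DE] of the
    potential is at most [B^14 sg], so that [E1s <= B^28 d^3]. The choice [K^3 = B^42] separates the
    two. *)
Lemma lower_barrier_absurd {R : realType} (B K d sg x DE E1s : R) :
  4 <= B -> K = B ^+ 14 -> 0 < d -> sg ^+ 2 = d ^+ 3 -> 0 < sg ->
  K * d / 4 <= x ->
  B^-1 * (x ^+ 3 / (24 * B ^+ 4) - 8 * B ^+ 4 * d ^+ 3) <= E1s ->
  E1s <= DE ^+ 2 -> `|DE| <= 80 * B ^+ 10 * sg -> False.
Proof.
move=> B4 KE d0 sE s0 hx h1 h2 h3.
have B1 : 1 <= B by lra.
have Bn n : 1 <= B ^+ n by rewrite exprn_ege1.
have B0 : 0 < B by lra.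
have d3 : 0 < d ^+ 3 by rewrite exprn_gt0.
have K0 : 0 < K by rewrite KE; have := Bn 14%N; lra.
have b2 : 16 <= B ^+ 2 by rewrite expr2; nra.
have b3 : 64 <= B ^+ 3 by rewrite exprS; nra.
have b4 : 256 <= B ^+ 4 by rewrite (exprD B 2 2); nra.
have {}h3 : `|DE| <= B ^+ 14 * sg.
  apply: le_trans h3 _; rewrite ler_wpM2r//; first exact: ltW.
  rewrite (exprD B 4 10) ler_wpM2r//; last lra.
  by have := Bn 10%N; lra.
have H : B^-1 * (x ^+ 3 / (24 * B ^+ 4) - 8 * B ^+ 4 * d ^+ 3) <= B ^+ 28 * d ^+ 3.
  apply: le_trans h1 _; apply: le_trans h2 _.
  rewrite -[DE ^+ 2]real_normK ?num_real//.
  have -> : B ^+ 28 * d ^+ 3 = (B ^+ 14 * sg) ^+ 2 by rewrite -sE; ring.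
  by rewrite lerXn2r// nnegrE; apply: le_trans h3.
have H2 : x ^+ 3 / (24 * B ^+ 4) <= B ^+ 29 * d ^+ 3 + 8 * B ^+ 4 * d ^+ 3.
  rewrite -lerBlDr.
  have := ler_wpM2l (ltW B0) H; rewrite mulrA mulfV ?gt_eqF// mul1r => /le_trans; apply.
  by rewrite le_eqVlt; apply/orP; left; apply/eqP; ring.
have H3 : (K * d / 4) ^+ 3 / (24 * B ^+ 4) <= 2 * B ^+ 29 * d ^+ 3.
  apply: (@le_trans _ _ (x ^+ 3 / (24 * B ^+ 4))).
    rewrite ler_wpM2r// ?invr_ge0; first by rewrite mulr_ge0//; lra.
    have : 0 <= K * d / 4 by rewrite divr_ge0// mulr_ge0 ?ltW.
    by move=> h; rewrite lerXn2r// nnegrE; lra.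
  apply: le_trans H2 _.
  have b : 8 * B ^+ 4 <= B ^+ 29.
    apply: (@le_trans _ _ (B ^+ 3 * B ^+ 4)); first by rewrite ler_wpM2r//; lra.
    by rewrite -exprD ler_weXn2l.
  have := ler_wpM2r (ltW d3) b; lra.
move: H3; rewrite ler_pdivrMr; last by lra.
have -> : 2 * B ^+ 29 * d ^+ 3 * (24 * B ^+ 4) = 48 * B ^+ 33 * d ^+ 3 by ring.
have -> : (K * d / 4) ^+ 3 = K ^+ 3 / 64 * d ^+ 3 by field.
rewrite ler_pM2r// ler_pdivrMr//.
have -> : K ^+ 3 = B ^+ 42 by rewrite KE -exprM.
have : 48 * B ^+ 33 * 64 < B ^+ 3 * B ^+ 33 * B ^+ 4.
  have b33 := Bn 33%N; move: (B ^+ 33) (B ^+ 3) (B ^+ 4) b33 b3 b4 => c a b hc ha hb.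
  have : 48 * c < a * c by rewrite ltr_pM2r; lra.
  move=> h; have : 48 * c * 64 < 48 * c * b by rewrite ltr_pM2l; lra.
  have : 48 * c * b < a * c * b by rewrite ltr_pM2r; lra.
  lra.
rewrite -!exprD [(3 + 33 + 4)%N]/= => h1' h2'.
have b12 : B ^+ 40 <= B ^+ 42 by rewrite ler_weXn2l.
lra.
Qed.

(** At a maximum above [N] the first derivative vanishes and the second is positive nearby, so [f]
    would still grow to the right. The limits at both ends force such a maximum to be interior. *)
Lemma max_principle {R : realType} (f f1 g : R -> R) (N l1 l2 : R) :
  (forall y : R, hder f y (f1 y)) -> (forall y : R, hder f1 y (g y)) -> continuous g ->
  (forall y, N < f y -> 0 < g y) ->
  f y @[y --> -oo] --> l1 -> f y @[y --> +oo] --> l2 -> l1 <= N -> l2 <= N ->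
  forall y, f y <= N.
Proof.
move=> Df Df1 cg gN fNy fy l1N l2N y0; rewrite leNgt; apply/negP => fN.
pose m := (f y0 + N) / 2.
have [mN mf] : N < m /\ m < f y0 by rewrite /m; lra.
have [a [ay fa]] : exists a, a < y0 /\ f a < m.
  have N1 : \forall a \near -oo, f a < m by apply: (cvgr_lt _ fNy); lra.
  have N2 : \forall a \near -oo, a < y0 by apply: nbhs_ninfty_lt; exact: num_real.
  by have [a [h1 h2]] := @filter_ex _ _ (@proper_ninfty_nbhs R) _ (filterI N1 N2); exists a.
have [b [by0 fb]] : exists b, y0 < b /\ f b < m.
  have H1 : \forall a \near +oo, f a < m by apply: (cvgr_lt _ fy); lra.
  have H2 : \forall a \near +oo, y0 < a by apply: nbhs_pinfty_gt; exact: num_real.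
  by have [b [h1 h2]] := @filter_ex _ _ (@proper_pinfty_nbhs R) _ (filterI H1 H2); exists b.
have ab : a <= b by rewrite ltW// (lt_trans ay).
have cf : continuous f by move=> z; exact: hder_continuous (Df z).
have [c cI cM] := EVT_max ab (continuous_subspaceT cf).
have fc : f y0 <= f c by apply: cM; rewrite in_itv /= !ltW.
have [ac cb] : a < c /\ c < b.
  move: cI; rewrite in_itv /= => /andP[]; rewrite !le_eqVlt => /orP[/eqP ac|ac] /orP[/eqP cb|cb] //.
  - by move: fa; rewrite ac; lra.
  - by move: fa; rewrite ac; lra.
  - by move: fb; rewrite -cb; lra.
have f1c : f1 c = 0.
  have H : is_derive c (1 : R) f 0.
    apply: (@derive1_at_max _ f a b c ab) => [t _||t tI].
    - by have [] := Df t.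
    - by rewrite in_itv /= ac.
    - by apply: cM; apply: subset_itv_oo_cc.
  by have [_ <-] := Df c; have [_ ->] := H.
have gc : 0 < g c by apply: gN; lra.
have [e /= e0 ge] : \forall x \near c, 0 < g x by apply: (cvgr_gt _ (cg c)).
pose x := Num.min ((c + b) / 2) (c + e / 2).
have [cx xb xe] : [/\ c < x, x < b & x < c + e].
  by rewrite /x; split; rewrite ?lt_min ?gt_min; [apply/andP; split; lra|apply/orP; left; lra|apply/orP; right; lra].
have [xi [/andP[x1 x2] Hx]] := MVT_seg f f1 c x cx (fun z _ => Df z).
have [xj [/andP[x3 x4] Hj]] := MVT_seg f1 g c xi x1 (fun z _ => Df1 z).
have gj : 0 < g xj.
  apply: ge; rewrite /= distrC ger0_norm; lra.
have f1xi : 0 < f1 xi.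
  have : 0 < g xj * (xi - c) by rewrite mulr_gt0// subr_gt0.
  by rewrite -Hj f1c subr0.
have : 0 < f1 xi * (x - c) by rewrite mulr_gt0// subr_gt0.
have : f x <= f c by apply: cM; rewrite in_itv /=; apply/andP; split; lra.
by rewrite -Hx; lra.
Unshelve. all: by end_near. Qed.

Lemma hder_derive1 {R : realType} (f : R -> R) (x : R) : derivable f x 1 -> hder f x (derive1 f x).
Proof. by move=> h; rewrite derive1E; exact: derivableP. Qed.

Lemma hder_derive1E {R : realType} (f f' : R -> R) : (forall x, hder f x (f' x)) -> derive1 f = f'.
Proof. by move=> h; apply/funext => x; rewrite derive1E; apply: derive_val; exact: h. Qed.

Lemma hder_cst {R : realType} (f : R -> R) : (forall x, hder f x 0) -> forall x y, f x = f y.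
Proof. by move=> h x y; exact: is_derive_0_is_cst. Qed.

(** * Smallness of the shock profile *)

(** [r] is the density, [E] the potential, [E1] its derivative, [p] the derivative of the velocity.
    [pE] is the momentum equation integrated once, [d] the shock strength, [sg = d^(3/2)] the
    expected size of [p], and [B] a bound on all data and their inverses. *)
Section profile_ode.
Context {R : realType}.
Variables (T rm rp j B d sg : R) (r E E1 p : R -> R).
Hypotheses (B4 : 4 <= B) (T0 : 0 < T) (TB : T + 1 <= B) (TBi : 1 <= B * (T + 1)).
Hypotheses (rmB : rm <= B) (rmBi : 1 <= B * rm) (j0 : 0 < j) (jB : j <= B) (jBi : 1 <= B * j).
Hypotheses (rp2 : rm / 2 <= rp) (rprm : rp < rm) (drp : rm - rp <= d) (jE : j ^+ 2 = (T + 1) * rm * rp).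
Hypotheses (sg0 : 0 < sg) (sgE : sg ^+ 2 = d ^+ 3) (sgd : sg <= d).
Variable K : R.
Hypothesis KE : K = B ^+ 14.
Hypothesis dK : B ^+ 63 * d <= 1.
Hypotheses (r0 : forall y, 0 < r y).
Hypotheses (Dr : forall y : R, hder r y (r y ^+ 2 / j * p y)).
Hypotheses (DE : forall y : R, hder E y (E1 y)).
Hypotheses (DE1 : forall y : R, hder E1 y (expR (E y) - r y)).
Hypothesis pE : forall y, p y = (T + 1) * (r y - rm) * (r y - rp) / r y + (expR (E y) - r y) - E1 y ^+ 2 / 2.
Hypotheses (r_Ny : r y @[y --> -oo] --> rm) (r_y : r y @[y --> +oo] --> rp).
Hypotheses (E_Ny : E y @[y --> -oo] --> ln rm) (E_y : E y @[y --> +oo] --> ln rp).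
Hypotheses (p_Ny : p y @[y --> -oo] --> 0) (p_y : p y @[y --> +oo] --> 0).

Ltac hy := pose proof B4; pose proof T0; pose proof TB; pose proof TBi; pose proof rmB; pose proof rmBi; pose proof
  j0; pose proof jB; pose proof jBi; pose proof rp2; pose proof rprm; pose proof drp; pose proof sg0; pose proof sgd.
Let B1 : 1 <= B. Proof. apply: le_trans B4; lra. Qed.
Let B0 : 0 < B. Proof. exact: lt_le_trans ltr01 B1. Qed.
Let rm0 : 0 < rm.
Proof. by rewrite -(pmulr_rgt0 _ B0); exact: lt_le_trans ltr01 rmBi. Qed.
Let rp0 : 0 < rp. Proof. by apply: lt_le_trans rp2; rewrite divr_gt0.  Qed.
Let d0 : 0 < d. Proof. hy; lra. Qed.
Let jn : j != 0. Proof. by rewrite gt_eqF. Qed.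
Let rmn : rm != 0. Proof. by rewrite gt_eqF. Qed.
Let rn0 y : r y != 0. Proof. by rewrite gt_eqF. Qed.

(** A Bernoulli function: kinetic energy in the frame of the shock, isothermal enthalpy and electric
    potential, corrected by the viscous term [p / r]. *)
Let Q y := j ^+ 2 / 2 * ((r y)^-1) ^+ 2 + T * ln (r y) + E y - p y / r y.

Let pE' y : p y = (T + 1) * r y - (T + 1) * (rm + rp) + j ^+ 2 * (r y)^-1 + (expR (E y) - r y) - E1 y ^+ 2 / 2.
Proof. by rewrite pE jE; field. Qed.

Let Dp (y : R) : hder p y ((T - j ^+ 2 * ((r y)^-1) ^+ 2) * (r y ^+ 2 / j * p y) + r y * E1 y).
Proof.
have -> : p = (fun y => (T + 1) * r y - (T + 1) * (rm + rp) + j ^+ 2 * (r y)^-1 + (expR (E y) - r y) - 2^-1 * E1 y ^+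
  2).
  by apply/funext => z; rewrite pE' (mulrC _ (2^-1)).
apply: hder_eq.
  apply: dB; last by apply: dZ; apply: dsqr; exact: DE1.
  apply: dD; last by apply: dB; [apply: dexp; exact: DE|exact: Dr].
  apply: dD; last by apply: dZ; apply: dinv; [exact: rn0|exact: Dr].
  apply: dB; last exact: dcst.
  by apply: dZ; exact: Dr.
by rewrite pE'; field; rewrite rn0 jn.
Qed.

Let DQ (y : R) : hder Q y (p y ^+ 2 / j).
Proof.
apply: hder_eq.
  apply: dB; last by apply: dM; [exact: Dp|apply: dinv; [exact: rn0|exact: Dr]].
  apply: dD; last exact: DE.
  apply: dD; last by apply: dZ; apply: dln; [exact: r0|exact: Dr].
  by apply: dZ; apply: dsqr; apply: dinv; [exact: rn0|exact: Dr].
by rewrite /=; field; rewrite rn0 jn.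
Qed.

Let Qmono x y : x <= y -> Q x <= Q y.
Proof.
move=> xy; apply: (mono_seg Q (fun y => p y ^+ 2 / j) x y xy (fun z _ => DQ z)) => z _.
by rewrite divr_ge0 ?sqr_ge0// ltW.
Qed.

(** [Pf r - (T + 1)] is the value of [Q] under exact quasineutrality [E = ln r] with zero field, [p]
    being given by [pE]. For positive argument it is critical exactly at the two end states. *)
Let Pf x := (T + 1) * ln x + (T + 1) * (rm + rp) * x^-1 - j ^+ 2 / 2 * (x^-1) ^+ 2.

Let DPf (x : R) : 0 < x -> hder Pf x ((T + 1) * (x - rm) * (x - rp) / x ^+ 3).
Proof.
move=> x0; apply: hder_eq.
  apply: dB; last by apply: dZ; apply: dsqr; apply: dinv; [exact: lt0r_neq0|exact: did].
  apply: dD; last by apply: dZ; apply: dinv; [exact: lt0r_neq0|exact: did].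
  by apply: dZ; apply: dln; [exact: x0|exact: did].
by rewrite jE; field; rewrite gt_eqF.
Qed.

Let Q_lim (F : set_system R) (FF : ProperFilter F) rl : 0 < rl -> (rl - rm) * (rl - rp) = 0 ->
  r y @[y --> F] --> rl -> E y @[y --> F] --> ln rl -> p y @[y --> F] --> 0 ->
  Q y @[y --> F] --> Pf rl - (T + 1).
Proof.
move=> rl0 rlE rF EF pF.
have -> : Pf rl - (T + 1) = j ^+ 2 / 2 * (rl^-1) ^+ 2 + T * ln rl + ln rl - 0 / rl.
  have h : (T + 1) * ((rl - rm) * (rl - rp)) = 0 by rewrite rlE mulr0.
  have : (T + 1) * (rm + rp) * rl^-1 - (T + 1) = j ^+ 2 * (rl^-1) ^+ 2.
    rewrite jE; apply/eqP; rewrite -subr_eq0; apply/eqP.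
    have -> : (T + 1) * (rm + rp) / rl - (T + 1) - (T + 1) * rm * rp * rl^-1 ^+ 2 =
       - ((T + 1) * ((rl - rm) * (rl - rp))) * rl^-1 ^+ 2 by field; rewrite gt_eqF.
    by rewrite h oppr0 mul0r.
  rewrite /Pf mul0r subr0; lra.
have rV : (r y)^-1 @[y --> F] --> rl^-1 by apply: cvgV => //; exact: lt0r_neq0.
have lnF : ln (r y) @[y --> F] --> ln rl.
  by apply: (cvg_comp _ _ rF); exact: (hder_continuous _ _ _ (is_derive1_ln rl0)).
apply: cvgB; last by apply: cvgM.
apply: cvgD => //; apply: cvgD; last by apply: cvgM => //; exact: cvg_cst.
apply: cvgM; first exact: cvg_cst.
by rewrite expr2; under eq_fun do rewrite expr2; exact: cvgM.
Qed.

Let Qm := Pf rm - (T + 1).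

(** Between the end states the derivative of [Pf] contains two factors of size at most [d], and the
    interval has length at most [d]. *)
Let J8 : Pf rp - Pf rm <= 8 * B ^+ 4 * d ^+ 3.
Proof.
have [c [/andP[h1 h2] H]] := MVT_seg Pf (fun x => (T + 1) * (x - rm) * (x - rp) / x ^+ 3) rp rm rprm
  (fun x h => DPf x (lt_le_trans rp0 (andP h).1)).
have c0 : 0 < c by exact: lt_trans rp0 h1.
hy.
have ci : c^-1 <= 2 * B.
  rewrite -[leLHS]mul1r ler_pdivrMr//; nra.
have ci0 : 0 < c^-1 by rewrite invr_gt0.
have -> : Pf rp - Pf rm = ((T + 1) * (rm - c) * (c - rp) * (rm - rp)) * (c^-1 ^+ 3).
  by rewrite -opprB H exprVn; ring.
have -> : 8 * B ^+ 4 * d ^+ 3 = (B * d * d * d) * ((2 * B) ^+ 3) by ring.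
apply: ler_pM.
- by rewrite !mulr_ge0//; lra.
- by rewrite exprn_ge0// ltW.
- by rewrite !ler_pM ?mulr_ge0//; lra.
- by rewrite lerXn2r// nnegrE ?mulr_ge0// ltW.
Qed.

Let qB y : 0 <= Q y - Qm <= 8 * B ^+ 4 * d ^+ 3.
Proof.
have h1 FF H := Q_lim _ FF rm rm0 H r_Ny E_Ny p_Ny.
have h2 FF H := Q_lim _ FF rp rp0 H r_y E_y p_y.
have {}h1 := h1 _ (_ : (rm - rm) * (rm - rp) = 0).
have {}h2 := h2 _ (_ : (rp - rm) * (rp - rp) = 0).
have A1 : Qm <= Q y by apply: (mono_lim_Ny Q _ Qmono); apply: h1; rewrite subrr mul0r.
have A2 : Q y <= Pf rp - (T + 1) by apply: (mono_lim_y Q _ Qmono); apply: h2; rewrite subrr mulr0.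
apply/andP; split; first lra.
by apply: le_trans J8; rewrite /Qm; lra.
Qed.

(** Departure from the quasineutral relation. *)
Let G y := E y - ln (r y).

Let GE y : G y = p y / r y - (T + 1) * (r y - rm) * (r y - rp) / r y ^+ 2 - (Pf (r y) - Pf rm) + (Q y - Qm).
Proof.
rewrite /G /Q /Qm /Pf jE.
by field; rewrite rn0 rmn.
Qed.

(** [p] is eliminated between [pE] and the entropy. Nonnegativity of the left side excludes large
    [r]; for low [r] the identity forces a large field. *)
Let E1sq y : E1 y ^+ 2 / 2 = r y * ((expR (G y) - 1 - G y) - (Pf (r y) - Pf rm) + (Q y - Qm)).
Proof.
have eG : expR (E y) = r y * expR (G y).
  by rewrite /G expRB lnK ?posrE//; field.
have -> : E1 y ^+ 2 / 2 = (T + 1) * (r y - rm) * (r y - rp) / r y + (expR (E y) - r y) - p y by rewrite (pE y); ring.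
rewrite eG.
have -> : p y = r y * (G y + (T + 1) * (r y - rm) * (r y - rp) / r y ^+ 2 + (Pf (r y) - Pf rm) - (Q y - Qm)).
  by rewrite GE; field.
by field.
Qed.

Let Theta0 y : 0 <= expR (G y) - 1 - G y.
Proof. have := expR_ge1Dx (G y); lra. Qed.

Let Zpos y : 0 <= expR (G y) - 1 - G y - (Pf (r y) - Pf rm) + (Q y - Qm).
Proof. by rewrite -(pmulr_rge0 _ (r0 y)) -E1sq divr_ge0// sqr_ge0. Qed.

(** The increment of [Q] over a unit interval is [p^2 / j] at some point, and it is at most the
    total jump [8 B^4 d^3]. *)
Let small_p y : exists e, y < e < y + 1 /\ `|p e| <= 3 * B ^+ 3 * sg.
Proof.
have [|c [hc H]] := MVT_seg Q (fun y => p y ^+ 2 / j) y (y + 1) _ (fun x _ => DQ x); first lra.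
exists c; split => //.
have := qB (y + 1); have := qB y; move=> /andP[q1 q2] /andP[q3 q4].
have : p c ^+ 2 / j <= 8 * B ^+ 4 * d ^+ 3.
  have -> : p c ^+ 2 / j = Q (y + 1) - Q y by rewrite H; ring.
  lra.
rewrite ler_pdivrMr// => h.
have s0 : 0 <= 3 * B ^+ 3 * sg by rewrite !mulr_ge0// ?exprn_ge0 ?ltW.
rewrite -(@ler_pXn2r _ 2)// ?nnegrE// real_normK ?num_real//.
apply: le_trans h _.
have -> : (3 * B ^+ 3 * sg) ^+ 2 = 9 * B ^+ 6 * d ^+ 3 by rewrite -sgE; ring.
have d3 : 0 <= d ^+ 3 by rewrite exprn_ge0// ltW.
have b4 : 0 <= B ^+ 4 by rewrite exprn_ge0// ltW.
have : j <= B ^+ 2 by apply: le_trans jB _; rewrite expr2 ler_peMl// ltW.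
have -> : B ^+ 6 = B ^+ 4 * B ^+ 2 by rewrite -exprD.
move: (B ^+ 2) => b jb.
have : 0 <= B ^+ 4 * d ^+ 3 by rewrite mulr_ge0.
set X := B ^+ 4 * d ^+ 3 => X0.
have -> : 8 * B ^+ 4 * d ^+ 3 * j = 8 * X * j by rewrite /X; ring.
have -> : 9 * (B ^+ 4 * b) * d ^+ 3 = 9 * X * b by rewrite /X; ring.
apply: ler_pM; [by rewrite mulr_ge0|exact: ltW| |exact: jb].
by rewrite ler_wpM2r//; lra.
Qed.

(** [(1/r)' = - p / j], and the integral of [p^2] is bounded by the jump of [j Q]. Instead of
    Cauchy-Schwarz, the function [g] is monotone: its derivative is the square [(p + e sg)^2] for
    [e = 1] or [e = -1]. *)
Let inv_var x y : x <= y <= x + 3 -> `|(r y)^-1 - (r x)^-1| <= 6 * B ^+ 6 * sg.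
Proof.
move=> /andP[xy yx].
have Dnu (z : R) : hder (fun z => (r z)^-1) z (- (p z / j)).
  apply: hder_eq; first by apply: dinv; [exact: rn0|exact: Dr].
  by field; rewrite rn0 gt_eqF.
have key (e : R) : e ^+ 2 = 1 -> e * ((r y)^-1 - (r x)^-1) <= 6 * B ^+ 6 * sg.
  move=> e1.
  pose g z := sg ^+ 2 * z + j * Q z - 2 * sg * j * e * (r z)^-1.
  have Dg (z : R) : hder g z (sg ^+ 2 + p z ^+ 2 + 2 * sg * e * p z).
    apply: hder_eq.
      apply: dB; last by apply: dZ; exact: Dnu.
      by apply: dD; apply: dZ; [exact: did|exact: DQ].
    by field.
  have := mono_seg g (fun z => sg ^+ 2 + p z ^+ 2 + 2 * sg * e * p z) x y xy (fun z _ => Dg z).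
  have gp z : 0 <= sg ^+ 2 + p z ^+ 2 + 2 * sg * e * p z.
    have -> : sg ^+ 2 + p z ^+ 2 + 2 * sg * e * p z = (p z + e * sg) ^+ 2 + (1 - e ^+ 2) * sg ^+ 2 by ring.
    by rewrite e1 subrr mul0r addr0 sqr_ge0.
  move=> /(_ (fun z _ => gp z)); rewrite /g => H.
  have /andP[qx1 qx2] := qB x; have /andP[qy1 qy2] := qB y.
  have QQ : Q y - Q x <= 8 * B ^+ 4 * sg ^+ 2 by rewrite sgE; lra.
  set D := e * ((r y)^-1 - (r x)^-1).
  have H1 : 2 * sg * j * D <= sg ^+ 2 * (y - x) + j * (Q y - Q x) by rewrite /D; lra.
  have H2 : 2 * sg * j * D <= sg ^+ 2 * 3 + j * (8 * B ^+ 4 * sg ^+ 2).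
    apply: le_trans H1 _; apply: lerD.
      by rewrite ler_wpM2l ?sqr_ge0//; lra.
    by rewrite ler_wpM2l// ltW.
  have H3 : 2 * j * D <= sg * 3 + j * (8 * B ^+ 4 * sg).
    rewrite -(ler_pM2l sg0).
    have -> : sg * (2 * j * D) = 2 * sg * j * D by ring.
    by apply: le_trans H2 _; rewrite le_eqVlt; apply/orP; left; apply/eqP; ring.
  hy; have j2 : 0 < 2 * j by rewrite mulr_gt0.
  rewrite -(ler_pM2l j2); apply: le_trans H3 _.
  have b4 : 1 <= B ^+ 4 by rewrite exprn_ege1.
  have b6 : B ^+ 6 = B ^+ 5 * B by rewrite -exprSr.
  have b5 : B ^+ 5 = B ^+ 4 * B by rewrite -exprSr.
  have jb : 1 <= j * B by rewrite mulrC.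
  have jb6 : B ^+ 4 * B <= j * B ^+ 6.
    by rewrite b6 b5 mulrCA ler_peMr// mulr_ge0//; lra.
  have X1 : 1 <= B ^+ 4 * B by rewrite -exprSr exprn_ege1.
  have X2 : j * B ^+ 4 <= B ^+ 4 * B by rewrite mulrC ler_wpM2l//; lra.
  have : 3 + j * (8 * B ^+ 4) <= 2 * j * (6 * B ^+ 6) by lra.
  move=> h; have := ler_wpM2r (ltW sg0) h; lra.
rewrite ler_norml; apply/andP; split.
- by have := key (-1); rewrite sqrrN expr1n => /(_ erefl); lra.
- by have := key 1; rewrite expr1n => /(_ erefl); lra.
Qed.

Let Kf := barrier_sizes B K d sg B4 KE d0 dK sg0 sgd.

Let invB x : rm / 2 <= x -> 0 < x /\ x^-1 <= 2 * B.
Proof.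
hy; move=> h; have x0 : 0 < x by apply: lt_le_trans h; rewrite divr_gt0.
split => //; rewrite -[leLHS]mul1r ler_pdivrMr//.
have : B * (rm / 2) <= B * x by rewrite ler_wpM2l// ltW.
lra.
Qed.

Let r_var x y : x <= y <= x + 3 -> 3 / 4 * rm <= r x <= 5 / 4 * rm ->
  [/\ rm / 2 <= r y, r y <= 2 * rm & `|r y - r x| <= 24 * B ^+ 8 * sg].
Proof.
move=> xy /andP[rx1 rx2].
have H := inv_var x y xy.
have [_ _ f2 _ _] := Kf.
set a := (r x)^-1 in H *; set b := (r y)^-1 in H *.
have a0 : 0 < a by rewrite invr_gt0.
have b0 : 0 < b by rewrite invr_gt0.
have ra : r x * a = 1 by rewrite mulfV.
have rb : r y * b = 1 by rewrite mulfV.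
have D : rm * (6 * B ^+ 6 * sg) <= 10^-1.
  have h1 : rm * (6 * B ^+ 6 * sg) <= B * (6 * B ^+ 6 * sg).
    by rewrite ler_wpM2r// !mulr_ge0// ?exprn_ge0// ltW.
  have h2 : B ^+ 7 <= B ^+ 8 by rewrite ler_weXn2l.
  have h3 := ler_wpM2r (ltW sg0) h2.
  have : B * (6 * B ^+ 6 * sg) = 6 * B ^+ 7 * sg by ring.
  lra.
move: (H); rewrite ler_norml => /andP[H1 H2].
have rma1 : 4 / 5 <= rm * a.
  have : r x * a <= 5 / 4 * rm * a by rewrite ler_wpM2r// ltW.
  rewrite ra; lra.
have rma2 : rm * a <= 4 / 3.
  have : 3 / 4 * rm * a <= r x * a by rewrite ler_wpM2r// ltW.
  rewrite ra; lra.
have K1 := ler_wpM2l (ltW rm0) H1; have K2 := ler_wpM2l (ltW rm0) H2.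
have rmb1 : 7 / 10 <= rm * b by lra.
have rmb2 : rm * b <= 3 / 2 by lra.
have ry1 : rm / 2 <= r y.
  rewrite -(ler_pM2r b0) rb; lra.
have ry2 : r y <= 2 * rm.
  rewrite -(ler_pM2r b0) rb; lra.
split => //.
have -> : r y - r x = - (r x * r y * (b - a)).
  have -> : r x * r y * (b - a) = r x * (r y * b) - r y * (r x * a) by ring.
  by rewrite ra rb; ring.
rewrite normrN normrM ger0_norm; last by rewrite mulr_ge0// ltW.
have -> : 24 * B ^+ 8 * sg = (2 * B) * (2 * B) * (6 * B ^+ 6 * sg) by ring.
hy; apply: ler_pM => //; first by rewrite mulr_ge0// ltW.
by apply: ler_pM; [exact: ltW|exact: ltW|lra|lra].
Qed.

Let cB x : rm / 2 <= x -> x <= 2 * rm -> [/\ 0 < x, (x ^+ 3)^-1 <= 8 * B ^+ 3 & 1 <= 8 * B ^+ 3 * (x ^+ 3)^-1].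
Proof.
move=> h1 h2; have [x0 xi] := invB x h1; hy.
have xi0 : 0 < x^-1 by rewrite invr_gt0.
split => //.
- have -> : 8 * B ^+ 3 = (2 * B) ^+ 3 by ring.
  by rewrite -exprVn lerXn2r// nnegrE ?mulr_ge0// ltW.
- rewrite ler_pdivlMr ?exprn_gt0// mul1r.
  have -> : 8 * B ^+ 3 = (2 * B) ^+ 3 by ring.
  by apply: lerXn2r; rewrite ?nnegrE; lra.
Qed.

(** Above [rm] both factors [x - rm] and [x - rp] of the derivative of [Pf] are at least [x - rm];
    subtracting a cubic leaves a nondecreasing function. The upper bound is the mean value
    theorem. *)
Let Pdiff x : rm <= x -> x <= 2 * rm ->
  (x - rm) ^+ 3 / (24 * B ^+ 4) <= Pf x - Pf rm <= 8 * B ^+ 4 * (x - rm) ^+ 2 * (x - rm + d).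
Proof.
move=> x1 x2; hy.
have B40 : 0 < B ^+ 4 by rewrite exprn_gt0.
apply/andP; split.
  pose g z := Pf z - (24 * B ^+ 4)^-1 * ((z - rm) ^+ 2 * (z - rm)).
  have Dg z : rm <= z <= x -> hder g z ((T + 1) * (z - rm) * (z - rp) / z ^+ 3 - (8 * B ^+ 4)^-1 * (z - rm) ^+ 2).
    move=> /andP[z1 z2]; apply: hder_eq.
      apply: dB; first by apply: DPf; apply: lt_le_trans z1.
      have hz : hder (fun z => z - rm) z (1 - 0) by apply: dB; [exact: did|exact: dcst].
      by apply: dZ; apply: dM; [apply: dsqr; exact: hz|exact: hz].
    have z0 : 0 < z by lra.
    by rewrite /=; field; rewrite !gt_eqF.
  have := mono_seg g _ rm x x1 Dg.
  have -> : g rm = Pf rm by rewrite /g subrr expr2 !mulr0 subr0.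
  have -> : g x = Pf x - (x - rm) ^+ 3 / (24 * B ^+ 4) by rewrite /g; field; rewrite gt_eqF.
  move=> HH; have : Pf rm <= Pf x - (x - rm) ^+ 3 / (24 * B ^+ 4); last by lra.
  apply: HH => z /andP[z1 z2].
  have [z0 _ hz] := cB z (ltac:(lra)) (ltac:(lra)).
  rewrite subr_ge0.
  have s2 : 0 <= (z - rm) ^+ 2 by exact: sqr_ge0.
  rewrite ler_pdivrMl; last by rewrite mulr_gt0.
  have -> : 8 * B ^+ 4 * ((T + 1) * (z - rm) * (z - rp) / z ^+ 3) = (B * (T + 1)) * ((z - rm) * (z - rp)) * (8 * B ^+
    3 / z ^+ 3).
    by field; rewrite gt_eqF.
  have zz : (z - rm) ^+ 2 <= (z - rm) * (z - rp) by rewrite expr2 ler_wpM2l//; lra.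
  rewrite -[leLHS]mulr1; apply: ler_pM => //.
  by rewrite -[leLHS]mul1r; apply: ler_pM => //; lra.
move: x1; rewrite le_eqVlt => /orP[/eqP <-|x1].
  by rewrite !subrr expr2 mulr0 mulr0 mul0r.
have [c [/andP[c1 c2] ->]] := MVT_seg Pf (fun x => (T + 1) * (x - rm) * (x - rp) / x ^+ 3) rm x x1
  (fun x h => DPf x (lt_le_trans rm0 (andP h).1)).
have [c0 ci _] := cB c (ltac:(lra)) (ltac:(lra)).
have ci0 : 0 < (c ^+ 3)^-1 by rewrite invr_gt0 exprn_gt0.
have -> : (T + 1) * (c - rm) * (c - rp) / c ^+ 3 * (x - rm) = (T + 1) * (c - rm) * (c - rp) * (c ^+ 3)^-1 * (x - rm)
  by [].
have -> : 8 * B ^+ 4 * (x - rm) ^+ 2 * (x - rm + d) = B * (x - rm) * (x - rm + d) * (8 * B ^+ 3) * (x - rm) by ring.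
rewrite ler_pM2r ?subr_gt0//; apply: ler_pM => //.
- by rewrite !mulr_ge0//; lra.
- exact: ltW.
- apply: ler_pM; [rewrite mulr_ge0//; lra|lra| |lra].
  by apply: ler_pM => //; lra.
Qed.

(** Mirror image of the lower bound in [Pdiff], with the cubic centred at [rp]. *)
Let Plow x : rm / 2 <= x -> x <= rp -> (rp - x) ^+ 3 / (24 * B ^+ 4) <= Pf rp - Pf x.
Proof.
move=> x1 x2; hy.
have B40 : 0 < B ^+ 4 by rewrite exprn_gt0.
pose g z := Pf z - (24 * B ^+ 4)^-1 * ((z - rp) ^+ 2 * (z - rp)).
have Dg z : x <= z <= rp -> hder g z ((T + 1) * (z - rm) * (z - rp) / z ^+ 3 - (8 * B ^+ 4)^-1 * (z - rp) ^+ 2).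
  move=> /andP[z1 z2]; have [x0 _] := invB x x1; apply: hder_eq.
    apply: dB; first by apply: DPf; apply: lt_le_trans z1.
    have hz : hder (fun z => z - rp) z (1 - 0) by apply: dB; [exact: did|exact: dcst].
    by apply: dZ; apply: dM; [apply: dsqr; exact: hz|exact: hz].
  have z0 : 0 < z by lra.
  by rewrite /=; field; rewrite !gt_eqF.
have := mono_seg g _ x rp x2 Dg.
have -> : g rp = Pf rp by rewrite /g subrr expr2 !mulr0 subr0.
have -> : g x = Pf x + (rp - x) ^+ 3 / (24 * B ^+ 4) by rewrite /g; field; rewrite gt_eqF.
move=> HH; have : Pf x + (rp - x) ^+ 3 / (24 * B ^+ 4) <= Pf rp; last by lra.
apply: HH => z /andP[z1 z2].
have [z0 _ hz] := cB z (ltac:(lra)) (ltac:(lra)).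
rewrite subr_ge0.
have s2 : 0 <= (z - rp) ^+ 2 by exact: sqr_ge0.
rewrite ler_pdivrMl; last by rewrite mulr_gt0.
have -> : 8 * B ^+ 4 * ((T + 1) * (z - rm) * (z - rp) / z ^+ 3) = (B * (T + 1)) * ((rm - z) * (rp - z)) * (8 * B ^+ 3
  / z ^+ 3).
  by field; rewrite gt_eqF.
have zz : (z - rp) ^+ 2 <= (rm - z) * (rp - z).
  have -> : (z - rp) ^+ 2 = (rp - z) * (rp - z) by ring.
  by rewrite ler_wpM2r//; lra.
rewrite -[leLHS]mulr1; apply: ler_pM => //.
by rewrite -[leLHS]mul1r; apply: ler_pM => //; lra.
Qed.

Let cr : continuous r. Proof. by move=> z; exact: hder_continuous (Dr z). Qed.

Let KdB : K * d <= rm / 100.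
Proof.
have [K1 f1 _ _ _] := Kf; hy.
have h1 : 100 * B <= 400 * B ^+ 4.
  have : 1 <= B ^+ 3 by rewrite exprn_ege1.
  by rewrite exprSr; move: (B ^+ 3) => b; nra.
have X0 : 0 <= K * d by rewrite mulr_ge0//; lra.
have h2 := ler_wpM2r X0 h1.
have : B * (100 * (K * d)) <= B * rm by lra.
rewrite ler_pM2l//; lra.
Qed.

Let fr_bound x : rm <= x -> x <= 2 * rm ->
  0 <= (T + 1) * (x - rm) * (x - rp) / x ^+ 2 <= 4 * B ^+ 3 * (x - rm) * (x - rm + d).
Proof.
move=> x1 x2; have R0 := rm0; have [x0 xi] := invB x (ltac:(lra)).
have T1 : 0 < T + 1 by have := T0; lra.
have y0 : 0 <= x - rm by lra.
have z0 : 0 <= x - rp by have := rprm; lra.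
have zd : x - rp <= x - rm + d by have := drp; lra.
have xi0 : 0 < x^-1 by rewrite invr_gt0.
apply/andP; split; first by rewrite divr_ge0 ?sqr_ge0// !mulr_ge0// ltW.
have -> : 4 * B ^+ 3 * (x - rm) * (x - rm + d) = B * (x - rm) * (x - rm + d) * (2 * B) ^+ 2 by ring.
rewrite -exprVn; apply: ler_pM => //; [by rewrite !mulr_ge0// ltW|exact: sqr_ge0| |].
  apply: ler_pM => //; first by rewrite mulr_ge0// ltW.
  by rewrite ler_wpM2r.
by rewrite lerXn2r// nnegrE ?mulr_ge0// ltW.
Qed.

(** At a crossing of [rm + K d], [small_p] gives a point at distance less than one where [p] is
    small. There [r] has moved by at most [24 B^8 sg], far less than [K d], and the barrier argument
    applies. *)
Let upper y : r y < rm + K * d.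
Proof.
rewrite ltNge; apply/negP => ry.
have X0 : 0 < K * d by rewrite mulr_gt0//; have [h _ _ _ _] := Kf; lra.
have [x [xy rx]] : exists x, x < y /\ r x < rm + K * d.
  have N1 : \forall a \near -oo, r a < rm + K * d by apply: (cvgr_lt _ r_Ny); rewrite ltrDl.
  have N2 : \forall a \near -oo, a < y by apply: nbhs_ninfty_lt; exact: num_real.
  by have [a [h1 h2]] := @filter_ex _ _ (@proper_ninfty_nbhs R) _ (filterI N1 N2); exists a.
have [|y0 _ ry0] := @IVT _ r x y (rm + K * d) (ltW xy) (continuous_subspaceT cr).
  by rewrite ge_min le_max ry (ltW rx) orbT.
have [e [/andP[e1 e2] pe]] := small_p y0.
have [||re1 re2 re3] := r_var y0 e.
- by apply/andP; split; lra.
- by rewrite ry0; have h1 := KdB; have h2 := rm0; apply/andP; split; lra.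
rewrite ry0 in re3.
have re4 : `|r e - rm - K * d| <= 24 * B ^+ 8 * sg by have -> : r e - rm - K * d = r e - (rm + K * d) by ring.
have re5 : rm <= r e.
  have [_ _ _ f3 _] := Kf; move: re4; rewrite ler_norml => /andP[]; lra.
have /andP[P1 P2] := Pdiff (r e) re5 re2.
have [ri0 ri] := invB (r e) re1.
have rei0 : 0 < (r e)^-1 by rewrite invr_gt0.
have hp : `|p e / r e| <= 6 * B ^+ 4 * sg.
  rewrite normrM (ger0_norm (ltW rei0)).
  have -> : 6 * B ^+ 4 * sg = 3 * B ^+ 3 * sg * (2 * B) by ring.
  by apply: ler_pM => //; exact: ltW.
exact: (upper_barrier_absurd B K d sg (r e - rm) (p e / r e) ((T + 1) * (r e - rm) * (r e - rp) / r e ^+ 2)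
  (Pf (r e) - Pf rm) (Q e - Qm) (expR (G e) - 1 - G e) (G e) B4 KE d0 dK sg0 sgd sgE re4 hp
  (fr_bound (r e) re5 re2) P1 P2 (qB e) (GE e) (expR_quad (G e)) (Zpos e)).
Qed.

Let lower_window y0 z : r y0 = rm - K * d -> y0 <= z <= y0 + 3 ->
  [/\ rm / 2 <= r z, r z <= rp & K * d / 4 <= rp - r z].
Proof.
move=> ry0 hz; have [_ _ _ f3 f4] := Kf.
have KdB' := KdB; have R0 := rm0; have drp' := drp; have d0' := d0.
have [|h1 h2 h3] := r_var y0 z hz.
  by rewrite ry0; apply/andP; split; lra.
by move: h3; rewrite ry0 ler_norml => /andP[h3 h4]; split; lra.
Qed.

(** In [E1sq] the terms [expR G - 1 - G] and [Q - Qm] are nonnegative and are discarded; [Plow]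
    bounds the rest from below, up to the jump [J8]. *)
Let E1_low x : rm / 2 <= r x -> r x <= rp ->
  B^-1 * ((rp - r x) ^+ 3 / (24 * B ^+ 4) - 8 * B ^+ 4 * d ^+ 3) <= E1 x ^+ 2.
Proof.
move=> w1 w2; have P1 := Plow (r x) w1 w2; have P2 := J8.
have /andP[q1 q2] := qB x; have T1 := Theta0 x.
set Y := (rp - r x) ^+ 3 / (24 * B ^+ 4) - 8 * B ^+ 4 * d ^+ 3.
have YY : Y <= expR (G x) - 1 - G x - (Pf (r x) - Pf rm) + (Q x - Qm) by rewrite /Y; lra.
have -> : E1 x ^+ 2 = 2 * (E1 x ^+ 2 / 2) by field.
rewrite E1sq; set Z := _ + _ in YY *.
have Z0 : 0 <= Z by exact: Zpos.
have rb : 1 <= 2 * (r x) * B.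
  have h : B * (rm / 2) <= B * r x by rewrite ler_wpM2l// ltW.
  have := rmBi; lra.
rewrite ler_pdivrMl//.
apply: le_trans YY _.
have -> : B * (2 * (r x * Z)) = 2 * r x * B * Z by ring.
by rewrite ler_peMl.
Qed.

Let pr_le z : 0 < (r z)^-1 -> (r z)^-1 <= 2 * B -> `|p z| <= 3 * B ^+ 3 * sg -> `|p z / r z| <= 6 * B ^+ 10 * sg.
Proof.
move=> z0 z1 z2; rewrite normrM (ger0_norm (ltW z0)).
apply: (@le_trans _ _ (3 * B ^+ 3 * sg * (2 * B))); first by apply: ler_pM => //; exact: ltW.
have h : B ^+ 4 <= B ^+ 10 by rewrite ler_weXn2l.
have := ler_wpM2r (ltW sg0) h.
have -> : 3 * B ^+ 3 * sg * (2 * B) = 6 * (B ^+ 4 * sg) by ring.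
lra.
Qed.

Let Q_var e e' : `|Q e' - Q e| <= 8 * B ^+ 10 * sg.
Proof.
have /andP[q1 q2] := qB e; have /andP[q3 q4] := qB e'.
have : 8 * B ^+ 4 * d ^+ 3 <= 8 * B ^+ 10 * sg.
  rewrite -sgE expr2.
  have s1 : sg <= 1.
    have [_ _ f2 _ _] := Kf; apply: le_trans f2; rewrite ler_peMl// ?(ltW sg0)//.
    have b8 : 1 <= B ^+ 8 by rewrite exprn_ege1.
    lra.
  have h : B ^+ 4 <= B ^+ 10 by rewrite ler_weXn2l.
  have -> : 8 * B ^+ 4 * (sg * sg) = 8 * (B ^+ 4 * sg) * sg by ring.
  apply: (@le_trans _ _ (8 * (B ^+ 4 * sg))).
    by rewrite ler_piMr// mulr_ge0// mulr_ge0 ?exprn_ge0 ?ltW.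
  have := ler_wpM2r (ltW sg0) h; lra.
by move=> h; rewrite ler_norml; apply/andP; split; lra.
Qed.

Let inv2_var a b : 0 < a^-1 -> a^-1 <= 2 * B -> 0 < b^-1 -> b^-1 <= 2 * B -> `|b^-1 - a^-1| <= 6 * B ^+ 6 * sg ->
  `|j ^+ 2 / 2 * ((b^-1 + a^-1) * (b^-1 - a^-1))| <= 12 * B ^+ 10 * sg.
Proof.
move=> a0 a1 b0 b1 IV.
rewrite normrM (normrM (b^-1 + _)).
apply: (@le_trans _ _ (B ^+ 2 / 2 * ((4 * B) * (6 * B ^+ 6 * sg)))).
  apply: ler_pM => //.
    rewrite ger0_norm ?divr_ge0 ?sqr_ge0// ler_pM2r ?invr_gt0//.
    by rewrite lerXn2r// nnegrE ltW.
  by apply: ler_pM => //; rewrite ger0_norm; lra.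
have h : B ^+ 9 <= B ^+ 10 by rewrite ler_weXn2l.
have := ler_wpM2r (ltW sg0) h.
have -> : B ^+ 2 / 2 * (4 * B * (6 * B ^+ 6 * sg)) = 12 * (B ^+ 9 * sg) by field.
lra.
Qed.

Let ln_var a b : 0 < a -> a^-1 <= 2 * B -> 0 < b -> b^-1 <= 2 * B -> a <= B * 2 -> b <= B * 2 ->
  `|b^-1 - a^-1| <= 6 * B ^+ 6 * sg -> `|T * (ln b - ln a)| <= 48 * B ^+ 10 * sg.
Proof.
move=> a0 a1 b0 b1 aB bB IV.
have ai : 0 < a^-1 by rewrite invr_gt0.
have bi : 0 < b^-1 by rewrite invr_gt0.
have rr : `|b - a| <= 24 * B ^+ 8 * sg.
  have -> : b - a = - (a * b * (b^-1 - a^-1)) by field; rewrite !gt_eqF.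
  rewrite normrN normrM ger0_norm; last by rewrite mulr_ge0// ltW.
  have -> : 24 * B ^+ 8 * sg = (B * 2) * (B * 2) * (6 * B ^+ 6 * sg) by ring.
  apply: ler_pM => //; first by rewrite mulr_ge0// ltW.
  by apply: ler_pM => //; exact: ltW.
have lnb : `|ln b - ln a| <= 24 * B ^+ 8 * sg * (2 * B).
  have h1 := ln_diff_le b a b0 a0; have h2 := ln_diff_le a b a0 b0.
  have h3 : (b - a) / a <= 24 * B ^+ 8 * sg * (2 * B).
    apply: le_trans (ler_norm _) _; rewrite normrM (ger0_norm (ltW ai)).
    by apply: ler_pM => //; exact: ltW.
  have h4 : (a - b) / b <= 24 * B ^+ 8 * sg * (2 * B).
    apply: le_trans (ler_norm _) _; rewrite normrM (ger0_norm (ltW bi)) distrC.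
    by apply: ler_pM => //; exact: ltW.
  by rewrite ler_norml; apply/andP; split; lra.
rewrite normrM (ger0_norm (ltW T0)).
have -> : 48 * B ^+ 10 * sg = B * (24 * B ^+ 8 * sg * (2 * B)) by ring.
apply: ler_pM => //; first exact: ltW.
have := TB; lra.
Qed.

(** [E] is solved from the definition of [Q]. Between two points where [p] is small, every other
    term varies by a multiple of [sg]. *)
Let E_var e e' : e <= e' <= e + 3 -> rm / 2 <= r e -> r e <= rp -> rm / 2 <= r e' -> r e' <= rp ->
  `|p e| <= 3 * B ^+ 3 * sg -> `|p e'| <= 3 * B ^+ 3 * sg -> `|E e' - E e| <= 80 * B ^+ 10 * sg.
Proof.
move=> ee we1 we2 we1' we2' pe pe'.
have [re0 rei] := invB (r e) we1; have [re0' rei'] := invB (r e') we1'.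
have ri0 : 0 < (r e)^-1 by rewrite invr_gt0.
have ri0' : 0 < (r e')^-1 by rewrite invr_gt0.
have rpB : rp <= B * 2 by have h1 := rprm; have h2 := rmB; have h3 := B0; lra.
have A0 : E e' - E e = (Q e' - Q e) + (p e' / r e' - p e / r e)
    - j ^+ 2 / 2 * (((r e')^-1 + (r e)^-1) * ((r e')^-1 - (r e)^-1)) - T * (ln (r e') - ln (r e)).
  by rewrite /Q; ring.
have IV := inv_var e e' ee.
have A1 := Q_var e e'.
have A3 := inv2_var (r e) (r e') ri0 rei ri0' rei' IV.
have A4 := ln_var (r e) (r e') re0 rei re0' rei' (le_trans we2 rpB) (le_trans we2' rpB) IV.
have A5 := pr_le e ri0 rei pe; have A6 := pr_le e' ri0' rei' pe'.
rewrite A0; move: A1 A3 A4 A5 A6; rewrite !ler_norml.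
by move=> /andP[? ?] /andP[? ?] /andP[? ?] /andP[? ?] /andP[? ?]; apply/andP; split; lra.
Qed.

(** Otherwise [r] stays low on a window of length 3, on which [E1] has a fixed size while [E] varies too little. *)
Let lower y : rm - K * d < r y.
Proof.
rewrite ltNge; apply/negP => ry.
have [x [xy rx]] : exists x, x < y /\ rm - K * d < r x.
  have N1 : \forall a \near -oo, rm - K * d < r a.
    by apply: (cvgr_gt _ r_Ny); rewrite ltrBlDr ltrDl mulr_gt0//; have [h _ _ _ _] := Kf; lra.
  have N2 : \forall a \near -oo, a < y by apply: nbhs_ninfty_lt; exact: num_real.
  by have [a [h1 h2]] := @filter_ex _ _ (@proper_ninfty_nbhs R) _ (filterI N1 N2); exists a.
have [|y0 _ ry0] := @IVT _ r x y (rm - K * d) (ltW xy) (continuous_subspaceT cr).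
  by rewrite ge_min le_max ry (ltW rx) orbT.
have [e [/andP[e1 e2] pe]] := small_p y0.
(* [e < y0 + 1] and [e' > y0 + 2]: the points are more than one apart, so the mean field between
   them is at most the increment of [E]. *)
have [e' [/andP[e1' e2'] pe']] := small_p (y0 + 2).
have ee : e < e' by lra.
have [x1 [/andP[x2 x3] HE]] := MVT_seg E E1 e e' ee (fun z _ => DE z).
have [w1 w2 w3] := lower_window y0 x1 ry0 (ltac:(apply/andP; split; lra)).
have [we1 we2 _] := lower_window y0 e ry0 (ltac:(apply/andP; split; lra)).
have [we1' we2' _] := lower_window y0 e' ry0 (ltac:(apply/andP; split; lra)).
have h1 := E1_low x1 w1 w2.
have h2 := E_var e e' (ltac:(apply/andP; split; lra)) we1 we2 we1' we2' pe pe'.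
have h3 : E1 x1 ^+ 2 <= (E e' - E e) ^+ 2.
  rewrite HE exprMn ler_peMr ?sqr_ge0//.
  have : 1 <= (e' - e) by lra.
  by move=> h; rewrite exprn_ege1.
exact: (lower_barrier_absurd B K d sg (rp - r x1) (E e' - E e) (E1 x1 ^+ 2) B4 KE d0 sgE sg0 w3 h1 h3 h2).
Qed.

Let X := K * d.
Let X0 : 0 < X.
Proof. by rewrite mulr_gt0//; have [h _ _ _ _] := Kf; lra. Qed.

Let dX : 4 * d <= X. Proof. by have [_ _ _ _ h] := Kf. Qed.

Let BX n : (n <= 4)%N -> 64 * B ^+ n * X <= 1.
Proof.
move=> n4; have [_ h _ _ _] := Kf; apply: le_trans h.
rewrite ler_pM2r//; apply: ler_pM => //; [exact: exprn_ge0 (ltW B0)|by rewrite ler_nat|].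
exact: ler_weXn2l.
Qed.

Let X1 : 64 * X <= 1. Proof. by have := BX 0 isT; rewrite expr0 mulr1. Qed.

Let Xrm : X <= rm / 100. Proof. exact: KdB. Qed.

(** Where [E] exceeds [ln (rm + X)], the equation [E'' = expR E - r] makes it strictly convex
    because [r < rm + X]; the maximum principle excludes this. *)
Let E_up z : E z <= ln (rm + X).
Proof.
have x0 := X0; have R0 := rm0.
have cg : continuous (fun z => expR (E z) - r z).
  move=> t; apply: cvgB; last exact: cr.
  apply: (continuous_comp (f := E)); first exact: hder_continuous (DE t).
  exact: continuous_expR.
apply: (max_principle E E1 (fun z => expR (E z) - r z) (ln (rm + X)) (ln rm) (ln rp)) => //.
- move=> t h; rewrite subr_gt0; apply: lt_trans (upper t) _.
  by rewrite -(@lnK _ (rm + X)) ?posrE ?ltr_expR//; lra.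
- by rewrite ler_ln ?posrE//; lra.
- by rewrite ler_ln ?posrE//; have := rprm; lra.
Qed.

Let E_dn z : ln (rm - X) <= E z.
Proof.
have x0 := X0; have R0 := rm0; have xr := Xrm.
have cg : continuous (fun z => - (expR (E z) - r z)).
  move=> t; apply: cvgN; apply: cvgB; last exact: cr.
  apply: (continuous_comp (f := E)); first exact: hder_continuous (DE t).
  exact: continuous_expR.
rewrite -lerN2.
apply: (max_principle (fun z => - E z) (fun z => - E1 z) (fun z => - (expR (E z) - r z)) (- ln (rm - X)) (- ln rm) (-
  ln rp)) => //.
- by move=> t; exact: (is_deriveN (DE t)).
- by move=> t; exact: (is_deriveN (DE1 t)).
- move=> t h; rewrite oppr_gt0 subr_lt0; apply: lt_trans (lower t).
  rewrite -(@lnK _ (rm - X)) ?posrE; last lra.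
  by rewrite ltr_expR; lra.
- exact: cvgN.
- exact: cvgN.
- by rewrite lerN2 ler_ln ?posrE//; lra.
- by rewrite lerN2 ler_ln ?posrE//; have h1 := drp; have h2 := dX; have h3 := d0; lra.
Qed.

Let ry1 y : rm / 2 <= r y.
Proof. by have h1 := lower y; have h2 := Xrm; have h3 := rm0; rewrite -/X in h1; lra. Qed.
Let ry2 y : r y <= 2 * rm.
Proof. by have h1 := upper y; have h2 := Xrm; have h3 := rm0; rewrite -/X in h1; lra. Qed.
Let ryX y : `|r y - rm| <= X.
Proof.
have h1 := upper y; have h2 := lower y; rewrite -/X in h1 h2.
by rewrite ler_norml; apply/andP; split; lra.
Qed.
Let ryX2 y : `|r y - rp| <= 2 * X.
Proof.
have := ryX y; have h1 := drp; have h2 := dX; have h3 := d0; have h4 := rprm.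
by rewrite !ler_norml => /andP[? ?]; apply/andP; split; lra.
Qed.
Let riV y : (r y)^-1 <= 2 * B. Proof. by have [_] := invB (r y) (ry1 y). Qed.
Let ri0 y : 0 < (r y)^-1. Proof. by rewrite invr_gt0. Qed.
Let rB y : r y <= 2 * B.
Proof. by apply: le_trans (ry2 y) _; rewrite ler_pM2l. Qed.

Let G_b y : `|G y| <= 4 * B * X.
Proof.
have x0 := X0; have R0 := rm0; have xr := Xrm.
have uy := upper y; have ly := lower y; rewrite -/X in uy ly.
have Euy := E_up y; have Ely := E_dn y.
have p1 : 0 < rm + X by lra.
have p2 : 0 < rm - X by lra.
have [_ li] := invB (rm - X) (ltac:(lra)).
have h1 := ln_diff_le (rm + X) (r y) p1 (r0 y).
have h2 := ln_diff_le (r y) (rm - X) (r0 y) p2.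
have i2 : 0 <= (rm - X)^-1 by rewrite invr_ge0 ltW.
have i1 := ltW (ri0 y).
have h3 : (rm + X - r y) / r y <= (2 * X) * (2 * B).
  by apply: ler_pM => //; lra.
have h4 : (r y - (rm - X)) / (rm - X) <= (2 * X) * (2 * B).
  by apply: ler_pM => //; lra.
by rewrite /G ler_norml; apply/andP; split; lra.
Qed.

Let f_b y : `|(T + 1) * (r y - rm) * (r y - rp) / r y ^+ 2| <= 2^-1 * X.
Proof.
have T1 : 0 < T + 1 by have := T0; lra.
rewrite normrM (ger0_norm (_ : 0 <= (r y ^+ 2)^-1)) ?invr_ge0 ?sqr_ge0// -exprVn.
apply: (@le_trans _ _ (B * X * (2 * X) * (2 * B) ^+ 2)).
  apply: ler_pM => //; [exact: sqr_ge0| |by rewrite lerXn2r// nnegrE ?mulr_ge0// ltW].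
  rewrite normrM [X in X * _]normrM; apply: ler_pM => //.
  by apply: ler_pM => //; rewrite gtr0_norm.
have -> : B * X * (2 * X) * (2 * B) ^+ 2 = 8 * B ^+ 3 * X * X by ring.
rewrite ler_pM2r//; have := BX 3 isT; lra.
Qed.

Let P_var a b : a < b -> rm - X <= a -> b <= rm + X -> `|Pf b - Pf a| <= 2^-1 * X ^+ 2.
Proof.
move=> ab ha hb; have x0 := X0; have R0 := rm0; have xr := Xrm.
have a0 : 0 < a by lra.
have [c [/andP[c1 c2] ->]] := MVT_seg Pf (fun x => (T + 1) * (x - rm) * (x - rp) / x ^+ 3) a b ab
  (fun x h => DPf x (lt_le_trans a0 (andP h).1)).
have [c0 ci _] := cB c (ltac:(lra)) (ltac:(lra)).
have ci0 : 0 < (c ^+ 3)^-1 by rewrite invr_gt0 exprn_gt0.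
have T1 : 0 < T + 1 by have := T0; lra.
have cm : `|c - rm| <= X by rewrite ler_norml; apply/andP; split; lra.
have cp : `|c - rp| <= 2 * X.
  by have h1 := drp; have h2 := dX; have h3 := d0; have h4 := rprm; rewrite ler_norml; apply/andP; split; lra.
have ba : 0 < b - a by lra.
have ba2 : b - a <= 2 * X by lra.
rewrite normrM normrM (gtr0_norm ci0) (gtr0_norm ba).
apply: (@le_trans _ _ (B * X * (2 * X) * (8 * B ^+ 3) * (2 * X))).
  apply: ler_pM => //; [by rewrite !mulr_ge0// ltW|exact: ltW|].
  apply: ler_pM => //; first exact: ltW.
  rewrite normrM [X in X * _]normrM; apply: ler_pM => //.
  by apply: ler_pM => //; rewrite gtr0_norm.
have -> : B * X * (2 * X) * (8 * B ^+ 3) * (2 * X) = 32 * B ^+ 4 * X * X ^+ 2 by ring.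
rewrite ler_wpM2r ?sqr_ge0//; have := BX 4 isT; lra.
Qed.

Let P_b y : `|Pf (r y) - Pf rm| <= 2^-1 * X ^+ 2.
Proof.
have uy := upper y; have ly := lower y; rewrite -/X in uy ly; have x0 := X0.
have [h|h|->] := ltgtP (r y) rm.
- by rewrite distrC; apply: P_var => //; lra.
- by apply: P_var => //; lra.
- by rewrite subrr normr0 mulr_ge0// sqr_ge0.
Qed.

Let q_b y : 0 <= Q y - Qm <= 2^-1 * X ^+ 2.
Proof.
have /andP[q0 q1] := qB y; apply/andP; split => //.
apply: le_trans q1 _.
have -> : 8 * B ^+ 4 * d ^+ 3 = 8 * B ^+ 4 * d * (d * d) by ring.
have dX1 : d <= X by have h1 := dX; have h2 := d0; lra.
have h2 : d * d <= X * X by apply: ler_pM => //; exact: ltW.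
have h3 : 0 <= d * d by rewrite mulr_ge0// ltW.
have b4 : 0 <= B ^+ 4 by rewrite exprn_ge0// ltW.
have h4 : 8 * B ^+ 4 * d <= 8 * B ^+ 4 * X by rewrite ler_wpM2l// mulr_ge0.
have h5 : 8 * B ^+ 4 * d <= 2^-1 by have := BX 4 isT; lra.
rewrite expr2; apply: ler_pM => //; by rewrite !mulr_ge0// ltW.
Qed.

Let X_sqr : X ^+ 2 <= 2^-1 * X.
Proof. by rewrite expr2 ler_pM2r//; have h1 := X1; have h2 := X0; lra. Qed.

Let G_sqr y : G y ^+ 2 <= 16 * B ^+ 2 * X ^+ 2.
Proof.
rewrite -[G y ^+ 2]real_normK ?num_real//.
have -> : 16 * B ^+ 2 * X ^+ 2 = (4 * B * X) ^+ 2 by ring.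
by rewrite lerXn2r// nnegrE; apply: le_trans (G_b y).
Qed.

Let BX1 : X <= B * X. Proof. by rewrite ler_peMl// ltW. Qed.
Let BXs : 64 * (B * X) <= 1. Proof. by have := BX 1 isT; rewrite expr1 mulrA. Qed.

Let Th_b y : expR (G y) - 1 - G y <= 32 * B ^+ 2 * X ^+ 2.
Proof.
have h : G y <= 2^-1.
  by apply: le_trans (ler_norm _) _; apply: le_trans (G_b y) _; have := BXs; lra.
apply: le_trans (expR_quad _ h) _; have := G_sqr y; lra.
Qed.

(** Once [r] and [E] are confined, [GE] is a formula for [p] with all terms of order [X], and [E1sq]
    one for the squared field with all terms of order [X^2]. *)
Let p_b y : `|p y| <= 12 * B ^+ 2 * X.
Proof.
have -> : p y = r y * (G y + (T + 1) * (r y - rm) * (r y - rp) / r y ^+ 2 + (Pf (r y) - Pf rm) - (Q y - Qm)).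
  by rewrite GE; field.
rewrite normrM (gtr0_norm (r0 y)).
have -> : 12 * B ^+ 2 * X = 2 * B * (6 * (B * X)) by ring.
apply: ler_pM => //; first exact: ltW.
have h1 := BX1; have h2 := X_sqr; have h3 := sqr_ge0 X; have /andP[h4 h5] := q_b y; have h6 := X0.
move: (G_b y) (f_b y) (P_b y); rewrite !ler_norml.
by move=> /andP[? ?] /andP[? ?] /andP[? ?]; apply/andP; split; lra.
Qed.

Let E1_b y : `|E1 y| <= 13 * B ^+ 2 * X.
Proof.
have C0 : 0 <= 13 * B ^+ 2 * X.
  by apply: mulr_ge0; [apply: mulr_ge0; [exact: ler0n|exact: sqr_ge0]|exact: ltW].
rewrite -(@ler_pXn2r _ 2)// ?nnegrE// real_normK ?num_real//.
have -> : E1 y ^+ 2 = 2 * (E1 y ^+ 2 / 2) by field.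
rewrite E1sq.
have b2 : 1 <= B ^+ 2 by rewrite exprn_ege1.
apply: (@le_trans _ _ (2 * (2 * B * (33 * B ^+ 2 * X ^+ 2)))).
  rewrite ler_pM2l//; apply: ler_pM => //.
  - exact: ltW.
  - have h1 : X ^+ 2 <= B ^+ 2 * X ^+ 2 by rewrite ler_peMl// sqr_ge0.
    have h2 := Th_b y; have /andP[h3 h4] := q_b y.
    by move: (P_b y); rewrite ler_norml => /andP[? ?]; lra.
have -> : (13 * B ^+ 2 * X) ^+ 2 = 169 * B * (B ^+ 3 * X ^+ 2) by ring.
have -> : 2 * (2 * B * (33 * B ^+ 2 * X ^+ 2)) = 132 * (B ^+ 3 * X ^+ 2) by ring.
have h0 : 0 <= B ^+ 3 * X ^+ 2 by rewrite mulr_ge0 ?sqr_ge0// exprn_ge0// ltW.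
rewrite ler_wpM2r//; have := B1; lra.
Qed.

Let E2_b y : `|expR (E y) - r y| <= 16 * B ^+ 2 * X.
Proof.
have eG : expR (E y) = r y * expR (G y).
  by rewrite /G expRB lnK ?posrE//; field.
have -> : expR (E y) - r y = r y * (expR (G y) - 1) by rewrite eG; ring.
rewrite normrM (gtr0_norm (r0 y)).
have -> : 16 * B ^+ 2 * X = 2 * B * (8 * (B * X)) by ring.
apply: ler_pM => //; first exact: ltW.
have h1 : 32 * B ^+ 2 * X ^+ 2 <= B * X.
  have -> : 32 * B ^+ 2 * X ^+ 2 = (32 * (B * X)) * (B * X) by ring.
  have h0 : 0 <= B * X by rewrite mulr_ge0 ?ltW.
  rewrite ler_piMl//; have h1 := BXs; lra.
have h2 := Th_b y; have h3 := Theta0 y; have h4 := BX1; have h5 := X0.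
by move: (G_b y); rewrite !ler_norml => /andP[? ?]; apply/andP; split; lra.
Qed.

Lemma profile_ode_bounds y :
  [/\ `|r y - rm| <= K * d, rm / 2 <= r y, r y <= 2 * rm, `|E y - ln (r y)| <= 4 * B * (K * d) &
    [/\ `|p y| <= 12 * B ^+ 2 * (K * d), `|E1 y| <= 13 * B ^+ 2 * (K * d)
     & `|expR (E y) - r y| <= 16 * B ^+ 2 * (K * d)]].
Proof.
by split; [exact: ryX|exact: ry1|exact: ry2|exact: G_b|split; [exact: p_b|exact: E1_b|exact: E2_b]].
Qed.

End profile_ode.

(** * Limits of derivatives at infinity *)

Lemma near_shift_y {R : realType} (P : R -> Prop) : (\forall y \near +oo, P y) ->
  \forall y \near +oo, forall c : R, y <= c <= y + 1 -> P c.
Proof.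
move=> [M [Mr HM]]; exists M; split => // y My c /andP[yc _].
by apply: HM; exact: lt_le_trans yc.
Qed.

Lemma near_shift_Ny {R : realType} (P : R -> Prop) : (\forall y \near -oo, P y) ->
  \forall y \near -oo, forall c : R, y <= c <= y + 1 -> P c.
Proof.
move=> [M [Mr HM]]; exists (M - 1); split; first exact: num_real.
by move=> y /= My c /andP[_ yc]; apply: HM; lra.
Qed.

(** Eventual properties hold on whole unit windows, on which the mean value theorem acts. This
    treats both ends of the line at once. *)
Definition shift_stable {R : realType} (F : set_system R) : Prop :=
  forall P : R -> Prop, (\forall y \near F, P y) -> \forall y \near F, forall c : R, y <= c <= y + 1 -> P c.

(** Increments of [f] over unit windows tend to [0], and each is a value of [f'] close to [L]. *)
Lemma lim_deriv0 {R : realType} (F : set_system R) {FF : ProperFilter F} (sF : shift_stable F)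
  (f f' : R -> R) (l L : R) : (forall y, hder f y (f' y)) ->
  f y @[y --> F] --> l -> f' y @[y --> F] --> L -> L = 0.
Proof.
move=> Df fl f'L; apply/eqP; rewrite -normr_le0; apply/ler_addgt0Pr => e e0.
have e4 : 0 < e / 4 by rewrite divr_gt0.
have N1 : \forall y \near F, forall c : R, y <= c <= y + 1 -> `|l - f c| < e / 4.
  by apply: sF; move/cvgrPdist_lt: fl => /(_ _ e4).
have N2 : \forall y \near F, forall c : R, y <= c <= y + 1 -> `|L - f' c| < e / 4.
  by apply: sF; move/cvgrPdist_lt: f'L => /(_ _ e4).
have [y [h1 h2]] := @filter_ex _ _ FF _ (filterI N1 N2).
have [|c [/andP[c1 c2] H]] := MVT_seg f f' y (y + 1) _ (fun x _ => Df x); first lra.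
have a1 := h1 y (ltac:(apply/andP; split; lra)).
have a2 := h1 (y + 1) (ltac:(apply/andP; split; lra)).
have a3 := h2 c (ltac:(apply/andP; split; lra)).
have {}H : f (y + 1) - f y = f' c by rewrite H; ring.
move: a1 a2 a3; rewrite !ltr_norml => /andP[? ?] /andP[? ?] /andP[? ?].
by rewrite ler_norml; apply/andP; split; lra.
Qed.

(** On a unit window some value of [f'] is a small increment of [f], and [f'] varies there by no
    more than the small values of [f'']. *)
Lemma lim_deriv_second {R : realType} (F : set_system R) {FF : ProperFilter F} (sF : shift_stable F)
  (f f' f'' : R -> R) (l : R) : (forall y, hder f y (f' y)) -> (forall y, hder f' y (f'' y)) ->
  f y @[y --> F] --> l -> f'' y @[y --> F] --> 0 -> f' y @[y --> F] --> 0.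
Proof.
move=> Df Df' fl f''0; apply/cvgrPdist_lt => e e0.
have e4 : 0 < e / 4 by rewrite divr_gt0.
have N1 : \forall y \near F, forall c : R, y <= c <= y + 1 -> `|l - f c| < e / 4.
  by apply: sF; move/cvgrPdist_lt: fl => /(_ _ e4).
have N2 : \forall y \near F, forall c : R, y <= c <= y + 1 -> `|0 - f'' c| < e / 4.
  by apply: sF; move/cvgrPdist_lt: f''0 => /(_ _ e4).
apply: filterS2 N1 N2 => y h1 h2.
have [|c [/andP[c1 c2] H]] := MVT_seg f f' y (y + 1) _ (fun x _ => Df x); first lra.
have [|d [/andP[d1 d2] G]] := MVT_seg f' f'' y c _ (fun x _ => Df' x); first lra.
have a1 := h1 y (ltac:(apply/andP; split; lra)).
have a2 := h1 (y + 1) (ltac:(apply/andP; split; lra)).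
have a3 := h2 d (ltac:(apply/andP; split; lra)).
have {}H : f (y + 1) - f y = f' c by rewrite H; ring.
have : `|f' c - f' y| <= e / 4.
  rewrite G normrM -[leRHS]mulr1; apply: ler_pM => //.
    by rewrite ltW// -normrN -sub0r.
  by rewrite ger0_norm; lra.
move: a1 a2; rewrite !ltr_norml ler_norml => /andP[? ?] /andP[? ?] /andP[? ?].
by rewrite ?ltr_norml; apply/andP; split; lra.
Qed.

Lemma cst_lim {R : realType} (F : set_system R) {FF : ProperFilter F} (f : R -> R) (l : R) :
  (forall x y, f x = f y) -> f y @[y --> F] --> l -> forall y, f y = l.
Proof.
move=> fc fl y; have E : f = fun=> f y by apply/funext => x; exact: fc.
have h : f y @[y --> F] --> f y by rewrite {1}E; exact: cvg_cst.
exact: (cvg_unique _ h fl).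
Qed.

(** * Rankine-Hugoniot relations *)

Section shock_algebra.
Context {R : realType}.
Variables (T rm rp a s : R).
Hypotheses (T0 : 0 < T) (rm0 : 0 < rm) (rp0 : 0 < rp) (a0 : 0 < a).
Hypotheses (RH1 : - s * (rp - rm) + rp * (- a) - rm * a = 0).
Hypotheses (RH2 : - s * (rp * (- a) - rm * a) + rp * (- a) ^+ 2 - rm * a ^+ 2 + (T + 1) * (rp - rm) = 0).
Hypotheses (L1 : - a + Num.sqrt (T + 1) < s).

(** Combining the jump relations and dividing by [rm - rp], nonzero because [a > 0], gives
    [s^2 = a^2 + T + 1]. The Lax inequality [L1] selects the positive root, which orders the
    densities. *)
Lemma shock_facts : [/\ s ^+ 2 = a ^+ 2 + (T + 1), a < s, rp < rm, rm * (s - a) = rp * (s + a) &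
  s <= a + (T + 1) /\ a * (rp + rm) = s * (rm - rp)].
Proof.
pose proof T0; pose proof rm0; pose proof rp0; pose proof a0; pose proof RH1 as r1; pose proof RH2 as r2.
have E1 : s * (rm - rp) = a * (rp + rm) by lra.
have E2 : s * (a * (rp + rm)) = (rm - rp) * (a ^+ 2 + (T + 1)) by lra.
have P : 0 < a * (rp + rm) by rewrite mulr_gt0// addr_gt0.
have D0 : rm - rp != 0 by apply/negP => /eqP h; move: E1; rewrite h mulr0; lra.
have S2 : s ^+ 2 = a ^+ 2 + (T + 1).
  by apply: (mulIf D0); rewrite expr2 -mulrA E1 E2 mulrC.
have q0 : 0 < Num.sqrt (T + 1) by rewrite sqrtr_gt0; lra.
have s0 : 0 < s.
  rewrite ltNge; apply/negP => sn.
  have h1 : - s < a by have := L1; lra.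
  have : (- s) ^+ 2 < a ^+ 2 by rewrite ltr_pXn2r// nnegrE; lra.
  by rewrite sqrrN S2; lra.
have sa : a < s by rewrite -(@ltr_pXn2r _ 2)// ?nnegrE ?S2; lra.
have rr : rp < rm.
  by have : 0 < s * (rm - rp) by [rewrite E1]; rewrite pmulr_rgt0// subr_gt0.
split => //; first lra.
split; last lra.
rewrite -(@ler_pXn2r _ 2)// ?nnegrE; [|lra|lra].
rewrite S2 sqrrD -subr_ge0.
have -> : a ^+ 2 + a * (T + 1) *+ 2 + (T + 1) ^+ 2 - (a ^+ 2 + (T + 1)) = (T + 1) * (2 * a + T) by ring.
by rewrite mulr_ge0//; lra.
Qed.

End shock_algebra.

(** * First integrals of the travelling wave system *)

Section profile_first_order.
Context {R : realType}.
Variables (T : R) (Sh : shock R) (W : wave R).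
Hypotheses (T0 : 0 < T) (hS : is_shock T Sh) (hW : is_profile T Sh W).

(** [j] is minus the mass flux relative to the shock. *)
Lemma profile_first_order : exists j : R, let rm := rhom Sh in let rp := rhop Sh in let s := speed Sh in
  let r := wrho W in let E := wE W in let E1 := derive1 E in
  let p := fun y => j * ((r y)^-1) ^+ 2 * derive1 r y in
  [/\ [/\ 0 < j, j ^+ 2 = (T + 1) * rm * rp, rp < rm & 0 < rm],
   [/\ 0 < s, s <= um Sh + (T + 1), j = rm * (s - um Sh), 0 < um Sh & um Sh * (rp + rm) = s * (rm - rp)],
   [/\ forall y, 0 < r y, forall y, wu W y = s - j * (r y)^-1,
    forall y, hder r y (r y ^+ 2 / j * p y), forall y, hder E y (E1 y) & forall y, hder E1 y (expR (E y) - r y)],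
   forall y, p y = (T + 1) * (r y - rm) * (r y - rp) / r y + (expR (E y) - r y) - E1 y ^+ 2 / 2
   & [/\ r y @[y --> -oo] --> rm /\ r y @[y --> +oo] --> rp,
    E y @[y --> -oo] --> ln rm /\ E y @[y --> +oo] --> ln rp
    & p y @[y --> -oo] --> 0 /\ p y @[y --> +oo] --> 0]].
Proof.
case: Sh hS hW => rm rp um up s [rm0 rp0 RH1 RH2 [L1 _ _ [ue u0]]].
rewrite /is_profile /=.
set r := wrho W; set m := wm W; set E := wE W.
move=> [[sr sm sE r0] e1 e2 e3 [[rN rP] [mN mP] [EN EP]]].
have upE : up = - um by rewrite ue opprK.
rewrite upE in RH1 RH2 L1 mP.
have [S2 us rr jE [ss ur]] := shock_facts T rm rp um s T0 rm0 rp0 u0 RH1 RH2 L1.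
pose j := rm * (s - um); exists j => /=.
have j0 : 0 < j by rewrite mulr_gt0// subr_gt0.
have jn : j != 0 by rewrite gt_eqF.
have rn y : r y != 0 by rewrite gt_eqF.
have j2 : j ^+ 2 = (T + 1) * rm * rp.
  rewrite expr2 {2}/j jE /j.
  have -> : rm * (s - um) * (rp * (s + um)) = (s ^+ 2 - um ^+ 2) * rm * rp by ring.
  by rewrite S2; ring.
have Dr y : hder r y (derive1 r y) by apply: hder_derive1; exact: (sr 0%N).
have Dm y : hder m y (derive1 m y) by apply: hder_derive1; exact: (sm 0%N).
have DE y : hder E y (derive1 E y) by apply: hder_derive1; exact: (sE 0%N).
have DE1 y : hder (derive1 E) y (expR (E y) - r y).
  apply: hder_eq; first by apply: hder_derive1; exact: (sE 1%N).
  by have := e3 y; rewrite /derive1n /=; lra.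
have mE y : m y = s * r y - j.
  have H : forall x y, m x - s * r x = m y - s * r y.
    apply: hder_cst => x; apply: hder_eq; first by apply: dB; [exact: Dm|apply: dZ; exact: Dr].
    by have := e1 x; lra.
  have hl : m y - s * r y @[y --> -oo] --> rm * um - s * rm.
    by apply: cvgB => //; apply: cvgM => //; exact: cvg_cst.
  have := @cst_lim _ _ (@proper_ninfty_nbhs R) _ _ H hl y.
  by rewrite /j; lra.
have uE : wu W = fun y => s - j * (r y)^-1.
  by apply/funext => y; rewrite /wu -/m -/r mE; field.
pose p y := j * ((r y)^-1) ^+ 2 * derive1 r y.
have Du y : hder (wu W) y (p y).
  rewrite uE; apply: hder_eq.
    by apply: dB; [exact: dcst|apply: dZ; apply: dinv; [exact: rn|exact: Dr]].
  by rewrite /p; ring.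
have [p' Dp] : exists p', forall y, hder p y (p' y).
  eexists => y; apply: dM; last by apply: hder_derive1; exact: (sr 1%N).
  by apply: dZ; apply: dsqr; apply: dinv; [exact: rn|exact: Dr].
have p'E : derive1 (derive1 (wu W)) = p'.
  by rewrite (hder_derive1E _ _ Du) (hder_derive1E _ _ Dp).
have rV (F : set_system R) (FF : ProperFilter F) (l : R) : l != 0 -> r y @[y --> F] --> l -> (r y)^-1 @[y --> F] -->
  l^-1.
  by move=> l0 h; exact: cvgV.
have eE (F : set_system R) (FF : ProperFilter F) (l : R) : 0 < l -> E y @[y --> F] --> ln l -> expR (E y) @[y --> F]
  --> l.
  move=> l0 h.
  have <- : expR (ln l) = l by rewrite lnK// posrE.
  by apply: (cvg_comp _ _ h); exact: continuous_expR.
have E10 (F : set_system R) (FF : ProperFilter F) (l : R) : shift_stable F -> 0 < l ->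
    r y @[y --> F] --> l -> E y @[y --> F] --> ln l -> derive1 E y @[y --> F] --> 0.
  move=> sF l0 hr hE; apply: (lim_deriv_second F sF E _ _ (ln l) DE DE1 hE).
  by rewrite -(subrr l); apply: cvgB => //; exact: eE.
(* The momentum equation in conservative form: by the Poisson equation the electric force is
   [r E' = (expR E - E'^2 / 2)']. *)
pose Phi y := - s * m y + m y ^+ 2 / r y + T * r y - p y + expR (E y) - derive1 E y ^+ 2 / 2.
have Phi_cst : forall x y, Phi x = Phi y.
  apply: hder_cst => x; rewrite /Phi.
  have [q hq] : exists q, hder (fun y => m y ^+ 2 / r y) x q.
    eexists; apply: dM; first by apply: dsqr; exact: Dm.
    by apply: dinv; [exact: rn|exact: Dr].
  apply: hder_eq.
    apply: dB; last by apply: dM; [apply: dsqr; exact: DE1|exact: dcst].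
    apply: dD; last by apply: dexp; exact: DE.
    apply: dB; last exact: Dp.
    apply: dD; last by apply: dZ; exact: Dr.
    by apply: dD; [apply: dZ; exact: Dm|exact: hq].
  have := e2 x; rewrite p'E.
  have -> : derive1 (fun y => m y ^+ 2 / r y) x = q by rewrite derive1E; apply: derive_val.
  move=> h.
  have -> : - s * derive1 m x + q + T * derive1 r x - p' x = - r x * derive1 E x by lra.
  by field.
have q0 (F : set_system R) (FF : ProperFilter F) (l : R) : shift_stable F -> 0 < l ->
    r y @[y --> F] --> l -> E y @[y --> F] --> ln l ->
    p y @[y --> F] --> 0 /\ Phi y @[y --> F] --> j ^+ 2 / l - s * j + T * l + l.
  move=> sF l0 hr hE.
  have ln0 : l != 0 by rewrite gt_eqF.
  have hm : m y @[y --> F] --> s * l - j.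
    rewrite (_ : m = fun y => s * r y - j); last by apply/funext => y; exact: mE.
    by apply: cvgB; [apply: cvgM => //; exact: cvg_cst|exact: cvg_cst].
  have hu : wu W y @[y --> F] --> s - j * l^-1.
    rewrite uE; apply: cvgB; first exact: cvg_cst.
    by apply: cvgM; [exact: cvg_cst|exact: rV].
  have hE1 := E10 F FF l sF l0 hr hE.
  have A : (- s * m y + m y ^+ 2 / r y + T * r y + expR (E y) - derive1 E y ^+ 2 / 2) @[y --> F] -->
     - s * (s * l - j) + (s * l - j) ^+ 2 / l + T * l + l - 0 ^+ 2 / 2.
    apply: cvgB; last first.
      by apply: cvgM; [rewrite expr2; apply: cvgM|exact: cvg_cst].
    apply: cvgD; last exact: eE.
    apply: cvgD; last by apply: cvgM => //; exact: cvg_cst.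
    apply: cvgD; first by apply: cvgM => //; exact: cvg_cst.
    by apply: cvgM; [rewrite expr2; apply: cvgM|exact: rV].
  have hp : p y @[y --> F] --> - s * (s * l - j) + (s * l - j) ^+ 2 / l + T * l + l - 0 ^+ 2 / 2 - Phi 0.
    rewrite (_ : p = fun y => (- s * m y + m y ^+ 2 / r y + T * r y + expR (E y) - derive1 E y ^+ 2 / 2) - Phi 0).
      by apply: cvgB => //; exact: cvg_cst.
    by apply/funext => y; rewrite (Phi_cst 0 y) /Phi; ring.
  (* [p] converges because [Phi] is constant, and it is the derivative of the convergent velocity,
     so its limit is [0]. *)
  have L0 := lim_deriv0 F sF _ _ _ _ Du hu hp.
  rewrite L0 in hp; split => //.
  rewrite (_ : Phi = fun y => (- s * m y + m y ^+ 2 / r y + T * r y + expR (E y) - derive1 E y ^+ 2 / 2) - p y).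
    have -> : j ^+ 2 / l - s * j + T * l + l = - s * (s * l - j) + (s * l - j) ^+ 2 / l + T * l + l - 0 ^+ 2 / 2 - 0
      by field.
    exact: cvgB.
  by apply/funext => y; rewrite /Phi; ring.
have [pN PhiN] := q0 _ (@proper_ninfty_nbhs R) rm near_shift_Ny rm0 rN EN.
have [pP _] := q0 _ (@proper_pinfty_nbhs R) rp near_shift_y rp0 rP EP.
have PhiE := @cst_lim _ _ (@proper_ninfty_nbhs R) _ _ Phi_cst PhiN.
split => //.
- by split => //; lra.
- split => // [y|y]; first by rewrite uE.
  by apply: hder_eq (Dr y) _; rewrite /p; field; rewrite jn rn.
- move=> y; have := PhiE y; rewrite /Phi mE -/(p y) => h.
  have -> : p y = - s * (s * r y - j) + (s * r y - j) ^+ 2 / r y + T * r y + expR (E y) - derive1 E y ^+ 2 / 2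
    - (j ^+ 2 / rm - s * j + T * rm + rm) by rewrite -h; ring.
  have -> : - s * (s * r y - j) + (s * r y - j) ^+ 2 / r y = - s * j + j ^+ 2 / r y by field.
  by rewrite j2; field; rewrite rn gt_eqF.
Qed.

End profile_first_order.

(** * Bounds on the profile in terms of the shock strength *)

Section profile_base.
Context {R : realType}.
Variables (T rho_m B delta : R) (Sh : shock R) (W : wave R).
Hypotheses (T0 : 0 < T) (B4 : 4 <= B) (TB : T + 1 <= B) (TBi : 1 <= B * (T + 1)).
Hypotheses (rmB : rho_m <= B) (rmBi : 1 <= B * rho_m) (Tr : (T + 1) * rho_m <= B) (Tri : 2 <= B * ((T + 1) * rho_m)).
Hypotheses (d0 : 0 < delta) (dB : B ^+ 63 * delta <= 1).
Hypotheses (hS : is_shock T Sh) (hr : rhom Sh = rho_m) (hd : `|rhop Sh - rhom Sh| <= delta).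
Hypothesis hW : is_profile T Sh W.

(** The velocity itself is small thanks to the Galilean normalisation: [um (rp + rm) = s (rm - rp)]
    makes [um] of order [delta], and [wu] differs from [um] by a multiple of [r - rho_m]. *)
Lemma profile_base : exists j : R, let r := wrho W in let E := wE W in let E1 := derive1 E in
  let p := fun y => j * ((r y)^-1) ^+ 2 * derive1 r y in
  [/\ [/\ 0 < j, j <= B, j^-1 <= B & `|speed Sh| <= B + 1],
   [/\ forall y, 0 < r y, forall y, wu W y = speed Sh - j * (r y)^-1,
    forall y, hder r y (r y ^+ 2 / j * p y), forall y, hder E y (E1 y) & forall y, hder E1 y (expR (E y) - r y)],
   forall y, rho_m / 2 <= r y <= 2 * rho_m,
   forall y, `|wu W y| <= (2 * B ^+ 2 + 2 * B ^+ 16) * delta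
   & [/\ forall y, `|E y| <= `|ln (rho_m / 2)| + `|ln (2 * rho_m)| + 4 * B ^+ 15,
     forall y, `|p y| <= 12 * B ^+ 16 * delta, forall y, `|E1 y| <= 13 * B ^+ 16 * delta
     & forall y, `|expR (E y) - r y| <= 16 * B ^+ 16 * delta]].
Proof.
pose proof T0; pose proof B4; pose proof TB; pose proof d0.
have B1 : 1 <= B by lra.
have B0 : 0 < B by lra.
have dle n : (n <= 63)%N -> B ^+ n * delta <= 1.
  move=> n63; apply: le_trans dB; rewrite (ler_wpM2r (ltW d0))//; exact: ler_weXn2l.
have d1 : delta <= 1 by have := dle 0%N isT; rewrite expr0 mul1r.
have [j] := profile_first_order T Sh W T0 hS hW.
cbv zeta; rewrite hr => -[[j0 j2 rr rm0] [s0 su jE um0 ur] [r0 uE Dr DE DE1] pE [[rN rP] [EN EP] [pN pP]]].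
have drp : rho_m - rhop Sh <= delta by move: hd; rewrite hr ler_norml => /andP[]; lra.
have Bd1 : 4 * B * delta <= 1.
  apply: le_trans (dle 2%N isT); rewrite (ler_wpM2r (ltW d0))// expr2.
  by rewrite (ler_wpM2r (ltW B0)).
have drm : 4 * delta <= rho_m.
  rewrite -(ler_pM2l B0); have := rmBi; lra.
have rp2 : rho_m / 2 <= rhop Sh by lra.
have jB : j <= B.
  rewrite -(@ler_pXn2r _ 2)// ?nnegrE ?(ltW j0) ?(ltW B0)// j2 expr2.
  by apply: ler_pM => //; [rewrite mulr_ge0//; lra|lra|have := rmB; lra].
have jBi : 1 <= B * j.
  rewrite -(@ler_pXn2r _ 2)// ?nnegrE//; last by rewrite mulr_ge0 ?ltW.
  rewrite expr1n exprMn j2.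
  have -> : B ^+ 2 * ((T + 1) * rho_m * rhop Sh) = (B * ((T + 1) * rho_m)) * (B * rhop Sh) by ring.
  have h1 : B * (rho_m / 2) <= B * rhop Sh by rewrite ler_pM2l.
  have h2 : 2^-1 <= B * rhop Sh by have := rmBi; lra.
  have h3 : 2 * 2^-1 <= (B * ((T + 1) * rho_m)) * (B * rhop Sh) by exact: ler_pM.
  lra.
(* [sg = delta^(3/2)] is the size of [p] that corresponds to an entropy jump of order [delta^3]. *)
have sgE : Num.sqrt (delta ^+ 3) ^+ 2 = delta ^+ 3 by rewrite sqr_sqrtr// exprn_ge0// ltW.
have sg0 : 0 < Num.sqrt (delta ^+ 3) by rewrite sqrtr_gt0 exprn_gt0.
have sgd : Num.sqrt (delta ^+ 3) <= delta.
  rewrite -(@ler_pXn2r _ 2)// ?nnegrE ?sqrtr_ge0 ?(ltW d0)//.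
  by rewrite sgE exprSr ler_piMr// sqr_ge0.
have HH y := profile_ode_bounds T rho_m (rhop Sh) j B delta (Num.sqrt (delta ^+ 3)) (wrho W) (wE W) (derive1 (wE W))
  (fun y => j * ((wrho W y)^-1) ^+ 2 * derive1 (wrho W) y) B4 T0 TB TBi rmB rmBi j0 jB jBi rp2 rr drp j2 sg0 sgE sgd
  (B ^+ 14) erefl dB r0 Dr DE DE1 pE rN rP EN EP pN pP y.
have Kd : B ^+ 14 * delta <= 1 by exact: dle.
have jBV : j^-1 <= B by rewrite -[leLHS]mul1r ler_pdivrMr.
have umd : um Sh <= 2 * B ^+ 2 * delta.
  have h0 : um Sh * rho_m <= (um Sh + (T + 1)) * delta.
    apply: (@le_trans _ _ (um Sh * (rhop Sh + rho_m))).
      by rewrite ler_pM2l//; lra.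
    by rewrite ur; apply: ler_pM => //; [exact: ltW|lra].
  have h1 : um Sh * (4 * delta) <= um Sh * rho_m by rewrite ler_pM2l.
  have h2 : (T + 1) * delta <= B * delta by rewrite (ler_wpM2r (ltW d0)).
  have h2' : 0 <= B * delta by rewrite mulr_ge0 ?ltW.
  have h3 : um Sh * rho_m <= 2 * B * delta by lra.
  have h4 : um Sh * rho_m * B <= 2 * B * delta * B by rewrite (ler_wpM2r (ltW B0)).
  have h5 : um Sh * 1 <= um Sh * (B * rho_m) by rewrite ler_pM2l.
  lra.
have umd1 : um Sh <= 1.
  apply: le_trans umd _; apply: le_trans (dle 3%N isT).
  rewrite (ler_wpM2r (ltW d0))// (exprS B 2) (ler_wpM2r (exprn_ge0 _ (ltW B0)))//; lra.
exists j; cbv zeta; split => //.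
- split => //; rewrite ger0_norm; lra.
- by move=> y; have [_ h1 h2 _ _] := HH y; apply/andP.
- move=> y; rewrite uE.
  have rn : wrho W y != 0 by rewrite gt_eqF.
  have rmn : rho_m != 0 by rewrite gt_eqF.
  have -> : speed Sh - j * (wrho W y)^-1 = um Sh + (wrho W y - rho_m) * ((speed Sh - um Sh) * (wrho W y)^-1).
    by rewrite jE; field.
  have [h1 h2 _ _ _] := HH y.
  have e1 : `|speed Sh - um Sh| <= B by rewrite ger0_norm; [lra|have := j0; rewrite jE pmulr_rgt0//; lra].
  have e2 : (wrho W y)^-1 <= 2 * B.
    rewrite -[leLHS]mul1r ler_pdivrMr//.
    have : B * (rho_m / 2) <= B * wrho W y by rewrite ler_pM2l.
    have := rmBi; lra.
  apply: le_trans (ler_normD _ _) _; rewrite [leRHS]mulrDl; apply: lerD; first by rewrite ger0_norm// ltW.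
  rewrite normrM (normrM (_ - _) (_^-1)).
  rewrite (gtr0_norm (_ : 0 < (wrho W y)^-1)) ?invr_gt0//.
  have -> : 2 * B ^+ 16 * delta = (B ^+ 14 * delta) * (B * (2 * B)) by ring.
  apply: ler_pM => //; first by rewrite divr_ge0// ltW.
  by apply: ler_pM => //; rewrite invr_ge0 ltW.
- split=> y; have [h1 h2 h3 h4 [h5 h6 h7]] := HH y.
  + have l1 : ln (rho_m / 2) <= ln (wrho W y) by rewrite ler_ln// ?posrE// divr_gt0.
    have l2 : ln (wrho W y) <= ln (2 * rho_m) by rewrite ler_ln// ?posrE// mulr_gt0.
    have l3 : 4 * B * (B ^+ 14 * delta) <= 4 * B ^+ 15.
      have -> : 4 * B * (B ^+ 14 * delta) = 4 * B ^+ 15 * delta by ring.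
      by rewrite ler_piMr// mulr_ge0// exprn_ge0// ltW.
    have n1 := ler_norm (ln (2 * rho_m)).
    have n2 := ler_norm (- ln (rho_m / 2)); rewrite normrN in n2.
    have n3 := normr_ge0 (ln (2 * rho_m)); have n4 := normr_ge0 (ln (rho_m / 2)).
    move: h4; rewrite !ler_norml => /andP[k1 k2]; apply/andP; split; lra.
  + by apply: le_trans h5 _; rewrite le_eqVlt; apply/orP; left; apply/eqP; ring.
  + by apply: le_trans h6 _; rewrite le_eqVlt; apply/orP; left; apply/eqP; ring.
  + by apply: le_trans h7 _; rewrite le_eqVlt; apply/orP; left; apply/eqP; ring.
Qed.

End profile_base.

(** Uniform bounds, over an admissible family of profiles, on all derivatives up to order [n]:
    by a constant, or by a constant times the shock strength [dl] when [b] holds. *)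
Section uniform_class.
Context {R : realType} {I : Type}.
Variables (adm : I -> Prop) (dl : I -> R).
Hypothesis dl01 : forall i, adm i -> 0 < dl i <= 1.

Definition weight (b : bool) (i : I) : R := if b then dl i else 1.

Fixpoint unif (b : bool) (n : nat) (g : I -> R -> R) : Prop :=
  (exists C : R, forall i, adm i -> forall y, `|g i y| <= C * weight b i) /\
  match n with
  | 0%N => True
  | n.+1 => exists g' : I -> R -> R, (forall i, adm i -> forall y, hder (g i) y (g' i y)) /\ unif b n g'
  end.

Lemma unif_le b m n g : (m <= n)%N -> unif b n g -> unif b m g.
Proof.
elim: n m g => [|n IH] [|m] g // mn; first by case.
by move=> [h [g' [hg hn]]]; split => //; exists g'; split => //; exact: IH.
Qed.

Lemma weight_ge0 b i : adm i -> 0 <= weight b i.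
Proof. by move=> /dl01 /andP[h _]; case: b => //=; exact: ltW. Qed.

Lemma weight_le1 b i : adm i -> weight b i <= 1.
Proof. by move=> /dl01 /andP[_ h]; case: b. Qed.

Lemma unif_weak b n g : unif b n g -> unif false n g.
Proof.
elim: n g => [|n IH] g [[C hC] H]; (split; [exists `|C| => i ai y; apply: le_trans (hC i ai y) _|]) => //.
- rewrite mulr1; apply: le_trans (ler_norm _) _; rewrite normrM ler_piMr//.
  by rewrite ger0_norm ?weight_ge0 ?weight_le1.
- rewrite mulr1; apply: le_trans (ler_norm _) _; rewrite normrM ler_piMr//.
  by rewrite ger0_norm ?weight_ge0 ?weight_le1.
- by case: H => g' [h1 h2]; exists g'; split => //; exact: IH.
Qed.

Lemma unifD b n f g : unif b n f -> unif b n g -> unif b n (fun i y => f i y + g i y).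
Proof.
elim: n f g => [|n IH] f g [[C hC] Hf] [[D hD] Hg]; (split; [exists (C + D) => i ai y|]) => //.
- by rewrite mulrDl; apply: le_trans (ler_normD _ _) _; apply: lerD; [exact: hC|exact: hD].
- by rewrite mulrDl; apply: le_trans (ler_normD _ _) _; apply: lerD; [exact: hC|exact: hD].
- case: Hf => f' [h1 h2]; case: Hg => g' [h3 h4].
  exists (fun i y => f' i y + g' i y); split; last exact: IH.
  by move=> i ai y; apply: dD; [exact: h1|exact: h3].
Qed.

Lemma unifM b n f g : unif false n f -> unif b n g -> unif b n (fun i y => f i y * g i y).
Proof.
elim: n f g => [|n IH] f g Hf Hg.
  move: Hf Hg => [[C hC] _] [[D hD] _]; split => //; exists (C * D) => i ai y.
  rewrite normrM -mulrA; apply: ler_pM => //; last exact: hD.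
  by have := hC i ai y; rewrite mulr1.
have lf := unif_le _ _ _ _ (leqnSn n) Hf; have lg := unif_le _ _ _ _ (leqnSn n) Hg.
move: Hf Hg => [[C hC] [f' [h1 h2]]] [[D hD] [g' [h3 h4]]]; split.
  exists (C * D) => i ai y.
  rewrite normrM -mulrA; apply: ler_pM => //; last exact: hD.
  by have := hC i ai y; rewrite mulr1.
exists (fun i y => f' i y * g i y + f i y * g' i y); split.
  by move=> i ai y; apply: dM; [exact: h1|exact: h3].
by apply: unifD; exact: IH.
Qed.

Lemma unif_cst n (c : I -> R) : (exists C, forall i, adm i -> `|c i| <= C) -> unif false n (fun i _ => c i).
Proof.
move=> [C hC]; elim: n c hC => [|n IH] c hC; (split; [exists C => i ai y; rewrite mulr1; exact: hC|]) => //.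
exists (fun _ _ => 0); split => [i ai y|]; first exact: dcst.
elim: n {IH} => [|n IH]; (split; [by exists 0 => i ai y; rewrite normr0 mul0r|]) => //.
by exists (fun _ _ => 0); split => // i ai y; exact: dcst.
Qed.

Lemma unifZ b n (c : R) f : unif b n f -> unif b n (fun i y => c * f i y).
Proof. by move=> h; apply: (unifM b n (fun _ _ => c)) => //; apply: unif_cst; exists `|c|. Qed.

Lemma unifB b n f g : unif b n f -> unif b n g -> unif b n (fun i y => f i y - g i y).
Proof.
move=> hf hg; rewrite (_ : (fun i y => _) = fun i y => f i y + (-1) * g i y).
  by apply: unifD => //; exact: unifZ.
by apply/funext => i; apply/funext => y; ring.
Qed.

Lemma unif_S b n f f' : (exists C : R, forall i, adm i -> forall y, `|f i y| <= C * weight b i) ->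
  (forall i, adm i -> forall y, hder (f i) y (f' i y)) -> unif b n f' -> unif b n.+1 f.
Proof. by move=> h1 h2 h3; split => //; exists f'. Qed.

Lemma unif_derive1n b n f : unif b n f -> exists C : R, 0 <= C /\ forall i, adm i ->
  forall k y, (k <= n)%N -> `|derive1n k (f i) y| <= C * weight b i.
Proof.
elim: n f => [|n IH] f [[C hC] H].
  exists `|C|; split => // i ai [|k] y // _; apply: le_trans (hC i ai y) _.
  by rewrite ler_wpM2r ?weight_ge0// ler_norm.
case: H => f' [h1 /IH [D [D0 hD]]].
exists (`|C| + D); split; first exact: addr_ge0.
move=> i ai [|k] y kn.
  apply: le_trans (hC i ai y) _.
  rewrite ler_wpM2r ?weight_ge0//; apply: le_trans (ler_norm _) _; lra.
rewrite derive1Sn (hder_derive1E _ _ (h1 i ai)).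
apply: le_trans (hD i ai k y kn) _.
rewrite ler_wpM2r ?weight_ge0//; have := normr_ge0 C; lra.
Qed.

End uniform_class.

(** Bounds of order zero propagate to every order because [p], [E1], [E2], [r], [1/r] and [expR E]
    are closed under differentiation: each derivative is a polynomial in the family, with
    coefficients built from [T], [j] and [1/j]. The derivatives of [p], [E1] and [E2] keep an
    [O(delta)] factor in every term. *)
Lemma profile_bounds {R : realType} (T rho_m : R) : 0 < T -> 0 < rho_m -> exists C d0 : R, [/\ 0 < C, 0 < d0, d0 <= 1
  &
  forall (delta : R) (Sh : shock R) (W : wave R), 0 < delta <= d0 -> is_shock T Sh -> rhom Sh = rho_m ->
  `|rhop Sh - rhom Sh| <= delta -> is_profile T Sh W ->
  [/\ `|speed Sh| <= C, forall y, rho_m / 2 <= wrho W y <= 2 * rho_m,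
   forall k y, (k <= 4)%N -> `|derive1n k (derive1 (wrho W)) y| <= C * delta,
   forall k y, (k <= 5)%N -> `|derive1n k (wu W) y| <= C * delta
   & (forall y, `|wE W y| <= C) /\ forall k y, (k <= 4)%N -> `|derive1n k (derive1 (wE W)) y| <= C * delta]].
Proof.
move=> T0 rm0.
(* [B] bounds the data and their inverses. The factor [2] in the last term pays for
   [rhop >= rho_m / 2] in the lower bound on [j]. *)
pose B : R := 4 + (T + 1) + (T + 1)^-1 + rho_m + rho_m^-1 + (T + 1) * rho_m + 2 * ((T + 1) * rho_m)^-1.
have T1 : 0 < T + 1 by rewrite addr_gt0.
have a1 : 0 < (T + 1)^-1 by rewrite invr_gt0.
have a2 : 0 < rho_m^-1 by rewrite invr_gt0.
have a3 : 0 < (T + 1) * rho_m by rewrite mulr_gt0.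
have a4 : 0 < ((T + 1) * rho_m)^-1 by rewrite invr_gt0.
have B4 : 4 <= B by rewrite /B; lra.
have B0 : 0 < B by lra.
have b1 : T + 1 <= B by rewrite /B; lra.
have b2 : (T + 1)^-1 <= B by rewrite /B; lra.
have b3 : rho_m <= B by rewrite /B; lra.
have b4 : rho_m^-1 <= B by rewrite /B; lra.
have b5 : (T + 1) * rho_m <= B by rewrite /B; lra.
have b6 : 2 * ((T + 1) * rho_m)^-1 <= B by rewrite /B; lra.
clearbody B.
have c2 : 1 <= B * (T + 1) by rewrite -ler_pdivrMr// mul1r.
have c4 : 1 <= B * rho_m by rewrite -ler_pdivrMr// mul1r.
have c6 : 2 <= B * ((T + 1) * rho_m) by rewrite -ler_pdivrMr.
have Bk : 1 <= B ^+ 63 by rewrite exprn_ege1//; lra.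
pose adm (i : R * (shock R * wave R)) := [/\ 0 < i.1 <= (B ^+ 63)^-1, is_shock T i.2.1, rhom i.2.1 = rho_m,
  `|rhop i.2.1 - rhom i.2.1| <= i.1 & is_profile T i.2.1 i.2.2].
have base i (ai : adm i) : B ^+ 63 * i.1 <= 1.
  by case: ai => /andP[_ h] _ _ _ _; rewrite mulrC -ler_pdivlMr ?div1r//; lra.
have dl01 i : adm i -> 0 < i.1 <= 1.
  move=> ai; have h := base i ai; case: ai => /andP[h1 _] _ _ _ _; rewrite h1 /=.
  by apply: le_trans h; rewrite ler_peMl// ltW.
pose PJ (i : R * (shock R * wave R)) (j : R) :=
  let r := wrho i.2.2 in let E := wE i.2.2 in let E1 := derive1 E in
  let p := fun y => j * ((r y)^-1) ^+ 2 * derive1 r y in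
  [/\ [/\ 0 < j, j <= B, j^-1 <= B & `|speed i.2.1| <= B + 1],
   [/\ forall y, 0 < r y, forall y, wu i.2.2 y = speed i.2.1 - j * (r y)^-1,
    forall y, hder r y (r y ^+ 2 / j * p y), forall y, hder E y (E1 y) & forall y, hder E1 y (expR (E y) - r y)],
   forall y, rho_m / 2 <= r y <= 2 * rho_m,
   forall y, `|wu i.2.2 y| <= (2 * B ^+ 2 + 2 * B ^+ 16) * i.1
   & [/\ forall y, `|E y| <= `|ln (rho_m / 2)| + `|ln (2 * rho_m)| + 4 * B ^+ 15,
     forall y, `|p y| <= 12 * B ^+ 16 * i.1, forall y, `|E1 y| <= 13 * B ^+ 16 * i.1
     & forall y, `|expR (E y) - r y| <= 16 * B ^+ 16 * i.1]].
have [jf hj] : {jf : R * (shock R * wave R) -> R & forall i, adm i -> PJ i (jf i)}.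
  apply: (@choice _ _ (fun i j => adm i -> PJ i j)) => i.
  have [ai|nai] := pselect (adm i); last by exists 0.
  have h0 := base i ai; case: ai => /andP[h1 _] h2 h3 h4 h5.
  have [j H] := profile_base T rho_m B i.1 i.2.1 i.2.2 T0 B4 b1 c2 b3 c4 b5 c6 h1 h0 h2 h3 h4 h5.
  by exists j.
pose r (i : R * (shock R * wave R)) := wrho i.2.2.
pose E (i : R * (shock R * wave R)) := wE i.2.2.
pose E1 (i : R * (shock R * wave R)) := derive1 (wE i.2.2).
pose E2 (i : R * (shock R * wave R)) y := expR (E i y) - r i y.
pose p (i : R * (shock R * wave R)) y := jf i * ((r i y)^-1) ^+ 2 * derive1 (r i) y.
pose rV (i : R * (shock R * wave R)) y := (r i y)^-1.
pose eE (i : R * (shock R * wave R)) y := expR (E i y).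
pose r1 (i : R * (shock R * wave R)) y := (jf i)^-1 * (r i y * (r i y * p i y)).
pose U := unif adm (fun i => i.1).
have Dr i : adm i -> forall y, hder (r i) y (r1 i y).
  move=> /hj[_ [_ _ h _ _] _ _ _] y; apply: hder_eq (h y) _; rewrite /r1 /p /r; ring.
have r0 i : adm i -> forall y, 0 < r i y by move=> /hj[_ []].
have DrV i : adm i -> forall y, hder (rV i) y ((-1) * (rV i y * (rV i y * r1 i y))).
  move=> ai y; apply: hder_eq; first by apply: dinv; [rewrite gt_eqF// r0|exact: Dr].
  by rewrite /rV; ring.
have DE i : adm i -> forall y, hder (E i) y (E1 i y) by move=> /hj[_ []].
have DE1 i : adm i -> forall y, hder (E1 i) y (E2 i y) by move=> /hj[_ []].
have DeE i : adm i -> forall y, hder (eE i) y (eE i y * E1 i y).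
  by move=> ai y; apply: dexp; exact: DE.
have DE2 i : adm i -> forall y, hder (E2 i) y (eE i y * E1 i y - r1 i y).
  by move=> ai y; apply: dB; [exact: DeE|exact: Dr].
pose p1 (i : R * (shock R * wave R)) y := (T - jf i * (jf i * (rV i y * rV i y))) * r1 i y + r i y * E1 i y.
have Du i : adm i -> forall y, hder (wu i.2.2) y (p i y).
  move=> ai y; have [_ [_ uE _ _ _] _ _ _] := hj i ai.
  rewrite (_ : wu i.2.2 = fun y => speed i.2.1 - jf i * rV i y); last by apply/funext => z; exact: uE.
  apply: hder_eq; first by apply: dB; [exact: dcst|apply: dZ; exact: DrV].
  have j0 : jf i != 0 by have [[j0 _ _ _] _ _ _ _] := hj i ai; rewrite gt_eqF.
  have rn : r i y != 0 by rewrite gt_eqF// r0.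
  by rewrite /r1 /p /rV; field; rewrite j0 rn.
have Dp i : adm i -> forall y, hder (p i) y (p1 i y).
  move=> ai y; have [[j0 _ _ _] _ _ _ _] := hj i ai; case: (ai) => _ hSh _ _ hWW.
  have [j'] := profile_first_order T i.2.1 i.2.2 T0 hSh hWW.
  cbv zeta => -[[j'0 j'2 _ _] _ [_ uE' _ _ _] pE' _].
  have [_ [_ uE _ _ _] _ _ _] := hj i ai.
  have rn z : r i z != 0 by rewrite gt_eqF// r0.
  (* The flux is determined by the profile, since both values represent the same velocity. *)
  have jj : j' = jf i.
    have := uE' 0; rewrite uE => h.
    have : jf i * (wrho i.2.2 0)^-1 = j' * (wrho i.2.2 0)^-1 by lra.
    by move/(mulIf _) => -> //; rewrite invr_eq0; exact: rn.
  have pE : p i = fun z => (T + 1) * r i z - (T + 1) * (rhom i.2.1 + rhop i.2.1) + jf i ^+ 2 * rV i z + (eE i z - r i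
    z) - 2^-1 * E1 i z ^+ 2.
    apply/funext => z; have := pE' z; rewrite jj -/(p i z) => ->.
    by rewrite -jj j'2 /rV /eE /E /E1 /r; field; exact: rn.
  rewrite pE; apply: hder_eq.
    apply: dB; last by apply: dZ; apply: dsqr; exact: DE1.
    apply: dD; last by apply: dB; [exact: DeE|exact: Dr].
    apply: dD; last by apply: dZ; exact: DrV.
    by apply: dB; [apply: dZ; exact: Dr|exact: dcst].
  by rewrite /p1 /E2 /eE; field.
have bj n : U false n (fun i _ => jf i).
  by apply: unif_cst; exists B => i ai; have [[j0 jB _ _] _ _ _ _] := hj i ai; rewrite gtr0_norm.
have bjV n : U false n (fun i _ => (jf i)^-1).
  by apply: unif_cst; exists B => i ai; have [[j0 _ jB _] _ _ _ _] := hj i ai; rewrite gtr0_norm ?invr_gt0.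
have Br : exists C : R, forall i, adm i -> forall y, `|r i y| <= C * weight (fun i => i.1) false i.
  exists (2 * rho_m) => i ai y; have [_ _ h _ _] := hj i ai; rewrite mulr1 gtr0_norm ?r0//.
  by have /andP[] := h y.
have BrV : exists C : R, forall i, adm i -> forall y, `|rV i y| <= C * weight (fun i => i.1) false i.
  exists (2 * rho_m^-1) => i ai y; have [_ _ h _ _] := hj i ai; rewrite mulr1 gtr0_norm ?invr_gt0 ?r0//.
  have -> : 2 * rho_m^-1 = (rho_m / 2)^-1 by rewrite invf_div.
  have /andP[h1 _] := h y.
  by rewrite lef_pV2// ?posrE ?r0// divr_gt0.
have BE : exists C : R, forall i, adm i -> forall y, `|E i y| <= C * weight (fun i => i.1) false i.
  eexists => i ai y; have [_ _ _ _ [h _ _ _]] := hj i ai; rewrite mulr1; exact: h.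
have BeE : exists C : R, forall i, adm i -> forall y, `|eE i y| <= C * weight (fun i => i.1) false i.
  have [C hC] := BE; exists (expR C) => i ai y; rewrite mulr1 gtr0_norm ?expR_gt0// ler_expR.
  by apply: le_trans (ler_norm _) _; have := hC i ai y; rewrite mulr1.
have Bp : exists C : R, forall i, adm i -> forall y, `|p i y| <= C * weight (fun i => i.1) true i.
  by eexists => i ai y; have [_ _ _ _ [_ h _ _]] := hj i ai; exact: h.
have BE1 : exists C : R, forall i, adm i -> forall y, `|E1 i y| <= C * weight (fun i => i.1) true i.
  by eexists => i ai y; have [_ _ _ _ [_ _ h _]] := hj i ai; exact: h.
have BE2 : exists C : R, forall i, adm i -> forall y, `|E2 i y| <= C * weight (fun i => i.1) true i.
  by eexists => i ai y; have [_ _ _ _ [_ _ _ h]] := hj i ai; exact: h.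
have Bu : exists C : R, forall i, adm i -> forall y, `|wu i.2.2 y| <= C * weight (fun i => i.1) true i.
  by eexists => i ai y; have [_ _ _ h _] := hj i ai; exact: h.
have mr1 n : U false n r -> U true n p -> U true n r1.
  by move=> hr hp; rewrite /U /r1; apply: unifM; [exact: bjV|apply: unifM; [exact: hr|apply: unifM; [exact: hr|exact:
    hp]]].
(* The six bounds gain an order together, each derivative involving only members of the list at the
   previous order. *)
have main n : [/\ U true n p, U true n E1, U true n E2, U false n r & U false n rV /\ U false n eE].
  elim: n => [|n [hp hE1 hE2 hr [hrV heE]]]; first by split => //; split.
  have hr1 := mr1 n hr hp.
  have hr1' : U false n r1 by apply: unif_weak hr1.
  have hE1' : U false n E1 by apply: unif_weak hE1.
  split.
  - apply: unif_S Bp Dp _; apply: unifD; last exact: unifM.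
    apply: unifM => //; apply: unifB; first by apply: unif_cst; exists `|T|.
    by apply: unifM; [exact: bj|apply: unifM; [exact: bj|exact: unifM]].
  - exact: unif_S BE1 DE1 _.
  - by apply: unif_S BE2 DE2 _; apply: unifB => //; exact: unifM.
  - exact: unif_S Br Dr _.
  - split; first by apply: unif_S BrV DrV _; apply: unifZ => //; apply: unifM => //; exact: unifM.
    by apply: unif_S BeE DeE _; exact: unifM.
have [hp3 hE13 _ hr3 _] := main 4%N.
have hr13 := mr1 4%N hr3 hp3.
have hu4 : U true 5%N (fun i => wu i.2.2) by exact: unif_S Bu Du _.
have [C1 [C10 H1]] := unif_derive1n _ _ dl01 _ _ _ hr13.
have [C2 [C20 H2]] := unif_derive1n _ _ dl01 _ _ _ hu4.
have [C3 [C30 H3]] := unif_derive1n _ _ dl01 _ _ _ hE13.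
have [C4 H4] := BE.
have n4 := normr_ge0 C4.
have [e0 e1 e2 e3 [e4 e5]] : let S := B + 1 + C1 + C2 + C3 + `|C4| in
    [/\ 0 < S, B + 1 <= S, C1 <= S, C2 <= S & C3 <= S /\ C4 <= S].
  have := ler_norm C4; clear -B4 C10 C20 C30 n4; move=> /= h; split; [lra..|split; lra].
exists (B + 1 + C1 + C2 + C3 + `|C4|), (B ^+ 63)^-1; split => //; [by rewrite invr_gt0; lra|by rewrite invf_le1//;
  lra|].
move=> delta Sh W hdl hS hr hd hW.
have ai : adm (delta, (Sh, W)) by [].
have [[_ _ _ h1] _ h2 _ _] := hj _ ai.
have dl0 : 0 <= delta by move/andP: hdl => [/ltW].
split => //.
- exact: le_trans h1 e1.
- move=> k y k4; have := H1 _ ai k y k4; rewrite -(hder_derive1E _ _ (Dr _ ai)) => /le_trans; apply.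
  exact: ler_wpM2r e2.
- move=> k y k4; apply: le_trans (H2 _ ai k y k4) _.
  exact: ler_wpM2r e3.
- split => [y|k y k4].
    by apply: le_trans (H4 _ ai y) _; rewrite mulr1.
  by apply: le_trans (H3 _ ai k y k4) _; exact: ler_wpM2r e4.
Qed.

(** * Bump functions *)

(** Finite smoothness as a chain of explicit derivatives, so that closure rules exhibit a derivative
    instead of computing iterated ones. *)
Fixpoint sm {R : realType} (n : nat) (f : R -> R) : Prop :=
  match n with
  | 0%N => continuous f
  | n.+1 => exists f' : R -> R, (forall y, hder f y (f' y)) /\ sm n f'
  end.

Definition smooth {R : realType} (f : R -> R) : Prop := forall n, sm n f.

Lemma sm_le {R : realType} m n (f : R -> R) : (m <= n)%N -> sm n f -> sm m f.
Proof.
elim: n m f => [|n IH] [|m] f //= mn [f' [h1 h2]].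
  by move=> x; exact: hder_continuous (h1 x).
by exists f'; split => //; exact: IH.
Qed.

Lemma smD {R : realType} n (f g : R -> R) : sm n f -> sm n g -> sm n (fun y => f y + g y).
Proof.
elim: n f g => [|n IH] f g /=.
  by move=> cf cg x; apply: cvgD; [exact: cf|exact: cg].
move=> [f' [h1 h2]] [g' [h3 h4]]; exists (fun y => f' y + g' y); split; last exact: IH.
by move=> y; apply: dD.
Qed.

Lemma smM {R : realType} n (f g : R -> R) : sm n f -> sm n g -> sm n (fun y => f y * g y).
Proof.
elim: n f g => [|n IH] f g.
  by move=> cf cg x; apply: cvgM; [exact: cf|exact: cg].
move=> Hf Hg; have lf := sm_le _ _ _ (leqnSn n) Hf; have lg := sm_le _ _ _ (leqnSn n) Hg.
move: Hf Hg => [f' [h1 h2]] [g' [h3 h4]]; exists (fun y => f' y * g y + f y * g' y); split.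
  by move=> y; apply: dM.
by apply: smD; exact: IH.
Qed.

Lemma sm_cst {R : realType} n (c : R) : sm n (fun=> c).
Proof.
elim: n c => [|n IH] c; first by move=> x; exact: cvg_cst.
by exists (fun=> 0); split => // y; exact: dcst.
Qed.

Lemma smZ {R : realType} n (c : R) (f : R -> R) : sm n f -> sm n (fun y => c * f y).
Proof. by move=> h; apply: smM => //; exact: sm_cst. Qed.

Lemma sm_id {R : realType} n : sm n (fun y : R => y).
Proof.
case: n => [|n]; first by move=> x; exact: cvg_id.
by exists (fun=> 1); split; [move=> y; exact: did|exact: sm_cst].
Qed.

Lemma sm_cos_sin {R : realType} n (c : R) : sm n (fun y => cos (c * y)) /\ sm n (fun y => sin (c * y)).
Proof.
have dc (y : R) : hder (fun y => cos (c * y)) y (- c * sin (c * y)).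
  have h : hder (fun y => c * y) y (c * 1) by apply: dZ; exact: did.
  by apply: hder_eq (dcomp _ _ _ _ _ (is_derive_cos _) h) _; ring.
have ds (y : R) : hder (fun y => sin (c * y)) y (c * cos (c * y)).
  have h : hder (fun y => c * y) y (c * 1) by apply: dZ; exact: did.
  by apply: hder_eq (dcomp _ _ _ _ _ (is_derive_sin _) h) _; ring.
elim: n => [|n [IH1 IH2]].
  by split=> y; [exact: hder_continuous (dc y)|exact: hder_continuous (ds y)].
split; first by exists (fun y => - c * sin (c * y)); split => //; exact: smZ.
by exists (fun y => c * cos (c * y)); split => //; exact: smZ.
Qed.

Lemma sm_shift {R : realType} n (f : R -> R) (c : R) : sm n f -> sm n (fun y => f (y + c)).
Proof.
elim: n f => [|n IH] f /=.
  move=> cf y; apply: (continuous_comp (f := fun y => y + c)); last exact: cf.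
  by apply: cvgD; [exact: cvg_id|exact: cvg_cst].
move=> [f' [h1 h2]]; exists (fun y => f' (y + c)); split; last exact: IH.
move=> y; have h : hder (fun y => y + c) y (1 + 0) by apply: dD; [exact: did|exact: dcst].
by apply: hder_eq (dcomp _ _ _ _ _ (h1 _) h) _; ring.
Qed.

(** The difference quotient is squeezed by a multiple of [|h|]. This treats [flat] at the origin,
    where the two formulas meet. *)
Lemma hder_quad {R : realType} (f : R -> R) (x C : R) :
  (forall h, `|f (h + x) - f x| <= C * h ^+ 2) -> hder f x 0.
Proof.
move=> H.
have key : (fun h : R => h^-1 *: ((f \o shift x) (h *: (1 : R)) - f x)) @ 0^' --> (0 : R).
  apply: (@squeeze_cvgr _ _ _ _ (fun h : R => - (`|C| * `|h|)) (fun h : R => `|C| * `|h|)).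
  - near=> h; rewrite -ler_norml.
    have h0 : h != 0 by near: h; exact: nbhs_dnbhs_neq.
    have -> : h^-1 *: ((f \o shift x) (h *: (1 : R)) - f x) = h^-1 * (f (h + x) - f x).
      by rewrite /= [h *: 1]mulr1.
    rewrite normrM normfV ler_pdivrMl ?normr_gt0//.
    apply: le_trans (H h) _.
    have -> : `|h| * (`|C| * `|h|) = `|C| * (h ^+ 2) by rewrite mulrCA -expr2 real_normK// num_real.
    by rewrite ler_wpM2r ?sqr_ge0// ler_norm.
  - have A : (fun h : R => - (`|C| * `|h|)) @ 0 --> - (`|C| * `|0 : R|).
      by apply: cvgN; apply: cvgM; [exact: cvg_cst|exact: norm_continuous].
    by rewrite normr0 mulr0 oppr0 in A; exact: cvg_trans (cvg_app _ (@nbhs_dnbhs _ (0 : R))) A.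
  - have A : (fun h : R => `|C| * `|h|) @ 0 --> `|C| * `|0 : R|.
      by apply: cvgM; [exact: cvg_cst|exact: norm_continuous].
    by rewrite normr0 mulr0 in A; exact: cvg_trans (cvg_app _ (@nbhs_dnbhs _ (0 : R))) A.
apply: DeriveDef; first by apply/cvg_ex; exists 0.
exact: cvg_lim key.
Unshelve. all: by end_near. Qed.

(** [x^-k exp(-1/x)] extended by [0] to [x <= 0]: this family is closed under differentiation up to
    linear combinations. *)
Definition flat {R : realType} (k : nat) (x : R) : R := if 0 < x then x^-1 ^+ k * expR (- x^-1) else 0.

Lemma flat_ge0 {R : realType} k (x : R) : 0 <= flat k x.
Proof.
rewrite /flat; case: ifP => // x0; rewrite mulr_ge0 ?expR_ge0// exprn_ge0//.
by rewrite invr_ge0 ltW.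
Qed.

(** From [expR y >= y^(k+2) / (k+2)!] at [y = 1/x]. *)
Lemma flat_le {R : realType} k (x : R) : flat k x <= (k.+2)`!%:R * x ^+ 2.
Proof.
rewrite /flat; case: ifP => [x0|_]; last by rewrite mulr_ge0 ?sqr_ge0.
have y0 : 0 < x^-1 by rewrite invr_gt0.
have h := expR_ge1Dxn (k.+1) (ltW y0).
have F0 : 0 < (k.+2)`!%:R :> R by rewrite ltr0n fact_gt0.
have h2 : x^-1 ^+ k.+2 <= (k.+2)`!%:R * expR x^-1.
  by rewrite -ler_pdivrMl// mulrC; lra.
rewrite expRN ler_pdivrMr ?expR_gt0//.
have -> : x^-1 ^+ k = x ^+ 2 * x^-1 ^+ k.+2.
  by rewrite (exprD _ 2 k) mulrA -exprMn mulfV ?gt_eqF// expr1n mul1r.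
by rewrite [leRHS]mulrAC [leRHS]mulrC ler_pM2l// exprn_gt0.
Qed.

Lemma dpow {R : realType} (f : R -> R) (x a : R) k : hder f x a ->
  hder (fun y => f y ^+ k) x (k%:R * f x ^+ k.-1 * a).
Proof.
move=> hf; elim: k => [|k IH]; first by apply: hder_eq (dcst 1 x) _; rewrite mul0r mul0r.
rewrite (_ : (fun y => f y ^+ k.+1) = fun y => f y * f y ^+ k); last by apply/funext => y; rewrite exprS.
apply: hder_eq (dM _ _ _ _ _ hf IH) _.
case: k {IH} => [|k] /=; first by rewrite !expr0; ring.
by rewrite -[k.+2]addn1 natrD !exprS; ring.
Qed.

Lemma dflat {R : realType} k (x : R) : hder (flat k) x (flat k.+2 x - k%:R * flat k.+1 x).
Proof.
have [x0|x0|->] := ltgtP x 0.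
- have -> : flat k.+2 x - k%:R * flat k.+1 x = 0 by rewrite /flat ltNge (ltW x0) /= mulr0 subrr.
  apply: (near_eq_is_derive _ (is_derive_cst (0 : R) x 1)).
  near=> y; rewrite /flat ltNge (_ : y <= 0)//.
  by apply: ltW; near: y; exact: lt_nbhsl.
- apply: (@near_eq_is_derive R R R (fun z : R => z^-1 ^+ k * expR (- z^-1))).
    near=> y; rewrite /flat (_ : 0 < y)//.
    by near: y; exact: lt_nbhsr.
  have hv : hder (fun z : R => z^-1) x (- (1 * ((x)^-1) ^+ 2)).
    by apply: dinv; [rewrite gt_eqF|exact: did].
  apply: hder_eq.
    apply: dM; first by apply: dpow; exact: hv.
    by apply: dexp; exact: is_deriveN hv.
  rewrite /flat x0 /=.
  by case: k => [|k] /=; rewrite ?expr0 !exprS ?expr0; ring.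
- have -> : flat k.+2 0 - k%:R * flat k.+1 0 = 0 :> R by rewrite /flat ltxx mulr0 subrr.
  apply: (hder_quad _ _ ((k.+2)`!%:R)) => h.
  rewrite addr0 {2}/flat ltxx subr0 ger0_norm ?flat_ge0//.
  exact: flat_le.
Unshelve. all: by end_near. Qed.

Lemma sm_flat {R : realType} n k (q q' : R -> R) : (forall y, hder q y (q' y)) -> smooth q' ->
  sm n (fun y => flat k (q y)).
Proof.
move=> hq sq'.
have D j (y : R) : hder (fun y => flat j (q y)) y ((flat j.+2 (q y) + (- j%:R) * flat j.+1 (q y)) * q' y).
  by apply: hder_eq (dcomp _ _ _ _ _ (dflat j (q y)) (hq y)) _; rewrite mulNr.
elim: n k => [|n IH] k; first by move=> y; exact: hder_continuous (D k y).
eexists; split; first exact: D.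
by apply: smM => //; apply: smD => //; exact: smZ.
Qed.

(** An integral from [-(N+1)] is a primitive only to the right of its base point. Normalised to
    vanish at [0], these primitives agree on common domains and can be glued. *)
Lemma primitive {R : realType} (f : R -> R) : continuous f -> exists F : R -> R, forall y, hder F y (f y).
Proof.
move=> cf.
have loc (N : nat) : exists F : R -> R, F 0 = 0 /\ forall y, - N.+1%:R < y -> hder F y (f y).
  pose F x := (\int[lebesgue_measure]_(t in `[- N.+1%:R, x]) f t)%R.
  exists (fun x => F x - F 0); split; first by rewrite subrr.
  move=> y Ny.
  have yy : y < y + 1 by rewrite ltrDl.
  have [dF EF] := @continuous_FTC1_closed R f (- N.+1%:R) y (y + 1) yy
    (continuous_itv_integrable f _ _ cf) Ny (cf y).
  have h : hder F y (f y) by rewrite -EF; exact: hder_derive1.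
  by apply: hder_eq (dB _ _ _ _ _ h (dcst _ _)) _; rewrite subr0.
have [G HG] := choice loc.
have GG M N y : (M <= N)%N -> - M.+1%:R < y -> G M y = G N y.
  move=> MN My.
  have [GM0 dGM] := HG M; have [GN0 dGN] := HG N.
  have MNr : - N.+1%:R <= - M.+1%:R :> R by rewrite lerN2 ler_nat.
  have dD (z : R) : - M.+1%:R < z -> hder (fun x => G M x - G N x) z 0.
    move=> Mz; apply: hder_eq (dB _ _ _ _ _ (dGM z Mz) (dGN z (le_lt_trans MNr Mz))) _.
    exact: subrr.
  have M0 : - M.+1%:R < 0 :> R by rewrite oppr_lt0.
  have [y0|y0|->] := ltgtP y 0; last by rewrite GM0 GN0.
  - have [|c [_]] := MVT_seg (fun x => G M x - G N x) (fun=> 0) y 0 y0.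
      by move=> z /andP[z1 _]; apply: dD; exact: lt_le_trans z1.
    by rewrite mul0r GM0 GN0; lra.
  - have [|c [_]] := MVT_seg (fun x => G M x - G N x) (fun=> 0) 0 y y0.
      by move=> z /andP[z1 _]; apply: dD; exact: lt_le_trans z1.
    by rewrite mul0r GM0 GN0; lra.
exists (fun y => G (Num.truncn `|y|) y) => y.
(* The index at nearby points may exceed that of [y] by one, so the comparison is made with the next
   primitive. *)
have [_ dG] := HG (Num.truncn `|y|).+1.
have b0 (z : R) : `|z| < (Num.truncn `|z|).+1%:R by exact: truncnS_gt.
apply: (near_eq_is_derive _ (dG y _)).
  near=> z.
  have zy : ball (y : R) 1 z by near: z; exact: nbhsx_ballx.
  rewrite -ball_normE /= in zy; rewrite distrC in zy.
  have zy2 : (Num.truncn `|z| <= (Num.truncn `|y|).+1)%N.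
    rewrite -ltnS -(ltr_nat R).
    apply: (@le_lt_trans _ _ `|z|); first by rewrite truncn_le.
    have := ler_normD (z - y) y; rewrite subrK => h.
    have := b0 y; rewrite -[(Num.truncn `|y|).+2%:R]natr1; lra.
  symmetry; apply: GG => //.
  by have := b0 z; rewrite ltr_norml => /andP[].
have := b0 y; rewrite ltr_norml => /andP[h _]; apply: le_lt_trans h.
by rewrite lerN2 ler_nat.
Unshelve. all: by end_near. Qed.

Lemma zero_deriv_seg {R : realType} (F f : R -> R) (a b : R) : (forall y, hder F y (f y)) -> a <= b ->
  (forall y, a < y < b -> f y = 0) -> F a = F b.
Proof.
move=> hF; rewrite le_eqVlt => /orP[/eqP-> //|ab] h.
have [c [hc H]] := MVT_seg F f a b ab (fun z _ => hF z).
by move: H; rewrite (h c hc) mul0r => /eqP; rewrite subr_eq0 => /eqP.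
Qed.

(** [a] is an even mollifier of mass one supported in [[-e, e]], [A] its distribution function. *)
Definition line_bump {R : realType} (e : R) (A a : R -> R) : Prop :=
  [/\ smooth a, forall y, hder A y (a y), forall y, 0 <= a y /\ a (- y) = a y, forall y, e <= `|y| -> a y = 0
  & (forall y, y <= - e -> A y = 0) /\ (forall y, e <= y -> A y = 1)].

(** The classical bump [expR (-1 / (e^2 - y^2))] divided by its mass, which is positive because the
    bump is. *)
Lemma line_bump_exists {R : realType} (e : R) : 0 < e -> exists A a : R -> R, line_bump e A a.
Proof.
move=> e0.
pose q (y : R) := e ^+ 2 - y ^+ 2.
have dq (y : R) : hder q y ((-2) * y).
  apply: hder_eq; first by apply: dB; [exact: dcst|apply: dsqr; exact: did].
  by rewrite /=; ring.
have sq' : smooth (fun y : R => (-2) * y) by move=> n; apply: smZ; exact: sm_id.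
pose th y := flat 0 (q y).
have sth : smooth th by move=> n; exact: (sm_flat n 0%N q _ dq sq').
have [Th dTh] := primitive th (sth 0%N).
have th0 y : e <= `|y| -> th y = 0.
  move=> ey; rewrite /th /flat ltNge subr_le0 (_ : e ^+ 2 <= y ^+ 2)//.
  by rewrite -[y ^+ 2]real_normK ?num_real// lerXn2r// nnegrE// ltW.
have thp y : `|y| < e -> 0 < th y.
  move=> ey; rewrite /th /flat subr_gt0 (_ : y ^+ 2 < e ^+ 2).
    by rewrite expr0 mul1r expR_gt0.
  by rewrite -[y ^+ 2]real_normK ?num_real// ltr_pXn2r// nnegrE// ltW.
have th_ge0 y : 0 <= th y by exact: flat_ge0.
pose c := Th e - Th (- e).
have c0 : 0 < c.
  have [|x [/andP[x1 x2] H]] := MVT_seg Th th (- e) e _ (fun z _ => dTh z); first lra.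
  have [|x' [/andP[x1' x2'] H']] := MVT_seg Th th (- (e / 2)) (e / 2) _ (fun z _ => dTh z); first lra.
  have h1 : Th (- e) <= Th (- (e / 2)).
    by apply: (mono_seg Th th) => //; lra.
  have h2 : Th (e / 2) <= Th e.
    by apply: (mono_seg Th th) => //; lra.
  have : 0 < th x' * (e / 2 - - (e / 2)).
    by apply: mulr_gt0; [apply: thp; rewrite ltr_norml; apply/andP; split; lra|lra].
  rewrite -H' /c; lra.
exists (fun y => c^-1 * (Th y - Th (- e))), (fun y => c^-1 * th y); split.
- by move=> n; exact: smZ.
- move=> y; apply: dZ; apply: hder_eq; first by apply: dB; [exact: dTh|exact: dcst].
  exact: subr0.
- by move=> y; rewrite mulr_ge0 ?invr_ge0 ?(ltW c0)// /th /q sqrrN.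
- by move=> y /th0 ->; rewrite mulr0.
- split=> y ye.
  + rewrite (zero_deriv_seg Th th y (- e) dTh ye) ?subrr ?mulr0// => z /andP[_ z2].
    by apply: th0; rewrite ltr0_norm; lra.
  + rewrite -(zero_deriv_seg Th th e y dTh ye); first by rewrite mulVf// gt_eqF.
    by move=> z /andP[z1 _]; apply: th0; rewrite gtr0_norm; lra.
Qed.

(** A mollifier on the circle as a 1-periodic function; its primitive gains one per period. The last
    clause locates the support in [[-1, 1]] near the integers [0], [1] and [-1]. *)
Definition circle_bump {R : realType} (e : R) (B b : R -> R) : Prop :=
  [/\ smooth b, forall y, hder B y (b y), forall y, 0 <= b y /\ b (- y) = b y,
   forall y, b (y + 1) = b y /\ B (y + 1) = B y + 1
  & B 0 = 0 /\ forall y, `|y| <= 1 -> b y <> 0 -> [\/ `|y| < e, `|y - 1| < e | `|y + 1| < e]].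

(** [cos (2 pi y) - cos (2 pi e)] is smooth, periodic and positive exactly at distance less than [e]
    from the integers, so composing it with [flat] gives a periodic bump directly. *)
Lemma circle_bump_exists {R : realType} (e : R) : 0 < e -> e < 2^-1 -> exists B b : R -> R, circle_bump e B b.
Proof.
move=> e0 e2.
have p0 : 0 < pi :> R by exact: pi_gt0.
pose q (y : R) := cos ((2 * pi) * y) - cos ((2 * pi) * e).
have dq (y : R) : hder q y (- (2 * pi) * sin ((2 * pi) * y)).
  have h : hder (fun y : R => (2 * pi) * y) y ((2 * pi) * 1) by apply: dZ; exact: did.
  apply: hder_eq; first by apply: dB; [exact: (dcomp _ _ _ _ _ (is_derive_cos _) h)|exact: dcst].
  by ring.
have sq' : smooth (fun y : R => - (2 * pi) * sin ((2 * pi) * y)).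
  by move=> n; apply: smZ; exact: (sm_cos_sin n _).2.
pose th y := flat 0 (q y).
have sth : smooth th by move=> n; exact: (sm_flat n 0%N q _ dq sq').
have [Th dTh] := primitive th (sth 0%N).
have qN y : q (- y) = q y by rewrite /q mulrN cosN.
have q1 y : q (y + 1) = q y.
  by rewrite /q mulrDr mulr1 (_ : 2 * pi = pi *+ 2) ?cosD2pi// mulr_natl.
have qabs y : q `|y| = q y.
  by have [h|h] := leP 0 y; [rewrite ger0_norm|rewrite ltr0_norm ?qN].
have thp y : `|y| < e -> 0 < th y.
  move=> ey; rewrite /th /flat -qabs /q subr_gt0.
  have y0 := normr_ge0 y; move: (`|y|) ey y0 => z ey y0.
  rewrite ltr_cos; first by rewrite ltr_pM2l ?ey ?expr0 ?mul1r ?expR_gt0// mulr_gt0.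
  - by rewrite in_itv /=; apply/andP; split; nra.
  - by rewrite in_itv /=; apply/andP; split; nra.
have key y : e <= y -> y <= 2^-1 -> q y <= 0.
  move=> ey y2; rewrite /q subr_le0 leNgt ltr_cos.
  - by rewrite -leNgt ler_pM2l// mulr_gt0.
  - by rewrite in_itv /=; apply/andP; split; nra.
  - by rewrite in_itv /=; apply/andP; split; nra.
have th_ge0 y : 0 <= th y by exact: flat_ge0.
pose c := Th (2^-1) - Th (- 2^-1).
have c0 : 0 < c.
  have [|x' [/andP[x1' x2'] H']] := MVT_seg Th th (- (e / 2)) (e / 2) _ (fun z _ => dTh z); first lra.
  have h1 : Th (- 2^-1) <= Th (- (e / 2)).
    by apply: (mono_seg Th th) => //; lra.
  have h2 : Th (e / 2) <= Th 2^-1.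
    by apply: (mono_seg Th th) => //; lra.
  have : 0 < th x' * (e / 2 - - (e / 2)).
    by apply: mulr_gt0; [apply: thp; rewrite ltr_norml; apply/andP; split; lra|lra].
  rewrite -H' /c; lra.
have Th1 y : Th (y + 1) - Th y = c.
  have D (z : R) : hder (fun z => Th (z + 1) - Th z) z 0.
    have h : hder (fun y => y + 1) z (1 + 0) by apply: dD; [exact: did|exact: dcst].
    apply: hder_eq; first by apply: dB; [exact: (dcomp _ _ _ _ _ (dTh _) h)|exact: dTh].
    by rewrite /th q1; ring.
  rewrite (hder_cst _ D y (- 2^-1)) /c; congr (Th _ - _); by field.
exists (fun y => c^-1 * (Th y - Th 0)), (fun y => c^-1 * th y); split.
- by move=> n; exact: smZ.
- move=> y; apply: dZ; apply: hder_eq; first by apply: dB; [exact: dTh|exact: dcst].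
  exact: subr0.
- by move=> y; rewrite mulr_ge0 ?invr_ge0 ?(ltW c0)// /th qN.
- move=> y; rewrite /th q1; split => //.
  have -> : Th (y + 1) = Th y + c by rewrite -(Th1 y); ring.
  by field; rewrite gt_eqF.
- split; first by rewrite subrr mulr0.
  move=> y y1 by0.
  have ye : 0 < q y.
    by rewrite ltNge; apply/negP => h; apply: by0; rewrite /th /flat ltNge h mulr0.
  have y0 := normr_ge0 y.
  have : `|y| < e \/ 1 - e < `|y|.
    have [h|h] := ltP `|y| e; first by left.
    right; rewrite ltNge; apply/negP => h2.
    have [h3|h3] := leP `|y| 2^-1; first by have := key _ h h3; rewrite qabs; lra.
    have : q (1 - `|y|) <= 0 by apply: key; lra.
    by rewrite addrC q1 qN qabs; lra.
  move=> [h|h]; first by constructor 1.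
  have [yp|yn] := leP 0 y.
    constructor 2; rewrite ger0_norm in h y1 => //.
    by rewrite ltr_norml; apply/andP; split; lra.
  constructor 3; rewrite ltr0_norm in h y1 => //.
  by rewrite ltr_norml; apply/andP; split; lra.
Qed.

(** * Test functions and weak derivatives *)

Definition tens {R : realType} (a b c : R -> R) : R * (R * R) -> R :=
  fun x => a x.1 * b x.2.1 * c x.2.2.

Lemma tens_pd {R : realType} (i : 'I_3) (a a' b b' c c' : R -> R) :
  (forall y, hder a y (a' y)) -> (forall y, hder b y (b' y)) -> (forall y, hder c y (c' y)) ->
  (forall x, derivable (tens a b c) x (unitv i)) /\
  pd i (tens a b c) = match val i with 0%N => tens a' b c | 1%N => tens a b' c | _ => tens a b c' end.
Proof.
move=> ha hb hc.
have key x : hder (fun t : R => tens a b c (upd i x t)) (coord i x)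
    (match val i with 0%N => tens a' b c | 1%N => tens a b' c | _ => tens a b c' end x).
  case: i => -[|[|[|//]]] hi; rewrite /tens /upd /coord /=.
  - apply: hder_eq; first by apply: dM; [apply: dM; [exact: ha|exact: dcst]|exact: dcst].
    by rewrite /=; ring.
  - apply: hder_eq; first by apply: dM; [apply: dM; [exact: dcst|exact: hb]|exact: dcst].
    by rewrite /=; ring.
  - apply: hder_eq; first by apply: dM; [exact: dcst|exact: hc].
    by rewrite /=; ring.
split=> [x|]; first by rewrite derivable_upd; have [] := key x.
apply/funext => x; rewrite pd_upd derive1E; apply: derive_val; exact: key.
Qed.

Lemma continuous_fst3 {R : realType} (a : R -> R) : continuous a -> continuous (fun x : R * (R * R) => a x.1).
Proof. by move=> ca x; apply: (continuous_comp (f := fst)); [exact: cvg_fst|exact: ca]. Qed.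

Lemma continuous_tens {R : realType} (a b c : R -> R) : continuous a -> continuous b -> continuous c ->
  continuous (tens a b c).
Proof.
move=> ca cb cc x; apply: cvgM; first apply: cvgM.
- exact: continuous_fst3.
- apply: (continuous_comp (f := fun x : R * (R * R) => x.2.1)); last exact: cb.
  by apply: (continuous_comp (f := snd)); [exact: cvg_snd|exact: cvg_fst].
- apply: (continuous_comp (f := fun x : R * (R * R) => x.2.2)); last exact: cc.
  by apply: (continuous_comp (f := snd)); [exact: cvg_snd|exact: cvg_snd].
Qed.

Lemma Ck_tens {R : realType} n (a b c : R -> R) : sm n a -> sm n b -> sm n c -> Ck n (tens a b c).
Proof.
elim: n a b c => [|n IH] a b c ha hb hc; (split; first by apply: continuous_tens; apply: (sm_le 0%N _ _ (leq0n _));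
  eassumption) => //.
have la := sm_le _ _ _ (leqnSn n) ha; have lb := sm_le _ _ _ (leqnSn n) hb; have lc := sm_le _ _ _ (leqnSn n) hc.
move: ha hb hc => [a' [ha sa]] [b' [hb sb]] [c' [hc sc]] i.
have [h ->] := tens_pd i a a' b b' c c' ha hb hc; split => //.
by case: (val i) => [|[|k]]; exact: IH.
Qed.

Definition narrow {R : realType} (f : R * (R * R) -> R) : Prop :=
  exists a : R, forall x, a < `|x.1| -> f x = 0.

Lemma test_tens {R : realType} (a b c : R -> R) (M : R) : smooth a -> smooth b -> smooth c ->
  (forall y, M < `|y| -> a y = 0) -> (forall y, b (y + 1) = b y) -> (forall y, c (y + 1) = c y) ->
  test_fun (tens a b c).
Proof.
move=> sa sb sc aM pb pc; split.
- by move=> x1 x2 x3; rewrite /tens /= pb pc.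
- by move=> n; apply/CkP; exact: Ck_tens.
- by exists M => x h; rewrite /tens aM// !mul0r.
Qed.

Lemma pd_narrow {R : realType} i (f : R * (R * R) -> R) (a : R) :
  (forall x, a < `|x.1| -> f x = 0) -> forall x, a < `|x.1| -> pd i f x = 0.
Proof.
move=> H x ax; rewrite pd_upd derive1E.
rewrite (@near_eq_derive _ _ _ _ (cst (0 : R))); first exact: derive_cst.
case: i => -[|[|[|//]]] hi; rewrite /upd /coord /=.
- near=> t; apply: H => /=; near: t.
  by have := @norm_continuous R R x.1 => /cvgrPdist_lt/(_ _ (ltac:(by rewrite subr_gt0; exact: ax) : 0 < `|x.1| - a));
    apply: filterS => t; rewrite ltr_norml => /andP[_]; lra.
- by near=> t; exact: H.
- by near=> t; exact: H.
Unshelve. all: by end_near. Qed.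

Lemma test_pd {R : realType} i (f : R * (R * R) -> R) : test_fun f -> test_fun (pd i f).
Proof.
move=> [pf Cf [a ha]]; split.
- exact: periodic_pd.
- by move=> n; apply/CkP; apply: Ck_pd; apply/CkP.
- by exists a => x; exact: pd_narrow.
Qed.

Lemma test_pdn {R : realType} s (f : R * (R * R) -> R) : test_fun f -> test_fun (pdn s f).
Proof. by move=> tf; elim: s => //= i s IH; exact: test_pd. Qed.

Lemma cell_measurable {R : realType} (a : R) : measurable (`[- a, a] `*` T2 : set (mR R * (mR R * mR R))).
Proof. by apply: measurableX => //; exact: measurable_T2. Qed.

Lemma mu3_cell_fin {R : realType} (a : R) : (mu3 (`[(- a)%R, a] `*` @T2 R) < +oo)%E.
Proof.
rewrite /mu3 product_measure1E//=; last exact: measurable_T2.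
rewrite [X in (_ * X)%E]mu2_T2 mule1 lebesgue_measure_itv /=.
by case: ifP => _; rewrite ?ltry// -EFinD ltry.
Qed.

Lemma cell_integrable {R : realType} (f : R * (R * R) -> R) (a : R) : continuous f ->
  mu3.-integrable (`[- a, a] `*` T2) (EFin \o f).
Proof.
move=> cf; apply: measurable_bounded_integrable.
- exact: cell_measurable.
- exact: mu3_cell_fin.
- by apply: measurable_funS (continuous_measurable3 f cf).
- have cK : compact (`[- a, a] `*` T2 : set (R * (R * R))).
    by apply: compact_setX; [exact: segment_compact|exact: compact_T2].
  have [M [M0 HM]] := continuous_compact_bounded _ f cK cf.
  exists M; split; first exact: num_real.
  by move=> N MN x Kx; exact: le_trans (HM x Kx) (ltW MN).
Qed.

Lemma loc_integrable_continuous {R : realType} (f : R * (R * R) -> R) : continuous f -> loc_integrable f.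
Proof. by move=> cf; split; [exact: continuous_measurable3|move=> a; exact: cell_integrable]. Qed.

Lemma patch_narrow {R : realType} (f : R * (R * R) -> R) (a : R) : (forall x, a < `|x.1| -> f x = 0) ->
  (EFin \o f) \_ Omega = (EFin \o f) \_ (`[- a, a] `*` T2).
Proof.
move=> H; apply/funext => x; rewrite /patch.
have [xO|xO] := boolP (x \in Omega); have [xK|xK] := boolP (x \in `[- a, a] `*` T2) => //.
- move: xO; rewrite inE /Omega => -[_ x2]; rewrite /comp H//.
  rewrite ltNge; apply/negP => h; move/negP: xK; apply; rewrite inE; split => //=.
  by rewrite in_itv /= -ler_norml.
- by move: xK xO; rewrite !inE /Omega => -[_ x2] /negP h; case: h; rewrite inE; split.
Qed.

Lemma narrow_integrable {R : realType} (f : R * (R * R) -> R) : continuous f -> narrow f ->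
  mu3.-integrable Omega (EFin \o f).
Proof.
move=> cf [a H]; rewrite integrable_mkcond; last exact: measurable_Omega.
rewrite (patch_narrow f a H) -integrable_mkcond; last exact: cell_measurable.
exact: cell_integrable.
Qed.

Lemma mean_narrow {R : realType} (f : R * (R * R) -> R) (a : R) : (forall x, a < `|x.1| -> f x = 0) ->
  forall y, a < `|y| -> mean f y = 0.
Proof.
move=> H y ay; rewrite /mean (_ : (fun x' : R * R => f (y, x')) = cst 0) ?avg_cst//.
by apply/funext => x'; exact: H.
Qed.

Lemma integral_itv_narrow {R : realType} (g : R -> R) (a : R) : (forall y, a < `|y| -> g y = 0) ->
  (\int[lebesgue_measure]_y (g y)%:E = \int[lebesgue_measure]_(y in `[(- a)%R, a]) (g y)%:E)%E.
Proof.
move=> H; rewrite [RHS]integral_mkcond; apply: eq_integral => y _; rewrite /patch.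
case: ifPn => // yn; rewrite H// ltNge; apply/negP => h; move/negP: yn; apply.
by rewrite inE /= in_itv /= -ler_norml.
Qed.

(** The positive and negative parts are continuous and vanish outside the same slab; Tonelli applies
    to each. *)
Lemma Rintegral_Omega {R : realType} (f : R * (R * R) -> R) (a : R) : continuous f ->
  (forall x, a < `|x.1| -> f x = 0) ->
  \int[mu3]_(x in Omega) f x = \int[lebesgue_measure]_(y in `[- a, a]) mean f y.
Proof.
move=> cf H.
pose p x := 2^-1 * (`|f x| + f x); pose m x := 2^-1 * (`|f x| - f x).
have ca := continuous_abs f cf.
have cp : continuous p by move=> x; apply: cvgM; [exact: cvg_cst|apply: cvgD; [exact: ca|exact: cf]].
have cm : continuous m by move=> x; apply: cvgM; [exact: cvg_cst|apply: cvgB; [exact: ca|exact: cf]].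
have Hp x : a < `|x.1| -> p x = 0 by move=> /H h; rewrite /p h normr0 addr0 mulr0.
have Hm x : a < `|x.1| -> m x = 0 by move=> /H h; rewrite /m h normr0 subr0 mulr0.
have key (g : R * (R * R) -> R) : continuous g -> (forall x, a < `|x.1| -> g x = 0) -> (forall x, 0 <= g x) ->
    (\int[mu3]_(x in Omega) (g x)%:E = \int[lebesgue_measure]_(y in `[(- a)%R, a]) (mean g y)%:E)%E.
  move=> cg Hg g0; rewrite (tonelli_Omega (fun x => (g x)%:E)).
  - rewrite -integral_itv_narrow; last exact: mean_narrow.
    by apply: eq_integral => y _; rewrite -avgE//; exact: continuous_pair1.
  - exact: measurable_EFin3.
  - by move=> x; rewrite lee_fin.
have fE x : f x = p x - m x by rewrite /p /m; field.
have meanE y : mean f y = mean p y - mean m y.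
  rewrite /mean -avgB; [|exact: continuous_pair1|exact: continuous_pair1].
  by apply: eq_Rintegral => x' _; exact: fE.
have -> : \int[mu3]_(x in Omega) f x = \int[mu3]_(x in Omega) (p x - m x).
  by apply: eq_Rintegral => x _; exact: fE.
have -> : \int[lebesgue_measure]_(y in `[- a, a]) mean f y = \int[lebesgue_measure]_(y in `[- a, a]) (mean p y - mean
  m y).
  by apply: eq_Rintegral => x _; exact: meanE.
have -> : \int[mu3]_(x in Omega) (p x - m x) = \int[mu3]_(x in Omega) p x - \int[mu3]_(x in Omega) m x.
  by apply: RintegralB; [exact: measurable_Omega|exact: (narrow_integrable p cp (ex_intro _ a Hp))|exact:
    (narrow_integrable m cm (ex_intro _ a Hm))].
rewrite RintegralB; [|exact: measurable_itv|by apply: continuous_itv_integrable; exact: mean_continuous|by apply: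
  continuous_itv_integrable; exact: mean_continuous].
rewrite /Rintegral !key//.
- by move=> x; rewrite /m mulr_ge0// subr_ge0 ler_norm.
- by move=> x; rewrite /p mulr_ge0// -lerBlDr sub0r -normrN ler_norm.
Qed.

Lemma integral_pd0 {R : realType} (f : R * (R * R) -> R) i : Cper 1 f -> narrow f ->
  \int[mu3]_(x in Omega) pd i f x = 0.
Proof.
move=> [Cf pf] [a H].
have cp : continuous (pd i f) by exact: (Ck_cont 0 _ (Ck_pd _ _ _ Cf)).
(* [b] is positive and exceeds [a], so that [f] already vanishes at the end points [-b] and [b]. *)
pose b := `|a| + 1.
have H' x : b < `|x.1| -> f x = 0.
  by move=> h; apply: H; apply: lt_trans h; rewrite /b ltr_pwDr// ler_norm.
have b0 : 0 < b by rewrite /b ltr_wpDl.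
rewrite (Rintegral_Omega _ b cp (pd_narrow i f b H')).
have [i0|i0] := eqVneq (val i) 0%N; last first.
  have -> : \int[lebesgue_measure]_(y in `[- b, b]) mean (pd i f) y = \int[lebesgue_measure]_(y in `[- b, b]) 0.
    by apply: eq_Rintegral => y _; exact: mean_pd0.
  by rewrite Rintegral_cst// mul0r.
have -> : i = ord0 by exact: val_inj.
have -> : \int[lebesgue_measure]_(y in `[- b, b]) mean (pd ord0 f) y = \int[lebesgue_measure]_(y in `[- b, b])
  derive1 (mean f) y.
  by apply: eq_Rintegral => y _; rewrite (mean_derive f Cf y).2.
have bb : - b <= b by lra.
have H1 := mean_narrow f a H.
rewrite /Rintegral ftc2//.
- rewrite !H1 ?subrr//.
    by rewrite normrN ger0_norm ?(ltW b0)// /b ltr_pwDr// ler_norm.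
  by rewrite ger0_norm ?(ltW b0)// /b ltr_pwDr// ler_norm.
- by move=> y; exact: (mean_derive f Cf y).1.
- rewrite (_ : derive1 (mean f) = mean (pd ord0 f)).
    by apply: mean_continuous; exact: (Ck_cont 0 _ (Ck_pd _ _ _ Cf)).
  by apply/funext => y; exact: (mean_derive f Cf y).2.
Qed.

Lemma ibp {R : realType} (f phi : R * (R * R) -> R) i : Cper 1 f -> test_fun phi ->
  \int[mu3]_(x in Omega) (f x * pd i phi x) = - \int[mu3]_(x in Omega) (pd i f x * phi x).
Proof.
move=> [Cf pf] [pphi Cphi [a H]].
have C1 : Ck 1 phi by apply/CkP.
have cf : continuous f by exact: Ck_cont Cf.
have cphi : continuous phi by exact: Ck_cont C1.
have cpf : continuous (pd i f) by exact: (Ck_cont 0 _ (Ck_pd _ _ _ Cf)).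
have cpphi : continuous (pd i phi) by exact: (Ck_cont 0 _ (Ck_pd _ _ _ C1)).
have C : Cper 1 (fun x => f x * phi x).
  split; first exact: CkM.
  by move=> x1 x2 x3; have [-> ->] := pf x1 x2 x3; have [-> ->] := pphi x1 x2 x3.
have := integral_pd0 (fun x => f x * phi x) i C (ltac:(by exists a => x /H ->; rewrite mulr0)).
have [_ ->] := pdM i f phi (fun x => Ck_der 0 f i x Cf) (fun x => Ck_der 0 phi i x C1).
rewrite RintegralD; first by move/eqP; rewrite addrC addr_eq0 => /eqP.
- exact: measurable_Omega.
- apply: narrow_integrable; last by exists a => x /H ->; rewrite mulr0.
  by move=> x; apply: cvgM; [exact: cpf|exact: cphi].
- apply: narrow_integrable; last by exists a => x h; rewrite (pd_narrow i phi a H x h) mulr0.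
  by move=> x; apply: cvgM; [exact: cf|exact: cpphi].
Qed.

Lemma Cper_pdn {R : realType} n s (f : R * (R * R) -> R) : Cper (size s + n) f -> Cper n (pdn s f).
Proof.
elim: s n f => [|i s IH] n f //=; rewrite addSnnS => /IH; exact: Cper_pd.
Qed.

Lemma Cper_le {R : realType} m n (f : R * (R * R) -> R) : (m <= n)%N -> Cper n f -> Cper m f.
Proof. by move=> mn [h1 h2]; split => //; exact: Ck_le h1. Qed.

(** Integration by parts moves the outermost derivative of [phi] first, and it becomes the innermost
    one on [f]: hence the reversal of the list. *)
Lemma weak_deriv_classical {R : realType} s (f : R * (R * R) -> R) : Cper (size s) f ->
  weak_deriv s f (pdn (rev s) f).
Proof.
move=> Cf; split.
- by apply: loc_integrable_continuous; exact: (Ck_cont _ _ Cf.1).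
- apply: loc_integrable_continuous; apply: (Ck_cont 0).
  by apply: (Cper_pdn 0 _ _ _).1; rewrite size_rev addn0.
- elim: s f Cf => [|i s IH] f Cf phi tphi; first by rewrite /= expr0 mul1r.
  rewrite /= (ibp f (pdn s phi) i _ (test_pdn _ _ tphi)); last exact: Cper_le Cf.
  rewrite (IH (pd i f) (Cper_pd _ _ _ Cf) phi tphi) rev_cons -cats1 pdn_cat /= exprS mulN1r.
  by rewrite mulNr.
Qed.

Lemma weak_derivsq_le {R : realType} s (f : R * (R * R) -> R) : Cper (size s) f ->
  (weak_derivsq s f <= L2sq (pdn (rev s) f))%E.
Proof.
move=> Cf; apply: ereal_inf_lbound; exists (pdn (rev s) f) => //.
exact: weak_deriv_classical.
Qed.

Definition Hsq_card (k : nat) : nat := \sum_(j < k.+1) #|{: j.-tuple 'I_3}|.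

Lemma Hsq_le {R : realType} k (f : R * (R * R) -> R) (B : \bar R) : Cper k f ->
  (forall s, (size s <= k)%N -> (L2sq (pdn s f) <= B)%E) ->
  (Hsq k f <= (Hsq_card k)%:R%:E * B)%E.
Proof.
move=> Cf H.
have B0 : (0 <= B)%E by apply: le_trans (H [::] isT); exact: L2sq_ge0.
rewrite /Hsq /Hsq_card natr_sum -sumEFin ge0_sume_distrl; last by move=> j _; rewrite lee_fin.
apply: lee_sum => j _.
have -> : ((#|{: j.-tuple 'I_3}|%:R)%:E * B = \sum_(s : j.-tuple 'I_3) B)%E.
  by rewrite sumr_const mule_natl cardT.
apply: lee_sum => s _.
have sk : (size s <= k)%N by rewrite size_tuple -ltnS.
apply: le_trans (weak_derivsq_le s f (Cper_le _ _ _ sk Cf)) _.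
by apply: H; rewrite size_rev.
Qed.

(** * Mollification *)

(** Tensor mollifier centred at [x]: [a] acts on the line, [b] on each circle. *)
Definition ker {R : realType} (a b : R -> R) (x : R * (R * R)) : R * (R * R) -> R :=
  tens (fun t => a (t - x.1)) (fun t => b (t - x.2.1)) (fun t => b (t - x.2.2)).

Lemma tens_cells {R : realType} (M : R) (A a B b C c : R -> R) :
  (forall y, hder A y (a y)) -> (forall y, hder B y (b y)) -> (forall y, hder C y (c y)) ->
  continuous a -> continuous b -> continuous c -> (forall y, 0 <= b y) -> (forall y, 0 <= c y) ->
  0 <= M -> (forall y, M < `|y| -> a y = 0) ->
  \int[mu3]_(x in Omega) tens a b c x = (A M - A (- M)) * ((B 1 - B 0) * (C 1 - C 0)).
Proof.
move=> dA dB dC ca cb cc b0 c0 M0 aM.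
have dAE := hder_derive1E _ _ dA; have dBE := hder_derive1E _ _ dB; have dCE := hder_derive1E _ _ dC.
have F (G g : R -> R) (x y : R) : x <= y -> continuous g -> (forall t, hder G t (g t)) ->
    (\int[lebesgue_measure]_(t in `[x, y]) (g t)%:E = (G y - G x)%:E)%E.
  move=> xy cg dG; have E := hder_derive1E _ _ dG.
  rewrite -ftc2//; first by rewrite E.
  - by move=> t; have [] := dG t.
  - by rewrite E.
have ct : continuous (fun x' : R * R => b x'.1 * c x'.2).
  by move=> x; apply: cvgM; apply: continuous_comp; [exact: cvg_fst|exact: cb|exact: cvg_snd|exact: cc].
have T2E : \int[mu2]_(x' in T2) (b x'.1 * c x'.2) = (B 1 - B 0) * (C 1 - C 0).
  rewrite /Rintegral (tonelli_T2 (fun x' => (b x'.1 * c x'.2)%:E) _ _).1; last 2 first.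
  - by apply/measurable_EFinP; exact: continuous_measurable2.
  - by move=> x; rewrite lee_fin mulr_ge0.
  have -> : (\int[lebesgue_measure]_(x in `[0%R, 1%R]) \int[lebesgue_measure]_(y in `[0%R, 1%R]) (b (x, y).1 * c (x,
    y).2)%:E
     = \int[lebesgue_measure]_(x in `[0%R, 1%R]) ((C 1 - C 0)%:E * (b x)%:E))%E.
    apply: eq_integral => x _ /=.
    rewrite -(F C c 0 1 ler01 cc dC) muleC -ge0_integralZl//.
    - by apply: measurable_funS (measurableT) _ _ => //; apply/measurable_EFinP; exact: continuous_measurable_fun.
    - by move=> y _; rewrite lee_fin.
    - by rewrite lee_fin.
  have C0 : 0 <= C 1 - C 0.
    by rewrite -lee_fin -(F C c 0 1 ler01 cc dC); apply: integral_ge0 => y _; rewrite lee_fin.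
  rewrite ge0_integralZl//; [|by apply: measurable_funS (measurableT) _ _ => //; apply/measurable_EFinP; exact:
    continuous_measurable_fun|by move=> y _; rewrite lee_fin].
  by rewrite (F B b 0 1 ler01 cb dB) -EFinM /= mulrC.
have cF : continuous (tens a b c) by exact: continuous_tens.
rewrite (Rintegral_Omega _ M cF); last by move=> x h; rewrite /tens aM// !mul0r.
have mE y : mean (tens a b c) y = ((B 1 - B 0) * (C 1 - C 0)) * a y.
  rewrite -T2E /mean mulrC -avgZ//; apply: eq_Rintegral => x' _.
  by rewrite /tens /= mulrA.
have -> : \int[lebesgue_measure]_(y in `[- M, M]) mean (tens a b c) y =
    \int[lebesgue_measure]_(y in `[- M, M]) (((B 1 - B 0) * (C 1 - C 0)) * a y).
  by apply: eq_Rintegral => y _; exact: mE.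
rewrite RintegralZl//; last exact: continuous_itv_integrable.
rewrite mulrC; congr (_ * _).
by rewrite /Rintegral (F A a (- M) M)//; lra.
Qed.

Section kernel.
Context {R : realType}.
Variables (e : R) (A a B b : R -> R).
Hypotheses (e0 : 0 < e) (e2 : e < 2^-1) (hA : line_bump e A a) (hB : circle_bump e B b).

Let sa : smooth a. Proof. by case: hA. Qed.
Let sb : smooth b. Proof. by case: hB. Qed.

Lemma smooth_shift (f : R -> R) (c : R) : smooth f -> smooth (fun t => f (t - c)).
Proof. by move=> sf n; exact: sm_shift. Qed.

Lemma hder_shift (f f' : R -> R) (c : R) : (forall y, hder f y (f' y)) ->
  forall y, hder (fun t => f (t - c)) y (f' (y - c)).
Proof.
move=> hf y; have h : hder (fun t => t - c) y (1 - 0) by apply: dB; [exact: did|exact: dcst].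
by have := dcomp f (fun t => t - c) y _ _ (hf _) h; rewrite subr0 mulr1.
Qed.

Lemma ker_narrow x y : `|x.1| + e < `|y.1| -> ker a b x y = 0.
Proof.
move=> h; have [_ _ _ az _] := hA; rewrite /ker /tens az ?mul0r//.
have := ler_normD (y.1 - x.1) x.1; rewrite subrK; lra.
Qed.

Lemma test_ker x : test_fun (ker a b x).
Proof.
have [_ _ _ bp _] := hB.
apply: (test_tens _ _ _ (`|x.1| + e)); [exact: smooth_shift|exact: smooth_shift|exact: smooth_shift| | |].
- move=> y h; have [_ _ _ -> //] := hA.
  have := ler_normD (y - x.1) x.1; rewrite subrK; lra.
- by move=> y; rewrite addrAC (bp _).1.
- by move=> y; rewrite addrAC (bp _).1.
Qed.

Lemma ker_ge0 x y : 0 <= ker a b x y.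
Proof.
have [_ _ h _ _] := hA; have [_ _ h' _ _] := hB.
by rewrite /ker /tens !mulr_ge0//; [have [] := h (y.1 - x.1)|have [] := h' (y.2.1 - x.2.1)|have [] := h' (y.2.2 -
  x.2.2)].
Qed.

Lemma ker_sym x y : ker a b x y = ker a b y x.
Proof.
have [_ _ h _ _] := hA; have [_ _ h' _ _] := hB.
by rewrite /ker /tens -(opprB y.1) -(opprB y.2.1) -(opprB y.2.2) (h _).2 !(h' _).2.
Qed.

Lemma continuous_ker x : continuous (ker a b x).
Proof. by have [_ /(_ 0%N)[h _] _] := test_ker x; exact: (h [::]). Qed.

Lemma integral_ker x : \int[mu3]_(y in Omega) ker a b x y = 1.
Proof.
have [_ dA a0 az [A0 A1]] := hA; have [_ dB b0 bp [B0 _]] := hB.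
have xn := normr_ge0 x.1.
rewrite /ker (tens_cells (`|x.1| + e) (fun t => A (t - x.1)) _ (fun t => B (t - x.2.1)) _ (fun t => B (t - x.2.2))).
- rewrite A1; last by have := ler_norm x.1; lra.
  rewrite A0; last by have := ler_norm (- x.1); rewrite normrN; lra.
  have BB c : B (1 - c) - B (0 - c) = 1 by rewrite sub0r [1 - c]addrC (bp _).2; ring.
  by rewrite !BB; ring.
- exact: hder_shift.
- exact: hder_shift.
- exact: hder_shift.
- exact: (smooth_shift _ _ sa 0%N).
- exact: (smooth_shift _ _ sb 0%N).
- exact: (smooth_shift _ _ sb 0%N).
- by move=> y; exact: (b0 _).1.
- by move=> y; exact: (b0 _).1.
- by rewrite addr_ge0// ltW.
- move=> y h; apply: az.
  have := ler_normD (y - x.1) x.1; rewrite subrK; lra.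
Qed.

(** For [x] near the boundary of the cell the kernel also charges points close to a lattice
    translate of [x]. Periodicity of [k] brings them back next to [x], with three positions per
    circle and nine cases. *)
Lemma ker_near (k : R * (R * R) -> R) x y eta : torus_periodic k -> Omega x -> Omega y ->
  (forall z, `|z.1 - x.1| < e -> `|z.2.1 - x.2.1| < e -> `|z.2.2 - x.2.2| < e -> `|k z - k x| <= eta) ->
  ker a b x y != 0 -> `|k y - k x| <= eta.
Proof.
case: x => x1 [x2 x3]; case: y => y1 [y2 y3] pk [_ [/= hx2 hx3]] [_ [/= hy2 hy3]] H.
rewrite /ker /tens /= !mulf_eq0 !negb_or => /andP[/andP[n1 n2] n3].
have [_ _ _ az _] := hA; have [_ _ _ _ [_ bz]] := hB.
have d1 : `|y1 - x1| < e.
  by rewrite ltNge; apply/negP => h; move: n1; rewrite az// eqxx.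
have cell (u v : R) : u \in `[0, 1] -> v \in `[0, 1] -> `|u - v| <= 1.
  by rewrite !in_itv /= => /andP[? ?] /andP[? ?]; rewrite ler_norml; apply/andP; split; lra.
have C2 := bz _ (cell _ _ hy2 hx2) (elimN eqP n2).
have C3 := bz _ (cell _ _ hy3 hx3) (elimN eqP n3).
have p2 (u v : R) : k (y1, (u - 1, v)) = k (y1, (u, v)) by have [<- _] := pk y1 (u - 1) v; rewrite subrK.
have p3 (u v : R) : k (y1, (u, v - 1)) = k (y1, (u, v)) by have [_ <-] := pk y1 u (v - 1); rewrite subrK.
have q2 u v : k (y1, (u + 1, v)) = k (y1, (u, v)) by have [-> _] := pk y1 u v.
have q3 u v : k (y1, (u, v + 1)) = k (y1, (u, v)) by have [_ ->] := pk y1 u v.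
have key u v : `|u - x2| < e -> `|v - x3| < e -> `|k (y1, (u, v)) - k (x1, (x2, x3))| <= eta.
  by move=> hu hv; apply: H.
have E1 (u c : R) : u - c - 1 = u - 1 - c by ring.
have E2 (u c : R) : u - c + 1 = u + 1 - c by ring.
rewrite E1 E2 in C2; rewrite E1 E2 in C3.
case: C2 => h2; case: C3 => h3.
- exact: key.
- by rewrite -p3; exact: key.
- by rewrite -q3; exact: key.
- by rewrite -p2; exact: key.
- by rewrite -p2 -p3; exact: key.
- by rewrite -p2 -q3; exact: key.
- by rewrite -q2; exact: key.
- by rewrite -q2 -p3; exact: key.
- by rewrite -q2 -q3; exact: key.
Qed.

(** The kernel is a probability density on the cell, supported where [k] is within [eta] of
    [k x]. *)
Lemma ker_moll (k : R * (R * R) -> R) x eta : continuous k -> torus_periodic k -> Omega x ->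
  (forall z, `|z.1 - x.1| < e -> `|z.2.1 - x.2.1| < e -> `|z.2.2 - x.2.2| < e -> `|k z - k x| <= eta) ->
  `|\int[mu3]_(y in Omega) (k y * ker a b x y) - k x| <= eta.
Proof.
move=> ck pk Ox H.
have nar (f : R * (R * R) -> R) : continuous f -> mu3.-integrable Omega (EFin \o (fun y => f y * ker a b x y)).
  move=> cf; apply: narrow_integrable; last by exists (`|x.1| + e) => y h; rewrite ker_narrow// mulr0.
  by move=> y; apply: cvgM; [exact: cf|exact: continuous_ker].
have cc (c : R) : continuous (fun _ : R * (R * R) => c) by move=> ?; exact: cvg_cst.
have cI (c : R) : \int[mu3]_(y in Omega) (c * ker a b x y) = c.
  rewrite RintegralZl; first by rewrite integral_ker mulr1.
  - exact: measurable_Omega.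
  - have := nar (fun=> 1) (cc 1); apply: eq_integrable => //; first exact: measurable_Omega.
    by move=> y _ /=; rewrite mul1r.
have up : \int[mu3]_(y in Omega) (k y * ker a b x y) <= k x + eta.
  rewrite -(cI (k x + eta)); apply: le_Rintegral; [exact: measurable_Omega|exact: nar|exact: nar|].
  move=> y Oy; have [->|n0] := eqVneq (ker a b x y) 0; first by rewrite !mulr0.
  rewrite ler_wpM2r ?ker_ge0//.
  by have := ker_near k x y eta pk Ox Oy H n0; rewrite ler_norml => /andP[_]; lra.
have dn : k x - eta <= \int[mu3]_(y in Omega) (k y * ker a b x y).
  rewrite -(cI (k x - eta)); apply: le_Rintegral; [exact: measurable_Omega|exact: nar|exact: nar|].
  move=> y Oy; have [->|n0] := eqVneq (ker a b x y) 0; first by rewrite !mulr0.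
  rewrite ler_wpM2r ?ker_ge0//.
  by have := ker_near k x y eta pk Ox Oy H n0; rewrite ler_norml => /andP[]; lra.
by rewrite ler_norml; apply/andP; split; lra.
Qed.

End kernel.

Lemma continuous_box {R : realType} (k : R * (R * R) -> R) x eta : continuous k -> 0 < eta ->
  exists e0 : R, 0 < e0 /\ forall z, `|z.1 - x.1| < e0 -> `|z.2.1 - x.2.1| < e0 -> `|z.2.2 - x.2.2| < e0 ->
    `|k z - k x| <= eta.
Proof.
move=> ck eta0; have := ck x => /cvgrPdist_lt/(_ _ eta0)/nbhs_ballP[e0 /= e00 H].
exists e0; split => // z h1 h2 h3; rewrite distrC; apply: ltW; apply: H.
by split => /=; [|split => /=]; rewrite -ball_normE /= distrC.
Qed.

Lemma limn_einf_le {R : realType} (u v : (\bar R)^nat) : (forall n, u n <= v n)%E ->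
  (limn_einf u <= limn_einf v)%E.
Proof.
move=> uv; rewrite !limn_einf_lim; apply: lee_lim; [exact: is_cvg_einfs|exact: is_cvg_einfs|].
apply: nearW => n; apply: le_ereal_inf_tmp => _ [m /= nm <-].
by apply: le_trans (uv m); apply: ereal_inf_lbound; exists m.
Qed.

Lemma limn_einf_cst {R : realType} (c : \bar R) : limn_einf (fun=> c) = c.
Proof.
have h : (fun=> c) @ \oo --> c by exact: cvg_cst.
exact: (cvg_limn_einf_sup h).1.
Qed.

Lemma weak_integrable {R : realType} (g phi : R * (R * R) -> R) : loc_integrable g -> continuous phi -> narrow phi ->
  mu3.-integrable Omega (EFin \o (fun x => g x * phi x)).
Proof.
move=> [mg ig] cphi [a H].
have cK : compact (`[- a, a] `*` T2 : set (R * (R * R))).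
  by apply: compact_setX; [exact: segment_compact|exact: compact_T2].
have [M [M0 HM]] := continuous_compact_bounded _ phi cK cphi.
rewrite integrable_mkcond; last exact: measurable_Omega.
rewrite (patch_narrow _ a); last by move=> x /H ->; rewrite mulr0.
rewrite -integrable_mkcond; last exact: cell_measurable.
have iM := integrableZl (cell_measurable a) M (ig a).
apply: le_integrable iM; first exact: cell_measurable.
- apply/measurable_EFinP; apply: measurable_funTS; apply: measurable_funM => //.
  exact: continuous_measurable3.
- move=> x Kx; rewrite /= lee_fin normrM [leRHS]normrM mulrC.
  by rewrite ler_wpM2r// (ger0_norm M0) HM.
Qed.

Lemma measurable_ker {R : realType} (a b : R -> R) : continuous a -> continuous b ->
  measurable_fun setT (fun z : (mR R * (mR R * mR R)) * (mR R * (mR R * mR R)) => ker a b z.1 z.2).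
Proof.
move=> ca cb.
have m1 : measurable_fun setT (fun z : (mR R * (mR R * mR R)) * (mR R * (mR R * mR R)) => z.1).
  exact: measurable_fst.
have m2 : measurable_fun setT (fun z : (mR R * (mR R * mR R)) * (mR R * (mR R * mR R)) => z.2).
  exact: measurable_snd.
have mfst d1 d2 d3 (T1 : measurableType d1) (T2 : measurableType d2) (T3 : measurableType d3) (h : T1 -> T2 * T3) :
    measurable_fun setT h -> measurable_fun setT (fun z => (h z).1).
  by move=> mh; exact: (measurableT_comp measurable_fst mh).
have msnd d1 d2 d3 (T1 : measurableType d1) (T2 : measurableType d2) (T3 : measurableType d3) (h : T1 -> T2 * T3) :
    measurable_fun setT h -> measurable_fun setT (fun z => (h z).2).
  by move=> mh; exact: (measurableT_comp measurable_snd mh).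
have key (f : R -> R) (p q : (mR R * (mR R * mR R)) * (mR R * (mR R * mR R)) -> R) : continuous f ->
    measurable_fun setT p -> measurable_fun setT q -> measurable_fun setT (fun z => f (p z - q z)).
  move=> cf mp mq; apply: (measurableT_comp (f := f)); first exact: continuous_measurable_fun.
  exact: measurable_funB.
rewrite /ker /tens; apply: measurable_funM; first apply: measurable_funM.
- by apply: key => //; [exact: mfst m2|exact: mfst m1].
- by apply: key => //; [exact: mfst (msnd _ _ _ _ _ _ _ m2)|exact: mfst (msnd _ _ _ _ _ _ _ m1)].
- by apply: key => //; [exact: msnd (msnd _ _ _ _ _ _ _ m2)|exact: msnd (msnd _ _ _ _ _ _ _ m1)].
Qed.

Lemma weak_deriv_eq {R : realType} s (f g phi : R * (R * R) -> R) : Cper (size s) f -> weak_deriv s f g -> test_fun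
  phi ->
  \int[mu3]_(x in Omega) (g x * phi x) = \int[mu3]_(x in Omega) (pdn (rev s) f x * phi x).
Proof.
move=> Cf [_ _ wg] tphi; have [_ _ wc] := weak_deriv_classical s f Cf.
have := wg phi tphi; rewrite (wc phi tphi) => /(mulfI _) -> //.
by rewrite expf_eq0 oppr_eq0 oner_eq0 andbF.
Qed.

(** The width [1/(n+3)] is below [1/2] for every [n], as the circle bump requires. *)
Lemma bump_sequence {R : realType} : exists (A a B b : nat -> R -> R),
  forall n, line_bump (n.+3%:R^-1) (A n) (a n) /\ circle_bump (n.+3%:R^-1) (B n) (b n).
Proof.
have e0 n : 0 < (n.+3%:R^-1 : R) by rewrite invr_gt0 ltr0n.
have e2 n : n.+3%:R^-1 < 2^-1 :> R by rewrite ltf_pV2 ?posrE ?ltr0n// ltr_nat.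
have [p Hp] := @choice nat ((R -> R) * (R -> R)) (fun n p => line_bump (n.+3%:R^-1) p.1 p.2)
  (fun n => let: ex_intro A (ex_intro a h) := line_bump_exists _ (e0 n) in ex_intro _ (A, a) h).
have [q Hq] := @choice nat ((R -> R) * (R -> R)) (fun n p => circle_bump (n.+3%:R^-1) p.1 p.2)
  (fun n => let: ex_intro A (ex_intro a h) := circle_bump_exists _ (e0 n) (e2 n) in ex_intro _ (A, a) h).
by exists (fun n => (p n).1), (fun n => (p n).2), (fun n => (q n).1), (fun n => (q n).2).
Qed.

Lemma invn_small {R : realType} (e : R) : 0 < e -> \forall n \near \oo, n.+3%:R^-1 < e.
Proof.
move=> e0; near=> n.
have h : e^-1 < n.+3%:R.
  apply: (@lt_le_trans _ _ (n%:R)); last by rewrite ler_nat; do 3 (apply: leqW).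
  by near: n; exact: nbhs_infty_gtr.
by rewrite -[e]invrK ltf_pV2 ?posrE ?invr_gt0 ?ltr0n.
Unshelve. all: by end_near. Qed.

Lemma moll_cvg {R : realType} (A a B b : nat -> R -> R) (k : R * (R * R) -> R) x :
  (forall n, line_bump (n.+3%:R^-1) (A n) (a n) /\ circle_bump (n.+3%:R^-1) (B n) (b n)) ->
  continuous k -> torus_periodic k -> Omega x ->
  (fun n => \int[mu3]_(y in Omega) (k y * ker (a n) (b n) x y)) @ \oo --> k x.
Proof.
move=> H ck pk Ox; apply/cvgrPdist_le => eta eta0.
have [e0 [e00 He]] := continuous_box k x eta ck eta0.
near=> n.
have [h1 h2] := H n.
have ne : n.+3%:R^-1 < e0 by near: n; exact: invn_small.
have n0 : 0 < n.+3%:R^-1 :> R by rewrite invr_gt0 ltr0n.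
have n2 : n.+3%:R^-1 < 2^-1 :> R by rewrite ltf_pV2 ?posrE ?ltr0n// ltr_nat.
rewrite distrC; apply: (ker_moll _ _ _ _ _ n0 h1 h2) => // z z1 z2 z3.
by apply: He; [exact: lt_trans z1 ne|exact: lt_trans z2 ne|exact: lt_trans z3 ne].
Unshelve. all: by end_near. Qed.

Lemma measurable_int_Omega {R : realType} (F : (R * (R * R)) * (R * (R * R)) -> \bar R) :
  measurable_fun setT (F : (mR R * (mR R * mR R)) * (mR R * (mR R * mR R)) -> \bar R) -> (forall z, 0 <= F z)%E ->
  measurable_fun setT (fun x : mR R * (mR R * mR R) => \int[mu3]_(y in Omega) F (x, y))%E.
Proof.
move=> mF F0.
have mO : measurable (Omega : set (mR R * (mR R * mR R))) by exact: measurable_Omega.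
have := @measurable_fun_fubini_tonelli_F _ _ (mR R * (mR R * mR R))%type (mR R * (mR R * mR R))%type R mu3 (F \_
  (setT `*` Omega)).
have H1 : measurable_fun setT (F \_ (setT `*` Omega) : (mR R * (mR R * mR R)) * (mR R * (mR R * mR R)) -> \bar R).
  apply: (measurable_restrictT F _).1; first exact: measurableX.
  exact: measurable_funTS.
have H2 x : (0 <= (F \_ (setT `*` Omega)) x)%E by rewrite erestrict_ge0.
move=> /(_ H1 H2); congr (measurable_fun _ _); apply/funext => x; rewrite /fubini_F.
rewrite [RHS]integral_mkcond; apply: eq_integral => y _; rewrite !patchE; congr (if _ then _ else _).
by rewrite in_setX /= in_setT.
Qed.

(** The tangent inequality [2 c g - c^2 <= g^2], with [c] the weighted mean, integrated against a
    kernel of mass one. *)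
Lemma jensen_ker {R : realType} e (A a B b : R -> R) (g : R * (R * R) -> R) x :
  0 < e -> e < 2^-1 -> line_bump e A a -> circle_bump e B b -> loc_integrable g -> (L2sq g < +oo)%E ->
  (((\int[mu3]_(y in Omega) (g y * ker a b x y)) ^+ 2)%:E <= \int[mu3]_(y in Omega) (g y ^+ 2 * ker a b x y)%:E)%E.
Proof.
move=> e0 e2 hA hB lg g2.
have cK := continuous_ker e A a B b hA hB x.
have nK : narrow (ker a b x) by exists (`|x.1| + e) => y; exact: (ker_narrow e A a b hA).
have K0 y := ker_ge0 e A a B b hA hB x y.
have mO : measurable (Omega : set (mR R * (mR R * mR R))) by exact: measurable_Omega.
set c := \int[mu3]_(y in Omega) _.
have ig : mu3.-integrable Omega (EFin \o (fun y => g y * ker a b x y)) by exact: weak_integrable.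
have ik : mu3.-integrable Omega (EFin \o ker a b x) by exact: narrow_integrable.
have mg : measurable_fun setT g by case: lg.
have [M [M0 HM]] : exists M, 0 <= M /\ forall y, Omega y -> ker a b x y <= M.
  have cc : compact (`[- (`|x.1| + e), (`|x.1| + e)] `*` T2 : set (R * (R * R))).
    by apply: compact_setX; [exact: segment_compact|exact: compact_T2].
  have [M [M0 HM]] := continuous_compact_bounded _ (ker a b x) cc cK.
  exists M; split => // y Oy; have [h|h] := ltP (`|x.1| + e) `|y.1|.
    by rewrite (ker_narrow e A a b hA).
  apply: le_trans (ler_norm _) _; apply: HM; split; last by case: Oy.
  by rewrite /= in_itv /= -ler_norml.
have i2 : mu3.-integrable Omega (EFin \o (fun y => g y ^+ 2)).
  apply/integrableP; split.
    by apply/measurable_EFinP; apply: measurable_funTS; apply: measurable_funX.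
  apply: le_lt_trans g2; rewrite /L2sq le_eqVlt; apply/orP; left; apply/eqP.
  by apply: eq_integral => y _ /=; rewrite ger0_norm// sqr_ge0.
have i2k : mu3.-integrable Omega (EFin \o (fun y => g y ^+ 2 * ker a b x y)).
  have i3 := integrableZl mO M i2.
  apply: le_integrable i3; first exact: mO.
    apply/measurable_EFinP; apply: measurable_funTS; apply: measurable_funM; first exact: measurable_funX.
    exact: continuous_measurable3.
  move=> y Oy; have k0 := K0 y; have s0 := sqr_ge0 (g y).
  rewrite /= lee_fin (ger0_norm (mulr_ge0 s0 k0)) (ger0_norm (mulr_ge0 M0 s0)) mulrC ler_wpM2r//.
  exact: HM.
have E : c ^+ 2 = \int[mu3]_(y in Omega) (2 * c * (g y * ker a b x y) - c ^+ 2 * ker a b x y).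
  rewrite RintegralB//; last 2 first.
  - exact: (integrableZl mO (2 * c) ig).
  - exact: (integrableZl mO (c ^+ 2) ik).
  rewrite !RintegralZl// -/c (integral_ker e A a B b e0 hA hB); ring.
have i1 : mu3.-integrable Omega (EFin \o (fun y => 2 * c * (g y * ker a b x y) - c ^+ 2 * ker a b x y)).
  have j1 := integrableZl mO (2 * c) ig; have j2 := integrableZl mO (c ^+ 2) ik.
  exact: (integrableB mO j1 j2).
rewrite E /Rintegral fineK; last exact: integrable_fin_num.
apply: le_integral => // y _; rewrite lee_fin mulrA -mulrBl ler_wpM2r//.
by rewrite -subr_ge0; have := sqr_ge0 (g y - c); rewrite sqrrB; lra.
Qed.

(** [g] and the classical derivative [k] have the same integrals against test functions, hence the
    same mollifications, which converge to [k] at every point. Jensen bounds their squares by the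
    mollified [g^2]; Fatou and Tonelli conclude. *)
Lemma L2sq_le_weak {R : realType} s (f g : R * (R * R) -> R) : Cper (size s) f -> weak_deriv s f g ->
  (L2sq (pdn (rev s) f) <= L2sq g)%E.
Proof.
move=> Cf wg.
have [g2|] := ltP (L2sq g) +oo%E; last by rewrite leye_eq => /eqP ->; exact: leey.
have [_ lg _] := wg.
have [ck pk] : Cper 0 (pdn (rev s) f) by apply: Cper_pdn; rewrite size_rev addn0.
have {}ck := Ck_cont _ _ ck.
set k := pdn (rev s) f in ck pk *.
have [A [a [B [b Hb]]]] := @bump_sequence R.
have n0 n : 0 < n.+3%:R^-1 :> R by rewrite invr_gt0 ltr0n.
have n2 n : n.+3%:R^-1 < 2^-1 :> R by rewrite ltf_pV2 ?posrE ?ltr0n// ltr_nat.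
have mO : measurable (Omega : set (mR R * (mR R * mR R))) by exact: measurable_Omega.
have mg : measurable_fun setT g by case: lg.
pose F n (z : (R * (R * R)) * (R * (R * R))) : \bar R := (g z.2 ^+ 2 * ker (a n) (b n) z.1 z.2)%:E.
have F0 n z : (0 <= F n z)%E.
  by have [h1 h2] := Hb n; rewrite lee_fin mulr_ge0 ?sqr_ge0//; exact: (ker_ge0 _ _ _ _ _ h1 h2).
have mF n : measurable_fun setT (F n : (mR R * (mR R * mR R)) * (mR R * (mR R * mR R)) -> \bar R).
  apply/measurable_EFinP; apply: measurable_funM.
    by apply: measurable_funX; exact: (measurableT_comp mg measurable_snd).
  have [[sa _ _ _ _] [sb _ _ _ _]] := Hb n.
  by apply: measurable_ker; [exact: (sa 0%N)|exact: (sb 0%N)].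
pose G n x := (\int[mu3]_(y in Omega) F n (x, y))%E.
have mG n : measurable_fun setT (G n : mR R * (mR R * mR R) -> \bar R) by exact: measurable_int_Omega.
have G0 n x : (0 <= G n x)%E by apply: integral_ge0.
have kG x : Omega x -> ((k x ^+ 2)%:E <= limn_einf (G^~ x))%E.
  move=> Ox.
  pose u n : \bar R := ((\int[mu3]_(y in Omega) (k y * ker (a n) (b n) x y)) ^+ 2)%:E.
  have cu : u n @[n --> \oo] --> (k x ^+ 2)%:E.
    apply: cvg_EFin; first by apply: nearW.
    have h := moll_cvg A a B b k x Hb ck pk Ox.
    by rewrite (_ : fine \o u = fun n => (\int[mu3]_(y in Omega) (k y * ker (a n) (b n) x y)) ^+ 2) //; apply: cvgM.
  rewrite -(cvg_limn_einf_sup cu).1; apply: limn_einf_le => n.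
  have [h1 h2] := Hb n.
  rewrite /u -(weak_deriv_eq s f g _ Cf wg (test_ker _ _ _ _ _ h1 h2 x)).
  exact: (jensen_ker _ _ _ _ _ _ _ (n0 n) (n2 n) h1 h2 lg g2).
(* The kernel is symmetric, so its mass in the centre variable is also one. *)
have intG n : (\int[mu3]_(x in Omega) G n x = L2sq g)%E.
  rewrite /G.
  have := tonelli_setX _ _ _ _ mu3 mu3 Omega Omega (F n) mO mO (mF n) (F0 n).
  move=> [<- ->]; apply: eq_integral => y _.
  have [h1 h2] := Hb n.
  have -> : (\int[mu3]_(x in Omega) F n (x, y) = \int[mu3]_(x in Omega) ((g y ^+ 2)%:E * (ker (a n) (b n) y x)%:E))%E.
    by apply: eq_integral => x _; rewrite /F /= -EFinM (ker_sym _ _ _ _ _ h1 h2).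
  have ck' := continuous_ker _ _ _ _ _ h1 h2 y.
  rewrite ge0_integralZl//; last 3 first.
  - by apply: measurable_funTS; exact: measurable_EFin3.
  - by move=> x _; rewrite lee_fin; exact: (ker_ge0 _ _ _ _ _ h1 h2).
  - by rewrite lee_fin sqr_ge0.
  have ik : mu3.-integrable Omega (EFin \o ker (a n) (b n) y).
    by apply: narrow_integrable => //; exists (`|y.1| + n.+3%:R^-1) => x; exact: (ker_narrow _ _ _ _ h1).
  have E := congr1 EFin (integral_ker _ _ _ _ _ (n0 n) h1 h2 y).
  rewrite /Rintegral fineK in E; last exact: integrable_fin_num.
  by rewrite [X in (_ * X)%E]E mule1.
apply: (@le_trans _ _ (\int[mu3]_(x in Omega) limn_einf (G^~ x))%E).
  apply: ge0_le_integral => //.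
  - by move=> x _; rewrite lee_fin sqr_ge0.
  - by apply: measurable_funTS; apply: measurable_EFin3; exact: continuous_sqr.
  - apply: measurable_funTS; rewrite /limn_einf; apply: measurableT_comp => //.
    by apply: measurable_fun_limn_esup => n; exact: measurableT_comp.
have mG' n : measurable_fun Omega (G n : mR R * (mR R * mR R) -> \bar R) by apply: measurable_funTS; exact: mG.
have fat : (\int[mu3]_(x in Omega) limn_einf (G^~ x) <= limn_einf (fun n => \int[mu3]_(x in Omega) G n x))%E.
  by apply: fatou => //.
apply: le_trans fat _.
rewrite (_ : (fun n => \int[mu3]_(x in Omega) G n x)%E = fun=> L2sq g); last by apply/funext => n; exact: intG.
by rewrite limn_einf_cst.
Qed.

Lemma weak_derivsqE {R : realType} s (f : R * (R * R) -> R) : Cper (size s) f ->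
  weak_derivsq s f = L2sq (pdn (rev s) f).
Proof.
move=> Cf; apply/eqP; rewrite eq_le weak_derivsq_le//=.
by apply: le_ereal_inf_tmp => _ [g wg <-]; exact: L2sq_le_weak.
Qed.

(** * The Sobolev embedding *)

(** Young's inequality [|g psi| <= g^2 / (2 N) + N psi^2 / 2]; the weight makes the bound linear in
    [N]. *)
Lemma Rintegral_young {R : realType} (g psi : R * (R * R) -> R) (N K : R) : loc_integrable g -> continuous psi ->
  narrow psi ->
  0 < N -> (L2sq g <= (N ^+ 2)%:E)%E -> (L2sq psi <= K%:E)%E ->
  `|\int[mu3]_(x in Omega) (g x * psi x)| <= N / 2 * (1 + K).
Proof.
move=> lg cpsi npsi N0 gN pK.
have mO : measurable (Omega : set (mR R * (mR R * mR R))) by exact: measurable_Omega.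
have mg : measurable_fun setT g by case: lg.
have ig := weak_integrable g psi lg cpsi npsi.
apply: le_trans (le_normr_Rintegral mO ig) _.
have ia : mu3.-integrable Omega (EFin \o (fun x => `|g x * psi x|)) by exact: integrable_norm ig.
rewrite -lee_fin /Rintegral fineK; last exact: (integrable_fin_num mO ia).
pose c1 := (2 * N)^-1; pose c2 := N / 2.
have c10 : 0 <= c1 by rewrite invr_ge0 mulr_ge0// ltW.
have c20 : 0 <= c2 by rewrite divr_ge0// ltW.
have m1 : measurable_fun Omega (fun x : mR R * (mR R * mR R) => (g x ^+ 2)%:E).
  by apply/measurable_EFinP; apply: measurable_funTS; exact: measurable_funX.
have m2 : measurable_fun Omega (fun x : mR R * (mR R * mR R) => (psi x ^+ 2)%:E).
  by apply: measurable_funTS; apply: measurable_EFin3; exact: continuous_sqr.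
apply: (@le_trans _ _ (\int[mu3]_(x in Omega) (c1%:E * (g x ^+ 2)%:E + c2%:E * (psi x ^+ 2)%:E))%E).
  apply: ge0_le_integral => //.
  - by case/integrableP: ia.
  - by apply: emeasurable_funD; exact: measurable_funeM.
  - move=> x _; rewrite lee_fin normrM.
    have := sqr_ge0 (`|g x| - N * `|psi x|).
    rewrite -[g x ^+ 2]real_normK ?num_real// -[psi x ^+ 2]real_normK ?num_real//.
    move: (`|g x|) (`|psi x|) => u v h.
    have -> : c1 * u ^+ 2 + c2 * v ^+ 2 = u * v + c1 * (u - N * v) ^+ 2.
      by rewrite /c1 /c2; field; rewrite gt_eqF.
    by rewrite lerDl mulr_ge0.
rewrite ge0_integralD//; last 4 first.
- by move=> x _; rewrite -EFinM lee_fin mulr_ge0// sqr_ge0.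
- exact: measurable_funeM.
- by move=> x _; rewrite -EFinM lee_fin mulr_ge0// sqr_ge0.
- exact: measurable_funeM.
rewrite ge0_integralZl//; last by move=> x _; rewrite lee_fin sqr_ge0.
rewrite ge0_integralZl//; last by move=> x _; rewrite lee_fin sqr_ge0.
apply: (@le_trans _ _ (c1%:E * (N ^+ 2)%:E + c2%:E * K%:E)%E).
  by apply: leeD; apply: lee_wpmul2l.
rewrite -!EFinM -EFinD lee_fin le_eqVlt; apply/orP; left; apply/eqP.
by rewrite /c1 /c2; field; rewrite gt_eqF.
Qed.

Lemma L2sq_slab {R : realType} (psi : R * (R * R) -> R) (c D : R) : continuous psi ->
  (forall y, 1 < `|y.1 - c| -> psi y = 0) -> (forall y, Omega y -> `|psi y| <= D) ->
  (L2sq psi <= (2 * D ^+ 2)%:E)%E.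
Proof.
move=> cpsi H HD.
have D2 y : Omega y -> psi y ^+ 2 <= D ^+ 2.
  move=> /HD h; rewrite -[psi y ^+ 2]real_normK ?num_real// lerXn2r// nnegrE.
  exact: le_trans h.
rewrite L2sq_slice//.
have -> : (\int[lebesgue_measure]_x1 (\int[mu2]_(x' in T2) (psi (x1, x') ^+ 2))%:E =
   \int[lebesgue_measure]_(x1 in `[(c - 1)%R, (c + 1)%R]) (\int[mu2]_(x' in T2) (psi (x1, x') ^+ 2))%:E)%E.
  rewrite [RHS]integral_mkcond; apply: eq_integral => y _; rewrite /patch.
  case: ifPn => // yn; have yc : 1 < `|y - c|.
    rewrite ltNge; apply/negP; rewrite ler_norml => /andP[h1 h2]; move/negP: yn; apply.
    by rewrite inE /= in_itv /=; apply/andP; split; lra.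
  congr EFin; rewrite (_ : (fun x' : R * R => psi (y, x') ^+ 2) = cst 0) ?avg_cst//.
  by apply/funext => x'; rewrite H//= expr0n.
apply: (@le_trans _ _ (\int[lebesgue_measure]_(x1 in `[(c - 1)%R, (c + 1)%R]) (D ^+ 2)%:E)%E).
  apply: ge0_le_integral => //.
  - by move=> y _; rewrite lee_fin; apply: Rintegral_ge0 => x' _; exact: sqr_ge0.
  - apply: measurable_funTS; have := measurable_mean (fun x => psi x ^+ 2) (continuous_sqr _ cpsi).
    exact.
  - move=> y _; rewrite lee_fin -[leRHS](avg_cst (D ^+ 2)).
    apply: le_avg; [by apply: continuous_sqr; exact: continuous_pair1|by move=> ?; exact: cvg_cst|].
    by move=> x' Tx; apply: D2.
rewrite integral_cst//= lebesgue_measure_itv /= lte_fin.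
have -> : c - 1 < c + 1 by lra.
rewrite -EFinD -EFinM lee_fin le_eqVlt; apply/orP; left; apply/eqP; ring.
Qed.

Lemma smooth_prim {R : realType} (f f' : R -> R) : (forall y, hder f y (f' y)) -> smooth f' -> smooth f.
Proof.
by move=> hf sf [|n]; [move=> y; exact: hder_continuous (hf y)|exists f'; split => //; exact: sf].
Qed.

Lemma smooth_hder {R : realType} (f : R -> R) : smooth f -> forall y, hder f y (derive1 f y).
Proof. by move=> sf y; have [f' [h _]] := sf 1%N; rewrite (hder_derive1E _ _ h). Qed.

(** A factor [p] of a test function and the factor [p'] obtained by applying the derivations of the list [l]. *)
Definition slot {R : realType} (i : 'I_3) (p p' : R -> R) (l : seq 'I_3) : Prop :=
  smooth p /\ ((l = [::] /\ p' = p) \/ (l = [:: i] /\ forall y, hder p y (p' y))).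

Lemma slots_pdn {R : realType} (i1 i2 i3 : 'I_3) (p1 p1' p2 p2' p3 p3' : R -> R) l1 l2 l3 :
  val i1 = 0%N -> val i2 = 1%N -> val i3 = 2%N ->
  smooth p3' -> smooth p2' ->
  slot i1 p1 p1' l1 -> slot i2 p2 p2' l2 -> slot i3 p3 p3' l3 ->
  pdn (l1 ++ l2 ++ l3) (tens p1 p2 p3) = tens p1' p2' p3'.
Proof.
move=> v1 v2 v3 sp3' sp2' [s1 h1] [s2 h2] [s3 h3]; rewrite !pdn_cat.
have -> : pdn l3 (tens p1 p2 p3) = tens p1 p2 p3'.
  case: h3 => -[-> h3] /=; first by rewrite h3.
  have [_ ->] := tens_pd i3 p1 _ p2 _ p3 p3' (smooth_hder _ s1) (smooth_hder _ s2) h3.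
  by rewrite v3.
have -> : pdn l2 (tens p1 p2 p3') = tens p1 p2' p3'.
  case: h2 => -[-> h2] /=; first by rewrite h2.
  have [_ ->] := tens_pd i2 p1 _ p2 p2' p3' _ (smooth_hder _ s1) h2 (smooth_hder _ sp3').
  by rewrite v2.
case: h1 => -[-> h1] /=; first by rewrite h1.
have [_ ->] := tens_pd i1 p1 p1' p2' _ p3' _ h1 (smooth_hder _ sp2') (smooth_hder _ sp3').
by rewrite v1.
Qed.

Lemma smoothB {R : realType} (f g : R -> R) : smooth f -> smooth g -> smooth (fun y => f y - g y).
Proof.
move=> sf sg n; rewrite (_ : (fun y => _) = fun y => f y + (-1) * g y).
  by apply: smD => //; exact: smZ.
by apply/funext => y; rewrite mulN1r.
Qed.

(** The Dirac approximations [a], [b] of each variable are split as a fixed smooth function plus the derivative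
    of a bounded function, so that [f x] is a sum of integrals of weak derivatives of [f] against bounded
    functions. *)
Lemma sobolev_sup {R : realType} : exists C : R, 0 < C /\ forall (f : R * (R * R) -> R) (M : R), Cper 1 f -> 0 < M ->
  (forall s, (size s <= 4)%N -> (weak_derivsq s f <= (M ^+ 2)%:E)%E) ->
  forall x, Omega x -> `|f x| <= C * M /\ forall i, `|pd i f x| <= C * M.
Proof.
have [A1 [a1 h1]] := line_bump_exists (1 : R) ltr01.
have [sa1 dA1 a10 a1z [A10 A11]] := h1.
have [D1 [D10 HD1]] : exists D, 0 <= D /\ forall y, `|a1 y| <= D.
  have [D [D0 HD]] := continuous_compact_bounded (`[-1, 1]%classic : set R) a1 (@segment_compact _ _ _) (sa1 0%N).
  exists D; split => // y; have [h|h] := leP 1 `|y|; first by rewrite a1z// normr0.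
  by apply: HD; rewrite /= in_itv /= -ler_norml ltW.
(* Bound of the tensor test functions on the cell: [1 + D1] for the factor in [x1], [2] for each
   periodic factor. *)
pose D := (1 + D1) * 2 * 2.
have D0 : 0 <= D by rewrite !mulr_ge0// addr_ge0.
pose K := 2 * D ^+ 2.
have K0 : 0 <= K by rewrite mulr_ge0// sqr_ge0.
exists (8 * (1 + K)); split; first by rewrite mulr_gt0//; lra.
move=> f M Cf M0 Hf x Ox.
suff main sg : (size sg <= 1)%N -> `|pdn sg f x| <= 8 * (1 + K) * M.
  by split; [exact: (main [::])|move=> i; exact: (main [:: i])].
move=> sg1.
have [ck pk] : Cper 0 (pdn sg f) by apply: Cper_pdn; apply: Cper_le Cf; rewrite addn0.
have {}ck := Ck_cont _ _ ck.
pose I (phi : R * (R * R) -> R) := \int[mu3]_(y in Omega) (pdn sg f y * phi y).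
(* One derivative from [sg] and three from the kernel make four, which explains the order of the
   hypothesis. [f] is only [C^1], so [sg] is moved to the test function by a single classical
   integration by parts, and the weak derivatives do the rest. *)
have key s psi : (size s <= 3)%N -> test_fun psi -> (L2sq psi <= K%:E)%E -> `|I (pdn s psi)| <= (1 + K) * M.
  move=> s3 tpsi psiK.
  have cpsi : continuous psi by case: tpsi => _ /(_ 0%N)[h _] _; exact: (h [::]).
  have npsi : narrow psi by case: tpsi.
  have low s' : (size s' <= 4)%N -> `|\int[mu3]_(y in Omega) (f y * pdn s' psi y)| <= (1 + K) * M.
    move=> s4; have := Hf s' s4; move=> wM.
    (* A strict inequality is required to extract a weak derivative from the infimum; the factor [2]
       provides it. *)
    have : (weak_derivsq s' f < ((2 * M) ^+ 2)%:E)%E.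
      by apply: le_lt_trans wM _; rewrite lte_fin exprMn ltr_pMl ?exprn_gt0// expr2; lra.
    move=> /ereal_inf_lt[_ [g [_ lg wg] <-] gM].
    rewrite (wg psi tpsi) normrM normrX normrN normr1 expr1n mul1r.
    have M2 : 0 < 2 * M by rewrite mulr_gt0.
    apply: le_trans (Rintegral_young g psi (2 * M) K lg cpsi npsi M2 (ltW gM) psiK) _.
    by rewrite le_eqVlt; apply/orP; left; apply/eqP; field.
  case: sg sg1 @I {ck pk} => [|i [|//]] _ /=; first by apply: low; exact: leq_trans s3 _.
  by rewrite -normrN -(ibp f (pdn s psi) i Cf (test_pdn _ _ tpsi)); exact: (low (i :: s)).
have test_cont (psi : R * (R * R) -> R) : test_fun psi -> continuous psi /\ narrow psi.
  by move=> [_ /(_ 0%N)[h _] n]; split => //; exact: (h [::]).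
have split_I phi phi1 phi2 : test_fun phi1 -> test_fun phi2 -> (forall y, phi y = phi1 y + phi2 y) ->
    `|I phi| <= `|I phi1| + `|I phi2|.
  move=> /test_cont[c1 n1] /test_cont[c2 n2] E.
  rewrite /I; have -> : \int[mu3]_(y in Omega) (pdn sg f y * phi y) =
      \int[mu3]_(y in Omega) (pdn sg f y * phi1 y + pdn sg f y * phi2 y).
    by apply: eq_Rintegral => y _; rewrite E mulrDr.
  have lk := loc_integrable_continuous _ ck.
  rewrite RintegralD; [exact: ler_normD|exact: measurable_Omega|exact: weak_integrable|exact: weak_integrable].
apply/ler_addgt0Pr => eta eta0.
have [e1 [e10 He1]] := continuous_box (pdn sg f) x eta ck eta0.
pose e := Num.min e1 (4^-1).
have e0 : 0 < e by rewrite lt_min e10 invr_gt0 ltr0n.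
have ee1 : e <= e1 by rewrite ge_min lexx.
have e4 : e <= 4^-1 by rewrite ge_min lexx orbT.
have e2 : e < 2^-1 by apply: le_lt_trans e4 _; rewrite ltf_pV2 ?posrE ?ltr_nat.
have el1 : e <= 1 by lra.
have [A [a hA]] := line_bump_exists e e0.
have [B [b hB]] := circle_bump_exists e e0 e2.
have [sa dA a0 az [A0 A1']] := hA; have [sb dB0 b0 bp [B0 _]] := hB.
have moll := ker_moll e A a B b e0 hA hB (pdn sg f) x eta ck pk Ox
  (fun z z1 z2 z3 => He1 z (lt_le_trans z1 ee1) (lt_le_trans z2 ee1) (lt_le_trans z3 ee1)).
suff : `|I (ker a b x)| <= 8 * (1 + K) * M.
  have := ler_normB (I (ker a b x)) (I (ker a b x) - pdn sg f x).
  by rewrite opprB addrC subrK; move: moll; rewrite -/(I _); lra.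
have Am u v : u <= v -> A u <= A v.
  by move=> uv; apply: (mono_seg A a) => // y _; exact: (a0 y).1.
have A1m u v : u <= v -> A1 u <= A1 v.
  by move=> uv; apply: (mono_seg A1 a1) => // y _; exact: (a10 y).1.
have Bm u v : u <= v -> B u <= B v.
  by move=> uv; apply: (mono_seg B b) => // y _; exact: (b0 y).1.
have A01 u : 0 <= A u <= 1.
  apply/andP; split.
    by rewrite -(A0 (Num.min u (- e))) ?Am// ge_min lexx ?orbT.
  by rewrite -(A1' (Num.max u e)) ?Am// le_max lexx ?orbT.
have A101 u : 0 <= A1 u <= 1.
  apply/andP; split.
    by rewrite -(A10 (Num.min u (- 1))) ?A1m// ge_min lexx ?orbT.
  by rewrite -(A11 (Num.max u 1)) ?A1m// le_max lexx ?orbT.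
(* [al] is the concentrated bump, [be] the fixed one of width one, and [ps] is bounded with
   [ps' = al - be]. Likewise [th c] is bounded on the cell with derivative [ga c - 1]. None of these
   bounds depends on [e]. *)
pose al t := a (t - x.1); pose be t := a1 (t - x.1); pose ps t := A (t - x.1) - A1 (t - x.1).
pose ga c t := b (t - c); pose th c t := B (t - c) - (t - c).
have sal : smooth al by exact: smooth_shift.
have sbe : smooth be by exact: smooth_shift.
have sga c : smooth (ga c) by exact: smooth_shift.
have s1 : smooth (fun _ : R => 1 : R) by move=> n; exact: sm_cst.
have dps y : hder ps y (al y - be y) by exact: (dB _ _ _ _ _ (hder_shift A a x.1 dA y) (hder_shift A1 a1 x.1 dA1 y)).
have sps' : smooth (fun y => al y - be y) by exact: smoothB.
have sps : smooth ps by exact: smooth_prim dps sps'.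
have dth c y : hder (th c) y (ga c y - 1).
  have h := dB _ _ _ _ _ (hder_shift B b c dB0 y) (dB _ _ _ _ _ (did y) (dcst c y)).
  by apply: hder_eq h _; rewrite subr0.
have sth' c : smooth (fun y => ga c y - 1) by exact: smoothB.
have sth c : smooth (th c) by exact: smooth_prim (dth c) (sth' c).
have pga c y : ga c (y + 1) = ga c y by rewrite /ga addrAC (bp _).1.
have pth c y : th c (y + 1) = th c y by rewrite /th addrAC (bp _).2; ring.
have out c : 1 < `|c| -> [/\ a c = 0, a1 c = 0 & A c = A1 c].
  move=> h; split; [by apply: az; lra|by apply: a1z; exact: ltW|].
  have [c0|c0] := leP 0 c; first by rewrite ger0_norm// in h; rewrite A1' ?A11//; lra.
  by rewrite ltr0_norm// in h; rewrite A0 ?A10//; lra.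
have zal t : 1 < `|t - x.1| -> al t = 0 by move=> /out[].
have zbe t : 1 < `|t - x.1| -> be t = 0 by move=> /out[].
have zps t : 1 < `|t - x.1| -> ps t = 0 by move=> /out[_ _ h]; rewrite /ps h subrr.
have far t : `|x.1| + 1 < `|t| -> 1 < `|t - x.1|.
  by have := ler_normD (t - x.1) x.1; rewrite subrK; lra.
have test p1 p2 p3 : smooth p1 -> smooth p2 -> smooth p3 -> (forall t, 1 < `|t - x.1| -> p1 t = 0) ->
    (forall y, p2 (y + 1) = p2 y) -> (forall y, p3 (y + 1) = p3 y) -> test_fun (tens p1 p2 p3).
  by move=> u1 u2 u3 u4 u5 u6; apply: (test_tens _ _ _ (`|x.1| + 1)) => // y /far; exact: u4.
have thB c t : c \in `[0, 1] -> t \in `[0, 1] -> `|th c t| <= 2.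
  rewrite !in_itv /= => /andP[c0 c1] /andP[t0 t1].
  have l1 : B (t - c) <= 1.
    have -> : 1 = B 1 by have := (bp 0).2; rewrite add0r B0 add0r.
    by apply: Bm; lra.
  have l2 : -1 <= B (t - c).
    have -> : -1 = B (-1) by have := (bp (-1)).2; rewrite addNr B0; lra.
    by apply: Bm; lra.
  by rewrite /th ler_norml; apply/andP; split; lra.
have p1B t : `|be t| <= 1 + D1 /\ `|ps t| <= 1 + D1.
  split; first by have := HD1 (t - x.1); rewrite /be; lra.
  have /andP[? ?] := A01 (t - x.1); have /andP[? ?] := A101 (t - x.1).
  by rewrite /ps ler_norml; apply/andP; split; lra.
have [x2 x3] : x.2.1 \in `[0, 1] /\ x.2.2 \in `[0, 1] by case: Ox => _ [].
pose i1 : 'I_3 := Ordinal (isT : (0 < 3)%N); pose i2 : 'I_3 := Ordinal (isT : (1 < 3)%N).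
pose i3 : 'I_3 := Ordinal (isT : (2 < 3)%N).
have fin p1 p1' l1 p2 p2' l2 p3 p3' l3 : slot i1 p1 p1' l1 -> slot i2 p2 p2' l2 -> slot i3 p3 p3' l3 ->
    (size l1 <= 1)%N -> (size l2 <= 1)%N -> (size l3 <= 1)%N ->
    smooth p2' -> smooth p3' ->
    (forall t, 1 < `|t - x.1| -> p1 t = 0) -> (forall y, p2 (y + 1) = p2 y) -> (forall y, p3 (y + 1) = p3 y) ->
    (forall t, `|p1 t| <= 1 + D1) -> (forall t, t \in `[0, 1] -> `|p2 t| <= 2) -> (forall t, t \in `[0, 1] -> `|p3 t|
      <= 2) ->
    `|I (tens p1' p2' p3')| <= (1 + K) * M.
  move=> u1 u2 u3 v1 v2 v3 w2 w3 z1 z2 z3 B1 B2 B3.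
  rewrite -(slots_pdn i1 i2 i3 p1 p1' p2 p2' p3 p3' l1 l2 l3 erefl erefl erefl w3 w2 u1 u2 u3).
  have t123 := test p1 p2 p3 u1.1 u2.1 u3.1 z1 z2 z3.
  apply: key => //.
    by rewrite !size_cat; apply: (@leq_trans (1 + (1 + 1))) => //; do 2 (apply: leq_add => //).
  apply: (L2sq_slab _ x.1); first by have [] := test_cont _ t123.
    by move=> y h; rewrite /tens z1// !mul0r.
  move=> y [_ [y2 y3]]; rewrite /tens !normrM /D.
  by apply: ler_pM => //; [apply: ler_pM => //; exact: B2|exact: B3].
have o1 : slot i1 be be [::] by split => //; left.
have o1' : slot i1 ps (fun y => al y - be y) [:: i1] by split => //; right.
have o2 (i : 'I_3) : slot i (fun _ : R => 1 : R) (fun=> 1) [::] by split => //; left.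
have o2' (i : 'I_3) c : slot i (th c) (fun y => ga c y - 1) [:: i] by split => //; right; split => //; exact: dth.
have n12 (t : R) : t \in `[0, 1] -> `|1 : R| <= 2 by rewrite normr1; lra.
pose QM := (1 + K) * M.
have L3 p1 p1' l1 p2 p2' l2 : slot i1 p1 p1' l1 -> slot i2 p2 p2' l2 ->
    (size l1 <= 1)%N -> (size l2 <= 1)%N -> smooth p1' -> smooth p2' ->
    (forall t, 1 < `|t - x.1| -> p1 t = 0) -> (forall t, 1 < `|t - x.1| -> p1' t = 0) ->
    (forall y, p2 (y + 1) = p2 y) -> (forall y, p2' (y + 1) = p2' y) ->
    (forall t, `|p1 t| <= 1 + D1) -> (forall t, t \in `[0, 1] -> `|p2 t| <= 2) ->
    `|I (tens p1' p2' (ga x.2.2))| <= QM + QM.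
  move=> u1 u2 v1 v2 w1 w2 z1 z1' z2 z2' B1 B2.
  apply: le_trans (split_I _ (tens p1' p2' (fun=> 1)) (tens p1' p2' (fun y => ga x.2.2 y - 1)) _ _ _) _.
  - exact: test.
  - by apply: test => // y; rewrite pga.
  - by move=> y; rewrite /tens; ring.
  apply: lerD.
    by apply: (fin _ _ _ _ _ _ _ _ _ u1 u2 (o2 i3)).
  by apply: (fin _ _ _ _ _ _ _ _ _ u1 u2 (o2' i3 x.2.2)) => // t; exact: thB.
have L2 p1 p1' l1 : slot i1 p1 p1' l1 -> (size l1 <= 1)%N -> smooth p1' ->
    (forall t, 1 < `|t - x.1| -> p1 t = 0) -> (forall t, 1 < `|t - x.1| -> p1' t = 0) ->
    (forall t, `|p1 t| <= 1 + D1) ->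
    `|I (tens p1' (ga x.2.1) (ga x.2.2))| <= (QM + QM) + (QM + QM).
  move=> u1 v1 w1 z1 z1' B1.
  apply: le_trans (split_I _ (tens p1' (fun=> 1) (ga x.2.2)) (tens p1' (fun y => ga x.2.1 y - 1) (ga x.2.2)) _ _ _) _.
  - by apply: test.
  - by apply: test => // y; rewrite pga.
  - by move=> y; rewrite /tens; ring.
  apply: lerD.
    by apply: (L3 _ _ _ _ _ _ u1 (o2 i2)).
  by apply: (L3 _ _ _ _ _ _ u1 (o2' i2 x.2.1)) => // y; [rewrite pga|exact: thB].
(* Two choices in each of the three variables give eight terms, each at most [QM]. *)
have : `|I (ker a b x)| <= ((QM + QM) + (QM + QM)) + ((QM + QM) + (QM + QM)).
  apply: le_trans (split_I _ (tens be (ga x.2.1) (ga x.2.2)) (tens (fun y => al y - be y) (ga x.2.1) (ga x.2.2)) _ _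
    _) _.
  - by apply: test.
  - by apply: test => // t h; rewrite zal// zbe// subrr.
  - by move=> y; rewrite /ker /tens /al /ga; ring.
  apply: lerD.
    by apply: (L2 _ _ _ o1) => // t; have [] := p1B t.
  apply: (L2 _ _ _ o1') => //; first by move=> t h; rewrite zal// zbe// subrr.
  by move=> t; have [] := p1B t.
by rewrite /QM; lra.
Qed.

(** * Functions of x_1 up to fluctuations *)

Section oscillation.
Context {R : realType} {I : Type}.
Variable adm : I -> Prop.
Notation fam := (I -> R * (R * R) -> R).

Definition oscs (L : seq fam) (i : I) : seq (R * (R * R) -> R) := [seq neq (f i) | f <- L].

(** Being a function of [x1] up to [l] times fluctuations passes to sums, products and compositions,
    which lets the estimates be read off the structure of the nonlinear terms. *)
Definition osc (L : seq fam) (k l : I -> R) (a : fam) : Prop :=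
  exists C : R, 0 <= C /\ forall i, adm i -> exists c : R -> R, forall x, Omega x ->
    [/\ `|a i x| <= C * k i, `|c x.1| <= C * k i & `|a i x - c x.1| <= C * l i * sum_abs (oscs L i) x].

Lemma sum_abs_ge0 (fs : seq (R * (R * R) -> R)) x : 0 <= sum_abs fs x.
Proof. by rewrite /sum_abs; apply: sumr_ge0. Qed.

Lemma sum_abs_ge (fs : seq (R * (R * R) -> R)) f x : List.In f fs -> `|f x| <= sum_abs fs x.
Proof.
rewrite /sum_abs; elim: fs => [//|g fs IH] /= [->|/IH h]; rewrite big_cons.
  by rewrite lerDl sumr_ge0.
by apply: le_trans h _; rewrite lerDr.
Qed.

Lemma oscD L k l a b : osc L k l a -> osc L k l b -> osc L k l (fun i x => a i x + b i x).
Proof.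
move=> [C [C0 HC]] [D [D0 HD]]; exists (C + D); split; first exact: addr_ge0.
move=> i ai; have [c Hc] := HC i ai; have [d Hd] := HD i ai.
exists (fun y => c y + d y) => x Ox; have [h1 h2 h3] := Hc x Ox; have [h4 h5 h6] := Hd x Ox.
rewrite !mulrDl; split.
- by apply: le_trans (ler_normD _ _) _; exact: lerD.
- by apply: le_trans (ler_normD _ _) _; exact: lerD.
- rewrite (_ : a i x + b i x - _ = (a i x - c x.1) + (b i x - d x.1)); last by ring.
  by apply: le_trans (ler_normD _ _) _; exact: lerD.
Qed.

(** In [a b - c d = a (b - d) + (a - c) d], each fluctuation factor meets the size of the other
    function. *)
Lemma oscM L k1 l1 k2 l2 a b : osc L k1 l1 a -> osc L k2 l2 b ->
  osc L (fun i => k1 i * k2 i) (fun i => k1 i * l2 i + l1 i * k2 i) (fun i x => a i x * b i x).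
Proof.
move=> [C [C0 HC]] [D [D0 HD]]; exists (C * D); split; first exact: mulr_ge0.
move=> i ai; have [c Hc] := HC i ai; have [d Hd] := HD i ai.
exists (fun y => c y * d y) => x Ox; have [h1 h2 h3] := Hc x Ox; have [h4 h5 h6] := Hd x Ox.
have E : C * D * (k1 i * k2 i) = (C * k1 i) * (D * k2 i) by ring.
split.
- by rewrite E normrM; exact: ler_pM.
- by rewrite E normrM; exact: ler_pM.
- rewrite (_ : a i x * b i x - _ = a i x * (b i x - d x.1) + (a i x - c x.1) * d x.1); last by ring.
  apply: le_trans (ler_normD _ _) _; rewrite !normrM.
  rewrite (_ : C * D * _ * _ = (C * k1 i) * (D * l2 i * sum_abs (oscs L i) x) + (C * l1 i * sum_abs (oscs L i) x) *
    (D * k2 i)); last by ring.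
  by apply: lerD; exact: ler_pM.
Qed.

Lemma osc_weak L k l k' l' a : (exists D : R, 0 <= D /\ forall i, adm i -> k i <= D * k' i /\ l i <= D * l' i) ->
  osc L k l a -> osc L k' l' a.
Proof.
move=> [D [D0 HD]] [C [C0 HC]]; exists (C * D); split; first exact: mulr_ge0.
move=> i ai; have [c Hc] := HC i ai; have [d1 d2] := HD i ai.
exists c => x Ox; have [h1 h2 h3] := Hc x Ox; split.
- by apply: le_trans h1 _; rewrite -mulrA ler_wpM2l.
- by apply: le_trans h2 _; rewrite -mulrA ler_wpM2l.
- by apply: le_trans h3 _; rewrite ler_wpM2r ?sum_abs_ge0// -mulrA ler_wpM2l.
Qed.

Lemma osc_fst L k l (g : I -> R -> R) : (forall i, adm i -> 0 <= l i) ->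
  (exists C : R, forall i, adm i -> forall y, `|g i y| <= C * k i) -> (forall i, adm i -> 0 <= k i) ->
  osc L k l (fun i x => g i x.1).
Proof.
move=> l0 [C HC] k0; exists `|C|; split => // i ai; exists (g i) => x Ox.
have h : `|g i x.1| <= `|C| * k i.
  by apply: le_trans (HC i ai x.1) _; rewrite ler_wpM2r ?k0// ler_norm.
split => //; rewrite subrr normr0 mulr_ge0 ?sum_abs_ge0// mulr_ge0// l0//.
Qed.

Lemma norm_mean_le (f : R * (R * R) -> R) (M : R) x : continuous f -> (forall x, Omega x -> `|f x| <= M) ->
  Omega x -> `|mean f x.1| <= M.
Proof.
by move=> cf H [_ _]; apply: norm_avg_le; [exact: continuous_pair1|move=> x' T; exact: H].
Qed.

(** The function of [x1] is [Phi] evaluated at the zero mode of [f]; the Lipschitz bound turns the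
    difference into a fluctuation. *)
Lemma osc_comp L k l (f : fam) (r : I -> R) (Phi : I -> R -> R -> R) : List.In f L ->
  (forall i, adm i -> continuous (f i) /\ forall x, Omega x -> `|f i x| <= r i) ->
  (exists C : R, 0 <= C /\ forall i, adm i -> 0 <= l i /\ forall y u v, `|u| <= r i -> `|v| <= r i ->
     `|Phi i y u| <= C * k i /\ `|Phi i y u - Phi i y v| <= C * l i * `|u - v|) ->
  osc L k l (fun i x => Phi i x.1 (f i x)).
Proof.
move=> fL Hf [C [C0 HC]]; exists C; split => // i ai.
have [cf fr] := Hf i ai; have [l0 HP] := HC i ai.
exists (fun y => Phi i y (mean (f i) y)) => x Ox.
have mr : `|mean (f i) x.1| <= r i by exact: norm_mean_le.
have [h1 h2] := HP x.1 _ _ (fr x Ox) mr; have [h3 _] := HP x.1 _ _ mr mr.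
split => //; apply: le_trans h2 _; rewrite ler_wpM2l ?mulr_ge0//.
have -> : f i x - mean (f i) x.1 = neq (f i) x by [].
by apply: sum_abs_ge; rewrite /oscs; elim: (L) fL => [//|g L' IH] /= [->|/IH]; [left|right].
Qed.

(** The structure together with that of the first derivatives, as the [H^1] norm of a fluctuation
    requires. *)
Definition osc1 (L : seq fam) (k l : I -> R) (a : fam) : Prop :=
  [/\ forall i, adm i -> Cper 1 (a i), osc L k l a & forall j, osc L k l (fun i => pd j (a i))].

Lemma osc_ext L k l a b : (forall i, adm i -> a i = b i) -> osc L k l a -> osc L k l b.
Proof.
move=> E [C [C0 HC]]; exists C; split => // i ai; have [c Hc] := HC i ai.
by exists c => x Ox; rewrite -(E i ai); exact: Hc.
Qed.

Lemma CperM n (f g : R * (R * R) -> R) : Cper n f -> Cper n g -> Cper n (fun x => f x * g x).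
Proof.
move=> [cf pf] [cg pg]; split; first exact: CkM.
by move=> x1 x2 x3; have [-> ->] := pf x1 x2 x3; have [-> ->] := pg x1 x2 x3.
Qed.

Lemma CperD n (f g : R * (R * R) -> R) : Cper n f -> Cper n g -> Cper n (fun x => f x + g x).
Proof.
move=> [cf pf] [cg pg]; split; first exact: CkD.
by move=> x1 x2 x3; have [-> ->] := pf x1 x2 x3; have [-> ->] := pg x1 x2 x3.
Qed.

Lemma osc1D L k l a b : osc1 L k l a -> osc1 L k l b -> osc1 L k l (fun i x => a i x + b i x).
Proof.
move=> [ca oa da] [cb ob db]; split; [by move=> i ai; apply: CperD; [exact: ca|exact: cb]|exact: oscD|].
move=> j; apply: osc_ext (oscD _ _ _ _ _ (da j) (db j)) => i ai.
have [_ ->] // := pdD j (a i) (b i) (fun x => Ck_der 0 (a i) j x (ca i ai).1) (fun x => Ck_der 0 (b i) j x (cb i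
  ai).1).
Qed.

Lemma osc1_weak L k l k' l' a : (exists D : R, 0 <= D /\ forall i, adm i -> k i <= D * k' i /\ l i <= D * l' i) ->
  osc1 L k l a -> osc1 L k' l' a.
Proof. by move=> H [ca oa da]; split => //; [exact: osc_weak oa|move=> j; exact: osc_weak (da j)]. Qed.

Lemma osc1M L k1 l1 k2 l2 a b : osc1 L k1 l1 a -> osc1 L k2 l2 b ->
  osc1 L (fun i => k1 i * k2 i) (fun i => k1 i * l2 i + l1 i * k2 i) (fun i x => a i x * b i x).
Proof.
move=> [ca oa da] [cb ob db]; split; [by move=> i ai; apply: CperM; [exact: ca|exact: cb]|exact: oscM|].
move=> j; apply: osc_ext (oscD _ _ _ _ _ (oscM _ _ _ _ _ _ _ (da j) ob) (oscM _ _ _ _ _ _ _ oa (db j))) => i ai.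
have [_ ->] // := pdM j (a i) (b i) (fun x => Ck_der 0 (a i) j x (ca i ai).1) (fun x => Ck_der 0 (b i) j x (cb i
  ai).1).
Qed.

Lemma all_cont_oscs L i : (forall f, List.In f L -> continuous (f i)) -> all_cont (oscs L i).
Proof.
rewrite /oscs; elim: L => [//|f L IH] H /=; split; first by apply: neq_continuous; apply: H; left.
by apply: IH => g gL; apply: H; right.
Qed.

Lemma size_oscs L i : size (oscs L i) = size L.
Proof. by rewrite /oscs size_map. Qed.

Lemma sume_In_le (fs : seq (R * (R * R) -> R)) (F : (R * (R * R) -> R) -> \bar R) (B : \bar R) :
  (0 <= B)%E -> (forall f, List.In f fs -> (F f <= B)%E) -> (\sum_(f <- fs) F f <= (size fs)%:R%:E * B)%E.
Proof.
move=> B0; elim: fs => [|f fs IH] H; first by rewrite big_nil mul0e.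
rewrite big_cons /= -natr1 EFinD ge0_muleDl ?lee_fin//.
by rewrite mul1e addeC; apply: leeD; [apply: IH => g hg; apply: H; right|apply: H; left].
Qed.

Lemma In_oscs L i g : List.In g (oscs L i) -> exists f, List.In f L /\ g = neq (f i).
Proof.
rewrite /oscs; elim: L => [//|f L IH] /= [<-|/IH [h [h1 h2]]]; first by exists f; split => //; left.
by exists h; split => //; right.
Qed.

(** [neq] cancels the function of [x1], and [Q] stands for a squared norm dominating every
    fluctuation in [L]. *)
Lemma osc_L2 L k l a (Q : I -> \bar R) : osc L k l a -> (forall i, adm i -> continuous (a i)) ->
  (forall i, adm i -> 0 <= l i) ->
  (forall i, adm i -> (0 <= Q i)%E /\ forall f, List.In f L -> continuous (f i)) ->
  (exists D : R, 0 <= D /\ forall i, adm i -> forall f, List.In f L -> (L2sq (neq (f i)) <= D%:E * Q i)%E) ->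
  exists C : R, 0 <= C /\ forall i, adm i -> (L2sq (neq (a i)) <= (C * l i ^+ 2)%:E * Q i)%E.
Proof.
move=> [C [C0 HC]] ca l0 HQ [D [D0 HD]].
pose n : R := (size L)%:R.
exists (2 * C ^+ 2 * n * (n * D)); split; first by rewrite !mulr_ge0 ?sqr_ge0.
move=> i ai; have [c Hc] := HC i ai; have [Q0 cL] := HQ i ai.
have bnd := neq_L2_bound (a i) (oscs L i) [::] (C * l i) c (ca i ai) (all_cont_oscs L i cL) Logic.I
  (mulr_ge0 C0 (l0 i ai)).
apply: le_trans (bnd _) _.
  by move=> x Ox; have [_ _ h] := Hc x Ox; rewrite {2}/sum_abs big_nil addr0.
rewrite big_nil mule0 adde0 size_oscs.
have S : (\sum_(f <- oscs L i) L2sq f <= n%:E * (D%:E * Q i))%E.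
  rewrite /n -(size_oscs L i); apply: sume_In_le; first by rewrite mule_ge0// lee_fin.
  by move=> g /In_oscs[f [fL ->]]; exact: HD.
have c0 : 0 <= 2 * (C * l i) ^+ 2 * (size L)%:R :> R by apply: mulr_ge0 => //; apply: mulr_ge0 => //; exact: sqr_ge0.
apply: (@le_trans _ _ ((2 * (C * l i) ^+ 2 * (size L)%:R)%:E * (n%:E * (D%:E * Q i)))%E).
  exact: lee_wpmul2l.
rewrite !muleA -!EFinM le_eqVlt; apply/orP; left; apply/eqP; congr (_%:E * _)%E.
by rewrite -/n; ring.
Qed.

(** The second derivatives [pd m (pd j (f i))] are not bounded pointwise: their zero modes are paired with
    fluctuations through the one-dimensional embedding of [L2sq_neq_bar]. *)
Lemma osc1_second L L0 k l n w a f m j (Q : I -> \bar R) :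
  osc1 L k l a -> osc L0 k l a -> (forall i, adm i -> Cper 2 (f i)) -> osc L n w (fun i => pd j (f i)) ->
  (forall i, adm i -> [/\ 0 <= k i, 0 <= l i, 0 <= n i & 0 <= w i]) ->
  (forall i, adm i -> [/\ (0 <= Q i)%E, forall g, List.In g L -> continuous (g i) & forall g, List.In g L0 -> Cper 1
    (g i)]) ->
  (exists D : R, 0 <= D /\ forall i, adm i ->
     [/\ forall g, List.In g L -> (L2sq (neq (g i)) <= D%:E * Q i)%E,
      forall g, List.In g L0 -> (L2sq (neq (g i)) <= D%:E * Q i)%E /\ (L2sq (neq (pd ord0 (g i))) <= D%:E * Q i)%E,
      (L2sq (neq (pd m (pd j (f i)))) <= D%:E * Q i)%E & (L2sq (pd m (pd j (f i))) <= (D * n i ^+ 2)%:E)%E]) ->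
  exists C : R, 0 <= C /\ forall i, adm i ->
    (L2sq (neq (pd m (fun x => (a i x * pd j (f i) x)%R))) <= (C * (k i + l i * n i + k i * w i) ^+ 2)%:E * Q i)%E.
Proof.
move=> [ca oa da] oa0 cf ofj pos HQ [D [D0 HD]].
have [C1 [C10 H1]] := oscM _ _ _ _ _ _ _ (da m) ofj.
have [C2 [C20 H2]] := oa0.
pose C := C1 + C2; have C0 : 0 <= C by exact: addr_ge0.
pose s : R := (size L)%:R; pose s0 : R := (size L0)%:R.
have s_ge0 : 0 <= s by []. have s0_ge0 : 0 <= s0 by [].
exists (2 * C ^+ 2 * (s + 1) * ((s + 1) * D) + 2 * s0 * (s0 * (C ^+ 2 * (2 * (D + D) * D)))); split.
  by rewrite addr_ge0// !mulr_ge0 ?sqr_ge0 ?addr_ge0 ?mulr_ge0.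
move=> i ai; have [k0 l0 n0 w0] := pos i ai; have [Q0 cL cL0] := HQ i ai; have [d1 d2 d3 d4] := HD i ai.
have [c1 Hc1] := H1 i ai; have [c2 Hc2] := H2 i ai.
have Cai := ca i ai; have Cfi := cf i ai; have Cfj := Cper_pd _ _ j Cfi.
set b := pd m (pd j (f i)).
have Cb : Cper 0 b by exact: Cper_pd.
have cb : continuous b by exact: (Ck_cont _ _ Cb.1).
have [_ pdE] := pdM m (a i) (pd j (f i)) (fun x => Ck_der 0 (a i) m x Cai.1) (fun x => Ck_der 0 (pd j (f i)) m x
  Cfj.1).
rewrite pdE.
have cpa : continuous (pd m (a i)) by exact: (Ck_cont 0 _ (Cper_pd _ _ m Cai).1).
have cai : continuous (a i) by exact: (Ck_cont _ _ Cai.1).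
have cfj : continuous (pd j (f i)) by exact: (Ck_cont _ _ Cfj.1).
have cbar : continuous (bar b).
  by move=> x; apply: (continuous_comp (f := fst)); [exact: cvg_fst|exact: mean_continuous].
pose W := k i + l i * n i + k i * w i.
have W0 : 0 <= W by rewrite /W !addr_ge0 ?mulr_ge0.
(* Fluctuations multiplied by the zero mode of the second derivative [b]. The small factor is put
   inside, since their L2 norm comes from [L2sq_neq_bar] and not from a sup bound. *)
pose gs := [seq (fun x : R * (R * R) => (C * l i) * (neq (g i) x * bar b x)) | g <- L0].
have cgs : all_cont gs.
  rewrite /gs; elim: (L0) cL0 => [//|g L' IH] H /=; split.
    move=> x; apply: cvgM; first exact: cvg_cst.
    apply: cvgM; last exact: cbar.
    by apply: neq_continuous; apply: (Ck_cont _ _ (H g (or_introl erefl)).1).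
  by apply: IH => h hL; apply: H; right.
have gsE x : sum_abs gs x = C * l i * (sum_abs (oscs L0 i) x * `|bar b x|).
  rewrite /sum_abs /gs /oscs; elim: (L0) => [|g L' IH]; first by rewrite !big_nil mul0r mulr0.
  rewrite /= !big_cons IH !normrM (ger0_norm C0) (ger0_norm l0); ring.
(* The subtracted function of [x1] is [c1 + c2 mean b], so that [a b] leaves only [a neq b] and
   [(a - c2) bar b]. *)
have bnd := neq_L2_bound (fun x => pd m (a i) x * pd j (f i) x + a i x * b x) (neq b :: oscs L i) gs (C * W)
  (fun y => c1 y + c2 y * mean b y) _ _ cgs (mulr_ge0 C0 W0).
have H : (L2sq (neq (fun x => (pd m (a i) x * pd j (f i) x + a i x * b x)%R)) <=
   (2 * (C * W) ^+ 2 * (size (neq b :: oscs L i))%:R)%:E * (\sum_(f0 <- neq b :: oscs L i) L2sq f0)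
   + (2 * (size gs)%:R)%:E * \sum_(g <- gs) L2sq g)%E.
  apply: bnd.
  - by move=> x; apply: cvgD; apply: cvgM; [exact: cpa|exact: cfj|exact: cai|exact: cb].
  - by split; [exact: neq_continuous|exact: all_cont_oscs].
  - move=> x Ox; have [_ _ h1] := Hc1 x Ox; have [h2 h3 h4] := Hc2 x Ox.
    rewrite gsE {1}/sum_abs big_cons -/(sum_abs (oscs L i) x).
    rewrite (_ : _ - _ = (pd m (a i) x * pd j (f i) x - c1 x.1) + (a i x * neq b x + (a i x - c2 x.1) * bar b x));
      last first.
      by rewrite /neq /bar; ring.
    have S0 := sum_abs_ge0 (oscs L i) x; have S00 := sum_abs_ge0 (oscs L0 i) x.
    have t1 : `|pd m (a i) x * pd j (f i) x - c1 x.1| <= C * W * sum_abs (oscs L i) x.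
      apply: le_trans h1 _; rewrite ler_wpM2r//; apply: ler_pM => //.
      - by rewrite addr_ge0 ?mulr_ge0.
      - by rewrite /C lerDl.
      - by rewrite /W; lra.
    have t2 : `|a i x * neq b x| <= C * W * `|neq b x|.
      rewrite normrM ler_wpM2r//; apply: le_trans h2 _; apply: ler_pM => //; first by rewrite /C lerDr.
      by rewrite /W -addrA lerDl addr_ge0 ?mulr_ge0.
    have t3 : `|(a i x - c2 x.1) * bar b x| <= C * l i * (sum_abs (oscs L0 i) x * `|bar b x|).
      rewrite normrM [leRHS]mulrA ler_wpM2r//; apply: le_trans h4 _.
      by rewrite ler_wpM2r// ler_wpM2r// /C lerDr.
    apply: le_trans (ler_normD _ _) _; apply: le_trans (lerD t1 (le_trans (ler_normD _ _) (lerD t2 t3))) _.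
    by rewrite addrA [X in X + _]addrC -mulrDr.
apply: le_trans H _.
have A1 : (\sum_(f0 <- neq b :: oscs L i) L2sq f0 <= (s + 1)%:E * (D%:E * Q i))%E.
  have -> : s + 1 = (size (neq b :: oscs L i))%:R by rewrite /= size_oscs natr1.
  apply: sume_In_le; first by rewrite mule_ge0// lee_fin.
  by move=> g [<-|/In_oscs[g' [gL ->]]]; [exact: d3|exact: d1].
have A2 : (\sum_(g <- gs) L2sq g <= s0%:E * (((C * l i) ^+ 2 * (2 * (D + D) * (D * n i ^+ 2)))%:E * Q i))%E.
  have -> : s0 = (size gs)%:R by rewrite /gs size_map.
  apply: sume_In_le; first by rewrite mule_ge0// lee_fin !mulr_ge0 ?sqr_ge0 ?addr_ge0.
  move=> g gI; have [g' [gL ->]] : exists g', List.In g' L0 /\ g = (fun x : R * (R * R) => (C * l i) * (neq (g' i) x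
    * bar b x)).
    move: gI; rewrite /gs; elim: (L0) => [//|h L' IH] /= [<-|/IH[g' [h1 h2]]]; first by exists h; split => //; left.
    by exists g'; split => //; right.
  have [e1 e2] := d2 g' gL; have Cg := cL0 g' gL.
  have cn : continuous (neq (g' i)) by apply: neq_continuous; exact: (Ck_cont _ _ Cg.1).
  have cp : continuous (fun x => neq (g' i) x * bar b x) by move=> x; apply: cvgM; [exact: cn|exact: cbar].
  have -> : L2sq (fun x : R * (R * R) => (C * l i) * (neq (g' i) x * bar b x)) =
      (((C * l i) ^+ 2)%:E * L2sq (fun x : R * (R * R) => (neq (g' i) x * bar b x)%R))%E.
    rewrite /L2sq -ge0_integralZl//; last 4 first.
    - exact: measurable_Omega.
    - by apply: measurable_funTS; apply: measurable_EFin3; exact: continuous_sqr.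
    - by move=> x _; rewrite lee_fin sqr_ge0.
    - by rewrite lee_fin sqr_ge0.
    by apply: eq_integral => x _; rewrite -EFinM -exprMn.
  rewrite [((_ ^+ 2) * (2 * _ * _))%:E]EFinM -muleA; apply: lee_wpmul2l; first by rewrite lee_fin sqr_ge0.
  apply: le_trans (L2sq_neq_bar (g' i) b Cg cb) _.
  have B1 : (L2sq (neq (g' i)) + L2sq (neq (pd ord0 (g' i))) <= (D + D)%:E * Q i)%E.
    rewrite EFinD ge0_muleDl ?lee_fin//; exact: (leeD e1 e2).
  apply: (@le_trans _ _ (2%:E * ((D + D)%:E * Q i) * (D * n i ^+ 2)%:E)%E).
    apply: lee_pmul => //; [by rewrite mule_ge0// adde_ge0// L2sq_ge0|exact: L2sq_ge0|].
    exact: lee_wpmul2l.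
  by rewrite !EFinM -!muleA le_eqVlt; apply/orP; left; apply/eqP; rewrite [(Q i * _)%E]muleC !muleA.
apply: (@le_trans _ _ ((2 * (C * W) ^+ 2 * (s + 1))%:E * ((s + 1)%:E * (D%:E * Q i)) +
   (2 * s0)%:E * (s0%:E * (((C * l i) ^+ 2 * (2 * (D + D) * (D * n i ^+ 2)))%:E * Q i)))%E).
  apply: leeD.
  - have -> : (size (neq b :: oscs L i))%:R = s + 1 :> R by rewrite /= size_oscs -natr1.
    apply: lee_wpmul2l A1; rewrite lee_fin; apply: mulr_ge0; last exact: addr_ge0.
    by apply: mulr_ge0 => //; exact: sqr_ge0.
  - have -> : (size gs)%:R = s0 :> R by rewrite /gs size_map.
    by apply: lee_wpmul2l A2; rewrite lee_fin mulr_ge0.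
rewrite !muleA -!EFinM -ge0_muleDl ?lee_fin.
- rewrite -EFinD lee_wpmul2r// lee_fin -/W.
  have W1 : (l i * n i) ^+ 2 <= W ^+ 2.
    have lW : l i * n i <= W by rewrite /W addrAC lerDr addr_ge0 ?mulr_ge0.
    by apply: lerXn2r => //; rewrite nnegrE mulr_ge0.
  rewrite [leRHS]mulrDl; apply: lerD; first by rewrite le_eqVlt; apply/orP; left; apply/eqP; ring.
  apply: (@le_trans _ _ (2 * s0 * (s0 * (C ^+ 2 * (2 * (D + D) * D))) * (l i * n i) ^+ 2)).
    by rewrite le_eqVlt; apply/orP; left; apply/eqP; ring.
  by rewrite ler_wpM2l// !mulr_ge0 ?sqr_ge0 ?addr_ge0 ?mulr_ge0.
- have h1 : 0 <= (C * W) ^+ 2 by exact: sqr_ge0.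
  have h2 : 0 <= s + 1 by exact: addr_ge0.
  by do 4 (apply: mulr_ge0 => //).
- have h1 : 0 <= (C * l i) ^+ 2 by exact: sqr_ge0.
  apply: mulr_ge0; first by do 2 (apply: mulr_ge0 => //).
  have h2 : 0 <= n i ^+ 2 by exact: sqr_ge0.
  by apply: mulr_ge0 => //; apply: mulr_ge0; [apply: mulr_ge0 => //; exact: addr_ge0|exact: mulr_ge0].
Qed.

End oscillation.

(** * Norms of tuples, and the exponential near 0 *)

Lemma unif_sm {R : realType} {I : Type} (adm : I -> Prop) (dl : I -> R) b n (g : I -> R -> R) i : adm i ->
  unif adm dl b n.+1 g -> sm n (g i).
Proof.
move=> ai; elim: n g => [|n IH] g [_ [g' [h1 h2]]].
  by move=> y; exact: hder_continuous (h1 i ai y).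
by exists (g' i); split; [exact: h1|exact: IH].
Qed.

Lemma sm_derive1 {R : realType} n (f : R -> R) : sm n.+1 f -> (forall y, hder f y (derive1 f y)) /\ sm n (derive1 f).
Proof. by move=> [f' [h1 h2]]; rewrite (hder_derive1E f f' h1). Qed.

Lemma unif_of_sm {R : realType} {I : Type} (adm : I -> Prop) (dl : I -> R) b n (f : I -> R -> R) :
  (forall i, adm i -> sm n (f i)) ->
  (exists C : R, forall i, adm i -> forall k y, (k <= n)%N -> `|derive1n k (f i) y| <= C * weight dl b i) ->
  unif adm dl b n f.
Proof.
elim: n f => [|n IH] f Hs [C HC].
  by split => //; exists C => i ai y; exact: (HC i ai 0%N).
split; first by exists C => i ai y; exact: (HC i ai 0%N).
exists (fun i => derive1 (f i)); split; first by move=> i ai; have [] := sm_derive1 _ _ (Hs i ai).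
apply: IH; first by move=> i ai; have [] := sm_derive1 _ _ (Hs i ai).
by exists C => i ai k y kn; have := HC i ai k.+1 y kn; rewrite derive1Sn.
Qed.

Lemma unif_shift {R : realType} {I : Type} (adm : I -> Prop) (dl : I -> R) b n (f : I -> R -> R) (c : I -> R) :
  unif adm dl b n f -> unif adm dl b n (fun i y => f i (y - c i)).
Proof.
elim: n f => [|n IH] f [[C HC] h]; (split; first by exists C => i ai y; exact: HC) => //.
have [f' [h1 h2]] := h; exists (fun i y => f' i (y - c i)); split; last exact: IH.
move=> i ai y; have h3 : hder (fun y => y - c i) y (1 - 0) by apply: dB; [exact: did|exact: dcst].
by apply: hder_eq (dcomp _ _ _ _ _ (h1 i ai _) h3) _; ring.
Qed.

Lemma smooth1_sm {R : realType} n (f : R -> R) : smooth1 f -> sm n f.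
Proof.
elim: n f => [|n IH] f sf; first exact: smooth1_continuous.
exists (derive1 f); split; last by apply: IH; exact: smooth1_derive.
by move=> y; apply: hder_derive1; exact: (sf 0%N y).
Qed.

Lemma sm_inv {R : realType} n (f : R -> R) : (forall y, 0 < f y) -> sm n f -> sm n (fun y => (f y)^-1).
Proof.
move=> f0; elim: n => [|n IH] Hf.
  by move=> y; apply: cvgV; [rewrite gt_eqF|exact: Hf].
have h := IH (sm_le _ _ _ (leqnSn n) Hf); move: Hf => [f' [h1 h2]].
exists (fun y => (-1) * ((f y)^-1 * (f y)^-1) * f' y); split; last by apply: smM => //; apply: smZ; exact: smM.
by move=> y; apply: hder_eq (dinv _ _ _ _ (h1 y)) _; [rewrite gt_eqF|rewrite expr2; field; rewrite gt_eqF].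
Qed.

Lemma Ck_fst_sm {R : realType} n (g : R -> R) : sm n g -> Ck n (fun x : R * (R * R) => g x.1).
Proof.
move=> h; have -> : (fun x : R * (R * R) => g x.1) = tens g (fun=> 1) (fun=> 1) by apply/funext => x; rewrite /tens
  !mulr1.
by apply: Ck_tens => //; exact: sm_cst.
Qed.

Lemma Cper_fst_sm {R : realType} n (g : R -> R) : sm n g -> Cper n (fun x : R * (R * R) => g x.1).
Proof. by move=> h; split; [exact: Ck_fst_sm|]. Qed.

Lemma pd_fst_hder {R : realType} k (g g' : R -> R) : (forall y, hder g y (g' y)) ->
  pd k (fun x : R * (R * R) => g x.1) = (fun x => if k == ord0 then g' x.1 else 0).
Proof.
move=> h; have [_ ->] := pd_fst k g (fun y => @ex_derive _ _ _ _ _ _ _ (h y)).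
rewrite (hder_derive1E _ _ h); apply/funext => x.
by case: k => -[|k] hk.
Qed.

Lemma neq_neq {R : realType} (f : R * (R * R) -> R) : continuous f -> neq (neq f) = neq f.
Proof.
move=> cf; apply/funext => x; rewrite {1}/neq.
suff -> : mean (neq f) x.1 = 0 by rewrite subr0.
rewrite /mean /neq /= avgB ?avg_cst ?subrr//; first exact: continuous_pair1.
by move=> y; exact: cvg_cst.
Qed.

Definition sumL2 {R : realType} (fs : seq (R * (R * R) -> R)) : \bar R := (\sum_(f <- fs) L2sq f)%E.

Lemma sume_ge_In {R : realType} (fs : seq (R * (R * R) -> R)) (N : (R * (R * R) -> R) -> \bar R) f :
  (forall g, 0 <= N g)%E -> List.In f fs -> (N f <= \sum_(g <- fs) N g)%E.
Proof.
move=> N0; elim: fs => [//|g fs IH] /= [->|/IH h]; rewrite big_cons.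
  by rewrite leeDl// sume_ge0.
by apply: le_trans h _; rewrite leeDr.
Qed.

Lemma In_cat {T : Type} (x : T) (s1 s2 : seq T) : List.In x s1 \/ List.In x s2 -> List.In x (s1 ++ s2).
Proof.
elim: s1 => [[]|y s1 IH] //= [[->|h]|h]; [by left|by right; apply: IH; left|by right; apply: IH; right].
Qed.

Lemma cat_In {T : Type} (x : T) (s1 s2 : seq T) : List.In x (s1 ++ s2) -> List.In x s1 \/ List.In x s2.
Proof. by elim: s1 => [|y s1 IH] /=; [right|move=> [->|/IH[]]; [left; left|left; right|right]]. Qed.

Lemma In_map {T U : Type} (f : T -> U) (x : T) (s : seq T) : List.In x s -> List.In (f x) (map f s).
Proof. by elim: s => [//|y s IH] /= [->|/IH]; [left|right]. Qed.

Lemma map_In {T U : Type} (f : T -> U) (y : U) (s : seq T) : List.In y (map f s) -> exists2 x, List.In x s & y = f x.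
Proof. by elim: s => [//|z s IH] /= [<-|/IH[x h ->]]; [exists z => //; left|exists x => //; right]. Qed.

Lemma In_enum (k : 'I_3) : List.In k (enum 'I_3).
Proof.
have : k \in enum 'I_3 by rewrite mem_enum.
by elim: (enum _) => [//|j s IH]; rewrite inE => /orP[/eqP ->|/IH]; [left|right].
Qed.

Lemma In_comps {R : realType} (v : 'I_3 -> R * (R * R) -> R) j : List.In (v j) (comps v).
Proof. by apply: In_map; exact: In_enum. Qed.

Lemma comps_In {R : realType} (v : 'I_3 -> R * (R * R) -> R) g : List.In g (comps v) -> exists j, g = v j.
Proof. by move=> h; have [j _ ->] := map_In _ _ _ h; exists j. Qed.

Lemma In_grad {R : realType} (fs : seq (R * (R * R) -> R)) f k : List.In f fs -> List.In (pd k f) (grad fs).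
Proof.
rewrite /grad; elim: fs => [//|g fs IH] /= [->|/IH h]; apply: In_cat; last by right.
by left; apply: (In_map (fun k => pd k f)); exact: In_enum.
Qed.

Lemma sqrte_scale {R : realType} (C w : R) (A Q : \bar R) : 0 <= C -> 0 <= w -> (0 <= Q)%E ->
  (A <= (C * w ^+ 2)%:E * Q)%E -> (sqrte A <= (Num.sqrt C * w)%:E * sqrte Q)%E.
Proof.
move=> C0 w0 Q0 H.
have : (sqrte A <= sqrte ((C * w ^+ 2)%:E * Q))%E by rewrite lee_sqrt// mule_ge0// lee_fin mulr_ge0 ?sqr_ge0.
by rewrite sqrteM ?lee_fin ?mulr_ge0 ?sqr_ge0//= sqrtrM// sqrtr_sqr ger0_norm.
Qed.

Lemma tuple_norm_le {R : realType} (N : (R * (R * R) -> R) -> \bar R) (fs : seq (R * (R * R) -> R)) (C w : R) (Q :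
  \bar R) :
  0 <= C -> 0 <= w -> (0 <= Q)%E -> (forall f, List.In f fs -> (N f <= (C * w ^+ 2)%:E * Q)%E) ->
  (sqrte (\sum_(f <- fs) N f) <= (Num.sqrt ((size fs)%:R * C) * w)%:E * sqrte Q)%E.
Proof.
move=> C0 w0 Q0 H; apply: sqrte_scale => //; first exact: mulr_ge0.
apply: le_trans (sume_In_le _ _ _ _ H) _; first by rewrite mule_ge0// lee_fin mulr_ge0 ?sqr_ge0.
by rewrite muleA -EFinM mulrA.
Qed.

Lemma poincare_neq {R : realType} (f : R * (R * R) -> R) (Q : \bar R) : Cper 1 f ->
  (forall k, L2sq (neq (pd k f)) <= Q)%E -> (L2sq (neq f) <= 4%:E * Q)%E.
Proof.
move=> Cf H; rewrite -(neq_neq f (Ck_cont _ _ Cf.1)).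
apply: le_trans (poincare _ (Cper_neq _ _ Cf).1) _.
rewrite !neq_pd// (_ : 4%:E = 2%:E * (1 + 1)%:E)%E; last by rewrite -EFinM; congr (_%:E); ring.
by rewrite -muleA lee_wpmul2l// EFinD ge0_muleDl// mul1e leeD.
Qed.

Lemma weak_derivsq_ge0 {R : realType} (l : seq 'I_3) (f : R * (R * R) -> R) : (0 <= weak_derivsq l f)%E.
Proof. by apply: le_ereal_inf_tmp => _ [g _ <-]; exact: L2sq_ge0. Qed.

Lemma Hsq_ge0 {R : realType} k (f : R * (R * R) -> R) : (0 <= Hsq k f)%E.
Proof. by apply: sume_ge0 => j _; apply: sume_ge0 => s _; exact: weak_derivsq_ge0. Qed.

Lemma weak_derivsq_le_Hsq {R : realType} k (s : seq 'I_3) (f : R * (R * R) -> R) : (size s <= k)%N ->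
  (weak_derivsq s f <= Hsq k f)%E.
Proof.
move=> sk; have hj : (size s < k.+1)%N by [].
rewrite /Hsq (bigD1 (Ordinal hj))//=.
apply: le_trans (leeDl _ _); last by apply: sume_ge0 => j _; apply: sume_ge0 => l _; exact: weak_derivsq_ge0.
by rewrite (bigD1 (in_tuple s))//=; apply: leeDl; apply: sume_ge0 => l _; exact: weak_derivsq_ge0.
Qed.

Lemma L2sq_le_Hsq {R : realType} k s (f : R * (R * R) -> R) : (size s <= k)%N -> Cper (size s) f ->
  (L2sq (pdn s f) <= Hsq k f)%E.
Proof.
move=> sk Cf; rewrite -{1}(revK s) -weak_derivsqE ?size_rev//.
by apply: weak_derivsq_le_Hsq; rewrite size_rev.
Qed.

Lemma lip_MVT {R : realType} (f f' : R -> R) (r K : R) : (forall y, hder f y (f' y)) ->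
  (forall c, `|c| <= r -> `|f' c| <= K) -> forall u v, `|u| <= r -> `|v| <= r -> `|f u - f v| <= K * `|u - v|.
Proof.
move=> hf hK u v; wlog vu : u v / v < u => [th|].
  move=> h1 h2; have [->|uv] := eqVneq u v; first by rewrite !subrr normr0 mulr0.
  have [vu|vu] := ltP v u; first exact: (th u v).
  by rewrite (distrC (f u)) (distrC u); apply: (th v u) => //; rewrite lt_neqAle uv.
rewrite (ler_norml u) (ler_norml v) => /andP[h1 h2] /andP[h3 h4].
have [c [/andP[c1 c2] ->]] := MVT_seg f f' v u vu (fun x _ => hf x).
by rewrite normrM ler_wpM2r// hK// ler_norml; apply/andP; split; lra.
Qed.

Lemma expR_le2 {R : realType} (c : R) : `|c| <= 2^-1 -> expR c <= 2.
Proof.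
rewrite ler_norml => /andP[h1 h2]; have := expR_quad c h2.
have : c ^+ 2 <= 2^-1 ^+ 2 by rewrite -real_normK ?num_real// lerXn2r ?nnegrE// ler_norml h1.
by rewrite expr2; lra.
Qed.

Lemma expR1_lip {R : realType} (u v : R) : `|u| <= 2^-1 -> `|v| <= 2^-1 -> `|(expR u - 1) - (expR v - 1)| <= 2 * `|u
  - v|.
Proof.
apply: (lip_MVT (fun u => expR u - 1) expR).
  by move=> y; apply: hder_eq (dB _ _ _ _ _ (dexp _ _ _ (did y)) (dcst 1 y)) _; ring.
by move=> c h; rewrite ger0_norm ?expR_ge0// expR_le2.
Qed.

Lemma expR1_le {R : realType} (u : R) : `|u| <= 2^-1 -> `|expR u - 1| <= 2 * `|u|.
Proof.
by move=> h; have := expR1_lip u 0 h; rewrite normr0 expR0 subrr !subr0; apply.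
Qed.

Lemma expR2_lip {R : realType} (r u v : R) : r <= 2^-1 -> `|u| <= r -> `|v| <= r ->
  `|(expR u - 1 - u) - (expR v - 1 - v)| <= 2 * r * `|u - v|.
Proof.
move=> r2; apply: (lip_MVT (fun u => expR u - 1 - u) (fun u => expR u - 1)).
  move=> y; apply: hder_eq (dB _ _ _ _ _ (dB _ _ _ _ _ (dexp _ _ _ (did y)) (dcst 1 y)) (did y)) _; ring.
move=> c h; apply: le_trans (expR1_le c (le_trans h r2)) _; lra.
Qed.

Lemma expR2_le {R : realType} (r u : R) : r <= 2^-1 -> `|u| <= r -> `|expR u - 1 - u| <= r.
Proof.
move=> r2 h; have r0 : 0 <= r by exact: le_trans h.
have := expR2_lip r u 0 r2 h; rewrite normr0 expR0 subrr !subr0 => /(_ r0) /le_trans; apply.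
rewrite -[leRHS]mul1r; apply: ler_pM => //; [exact: mulr_ge0|lra].
Qed.

(** * Estimates of the nonlinear terms *)

(** One instance of the problem observed at one time. Used as an index, it makes a constant chosen
    before it uniform in time, shock strength and solution. *)
Record config {R : realType} := Config {
  c_d : R; c_v : R; c_s : R; c_W : wave R; c_F : flow R; c_t : R }.
Arguments config R : clear implicits.

Section families.
Context {R : realType}.
Implicit Types (i : config R).

Definition zf i := z (c_s i) (c_W i) (c_F i) (c_t i).
Definition wf (j : 'I_3) i := w (c_s i) (c_W i) (c_F i) (c_t i) j.
Definition Hf i := H (c_s i) (c_W i) (c_F i) (c_t i).
Definition Htf i := Ht (c_s i) (c_W i) (c_F i) (c_t i).
Definition rhof i := frho (c_F i) (c_t i).

(** What is known of each unknown: sup bounds up to first derivatives by the embedding, only L2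
    bounds for second derivatives. *)
Definition good (B v : R) (f : R * (R * R) -> R) : Prop :=
  [/\ Cper 2 f, forall x, Omega x -> `|f x| <= B * v /\ forall k, `|pd k f x| <= B * v
    & forall k l, (L2sq (pd l (pd k f)) <= (v ^+ 2)%:E)%E].

(** All that the nonlinear estimates assume. [reg_Bv] keeps [H] within [1/2], where the exponential
    bounds hold, and [z] within [rho_m / 4], so that the density stays above [rho_m / 4]. *)
Record regime (rho_m B : R) (i : config R) : Prop := Regime {
  reg_d : 0 < c_d i <= 1;
  reg_v : 0 <= c_v i <= 1;
  reg_Bv : B * c_v i <= 2^-1 /\ B * c_v i <= rho_m / 4;
  reg_s : `|c_s i| <= B;
  reg_sm : [/\ sm 5 (wrho (c_W i)), sm 5 (wu (c_W i)) & sm 5 (wE (c_W i))];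
  reg_rho : forall y, rho_m / 2 <= wrho (c_W i) y <= 2 * rho_m;
  reg_drho : forall k y, (k <= 4)%N -> `|derive1n k (derive1 (wrho (c_W i))) y| <= B * c_d i;
  reg_u : forall k y, (k <= 5)%N -> `|derive1n k (wu (c_W i)) y| <= B * c_d i;
  reg_E : forall y, `|wE (c_W i) y| <= B;
  reg_dE : forall k y, (k <= 4)%N -> `|derive1n k (derive1 (wE (c_W i))) y| <= B * c_d i;
  reg_pos : torus_periodic (rhof i) /\ forall x, 0 < rhof i x;
  reg_z : good B (c_v i) (zf i);
  reg_w : forall j, good B (c_v i) (wf j i);
  reg_H : good B (c_v i) (Hf i);
  reg_Ht : good B (c_v i) (Htf i) }.
End families.

Section estimates.
Context {R : realType}.
Variables (T rho_m B : R).
Hypotheses (T0 : 0 < T) (rm0 : 0 < rho_m) (B1 : 1 <= B).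
Notation adm := (@regime R rho_m B).
Notation I := (config R).
Notation fam := (I -> R * (R * R) -> R).
Notation dl := (@c_d R).
Notation nu := (@c_v R).
Notation one := (fun _ : I => 1 : R).
Notation dn := (fun i : I => dl i + nu i).
Notation U := (unif adm dl).
Notation osc := (osc adm).
Notation osc1 := (osc1 adm).

Lemma B_ge0 : 0 <= B. Proof. exact: le_trans B1. Qed.

Lemma reg_d0 i : adm i -> 0 <= dl i. Proof. by move=> /reg_d /andP[/ltW]. Qed.
Lemma reg_v0 i : adm i -> 0 <= nu i. Proof. by move=> /reg_v /andP[]. Qed.

Lemma dl01 i : adm i -> 0 < dl i <= 1.
Proof. exact: reg_d. Qed.

Lemma osc_leC (C : R) L (k l k' l' : I -> R) a : 0 <= C -> (forall i, adm i -> k i <= C * k' i /\ l i <= C * l' i) ->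
  osc L k l a -> osc L k' l' a.
Proof. by move=> C0 H; apply: osc_weak; exists C. Qed.

Lemma osc1_leC (C : R) L (k l k' l' : I -> R) a : 0 <= C -> (forall i, adm i -> k i <= C * k' i /\ l i <= C * l' i) ->
  osc1 L k l a -> osc1 L k' l' a.
Proof. by move=> C0 H; apply: osc1_weak; exists C. Qed.

Lemma rho_lower i y : adm i -> rho_m / 2 <= wrho (c_W i) y.
Proof. by move=> /reg_rho /(_ y) /andP[]. Qed.

(** * Profile coefficients and elementary factors *)

Definition Rho i (y : R) := wrho (c_W i) (y - c_s i * c_t i).
Definition Rho1 i (y : R) := derive1 (wrho (c_W i)) (y - c_s i * c_t i).
Definition Ee i (y : R) := wE (c_W i) (y - c_s i * c_t i).
Definition Ee1 i (y : R) := derive1 (wE (c_W i)) (y - c_s i * c_t i).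
Definition Uu i (y : R) := wu (c_W i) (y - c_s i * c_t i).
Definition Uu1 i (y : R) := derive1 (wu (c_W i)) (y - c_s i * c_t i).
Definition Uu2 i (y : R) := derive1 (derive1 (wu (c_W i))) (y - c_s i * c_t i).

Lemma dRho i y : adm i -> hder (Rho i) y (Rho1 i y).
Proof. by move=> ai; apply: (hder_shift (wrho (c_W i))); have [h _ _] := reg_sm _ _ _ ai; have [] := sm_derive1 _ _
  h. Qed.
Lemma dEe i y : adm i -> hder (Ee i) y (Ee1 i y).
Proof. by move=> ai; apply: (hder_shift (wE (c_W i))); have [_ _ h] := reg_sm _ _ _ ai; have [] := sm_derive1 _ _ h.
  Qed.
Lemma dUu i y : adm i -> hder (Uu i) y (Uu1 i y).
Proof. by move=> ai; apply: (hder_shift (wu (c_W i))); have [_ h _] := reg_sm _ _ _ ai; have [] := sm_derive1 _ _ h.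
  Qed.
Lemma dUu1 i y : adm i -> hder (Uu1 i) y (Uu2 i y).
Proof.
move=> ai; apply: (hder_shift (derive1 (wu (c_W i)))); have [_ h _] := reg_sm _ _ _ ai.
by have [_ h'] := sm_derive1 _ _ h; have [] := sm_derive1 _ _ h'.
Qed.

Lemma U_Rho1 : U true 4 Rho1.
Proof.
apply: (unif_shift adm dl true 4 (fun i => derive1 (wrho (c_W i)))); apply: unif_of_sm.
  by move=> i ai; have [h _ _] := reg_sm _ _ _ ai; have [] := sm_derive1 _ _ h.
by exists B => i ai k y k3; exact: (reg_drho _ _ _ ai).
Qed.

Lemma U_Ee1 : U true 4 Ee1.
Proof.
apply: (unif_shift adm dl true 4 (fun i => derive1 (wE (c_W i)))); apply: unif_of_sm.
  by move=> i ai; have [_ _ h] := reg_sm _ _ _ ai; have [] := sm_derive1 _ _ h.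
by exists B => i ai k y k3; exact: (reg_dE _ _ _ ai).
Qed.

Lemma U_Uu : U true 5 Uu.
Proof.
apply: (unif_shift adm dl true 5 (fun i => wu (c_W i))); apply: unif_of_sm.
  by move=> i ai; have [_ h _] := reg_sm _ _ _ ai.
by exists B => i ai k y k4; exact: (reg_u _ _ _ ai).
Qed.

Lemma U_Uu1 : U true 4 Uu1.
Proof.
apply: (unif_shift adm dl true 4 (fun i => derive1 (wu (c_W i)))); apply: unif_of_sm.
  by move=> i ai; have [_ h _] := reg_sm _ _ _ ai; have [] := sm_derive1 _ _ h.
by exists B => i ai k y k3; rewrite -derive1Sn; exact: (reg_u _ _ _ ai).
Qed.

Lemma U_Uu2 : U true 3 Uu2.
Proof.
apply: (unif_shift adm dl true 3 (fun i => derive1 (derive1 (wu (c_W i))))); apply: unif_of_sm.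
  move=> i ai; have [_ h _] := reg_sm _ _ _ ai; have [_ h'] := sm_derive1 _ _ h.
  by have [] := sm_derive1 _ _ h'.
by exists B => i ai k y k2; rewrite -!derive1Sn; exact: (reg_u _ _ _ ai).
Qed.

Lemma U_Rho : U false 4 Rho.
Proof.
apply: (unif_S _ _ false 3 Rho Rho1) => [|i ai y|]; [exists (2 * rho_m) => i ai y /=|exact: dRho|].
  rewrite mulr1 gtr0_norm; first by have /andP[] := reg_rho _ _ _ ai (y - c_s i * c_t i).
  by apply: lt_le_trans (rho_lower _ _ ai); have := rm0; lra.
by apply: unif_weak => //; [exact: dl01|exact: unif_le U_Rho1].
Qed.

Lemma osc_unif b n L (l : I -> R) (g : I -> R -> R) : (forall i, adm i -> 0 <= l i) -> U b n g ->
  osc L (weight dl b) l (fun i x => g i x.1).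
Proof.
move=> l0 Hg; apply: osc_fst => //; first by case: n Hg => [|n] [].
by move=> i ai; apply: (weight_ge0 _ _ dl01).
Qed.

Lemma osc1_unif b L (l : I -> R) (g : I -> R -> R) : (forall i, adm i -> 0 <= l i) -> U b 2 g ->
  osc1 L (weight dl b) l (fun i x => g i x.1).
Proof.
move=> l0 Hg; split; first by move=> i ai; apply: Cper_fst_sm; exact: (unif_sm _ _ _ _ _ _ ai Hg).
  exact: osc_unif Hg.
move=> j; have [_ [g' [h1 h2]]] := Hg.
apply: (osc_ext _ _ _ _ (fun i x => if j == ord0 then g' i x.1 else 0)).
  by move=> i ai; rewrite (pd_fst_hder _ _ _ (h1 i ai)).
have h3 : U b 1 g' by [].
case: (j == ord0); first exact: (osc_unif _ _ _ _ _ l0 h3).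
exists 0; split => // i ai; exists (fun=> 0) => x Ox; rewrite subrr normr0 !mul0r; split => //.
Qed.

Lemma osc1_0 L (k l : I -> R) : osc1 L k l (fun _ _ => 0).
Proof.
have h : osc L k l (fun _ _ => 0).
  by exists 0; split => // i ai; exists (fun=> 0) => x Ox; rewrite subrr normr0 !mul0r; split => //.
split => //; first by move=> i ai; split; [exact: Ck_cst|].
by move=> j; apply: (osc_ext _ _ _ _ (fun _ _ => 0)) h => i ai; have [_ ->] := pd_cst j (0 : R).
Qed.

Definition with_grad (fs : seq fam) : seq fam := flatten [seq f :: [seq (fun i => pd k (f i)) | k <- enum 'I_3] | f
  <- fs].

Lemma In_with_grad fs f : List.In f fs -> List.In f (with_grad fs) /\ forall k, List.In (fun i => pd k (f i))
  (with_grad fs).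
Proof.
rewrite /with_grad; elim: fs => [//|g fs IH] /= [->|/IH[h1 h2]]; split.
- by left.
- move=> k; right; apply: In_cat; left; apply: (In_map (fun (k : 'I_3) i => pd k (f i))); exact: In_enum.
- by right; apply: In_cat; right.
- by move=> k; right; apply: In_cat; right.
Qed.

Lemma with_grad_In fs g : List.In g (with_grad fs) -> exists2 f, List.In f fs & g = f \/ exists k, g = fun i => pd k
  (f i).
Proof.
rewrite /with_grad; elim: fs => [//|h fs IH] /= [->|hg]; first by exists g; left.
have [hm|/IH[f h1 h2]] := cat_In _ _ _ hg; last by exists f => //; right.
by have [k _ ->] := map_In _ _ _ hm; exists h; [left|right; exists k].
Qed.

(** A bounded unknown is its zero mode plus its own fluctuation: size [nu], fluctuation factor
    one. *)
Lemma good_osc (L : seq fam) f : (forall i, adm i -> continuous (f i) /\ forall x, Omega x -> `|f i x| <= B * nu i)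
  -> List.In f L ->
  osc L nu one f.
Proof.
move=> H fL; apply: (osc_comp _ _ _ _ f (fun i => B * nu i) (fun _ _ u => u)) => //.
exists B; split => [|i ai]; first exact: B_ge0.
by split => // y u v hu hv; split => //; rewrite mulr1 ler_peMl.
Qed.

Lemma good_sup (f : R * (R * R) -> R) v : good B v f -> continuous f /\ forall x, Omega x -> `|f x| <= B * v.
Proof. by move=> [h1 h2 _]; split; [exact: (Ck_cont _ _ h1.1)|move=> x Ox; have [] := h2 x Ox]. Qed.

Lemma good_osc1 (L : seq fam) f : (forall i, adm i -> good B (nu i) (f i)) -> List.In f L ->
  (forall k, List.In (fun i => pd k (f i)) L) -> osc1 L nu one f.
Proof.
move=> H fL dL; split; first by move=> i ai; have [h _ _] := H i ai; exact: Cper_le h.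
  by apply: good_osc => // i ai; apply: good_sup; exact: H.
move=> j; apply: good_osc => // i ai; have [h1 h2 _] := H i ai; split.
  by apply: (Ck_cont 1); exact: (Cper_pd _ _ _ h1).1.
by move=> x Ox; have [_] := h2 x Ox.
Qed.

(** The full velocity component, written so that its profile part is visibly a function of [x1] of
    size [delta]. *)
Definition uf (j : 'I_3) i x := wf j i x + (if j == ord0 then Uu i x.1 else 0).

Lemma dn_ge i : adm i -> 0 <= dl i /\ 0 <= nu i.
Proof. by move=> ai; split; [exact: reg_d0|exact: reg_v0]. Qed.

Lemma osc1_Uu (j : 'I_3) L (l : I -> R) : (forall i, adm i -> 0 <= l i) ->
  osc1 L dl l (fun i x => if j == ord0 then Uu i x.1 else 0).
Proof.
move=> l0; case: (j == ord0); last exact: osc1_0.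
by apply: (osc1_unif true) => //; apply: unif_le U_Uu.
Qed.

Lemma osc1_uf j L : List.In (wf j) L -> (forall k, List.In (fun i => pd k (wf j i)) L) -> osc1 L dn one (uf j).
Proof.
move=> h1 h2; apply: osc1D.
  apply: (osc1_leC 1 _ nu one) => //; last by apply: good_osc1 => // i ai; exact: (reg_w _ _ _ ai).
  by move=> i ai; have [] := dn_ge i ai; split; lra.
apply: (osc1_leC 1 _ dl one) => //; last exact: osc1_Uu.
by move=> i ai; have [] := dn_ge i ai; split; lra.
Qed.

Lemma osc_uf j L : List.In (wf j) L -> osc L dn one (uf j).
Proof.
move=> h1; apply: oscD.
  apply: (osc_leC 1 _ nu one) => //; last by apply: good_osc => // i ai; apply: good_sup; exact: (reg_w _ _ _ ai).
  by move=> i ai; have [] := dn_ge i ai; split; lra.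
apply: (osc_leC 1 _ dl one) => //; last by have [_ h _] := osc1_Uu j L one (fun _ _ => ler01).
by move=> i ai; have [] := dn_ge i ai; split; lra.
Qed.

Lemma dn0 i : adm i -> 0 <= dn i.
Proof. by move=> ai; have [] := dn_ge i ai; exact: addr_ge0. Qed.

(** For [u] in the range of [z], [Rho + u] stays above [rho_m / 4], where inversion is bounded and
    Lipschitz. *)
Lemma osc_rhoV L : List.In zf L -> osc L one one (fun i x => (rhof i x)^-1).
Proof.
move=> zL; apply: (osc_ext _ _ _ _ (fun i x => (fun i y u => (Rho i y + u)^-1) i x.1 (zf i x))).
  by move=> i ai; apply/funext => x; congr (_^-1); rewrite /zf /z /rhof /Rho /trho; ring.
apply: (osc_comp _ _ _ _ zf (fun i => B * nu i) (fun i y u => (Rho i y + u)^-1)) => //; first by move=> i ai; apply: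
  good_sup; exact: (reg_z _ _ _ ai).
have r0 := rm0; have c0 : 0 <= 4 / rho_m by rewrite divr_ge0// ltW.
exists (4 / rho_m + (4 / rho_m) ^+ 2); split; first by rewrite addr_ge0 ?sqr_ge0.
move=> i ai; split => // y u v hu hv.
have low (a : R) : `|a| <= B * nu i -> rho_m / 4 <= Rho i y + a.
  rewrite ler_norml => /andP[h1 h2]; have := rho_lower i (y - c_s i * c_t i) ai; rewrite -/(Rho i y).
  have [_ h3] := reg_Bv _ _ _ ai; lra.
have inv (a : R) : `|a| <= B * nu i -> 0 < Rho i y + a /\ (Rho i y + a)^-1 <= 4 / rho_m.
  move=> /low h; have p : 0 < Rho i y + a by apply: lt_le_trans h; rewrite divr_gt0.
  split => //; rewrite -[leLHS]mul1r ler_pdivrMr// mulrC; have := ler_wpM2r c0 h.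
  by rewrite (_ : rho_m / 4 * (4 / rho_m) = 1)//; field; rewrite gt_eqF.
have [p1 i1] := inv u hu; have [p2 i2] := inv v hv; rewrite !mulr1; split.
  by rewrite gtr0_norm ?invr_gt0//; apply: le_trans i1 _; rewrite lerDl sqr_ge0.
have -> : (Rho i y + u)^-1 - (Rho i y + v)^-1 = (Rho i y + u)^-1 * (Rho i y + v)^-1 * (v - u).
  by field; rewrite !gt_eqF.
rewrite normrM (distrC v); apply: ler_wpM2r => //.
rewrite gtr0_norm ?mulr_gt0 ?invr_gt0//; apply: (@le_trans _ _ ((4 / rho_m) ^+ 2)); last by rewrite lerDr.
by rewrite expr2; apply: ler_pM => //; rewrite invr_ge0 ltW.
Qed.

Lemma Rho_gt0 i y : adm i -> 0 < Rho i y.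
Proof. by move=> ai; apply: lt_le_trans (rho_lower _ _ ai); have := rm0; lra. Qed.

Lemma unif_RhoV : U false 4 (fun i y => (Rho i y)^-1).
Proof.
have bd : exists C : R, forall i, adm i -> forall y, `|(Rho i y)^-1| <= C * weight dl false i.
  exists (2 / rho_m) => i ai y /=; rewrite mulr1 gtr0_norm ?invr_gt0 ?Rho_gt0//.
  rewrite -[leLHS]mul1r ler_pdivrMr ?Rho_gt0// mulrC.
  have c0 : 0 <= 2 / rho_m by rewrite divr_ge0// ltW.
  have := ler_wpM2r c0 (rho_lower i (y - c_s i * c_t i) ai); rewrite -/(Rho i y).
  by rewrite (_ : rho_m / 2 * (2 / rho_m) = 1)//; field; rewrite gt_eqF.
have dV i : adm i -> forall y, hder (fun y => (Rho i y)^-1) y ((-1) * ((Rho i y)^-1 * (Rho i y)^-1) * Rho1 i y).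
  move=> ai y; have p := Rho_gt0 i y ai.
  by apply: hder_eq (dinv _ _ _ _ (dRho i y ai)) _; [rewrite gt_eqF|rewrite expr2; field; rewrite gt_eqF].
have R1 : U false 3 Rho1 by apply: unif_weak; [exact: dl01|exact: unif_le U_Rho1].
have step n : (n <= 3)%N -> U false n (fun i y => (Rho i y)^-1) -> U false n.+1 (fun i y => (Rho i y)^-1).
  move=> n3 h; apply: (unif_S _ _ _ _ _ _ bd dV); apply: unifM; last exact: unif_le R1.
  by apply: unifM; [apply: unif_cst; exists 1 => i _; rewrite normrN normr1|exact: unifM].
exact: (step 3%N isT (step 2%N isT (step 1%N isT (step 0%N isT (conj bd Logic.I))))).
Qed.

Lemma Ck_rho i : adm i -> Cper 2 (rhof i).
Proof.
move=> ai; have [h _ _] := reg_z _ _ _ ai.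
have -> : rhof i = fun x => zf i x + Rho i x.1 by apply/funext => x; rewrite /zf /z /rhof /Rho /trho; ring.
by apply: CperD => //; apply: Cper_fst_sm; exact: (unif_sm _ _ _ _ _ _ ai (unif_le _ _ _ 3 4 _ isT U_Rho)).
Qed.

Lemma pd_rho i k : adm i -> pd k (rhof i) = fun x => pd k (zf i) x + (if k == ord0 then Rho1 i x.1 else 0).
Proof.
move=> ai; have [h _ _] := reg_z _ _ _ ai.
have -> : rhof i = fun x => zf i x + Rho i x.1 by apply/funext => x; rewrite /zf /z /rhof /Rho /trho; ring.
have S : sm 3 (Rho i) by exact: (unif_sm _ _ _ _ _ _ ai U_Rho).
have [_ ->] := pdD k (zf i) (fun x => Rho i x.1) (fun x => Ck_der 1 _ k x h.1) (fun x => Ck_der 2 _ k x (Ck_fst_sm _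
  _ S)).
by rewrite (pd_fst_hder _ _ _ (fun y => dRho i y ai)).
Qed.

Lemma pd_rhoV i k : adm i ->
  pd k (fun x => (rhof i x)^-1) = fun x => - ((rhof i x)^-1 * (rhof i x)^-1) * pd k (rhof i) x.
Proof.
move=> ai; have [_ h] := reg_pos _ _ _ ai.
by have [_ ->] := pd_inv k (rhof i) (fun x => Ck_der 1 _ k x (Ck_rho i ai).1) h.
Qed.

Lemma osc1_rhoV L : List.In zf L -> (forall k, List.In (fun i => pd k (zf i)) L) ->
  osc1 L one one (fun i x => (rhof i x)^-1).
Proof.
move=> h1 h2; have o := osc_rhoV L h1; split => //.
  move=> i ai; have [p h] := reg_pos _ _ _ ai; split; first by apply: Ck_inv => //; exact: Ck_le (Ck_rho i ai).1.
  by move=> x1 x2 x3; have [-> ->] := p x1 x2 x3.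
move=> k; apply: (osc_ext _ _ _ _ (fun i x => (-1) * ((rhof i x)^-1 * (rhof i x)^-1) *
   (pd k (zf i) x + (if k == ord0 then Rho1 i x.1 else 0)))).
  by move=> i ai; rewrite pd_rhoV// pd_rho//; apply/funext => x; rewrite mulN1r.
have c1 : osc L one (fun=> 0) (fun _ _ => -1).
  by exists 1; split => // i ai; exists (fun=> -1) => x Ox; rewrite normrN normr1 subrr normr0 !mulr0 mul0r mulr1.
have dz : osc L nu one (fun i => pd k (zf i)).
  by have [_ _] := good_osc1 L zf (fun i ai => reg_z _ _ _ ai) h1 h2; apply.
have dR : osc L dl one (fun i x => if k == ord0 then Rho1 i x.1 else 0).
  case: (k == ord0); last by have [] := osc1_0 L dl one.
  by apply: (osc_unif true 4) => //; exact: U_Rho1.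
have dzR : osc L one one (fun i x => pd k (zf i) x + (if k == ord0 then Rho1 i x.1 else 0)).
  apply: oscD; [apply: (osc_leC 1 _ _ _ _ _ _ _ _ dz)|apply: (osc_leC 1 _ _ _ _ _ _ _ _ dR)] => //.
  - by move=> i /reg_v /andP[]; split; lra.
  - by move=> i /reg_d /andP[]; split; lra.
have m1 := oscM _ _ _ _ _ _ _ _ c1 (oscM _ _ _ _ _ _ _ _ o o).
apply: (osc_leC 4 _ _ _ _ _ _ _ _ (oscM _ _ _ _ _ _ _ _ m1 dzR)) => // i ai; split; lra.
Qed.

(** The constant [4] is the one of [poincare_neq], which absorbs the undifferentiated
    fluctuation. *)
Definition ctrl (Q : I -> \bar R) (f : fam) : Prop := forall i, adm i ->
  (L2sq (neq (f i)) <= 4%:E * Q i)%E /\ forall k, (L2sq (neq (pd k (f i))) <= 4%:E * Q i)%E.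

(** Finitely many constants are replaced by their sum. *)
Lemma unif_fin (l : I -> R) (Q : I -> \bar R) (J : finType) (N : J -> I -> \bar R) : (forall i, adm i -> (0 <= Q
  i)%E) ->
  (forall j, exists C : R, 0 <= C /\ forall i, adm i -> (N j i <= (C * l i ^+ 2)%:E * Q i)%E) ->
  exists C : R, 0 <= C /\ forall i, adm i -> forall j, (N j i <= (C * l i ^+ 2)%:E * Q i)%E.
Proof.
move=> Q0 HC; have [C h] := choice HC; have C0 j : 0 <= C j by have [] := h j.
exists (\sum_j C j); split; first by apply: sumr_ge0.
move=> i ai j; apply: le_trans ((h j).2 i ai) _; rewrite lee_wpmul2r ?Q0// lee_fin ler_wpM2r ?sqr_ge0//.
by rewrite (bigD1 j)//= lerDl sumr_ge0.
Qed.

Lemma Hnorm_final k (l : I -> R) (Q : I -> \bar R) (gl : I -> seq (R * (R * R) -> R)) n :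
  (forall i, size (gl i) = n) -> (forall i, adm i -> 0 <= l i) -> (forall i, adm i -> (0 <= Q i)%E) ->
  (exists C : R, 0 <= C /\ forall i, adm i -> forall g, List.In g (gl i) -> (Hsq k g <= (C * l i ^+ 2)%:E * Q i)%E) ->
  exists C : R, 0 <= C /\ forall i, adm i -> (Hnorm k (gl i) <= (C * l i)%:E * sqrte (Q i))%E.
Proof.
move=> sz l0 Q0 [C [C0 H]]; exists (Num.sqrt (n%:R * C)); split; first exact: sqrtr_ge0.
move=> i ai; rewrite -(sz i); apply: tuple_norm_le => //; [exact: l0|exact: Q0|exact: H].
Qed.

Lemma L2norm_final (l : I -> R) (Q : I -> \bar R) (gl : I -> seq (R * (R * R) -> R)) n :
  (forall i, size (gl i) = n) -> (forall i, adm i -> 0 <= l i) -> (forall i, adm i -> (0 <= Q i)%E) ->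
  (exists C : R, 0 <= C /\ forall i, adm i -> forall g, List.In g (gl i) -> (L2sq g <= (C * l i ^+ 2)%:E * Q i)%E) ->
  exists C : R, 0 <= C /\ forall i, adm i -> (L2norm (gl i) <= (C * l i)%:E * sqrte (Q i))%E.
Proof.
move=> sz l0 Q0 [C [C0 H]]; exists (Num.sqrt (n%:R * C)); split; first exact: sqrtr_ge0.
move=> i ai; rewrite -(sz i); apply: tuple_norm_le => //; [exact: l0|exact: Q0|exact: H].
Qed.

Lemma ctrl_lists fs (Q : I -> \bar R) : (forall i, adm i -> (0 <= Q i)%E) ->
  (forall f, List.In f fs -> ctrl Q f /\ forall i, adm i -> Cper 1 (f i)) ->
  (forall i, adm i -> (0 <= Q i)%E /\ forall f, List.In f (with_grad fs) -> continuous (f i)) /\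
  (exists D : R, 0 <= D /\ forall i, adm i -> forall f, List.In f (with_grad fs) -> (L2sq (neq (f i)) <= D%:E * Q
    i)%E).
Proof.
move=> Q0 Hfs; split.
  move=> i ai; split; first exact: Q0.
  move=> g gI; have [f fI] := with_grad_In _ _ gI; have [_ /(_ i ai) Cf] := Hfs f fI.
  move=> [->|[k' ->]]; first exact: (Ck_cont _ _ Cf.1).
  exact: (Ck_cont 0 _ (Cper_pd _ _ _ Cf).1).
exists 4; split => // i ai g gI; have [f fI] := with_grad_In _ _ gI; have [/(_ i ai)[h1 h2] _] := Hfs f fI.
by move=> [->|[k' ->]]; [exact: h1|exact: h2].
Qed.

Lemma osc1_Hsq fs k l a (Q : I -> \bar R) : osc1 (with_grad fs) k l a ->
  (forall i, adm i -> 0 <= l i) -> (forall i, adm i -> (0 <= Q i)%E) ->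
  (forall f, List.In f fs -> ctrl Q f /\ forall i, adm i -> Cper 1 (f i)) ->
  exists C : R, 0 <= C /\ forall i, adm i -> (L2sq (neq (a i)) <= (C * l i ^+ 2)%:E * Q i)%E /\
    forall m, (L2sq (neq (pd m (a i))) <= (C * l i ^+ 2)%:E * Q i)%E.
Proof.
move=> [ca oa da] l0 Q0 Hfs.
have [HQ HD] := ctrl_lists _ _ Q0 Hfs.
have [C0 [C00 H0]] := osc_L2 _ _ _ _ _ Q oa (fun i ai => Ck_cont _ _ (ca i ai).1) l0 HQ HD.
have HC m := osc_L2 _ _ _ _ _ Q (da m) (fun i ai => Ck_cont 0 _ (Cper_pd _ _ m (ca i ai)).1) l0 HQ HD.
have [C1 [C10 H1]] := unif_fin _ _ _ (fun m i => L2sq (neq (pd m (a i)))) Q0 HC.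
exists (C0 + C1); split; first exact: addr_ge0.
move=> i ai; split=> [|m].
  by apply: le_trans (H0 i ai) _; rewrite lee_wpmul2r ?Q0// lee_fin ler_wpM2r ?sqr_ge0// lerDl.
by apply: le_trans (H1 i ai m) _; rewrite lee_wpmul2r ?Q0// lee_fin ler_wpM2r ?sqr_ge0// lerDr.
Qed.

Lemma Hsq1_neq (G : R * (R * R) -> R) (D : \bar R) : Cper 1 G -> (L2sq (neq G) <= D)%E ->
  (forall m, L2sq (neq (pd m G)) <= D)%E -> (Hsq 1 (neq G) <= (Hsq_card 1)%:R%:E * D)%E.
Proof.
move=> CG h1 h2; apply: Hsq_le; first exact: Cper_neq.
case=> [_|m [|m' s'] hs]; [exact: h1|by rewrite /= (neq_pd _ _ CG); exact: h2|by []].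
Qed.

Lemma Hsq2_neq (G : R * (R * R) -> R) (D : \bar R) : Cper 2 G -> (L2sq (neq G) <= D)%E ->
  (forall m, L2sq (neq (pd m G)) <= D)%E -> (forall m k, L2sq (neq (pd m (pd k G))) <= D)%E ->
  (Hsq 2 (neq G) <= (Hsq_card 2)%:R%:E * D)%E.
Proof.
move=> CG h1 h2 h3; apply: Hsq_le; first exact: Cper_neq.
have C1 : Cper 1 G by exact: Cper_le CG.
case=> [_|m [|k [|k' s']] hs]; [exact: h1|by rewrite /= (neq_pd _ _ C1); exact: h2| |by []].
by rewrite /= (neq_pd _ _ C1) (neq_pd _ _ (Cper_pd _ _ _ CG)); exact: h3.
Qed.

Lemma osc1_Hsq1 fs k l (J : finType) (a : J -> fam) (Q : I -> \bar R) : (forall j, osc1 (with_grad fs) k l (a j)) ->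
  (forall i, adm i -> 0 <= l i) -> (forall i, adm i -> (0 <= Q i)%E) ->
  (forall f, List.In f fs -> ctrl Q f /\ forall i, adm i -> Cper 1 (f i)) ->
  exists C : R, 0 <= C /\ forall i, adm i -> forall j, (Hsq 1 (neq (a j i)) <= (C * l i ^+ 2)%:E * Q i)%E.
Proof.
move=> oa l0 Q0 Hfs; apply: (unif_fin _ _ _ (fun j i => Hsq 1 (neq (a j i)))) => // j.
have [C [C0 H]] := osc1_Hsq _ _ _ _ Q (oa j) l0 Q0 Hfs.
exists ((Hsq_card 1)%:R * C); split; first exact: mulr_ge0.
move=> i ai; have [h1 h2] := H i ai; have [ca _ _] := oa j.
by apply: le_trans (Hsq1_neq _ _ (ca i ai) h1 h2) _; rewrite muleA -EFinM mulrA.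
Qed.

Definition zwfs : seq fam := zf :: [seq wf j | j <- enum 'I_3].
Lemma zf_In : List.In zf zwfs. Proof. by left. Qed.
Lemma wf_In j : List.In (wf j) zwfs. Proof. by right; apply: In_map; exact: In_enum. Qed.

Lemma zwfs_good f : List.In f zwfs -> forall i, adm i -> good B (nu i) (f i).
Proof.
move=> [<-|h] i ai; first exact: (reg_z _ _ _ ai).
by have [j _ ->] := map_In _ _ _ h; exact: (reg_w _ _ _ ai).
Qed.

Lemma zwfs_neq f i : List.In f zwfs ->
  List.In (neq (f i)) (zneq (c_s i) (c_W i) (c_F i) (c_t i) :: comps (wneq (c_s i) (c_W i) (c_F i) (c_t i))).
Proof.
move=> [<-|h]; first by left.
by have [j _ ->] := map_In _ _ _ h; right; exact: (In_comps (wneq (c_s i) (c_W i) (c_F i) (c_t i))).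
Qed.

Lemma ctrl_grad (gs : I -> seq (R * (R * R) -> R)) f : (forall i, adm i -> Cper 1 (f i)) ->
  (forall i, adm i -> List.In (neq (f i)) (gs i)) -> ctrl (fun i => sumL2 (grad (gs i))) f.
Proof.
move=> Cf fI i ai; have h k : (L2sq (neq (pd k (f i))) <= sumL2 (grad (gs i)))%E.
  have -> : neq (pd k (f i)) = pd k (neq (f i)) by rewrite (neq_pd _ _ (Cf i ai)).
  exact: (sume_ge_In (grad (gs i)) L2sq (pd k (neq (f i))) L2sq_ge0 (In_grad _ _ k (fI i ai))).
split; first by apply: poincare_neq => //; exact: Cf.
move=> k; apply: le_trans (h k) _; rewrite -[leLHS]mul1e lee_wpmul2r// ?lee_fin ?ler1n//.
by apply: sume_ge0 => g _; exact: L2sq_ge0.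
Qed.

Lemma sumL2_ge0 (gs : seq (R * (R * R) -> R)) : (0 <= sumL2 gs)%E.
Proof. by apply: sume_ge0 => g _; exact: L2sq_ge0. Qed.

(** * The flux term [J1] *)

Lemma uE i j x : fu (c_F i) (c_t i) j x = uf j i x.
Proof. by rewrite /uf /wf /w /tu /Uu; case: (j == ord0); ring. Qed.

(** [J1] is exactly the fluctuation of [z u_j]: after splitting every factor into zero mode and
    fluctuation, the products of two functions of [x1] cancel. *)
Lemma J1E i j : adm i -> J1 (c_s i) (c_W i) (c_F i) (c_t i) j = neq (fun x => zf i x * uf j i x).
Proof.
move=> ai; have [Cz _ _] := reg_z _ _ _ ai; have [Cw _ _] := reg_w _ _ _ ai j.
apply/funext => x; rewrite /J1 -/(zf i) -/(wf j i).
have cz := Ck_cont _ _ Cz.1; have cw := Ck_cont _ _ Cw.1.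
set tu_ := tu _ _ _ _ _; have tuE : tu_ = (if j == ord0 then Uu i x.1 else 0) by [].
have pz : continuous (fun y => zf i (x.1, y)) by exact: continuous_pair1.
have pw : continuous (fun y => wf j i (x.1, y)) by exact: continuous_pair1.
have pzw : continuous (fun y => zf i (x.1, y) * wf j i (x.1, y)) by move=> y; apply: cvgM; [exact: pz|exact: pw].
rewrite tuE /neq /bar /=; set u_ := (if _ then _ else _).
set mz := mean (zf i) x.1; set mw := mean (wf j i) x.1.
have -> : mean (fun y => (zf i y - mean (zf i) y.1) * (wf j i y - mean (wf j i) y.1)) x.1 =
    mean (fun y => zf i y * wf j i y) x.1 - mz * mw.
  rewrite /mean /= -/mz -/mw.
  have -> : (fun y => (zf i (x.1, y) - mz) * (wf j i (x.1, y) - mw)) =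
     (fun y => (zf i (x.1, y) * wf j i (x.1, y) - mw * zf i (x.1, y)) + (mz * mw - mz * wf j i (x.1, y))).
    by apply/funext => y; ring.
  have cc (c : R) : continuous (fun _ : R * R => c) by move=> ?; exact: cvg_cst.
  have cM (c : R) (g : R * R -> R) : continuous g -> continuous (fun y => c * g y).
    by move=> cg y; apply: cvgM; [exact: cc|exact: cg].
  have cB (g h : R * R -> R) : continuous g -> continuous h -> continuous (fun y => g y - h y).
    by move=> cg ch y; apply: cvgB; [exact: cg|exact: ch].
  rewrite avgD; [|by apply: cB => //; exact: cM|by apply: cB => //; exact: cM].
  rewrite avgB//; last exact: cM.
  rewrite avgB//; last exact: cM.
  have ez : \int[mu2]_(y in T2) zf i (x.1, y) = mz by [].
  have ew : \int[mu2]_(y in T2) wf j i (x.1, y) = mw by [].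
  have r (A : R) : A - mw * mz + (mz * mw - mz * mw) = A - mz * mw by ring.
  by rewrite (avgZ mw _ pz) (avgZ mz _ pw) ez ew (avg_cst (mz * mw)); exact: r.
have -> : mean (fun y => zf i y * uf j i y) x.1 = mean (fun y => zf i y * wf j i y) x.1 + u_ * mz.
  rewrite /mean /uf /=.
  have -> : (fun y => zf i (x.1, y) * (wf j i (x.1, y) + u_)) =
     (fun y => zf i (x.1, y) * wf j i (x.1, y) + u_ * zf i (x.1, y)) by apply/funext => y; ring.
  rewrite avgD//; first by rewrite avgZ.
  by move=> y; apply: cvgM; [exact: cvg_cst|exact: pz].
rewrite /uf -/u_; ring.
Qed.

Lemma J1_est : exists C : R, 0 <= C /\ forall i, adm i ->
  (Hnorm 1 (comps (J1 (c_s i) (c_W i) (c_F i) (c_t i))) <= (C * dn i)%:E *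
    L2norm (grad (zneq (c_s i) (c_W i) (c_F i) (c_t i) :: comps (wneq (c_s i) (c_W i) (c_F i) (c_t i)))))%E.
Proof.
pose gs (i : I) := zneq (c_s i) (c_W i) (c_F i) (c_t i) :: comps (wneq (c_s i) (c_W i) (c_F i) (c_t i)).
pose Q (i : I) := sumL2 (grad (gs i)).
have Cfs f : List.In f zwfs -> forall i, adm i -> Cper 1 (f i).
  by move=> fI i ai; have [h _ _] := zwfs_good f fI i ai; exact: Cper_le h.
have Hfs f : List.In f zwfs -> ctrl Q f /\ forall i, adm i -> Cper 1 (f i).
  move=> fI; split; last exact: Cfs.
  by apply: ctrl_grad; [exact: Cfs|move=> i ai; exact: zwfs_neq].
have [hz1 hz2] := In_with_grad _ _ zf_In.
have o j : osc1 (with_grad zwfs) one dn (fun i x => zf i x * uf j i x).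
  have [hw1 hw2] := In_with_grad _ _ (wf_In j).
  have oz := good_osc1 (with_grad zwfs) zf (fun i ai => reg_z _ _ _ ai) hz1 hz2.
  apply: (osc1_leC 3 _ _ _ _ _ _ _ _ (osc1M _ _ _ _ _ _ _ _ oz (osc1_uf j _ hw1 hw2))) => // i ai.
  have /andP[d0 d1] := reg_d _ _ _ ai; have /andP[v0 v1] := reg_v _ _ _ ai.
  have := mulr_ge0 v0 (addr_ge0 (ltW d0) v0); have : nu i * dn i <= 1 * (1 + 1) by apply: ler_pM => //; lra.
  by split; lra.
have sz (i : I) : size (comps (J1 (c_s i) (c_W i) (c_F i) (c_t i))) = 3%N by rewrite size_map size_enum_ord.
apply: (Hnorm_final 1 dn Q _ 3 sz) => [i ai|i ai|]; [exact: dn0|exact: sumL2_ge0|].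
have [C [C0 HC]] := osc1_Hsq1 _ _ _ _ _ Q o dn0 (fun i _ => sumL2_ge0 _) Hfs.
exists C; split => // i ai f fI; have [j ->] := comps_In _ _ fI; rewrite J1E//; exact: HC.
Qed.

(** * Differentiated products containing a gradient *)

Definition pd_fluct (m : 'I_3) (l : I -> R) (Q : I -> \bar R) (a : fam) : Prop := (forall i, adm i -> Cper 1 (a i)) /\
  exists C : R, 0 <= C /\ forall i, adm i -> (L2sq (neq (pd m (a i))) <= (C * l i ^+ 2)%:E * Q i)%E.

Lemma L2sq_neqD (f g : R * (R * R) -> R) (A D : \bar R) : continuous f -> continuous g ->
  (L2sq (neq f) <= A)%E -> (L2sq (neq g) <= D)%E -> (L2sq (neq (fun x => (f x + g x)%R)) <= 4%:E * (A + D))%E.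
Proof.
move=> cf cg hA hD.
have bnd := neq_L2_bound (fun x => f x + g x) [:: neq f; neq g] [::] 1 (fun y => mean f y + mean g y).
apply: le_trans (bnd _ _ _ _ _) _ => //.
- by move=> x; apply: cvgD; [exact: cf|exact: cg].
- by split; [|split] => //; exact: neq_continuous.
- move=> x Ox; rewrite /sum_abs !big_cons !big_nil !addr0 mul1r.
  by rewrite (_ : f x + g x - _ = neq f x + neq g x) ?ler_normD// /neq; ring.
- rewrite !big_cons !big_nil mule0 !adde0 /= expr1n mulr1 (_ : 2 * 2 = 4 :> R); last by ring.
  by rewrite lee_wpmul2l// leeD.
Qed.

Lemma pd_fluctD m l Q a b : (forall i, adm i -> (0 <= Q i)%E) -> pd_fluct m l Q a -> pd_fluct m l Q b -> pd_fluct m l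
  Q (fun i x => a i x + b i x).
Proof.
move=> Q0 [ca [C [C0 HC]]] [cb [D [D0 HD]]]; split; first by move=> i ai; apply: CperD; [exact: ca|exact: cb].
exists (4 * (C + D)); split; first by rewrite mulr_ge0 ?addr_ge0.
move=> i ai; have Ca := ca i ai; have Cb := cb i ai.
have [_ ->] := pdD m (a i) (b i) (fun x => Ck_der 0 _ m x Ca.1) (fun x => Ck_der 0 _ m x Cb.1).
apply: le_trans (L2sq_neqD _ _ _ _ _ _ (HC i ai) (HD i ai)) _.
- exact: (Ck_cont 0 _ (Cper_pd _ _ _ Ca).1).
- exact: (Ck_cont 0 _ (Cper_pd _ _ _ Cb).1).
- have -> : 4 * (C + D) * l i ^+ 2 = 4 * (C * l i ^+ 2 + D * l i ^+ 2) by ring.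
  have c0 : 0 <= C * l i ^+ 2 by rewrite mulr_ge0 ?sqr_ge0.
  have d0 : 0 <= D * l i ^+ 2 by rewrite mulr_ge0 ?sqr_ge0.
  by rewrite (EFinM 4) -muleA (EFinD (C * l i ^+ 2)) (ge0_muleDl (Q i) (_ : (0 <= (C * l i ^+ 2)%:E)%E) (_ : (0 <= (D
    * l i ^+ 2)%:E)%E)) ?lee_fin.
Qed.

Lemma pd_fluct_sum m l Q (J : Type) (rr : seq J) (F : J -> fam) : (forall i, adm i -> (0 <= Q i)%E) ->
  (forall j, pd_fluct m l Q (F j)) -> pd_fluct m l Q (fun i x => \sum_(j <- rr) F j i x).
Proof.
move=> Q0 H; elim: rr => [|j rr IH].
  have E : (fun (i : I) (x : R * (R * R)) => \sum_(j <- [::]) F j i x) = (fun _ _ => 0).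
    by apply/funext => i; apply/funext => x; rewrite big_nil.
  rewrite E; split; first by move=> i ai; split; [exact: Ck_cst|].
  exists 0; split => // i ai; rewrite mul0r mul0e.
  have [_ ->] := pd_cst m (0 : R); have -> : neq (fun _ : R * (R * R) => 0 : R) = fun=> 0.
    by apply/funext => x; rewrite /neq /mean (avg_cst 0) subrr.
  by rewrite /L2sq; under eq_integral do rewrite expr0n /=; rewrite integral0.
have -> : (fun (i : I) (x : R * (R * R)) => \sum_(j' <- j :: rr) F j' i x) = (fun i x => F j i x + \sum_(j' <- rr) F
  j' i x).
  by apply/funext => i; apply/funext => x; rewrite big_cons.
exact: (pd_fluctD _ _ _ _ _ Q0 (H j) IH).
Qed.

Lemma pd_fluct_osc1 fs k l m a (Q : I -> \bar R) : osc1 (with_grad fs) k l a ->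
  (forall i, adm i -> 0 <= l i) -> (forall i, adm i -> (0 <= Q i)%E) ->
  (forall f, List.In f fs -> ctrl Q f /\ forall i, adm i -> Cper 1 (f i)) -> pd_fluct m l Q a.
Proof.
move=> oa l0 Q0 Hfs; split; first by have [] := oa.
have [C [C0 H]] := osc1_Hsq _ _ _ _ Q oa l0 Q0 Hfs.
by exists C; split => // i ai; have [_] := H i ai.
Qed.

Definition ctrl2 (Q : I -> \bar R) (f : fam) : Prop := ctrl Q f /\
  forall i, adm i -> forall k m, (L2sq (neq (pd m (pd k (f i)))) <= 4%:E * Q i)%E.

(** Differentiating [a] times a first derivative of [f] leaves [a] in front of a second derivative,
    whence the hypothesis [ctrl2]. The condition on [wt] gathers the three sizes produced by
    [osc1_second]. *)
Lemma pd_fluct_second fs k l wt m j a f (Q : I -> \bar R) : osc1 (with_grad fs) k l a -> osc fs k l a ->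
  List.In f fs -> (forall i, adm i -> good B (nu i) (f i)) ->
  (forall i, adm i -> (0 <= Q i)%E) -> (forall i, adm i -> 0 <= k i /\ 0 <= l i) ->
  (exists C : R, 0 <= C /\ forall i, adm i -> 0 <= wt i /\ k i + l i * nu i + k i * 1 <= C * wt i) ->
  (forall g, List.In g fs -> ctrl Q g /\ forall i, adm i -> Cper 1 (g i)) -> ctrl2 Q f ->
  pd_fluct m wt Q (fun i x => a i x * pd j (f i) x).
Proof.
move=> oa oa0 fI gf Q0 kl0 [D [D0 HD]] Hfs [_ c2]; have [ca _ _] := oa.
have Cf2 i : adm i -> Cper 2 (f i) by move=> ai; have [] := gf i ai.
split; first by move=> i ai; apply: CperM; [exact: ca|exact: Cper_pd (Cf2 i ai)].
have [f1 f2] := In_with_grad _ _ fI.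
have [_ _ of1] := good_osc1 (with_grad fs) f gf f1 f2.
have [HQ [E [E0 HE]]] := ctrl_lists _ _ Q0 Hfs.
have [|||C [C0 HC]] := osc1_second _ _ _ k l nu one a f m j Q oa oa0 Cf2 (of1 j) _ _ _.
- by move=> i ai; have [k0 l0] := kl0 i ai; split => //; exact: reg_v0.
- move=> i ai; have [q0 qc] := HQ i ai; split => // g gI; have [_] := Hfs g gI; exact.
- exists (E + 4); split; first by rewrite addr_ge0.
  move=> i ai; have q0 := Q0 i ai.
  have wk (x : \bar R) : (x <= 4%:E * Q i -> x <= (E + 4)%:E * Q i)%E.
    by move=> h; apply: le_trans h _; rewrite lee_wpmul2r// lee_fin lerDr.
  split.
  + by move=> g gI; apply: le_trans (HE i ai g gI) _; rewrite lee_wpmul2r// lee_fin lerDl.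
  + by move=> g gI; have [/(_ i ai)[h1 h2] _] := Hfs g gI; split; apply: wk; [exact: h1|exact: h2].
  + by apply: wk; exact: c2.
  + have [_ _ h] := gf i ai; apply: le_trans (h j m) _; rewrite lee_fin ler_peMl ?sqr_ge0//.
    by rewrite -[leLHS]add0r lerD// ler1n.
exists (C * D ^+ 2); split; first by rewrite mulr_ge0 ?sqr_ge0.
move=> i ai; apply: le_trans (HC i ai) _; rewrite lee_wpmul2r ?Q0// lee_fin -mulrA ler_wpM2l// -exprMn.
have [k0 l0] := kl0 i ai; have [w0 hw] := HD i ai; have v0 := reg_v0 i ai.
by rewrite lerXn2r// ?nnegrE ?mulr_ge0// !addr_ge0// mulr_ge0.
Qed.

Lemma osc_sum L k l (J : Type) (rr : seq J) (F : J -> fam) : (forall j, osc L k l (F j)) ->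
  osc L k l (fun i x => \sum_(j <- rr) F j i x).
Proof.
move=> H; elim: rr => [|j rr IH].
  apply: (osc_ext _ _ _ _ (fun _ _ => 0)); last by have [] := osc1_0 L k l.
  by move=> i ai; apply/funext => x; rewrite big_nil.
apply: (osc_ext _ _ _ _ (fun i x => F j i x + \sum_(j' <- rr) F j' i x)); last exact: oscD.
by move=> i ai; apply/funext => x; rewrite big_cons.
Qed.

Definition wfs : seq fam := [seq wf j | j <- enum 'I_3].
Lemma wfs_In j : List.In (wf j) wfs. Proof. by apply: In_map; exact: In_enum. Qed.

Lemma wfs_good f : List.In f wfs -> forall i, adm i -> good B (nu i) (f i).
Proof. by move=> h; apply: zwfs_good; right. Qed.

Lemma wfs_neq f i : List.In f wfs -> List.In (neq (f i)) (comps (wneq (c_s i) (c_W i) (c_F i) (c_t i))).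
Proof. by move=> h; have [j _ ->] := map_In _ _ _ h; exact: (In_comps (wneq (c_s i) (c_W i) (c_F i) (c_t i))). Qed.

Lemma good_Cper1 v (f : R * (R * R) -> R) : good B v f -> Cper 1 f.
Proof. by move=> [h _ _]; exact: Cper_le h. Qed.

Lemma ctrl_of (Q : I -> \bar R) f : (forall i, adm i -> Cper 2 (f i)) ->
  (forall i, adm i -> forall k, (L2sq (pd k (neq (f i))) <= Q i)%E) -> ctrl Q f.
Proof.
move=> Cf h i ai; have C1 : Cper 1 (f i) by apply: Cper_le (Cf i ai).
have h' k : (L2sq (neq (pd k (f i))) <= Q i)%E by rewrite -(neq_pd _ _ C1); exact: h.
split; first exact: poincare_neq.
have q0 : (0 <= Q i)%E by exact: le_trans (L2sq_ge0 _) (h' ord0).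
by move=> k; apply: le_trans (h' k) _; rewrite -[leLHS]mul1e lee_wpmul2r// lee_fin ler1n.
Qed.

Lemma ctrl2_of (Q : I -> \bar R) f : (forall i, adm i -> Cper 2 (f i)) ->
  (forall i, adm i -> forall k, (L2sq (pd k (neq (f i))) <= Q i)%E) ->
  (forall i, adm i -> forall k m, (L2sq (pd m (pd k (neq (f i)))) <= Q i)%E) -> ctrl2 Q f.
Proof.
move=> Cf h1 h2; split; first exact: ctrl_of.
move=> i ai k m; have C1 : Cper 1 (f i) by apply: Cper_le (Cf i ai).
have q0 : (0 <= Q i)%E by exact: le_trans (L2sq_ge0 _) (h1 i ai ord0).
rewrite -(neq_pd _ _ (Cper_pd _ _ _ (Cf i ai))) -(neq_pd _ _ C1).
by apply: le_trans (h2 i ai k m) _; rewrite -[leLHS]mul1e lee_wpmul2r// lee_fin ler1n.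
Qed.

Lemma L2sq_grad (gs : seq (R * (R * R) -> R)) g k : List.In g gs -> (L2sq (pd k g) <= sumL2 (grad gs))%E.
Proof. by move=> gI; exact: (sume_ge_In (grad gs) L2sq (pd k g) L2sq_ge0 (In_grad _ _ k gI)). Qed.

Lemma sumL2_cat (g1 g2 : seq (R * (R * R) -> R)) : sumL2 (g1 ++ g2) = (sumL2 g1 + sumL2 g2)%E.
Proof. by rewrite /sumL2 big_cat. Qed.

(** * The convection term [h1] *)

Definition h1f (j : 'I_3) i x := \sum_(k <- index_enum 'I_3) uf k i x * pd k (wf j i) x.

Lemma h1E i j : h1 (c_s i) (c_W i) (c_F i) (c_t i) j = h1f j i.
Proof. by apply/funext => x; apply: eq_bigr => k _; rewrite uE. Qed.

Lemma osc_h1 j : osc (with_grad wfs) one dn (h1f j).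
Proof.
apply: osc_sum => k; have [hw1 hw2] := In_with_grad _ _ (wfs_In k); have [hj1 hj2] := In_with_grad _ _ (wfs_In j).
have [_ ou _] := osc1_uf k _ hw1 hw2.
have [_ _ ow] := good_osc1 (with_grad wfs) (wf j) (fun i ai => reg_w _ _ _ ai j) hj1 hj2.
apply: (osc_leC 3 _ _ _ _ _ _ _ _ (oscM _ _ _ _ _ _ _ _ ou (ow k))) => // i ai.
have /andP[d0 d1] := reg_d _ _ _ ai; have /andP[v0 v1] := reg_v _ _ _ ai.
have : dn i * nu i <= (1 + 1) * 1 by apply: ler_pM => //; lra.
by split; lra.
Qed.

Lemma Cper_uf j i : adm i -> Cper 1 (uf j i).
Proof. by move=> ai; have [hw1 hw2] := In_with_grad _ _ (wfs_In j); have [h _ _] := osc1_uf j _ hw1 hw2; exact: h.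
  Qed.

(** Each summand is the velocity, of size [delta + nu], times a first derivative of [w];
    [pd_fluct_second] handles the second derivative created by [pd m]. *)
Lemma pd_fluct_h1 m j (Q : I -> \bar R) : (forall i, adm i -> (0 <= Q i)%E) -> (forall f, List.In f wfs -> ctrl2 Q f)
  ->
  pd_fluct m dn Q (h1f j).
Proof.
move=> Q0 H; apply: pd_fluct_sum => // k; have [hw1 hw2] := In_with_grad _ _ (wfs_In k).
apply: (pd_fluct_second wfs dn one dn m k (uf k) (wf j)) => //.
- exact: osc1_uf.
- by apply: osc_uf; exact: wfs_In.
- exact: wfs_In.
- by move=> i ai; exact: (reg_w _ _ _ ai).
- by move=> i ai; split => //; exact: dn0.
- exists 3; split => // i ai; split; first exact: dn0.
  by have [] := dn_ge i ai; lra.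
- move=> g gI; split; first by have [] := H g gI.
  by move=> i ai; apply: good_Cper1; exact: wfs_good.
- by apply: H; exact: wfs_In.
Qed.

Lemma h1_est0 : exists C : R, 0 <= C /\ forall i, adm i ->
  (L2norm (comps (h1neq (c_s i) (c_W i) (c_F i) (c_t i))) <= (C * dn i)%:E *
    L2norm (grad (comps (wneq (c_s i) (c_W i) (c_F i) (c_t i)))))%E.
Proof.
pose gs (i : I) := comps (wneq (c_s i) (c_W i) (c_F i) (c_t i)).
pose Q (i : I) := sumL2 (grad (gs i)).
have Q0 i : adm i -> (0 <= Q i)%E by move=> _; exact: sumL2_ge0.
have Hfs f : List.In f wfs -> ctrl Q f /\ forall i, adm i -> Cper 1 (f i).
  move=> fI; split; last by move=> i ai; apply: good_Cper1; exact: wfs_good.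
  apply: ctrl_of; first by move=> i ai; have [] := wfs_good _ fI i ai.
  by move=> i ai k; apply: L2sq_grad; exact: wfs_neq.
have sz (i : I) : size (comps (h1neq (c_s i) (c_W i) (c_F i) (c_t i))) = 3%N by rewrite size_map size_enum_ord.
apply: (L2norm_final dn Q _ 3 sz) => [i ai|//|]; first exact: dn0.
have [HQ HD] := ctrl_lists _ _ Q0 Hfs.
have Ch j i : adm i -> Cper 1 (h1f j i).
  have z0 (i' : I) : adm i' -> (0 <= +oo :> \bar R)%E by [].
  move=> ai; rewrite /h1f; elim: (index_enum 'I_3) => [|k rr IH].
    have -> : (fun x => \sum_(k <- [::]) uf k i x * pd k (wf j i) x) = fun=> 0 by apply/funext => x; rewrite big_nil.
    by split; [exact: Ck_cst|].
  have -> : (fun x => \sum_(k' <- k :: rr) uf k' i x * pd k' (wf j i) x) = fun x => uf k i x * pd k (wf j i) x +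
    \sum_(k' <- rr) uf k' i x * pd k' (wf j i) x.
    by apply/funext => x; rewrite big_cons.
  apply: CperD => //; apply: CperM; first exact: Cper_uf.
  by have [h _ _] := reg_w _ _ _ ai j; exact: Cper_pd h.
have HC j := osc_L2 _ _ _ _ _ Q (osc_h1 j) (fun i ai => Ck_cont _ _ (Ch j i ai).1) dn0 HQ HD.
have [C [C0 H]] := unif_fin dn Q _ (fun j i => L2sq (neq (h1f j i))) Q0 HC.
exists C; split => // i ai f fI; have [j ->] := comps_In _ _ fI.
by rewrite /h1neq h1E; exact: H.
Qed.

(** The right side contains second derivatives because [h1] already contains the gradient of [w]. *)
Lemma h1_est1 : exists C : R, 0 <= C /\ forall i, adm i ->
  (Hnorm 1 (comps (h1neq (c_s i) (c_W i) (c_F i) (c_t i))) <= (C * dn i)%:E *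
    L2norm (grad (comps (wneq (c_s i) (c_W i) (c_F i) (c_t i))) ++ grad (grad (comps (wneq (c_s i) (c_W i) (c_F i)
      (c_t i))))))%E.
Proof.
pose gs (i : I) := comps (wneq (c_s i) (c_W i) (c_F i) (c_t i)).
pose Q (i : I) := sumL2 (grad (gs i) ++ grad (grad (gs i))).
have Q0 i : adm i -> (0 <= Q i)%E by move=> _; exact: sumL2_ge0.
have C2 f : List.In f wfs -> ctrl2 Q f.
  move=> fI; apply: ctrl2_of; first by move=> i ai; have [] := wfs_good _ fI i ai.
    move=> i ai k; rewrite /Q sumL2_cat; apply: le_trans (leeDl _ (sumL2_ge0 _)).
    by apply: L2sq_grad; exact: wfs_neq.
  move=> i ai k m; rewrite /Q sumL2_cat; apply: le_trans (leeDr _ (sumL2_ge0 _)).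
  by apply: L2sq_grad; apply: In_grad; exact: wfs_neq.
have Hfs f : List.In f wfs -> ctrl Q f /\ forall i, adm i -> Cper 1 (f i).
  by move=> fI; split; [have [] := C2 f fI|move=> i ai; apply: good_Cper1; exact: wfs_good].
have sz (i : I) : size (comps (h1neq (c_s i) (c_W i) (c_F i) (c_t i))) = 3%N by rewrite size_map size_enum_ord.
apply: (Hnorm_final 1 dn Q _ 3 sz) => [i ai|//|]; first exact: dn0.
have [HQ HD] := ctrl_lists _ _ Q0 Hfs.
have Ch j i : adm i -> Cper 1 (h1f j i) by move=> ai; have [h _] := pd_fluct_h1 ord0 j Q Q0 C2; exact: h.
have [C1 [C10 H1]] := unif_fin dn Q _ (fun j i => L2sq (neq (h1f j i))) Q0
  (fun j => osc_L2 _ _ _ _ _ Q (osc_h1 j) (fun i ai => Ck_cont _ _ (Ch j i ai).1) dn0 HQ HD).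
have [C2' [C20 H2]] := unif_fin dn Q _ (fun (p : 'I_3 * 'I_3) i => L2sq (neq (pd p.1 (h1f p.2 i)))) Q0
  (fun p => (pd_fluct_h1 p.1 p.2 Q Q0 C2).2).
exists ((Hsq_card 1)%:R * (C1 + C2')); split; first by rewrite mulr_ge0 ?addr_ge0.
move=> i ai f fI; have [j ->] := comps_In _ _ fI; rewrite /h1neq h1E.
apply: le_trans (Hsq1_neq _ (((C1 + C2') * dn i ^+ 2)%:E * Q i) (Ch j i ai) _ _) _.
- by apply: le_trans (H1 i ai j) _; rewrite lee_wpmul2r ?Q0// lee_fin ler_wpM2r ?sqr_ge0// lerDl.
- by move=> m; apply: le_trans (H2 i ai (m, j)) _; rewrite lee_wpmul2r ?Q0// lee_fin ler_wpM2r ?sqr_ge0// lerDr.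
- by rewrite muleA -EFinM mulrA.
Qed.

(** * The term [h2] *)

Definition kap (j : 'I_3) i (y : R) := (j == ord0)%:R * (T * Rho1 i y - Uu2 i y).
Definition mu_ (j : 'I_3) i (y : R) := (j == ord0)%:R * Uu1 i y.

Lemma U_kap j : U true 3 (kap j).
Proof. by apply: unifZ; apply: unifB; [apply: unifZ; exact: unif_le U_Rho1|exact: U_Uu2]. Qed.

Lemma U_mu j : U true 3 (mu_ j).
Proof. by apply: unifZ; exact: unif_le U_Uu1. Qed.

(** The coefficients [kap] and [mu_] are profile derivatives of size [delta], present only in the
    first component. What multiplies them is bounded, so the whole term is small with [delta]
    alone. *)
Definition h2f (j : 'I_3) i x := ((rhof i x)^-1 - (Rho i x.1)^-1) * kap j i x.1 + wf ord0 i x * mu_ j i x.1.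

Lemma pd_tu i j k : adm i ->
  pd k (tu (c_s i) (c_W i) (c_t i) j) = fun x => (k == ord0)%:R * ((j == ord0)%:R * Uu1 i x.1).
Proof.
move=> ai; have -> : tu (c_s i) (c_W i) (c_t i) j = fun x => (j == ord0)%:R * Uu i x.1.
  by apply/funext => x; rewrite /tu /Uu; case: (j == ord0) => //=; rewrite ?mul1r ?mul0r.
rewrite (pd_fst_hder k (fun y => (j == ord0)%:R * Uu i y) (fun y => (j == ord0)%:R * Uu1 i y)); last first.
  by move=> y; apply: dZ; exact: dUu.
by apply/funext => x; case: (k == ord0); rewrite /= ?mul1r ?mul0r.
Qed.

Lemma h2E i j : adm i -> h2 T (c_s i) (c_W i) (c_F i) (c_t i) j = h2f j i.
Proof.
move=> ai; apply/funext => x; rewrite /h2 /h2f -/(rhof i x) -/(wf ord0 i x).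
rewrite -[trho (c_s i) (c_W i) (c_t i) x]/(Rho i x.1) pd_tu//= mul1r; congr (_ * _ + _).
rewrite (_ : trho (c_s i) (c_W i) (c_t i) = (fun x => Rho i x.1))// (pd_fst_hder _ _ _ (fun y => dRho i y ai)).
have -> : laplacian (tu (c_s i) (c_W i) (c_t i) j) x = (j == ord0)%:R * Uu2 i x.1.
  rewrite /laplacian.
  have E k : pd k (pd k (tu (c_s i) (c_W i) (c_t i) j)) x = (k == ord0)%:R * ((j == ord0)%:R * Uu2 i x.1).
    rewrite pd_tu//.
    rewrite (pd_fst_hder k (fun y => (k == ord0)%:R * ((j == ord0)%:R * Uu1 i y)) (fun y => (k == ord0)%:R * ((j ==
      ord0)%:R * Uu2 i y))).
      by case: (k == ord0); rewrite //= mul0r.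
    by move=> y; apply: dZ; apply: dZ; exact: dUu1.
  by rewrite (bigD1 ord0)//= E eqxx mul1r big1 ?addr0// => k k0; rewrite E (negbTE k0) mul0r.
by rewrite /kap; case: (j == ord0) => /=; ring.
Qed.

Definition zw0 : seq fam := [:: zf; wf ord0].

Lemma osc1_h2 j : osc1 (with_grad zw0) dl dl (h2f j).
Proof.
have [z1 z2] : List.In zf (with_grad zw0) /\ _ := In_with_grad zw0 zf (or_introl erefl).
have [w1 w2] : List.In (wf ord0) (with_grad zw0) /\ _ := In_with_grad zw0 (wf ord0) (or_intror (or_introl erefl)).
have ok : osc1 (with_grad zw0) dl dl (fun i x => kap j i x.1).
  by apply: (osc1_unif true); [exact: reg_d0|exact: unif_le (U_kap j)].
have om : osc1 (with_grad zw0) dl dl (fun i x => mu_ j i x.1).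
  by apply: (osc1_unif true); [exact: reg_d0|exact: unif_le (U_mu j)].
have oV : osc1 (with_grad zw0) one one (fun i x => (-1) * (Rho i x.1)^-1).
  apply: (osc1_unif false) (_ : U false 2 (fun i y => (-1) * (Rho i y)^-1)) => //.
  by apply: unifZ; exact: unif_le unif_RhoV.
have ow := good_osc1 (with_grad zw0) (wf ord0) (fun i ai => reg_w _ _ _ ai ord0) w1 w2.
have oz := osc1_rhoV _ z1 z2.
have o1 := osc1M _ _ _ _ _ _ _ _ (osc1D _ _ _ _ _ _ oz oV) ok.
have o2 := osc1M _ _ _ _ _ _ _ _ ow om.
have o1' : osc1 (with_grad zw0) dl dl (fun i x => ((rhof i x)^-1 + (-1) * (Rho i x.1)^-1) * kap j i x.1).
  by apply: (osc1_leC 2 _ _ _ _ _ _ _ _ o1) => // i ai; have := reg_d0 i ai; split; lra.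
have o2' : osc1 (with_grad zw0) dl dl (fun i x => wf ord0 i x * mu_ j i x.1).
  apply: (osc1_leC 2 _ _ _ _ _ _ _ _ o2) => // i ai; have d0 := reg_d0 i ai; have /andP[v0 v1] := reg_v _ _ _ ai.
  have : nu i * dl i <= 1 * dl i by rewrite ler_wpM2r.
  by split; lra.
have -> : h2f j = fun i x => ((rhof i x)^-1 + (-1) * (Rho i x.1)^-1) * kap j i x.1 + wf ord0 i x * mu_ j i x.1.
  by apply/funext => i; apply/funext => x; rewrite /h2f mulN1r.
exact: (osc1D _ _ _ _ _ _ o1' o2').
Qed.

Lemma zw0_zwfs f : List.In f zw0 -> List.In f zwfs.
Proof. by move=> [<-|[<-|//]]; [exact: zf_In|exact: wf_In]. Qed.

Lemma zwfs_Cper2 f i : List.In f zwfs -> adm i -> Cper 2 (f i).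
Proof. by move=> fI ai; have [] := zwfs_good _ fI i ai. Qed.

Lemma h2_est1 : exists C : R, 0 <= C /\ forall i, adm i ->
  (Hnorm 1 (comps (h2neq T (c_s i) (c_W i) (c_F i) (c_t i))) <= (C * dl i)%:E *
    L2norm (grad (zneq (c_s i) (c_W i) (c_F i) (c_t i) :: comps (wneq (c_s i) (c_W i) (c_F i) (c_t i)))))%E.
Proof.
pose gs (i : I) := zneq (c_s i) (c_W i) (c_F i) (c_t i) :: comps (wneq (c_s i) (c_W i) (c_F i) (c_t i)).
pose Q (i : I) := sumL2 (grad (gs i)).
have Hfs f : List.In f zw0 -> ctrl Q f /\ forall i, adm i -> Cper 1 (f i).
  move=> /zw0_zwfs fI; split; last by move=> i ai; apply: Cper_le (zwfs_Cper2 _ _ fI ai).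
  apply: ctrl_of; first by move=> i ai; exact: zwfs_Cper2.
  by move=> i ai k; apply: L2sq_grad; exact: zwfs_neq.
have sz (i : I) : size (comps (h2neq T (c_s i) (c_W i) (c_F i) (c_t i))) = 3%N by rewrite size_map size_enum_ord.
apply: (Hnorm_final 1 dl Q _ 3 sz) => [i ai|i ai|]; [exact: reg_d0|exact: sumL2_ge0|].
have [C [C0 HC]] := osc1_Hsq1 _ _ _ _ _ Q osc1_h2 reg_d0 (fun i _ => sumL2_ge0 _) Hfs.
by exists C; split => // i ai f fI; have [j ->] := comps_In _ _ fI; rewrite /h2neq h2E//; exact: HC.
Qed.

(** The singular terms of [pd l (h2f j)] are those in which [l] falls on [z] or [w]. *)
Lemma pd_h2 (l j : 'I_3) i : adm i -> pd l (h2f j i) = fun x =>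
  ((((-1) * ((rhof i x)^-1 * (rhof i x)^-1) + (Rho i x.1)^-1 * (Rho i x.1)^-1) * ((l == ord0)%:R * Rho1 i x.1)) * kap
    j i x.1
   + ((rhof i x)^-1 + (-1) * (Rho i x.1)^-1) * pd l (fun x => kap j i x.1) x + wf ord0 i x * pd l (fun x => mu_ j i
     x.1) x)
  + (-1) * ((rhof i x)^-1 * (rhof i x)^-1) * kap j i x.1 * pd l (zf i) x + mu_ j i x.1 * pd l (wf ord0 i) x.
Proof.
move=> ai; have [p rp] := reg_pos _ _ _ ai.
have Cz : Cper 2 (zf i) by have [] := reg_z _ _ _ ai.
have Cw : Cper 2 (wf ord0 i) by have [] := reg_w _ _ _ ai ord0.
have sk : sm 2 (kap j i) by exact: (unif_sm _ _ _ _ _ _ ai (U_kap j)).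
have sm_ : sm 2 (mu_ j i) by exact: (unif_sm _ _ _ _ _ _ ai (U_mu j)).
have sV : sm 3 (fun y => (Rho i y)^-1) by exact: (unif_sm _ _ _ _ _ _ ai unif_RhoV).
have dk x : derivable (fun x : R * (R * R) => kap j i x.1) x (unitv l) by exact: (Ck_der 1 _ _ _ (Ck_fst_sm _ _ sk)).
have dm x : derivable (fun x : R * (R * R) => mu_ j i x.1) x (unitv l) by exact: (Ck_der 1 _ _ _ (Ck_fst_sm _ _ sm_)).
have dV x : derivable (fun x : R * (R * R) => (Rho i x.1)^-1) x (unitv l) by exact: (Ck_der 2 _ _ _ (Ck_fst_sm _ _
  sV)).
have [dr pr] := pd_inv l (rhof i) (fun x => Ck_der 1 _ l x (Ck_rho i ai).1) rp.
have [dN pN] := pdN l _ dV.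
have [dS pS] := pdD l _ _ dr dN.
have [dP pP] := pdM l _ _ dS dk.
have [dQ pQ] := pdM l _ _ (fun x => Ck_der 1 _ l x Cw.1) dm.
have [_ pT] := pdD l _ _ dP dQ.
rewrite /h2f pT pP pQ pS pN pr pd_rho//.
have pV : pd l (fun x : R * (R * R) => (Rho i x.1)^-1) = fun x => (l == ord0)%:R * ((-1) * ((Rho i x.1)^-1 * (Rho i
  x.1)^-1) * Rho1 i x.1).
  rewrite (pd_fst_hder l (fun y => (Rho i y)^-1) (fun y => (-1) * ((Rho i y)^-1 * (Rho i y)^-1) * Rho1 i y)).
    by apply/funext => x; case: (l == ord0); rewrite /= ?mul1r ?mul0r.
  move=> y; have q := Rho_gt0 i y ai.
  by apply: hder_eq (dinv _ _ _ _ (dRho i y ai)) _; [rewrite gt_eqF|rewrite expr2; field; rewrite gt_eqF].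
apply/funext => x; rewrite pV; case: (l == ord0) => /=; ring.
Qed.

Lemma osc_rhoVV L (j : 'I_3) : List.In zf L ->
  osc L dl dl (fun i x => (-1) * ((rhof i x)^-1 * (rhof i x)^-1) * kap j i x.1).
Proof.
move=> zL; have o := osc_rhoV L zL.
have c1 : osc L one (fun=> 0) (fun _ _ => -1).
  by exists 1; split => // i ai; exists (fun=> -1) => x Ox; rewrite normrN normr1 subrr normr0 !mulr0 mul0r mulr1.
have ok : osc L dl dl (fun i x => kap j i x.1) by apply: (osc_unif true 3); [exact: reg_d0|exact: U_kap].
have m1 := oscM _ _ _ _ _ _ _ _ (oscM _ _ _ _ _ _ _ _ c1 (oscM _ _ _ _ _ _ _ _ o o)) ok.
by apply: (osc_leC 4 _ _ _ _ _ _ _ _ m1) => // i ai; have := reg_d0 i ai; split; lra.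
Qed.

Lemma osc1_cst L (c : R) (l : I -> R) : (forall i, adm i -> 0 <= l i) -> osc1 L one l (fun _ _ => c).
Proof.
move=> l0; split; first by move=> i ai; split; [exact: Ck_cst|].
  exists `|c|; split => // i ai; exists (fun=> c) => x Ox; rewrite subrr normr0 mulr1; split => //.
  by rewrite mulr_ge0 ?sum_abs_ge0// mulr_ge0// l0.
move=> j; apply: (osc_ext _ _ _ _ (fun _ _ => 0)); last by have [] := osc1_0 L one l.
by move=> i ai; have [_ ->] := pd_cst j c.
Qed.

Lemma osc1_pd_fst b L l0 (l : I -> R) (g : I -> R -> R) : (forall i, adm i -> 0 <= l i) -> U b 3 g ->
  osc1 L (weight dl b) l (fun i => pd l0 (fun x => g i x.1)).
Proof.
move=> l_ge0 [_ [g' [h1 h2]]].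
have h3 : U b 2 (fun i y => (l0 == ord0)%:R * g' i y) by exact: unifZ.
have [ca oa da] := osc1_unif b L l _ l_ge0 h3.
have E i : adm i -> (fun x : R * (R * R) => (l0 == ord0)%:R * g' i x.1) = pd l0 (fun x => g i x.1).
  move=> ai; rewrite (pd_fst_hder _ _ _ (h1 i ai)); apply/funext => x.
  by case: (l0 == ord0); rewrite /= ?mul1r ?mul0r.
split; first by move=> i ai; rewrite -E//; exact: ca.
  by apply: (osc_ext _ _ _ _ _ _ E).
by move=> j; apply: (osc_ext _ _ _ _ _ _ (fun i ai => congr1 (pd j) (E i ai))).
Qed.

(** The unknowns occur undifferentiated here, so one more derivative still produces only first
    derivatives, which are bounded pointwise. *)
Lemma osc1_h2_reg (l j : 'I_3) : osc1 (with_grad zw0) dl dl (fun i x =>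
  (((-1) * ((rhof i x)^-1 * (rhof i x)^-1) + (Rho i x.1)^-1 * (Rho i x.1)^-1) * ((l == ord0)%:R * Rho1 i x.1)) * kap
    j i x.1
   + ((rhof i x)^-1 + (-1) * (Rho i x.1)^-1) * pd l (fun x => kap j i x.1) x + wf ord0 i x * pd l (fun x => mu_ j i
     x.1) x).
Proof.
have [z1 z2] : List.In zf (with_grad zw0) /\ _ := In_with_grad zw0 zf (or_introl erefl).
have [w1 w2] : List.In (wf ord0) (with_grad zw0) /\ _ := In_with_grad zw0 (wf ord0) (or_intror (or_introl erefl)).
have one0 (i : I) : adm i -> 0 <= (1 : R) by [].
have ok : osc1 (with_grad zw0) dl dl (fun i x => kap j i x.1).
  by apply: (osc1_unif true); [exact: reg_d0|exact: unif_le (U_kap j)].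
have oR : osc1 (with_grad zw0) dl dl (fun i x => (l == ord0)%:R * Rho1 i x.1).
  apply: (osc1_unif true) (_ : U true 2 (fun i y => (l == ord0)%:R * Rho1 i y)); first exact: reg_d0.
  by apply: unifZ; exact: unif_le U_Rho1.
have dk := osc1_pd_fst true (with_grad zw0) l dl _ reg_d0 (U_kap j).
have dm := osc1_pd_fst true (with_grad zw0) l dl _ reg_d0 (U_mu j).
have oV : osc1 (with_grad zw0) one one (fun i x => (Rho i x.1)^-1).
  by apply: (osc1_unif false) (_ : U false 2 (fun i y => (Rho i y)^-1)) => //; exact: unif_le unif_RhoV.
have ow := good_osc1 (with_grad zw0) (wf ord0) (fun i ai => reg_w _ _ _ ai ord0) w1 w2.
have oz := osc1_rhoV _ z1 z2.
have cN := osc1_cst (with_grad zw0) (-1) one one0.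
have M2 a b : osc1 (with_grad zw0) one one a -> osc1 (with_grad zw0) one one b -> osc1 (with_grad zw0) one one (fun i
  x => a i x * b i x).
  by move=> ha hb; apply: (osc1_leC 2 _ _ _ _ _ _ _ _ (osc1M _ _ _ _ _ _ _ _ ha hb)) => // i ai; split; lra.
have Md a b : osc1 (with_grad zw0) one one a -> osc1 (with_grad zw0) dl dl b -> osc1 (with_grad zw0) dl dl (fun i x
  => a i x * b i x).
  move=> ha hb; apply: (osc1_leC 2 _ _ _ _ _ _ _ _ (osc1M _ _ _ _ _ _ _ _ ha hb)) => // i ai.
  by have := reg_d0 i ai; split; lra.
have D2 a b k : osc1 (with_grad zw0) k k a -> osc1 (with_grad zw0) k k b -> osc1 (with_grad zw0) k k (fun i x => a i
  x + b i x).
  exact: osc1D.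
have w11 : osc1 (with_grad zw0) one one (wf ord0).
  by apply: (osc1_leC 1 _ _ _ _ _ _ _ _ ow) => // i ai; have /andP[v0 v1] := reg_v _ _ _ ai; split; lra.
have d1 a : osc1 (with_grad zw0) dl dl a -> osc1 (with_grad zw0) one one a.
  by move=> h; apply: (osc1_leC 1 _ _ _ _ _ _ _ _ h) => // i ai; have /andP[v0 v1] := reg_d _ _ _ ai; split; lra.
have t1 := Md _ _ (M2 _ _ (D2 _ _ _ (M2 _ _ cN (M2 _ _ oz oz)) (M2 _ _ oV oV)) (d1 _ oR)) ok.
have t2 := Md _ _ (D2 _ _ _ oz (M2 _ _ cN oV)) dk.
have t3 := Md _ _ w11 dm.
exact: (D2 _ _ _ (D2 _ _ _ t1 t2) t3).
Qed.

Lemma pd_fluct_ext m l Q a b : (forall i, adm i -> a i = b i) -> pd_fluct m l Q a -> pd_fluct m l Q b.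
Proof.
move=> E [ca [C [C0 H]]]; split; first by move=> i ai; rewrite -E//; exact: ca.
exists C; split; [exact: C0|move=> i ai; rewrite -(E i ai); exact: (H i ai)].
Qed.

Lemma Hsq2_final fs k wt (J : finType) (a : J -> fam) (Q : I -> \bar R) :
  (forall j, osc1 (with_grad fs) k wt (a j)) -> (forall j i, adm i -> Cper 2 (a j i)) ->
  (forall i, adm i -> 0 <= wt i) -> (forall i, adm i -> (0 <= Q i)%E) ->
  (forall f, List.In f fs -> ctrl Q f /\ forall i, adm i -> Cper 1 (f i)) ->
  (forall j l m, pd_fluct m wt Q (fun i => pd l (a j i))) ->
  exists C : R, 0 <= C /\ forall i, adm i -> forall j, (Hsq 2 (neq (a j i)) <= (C * wt i ^+ 2)%:E * Q i)%E.
Proof.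
move=> oa ca w0 Q0 Hfs hs; apply: (unif_fin _ _ _ (fun j i => Hsq 2 (neq (a j i)))) => // j.
have [C [C0 H]] := osc1_Hsq _ _ _ _ Q (oa j) w0 Q0 Hfs.
have [D [D0 H']] := unif_fin wt Q _ (fun (p : 'I_3 * 'I_3) i => L2sq (neq (pd p.2 (pd p.1 (a j i))))) Q0
  (fun p => (hs j p.1 p.2).2).
exists ((Hsq_card 2)%:R * (C + D)); split; first by rewrite mulr_ge0 ?addr_ge0.
move=> i ai; have [h1 h2] := H i ai.
have wk (c : R) (x : \bar R) : c <= C + D -> (x <= (c * wt i ^+ 2)%:E * Q i -> x <= ((C + D) * wt i ^+ 2)%:E * Q i)%E.
  by move=> h hx; apply: le_trans hx _; rewrite lee_wpmul2r ?Q0// lee_fin ler_wpM2r ?sqr_ge0.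
have cC : C <= C + D by rewrite lerDl.
have cD : D <= C + D by rewrite lerDr.
apply: le_trans (Hsq2_neq _ (((C + D) * wt i ^+ 2)%:E * Q i) (ca j i ai) (wk _ _ cC h1) (fun m => wk _ _ cC (h2 m))
  (fun m l => wk _ _ cD (H' i ai (l, m)))) _.
by rewrite muleA -EFinM mulrA.
Qed.

Definition sumH1 (gs : seq (R * (R * R) -> R)) : \bar R := (\sum_(g <- gs) Hsq 1 g)%E.

Lemma sumH1_ge0 gs : (0 <= sumH1 gs)%E.
Proof. by apply: sume_ge0 => g _; exact: Hsq_ge0. Qed.

Lemma ctrl2_sumH1 (gs : I -> seq (R * (R * R) -> R)) f : (forall i, adm i -> Cper 2 (f i)) ->
  (forall i, adm i -> List.In (neq (f i)) (gs i)) -> ctrl2 (fun i => sumH1 (grad (gs i))) f.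
Proof.
move=> Cf fI.
have H i (k : 'I_3) : adm i -> (Hsq 1 (pd k (neq (f i))) <= sumH1 (grad (gs i)))%E.
  by move=> ai; exact: (sume_ge_In (grad (gs i)) (Hsq 1) _ (Hsq_ge0 1) (In_grad _ _ k (fI i ai))).
have C1 i (k : 'I_3) : adm i -> Cper 1 (pd k (neq (f i))) by move=> ai; apply: Cper_pd; exact: Cper_neq (Cf i ai).
apply: ctrl2_of => // i ai k.
  by apply: le_trans (H i k ai); apply: (L2sq_le_Hsq 1 [::]) => //; exact: Cper_le (C1 i k ai).
by move=> m; apply: le_trans (H i k ai); apply: (L2sq_le_Hsq 1 [:: m]) => //; exact: C1.
Qed.

Lemma Cper_h2 j i : adm i -> Cper 2 (h2f j i).
Proof.
move=> ai; have [p rp] := reg_pos _ _ _ ai.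
have C1 : Cper 2 (fun x => (rhof i x)^-1).
  split; first by apply: Ck_inv => //; exact: (Ck_rho i ai).1.
  by move=> x1 x2 x3; have [-> ->] := p x1 x2 x3.
have C2 : Cper 2 (fun x : R * (R * R) => (-1) * (Rho i x.1)^-1).
  by apply: (Cper_fst_sm 2 (fun y => (-1) * (Rho i y)^-1)); apply: smZ; apply: sm_le (unif_sm _ _ _ _ _ _ ai
    unif_RhoV).
have C3 : Cper 2 (fun x : R * (R * R) => kap j i x.1) by apply: Cper_fst_sm; exact: (unif_sm _ _ _ _ _ _ ai (U_kap
  j)).
have C4 : Cper 2 (fun x : R * (R * R) => mu_ j i x.1) by apply: Cper_fst_sm; exact: (unif_sm _ _ _ _ _ _ ai (U_mu j)).
have C5 : Cper 2 (wf ord0 i) by have [] := reg_w _ _ _ ai ord0.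
have -> : h2f j i = fun x => ((rhof i x)^-1 + (-1) * (Rho i x.1)^-1) * kap j i x.1 + wf ord0 i x * mu_ j i x.1.
  by apply/funext => x; rewrite /h2f mulN1r.
exact: (CperD _ _ _ (CperM _ _ _ (CperD _ _ _ C1 C2) C3) (CperM _ _ _ C5 C4)).
Qed.

(** By [pd_h2] a first derivative of [h2f] is the regular part plus profile-sized factors times
    gradients of [z] and [w]; the latter two go through [pd_fluct_second]. *)
Lemma h2_est2 : exists C : R, 0 <= C /\ forall i, adm i ->
  (Hnorm 2 (comps (h2neq T (c_s i) (c_W i) (c_F i) (c_t i))) <= (C * dl i)%:E *
    Hnorm 1 (grad (zneq (c_s i) (c_W i) (c_F i) (c_t i) :: comps (wneq (c_s i) (c_W i) (c_F i) (c_t i)))))%E.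
Proof.
pose gs (i : I) := zneq (c_s i) (c_W i) (c_F i) (c_t i) :: comps (wneq (c_s i) (c_W i) (c_F i) (c_t i)).
pose Q (i : I) := sumH1 (grad (gs i)).
have Q0 i : adm i -> (0 <= Q i)%E by move=> _; exact: sumH1_ge0.
have c2 f : List.In f zw0 -> ctrl2 Q f.
  by move=> /zw0_zwfs fI; apply: ctrl2_sumH1; [move=> i ai; exact: zwfs_Cper2|move=> i ai; exact: zwfs_neq].
have Hfs f : List.In f zw0 -> ctrl Q f /\ forall i, adm i -> Cper 1 (f i).
  by move=> fI; split; [have [] := c2 f fI|move=> i ai; apply: Cper_le (zwfs_Cper2 _ _ (zw0_zwfs _ fI) ai)].
have sz (i : I) : size (comps (h2neq T (c_s i) (c_W i) (c_F i) (c_t i))) = 3%N by rewrite size_map size_enum_ord.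
apply: (Hnorm_final 2 dl Q _ 3 sz) => [i ai|//|]; first exact: reg_d0.
have zI : List.In zf zw0 by left.
have wI : List.In (wf ord0) zw0 by right; left.
have hk : exists C : R, 0 <= C /\ forall i, adm i -> 0 <= dl i /\ dl i + dl i * nu i + dl i * 1 <= C * dl i.
  exists 3; split => // i ai; have d0 := reg_d0 i ai; have /andP[v0 v1] := reg_v _ _ _ ai; split => //.
  have : dl i * nu i <= dl i * 1 by rewrite ler_wpM2l.
  by lra.
have kl0 i : adm i -> 0 <= dl i /\ 0 <= dl i by move=> ai; split; exact: reg_d0.
have [z1 z2] : List.In zf (with_grad zw0) /\ _ := In_with_grad zw0 zf zI.
have one0 (i : I) : adm i -> 0 <= (1 : R) by [].
have hs j l m : pd_fluct m dl Q (fun i => pd l (h2f j i)).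
  apply: (pd_fluct_ext _ _ _ _ _ (fun i ai => esym (pd_h2 l j i ai))).
  have ok : osc1 (with_grad zw0) dl dl (fun i x => kap j i x.1).
    by apply: (osc1_unif true); [exact: reg_d0|exact: unif_le (U_kap j)].
  have om : osc1 (with_grad zw0) dl dl (fun i x => mu_ j i x.1).
    by apply: (osc1_unif true); [exact: reg_d0|exact: unif_le (U_mu j)].
  have om0 : osc zw0 dl dl (fun i x => mu_ j i x.1) by apply: (osc_unif true 3); [exact: reg_d0|exact: U_mu].
  have oa : osc1 (with_grad zw0) dl dl (fun i x => (-1) * ((rhof i x)^-1 * (rhof i x)^-1) * kap j i x.1).
    have oz := osc1_rhoV _ z1 z2.
    have m1 := osc1M _ _ _ _ _ _ _ _ (osc1M _ _ _ _ _ _ _ _ (osc1_cst _ (-1) one one0) (osc1M _ _ _ _ _ _ _ _ oz oz))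
      ok.
    by apply: (osc1_leC 4 _ _ _ _ _ _ _ _ m1) => // i ai; have := reg_d0 i ai; split; lra.
  have s1 := pd_fluct_osc1 _ _ _ m _ Q (osc1_h2_reg l j) reg_d0 Q0 Hfs.
  have s2 := pd_fluct_second zw0 dl dl dl m l _ zf Q oa (osc_rhoVV _ j zI) zI (fun i ai => reg_z _ _ _ ai) Q0 kl0 hk
    Hfs (c2 _ zI).
  have s3 := pd_fluct_second zw0 dl dl dl m l _ (wf ord0) Q om om0 wI (fun i ai => reg_w _ _ _ ai ord0) Q0 kl0 hk Hfs
    (c2 _ wI).
  exact: (pd_fluctD _ _ _ _ _ Q0 (pd_fluctD _ _ _ _ _ Q0 s1 s2) s3).
have [C [C0 HC]] := Hsq2_final zw0 dl dl _ h2f Q osc1_h2 Cper_h2 reg_d0 Q0 Hfs hs.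
by exists C; split => // i ai f fI; have [j ->] := comps_In _ _ fI; rewrite /h2neq h2E//; exact: HC.
Qed.

(** * The term [N2] *)

Lemma smooth1_expR : smooth1 (@expR R).
Proof.
move=> n y; have -> : derive1n n expR = expR :> (R -> R).
  by elim: n => [//|n IH]; rewrite derive1nS IH; apply: hder_derive1E => u; exact: is_derive_expR.
by have [] : hder expR y (expR y) by exact: is_derive_expR.
Qed.

Definition N2f i x := expR (Ee i x.1) * (expR (Hf i x) - 1 - Hf i x).

Lemma U_expE : U false 3 (fun i y => expR (Ee i y)).
Proof.
have bd : exists C : R, forall i, adm i -> forall y, `|expR (Ee i y)| <= C * weight dl false i.
  exists (expR B) => i ai y /=; rewrite mulr1 ger0_norm ?expR_ge0// ler_expR.
  by apply: le_trans (ler_norm _) _; exact: (reg_E _ _ _ ai).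
have dE i : adm i -> forall y, hder (fun y => expR (Ee i y)) y (expR (Ee i y) * Ee1 i y).
  by move=> ai y; apply: hder_eq (dexp _ _ _ (dEe i y ai)) _; ring.
have R1 : U false 3 Ee1 by apply: unif_weak; [exact: dl01|exact: unif_le U_Ee1].
have step n : (n <= 3)%N -> U false n (fun i y => expR (Ee i y)) -> U false n.+1 (fun i y => expR (Ee i y)).
  by move=> n3 h; apply: (unif_S _ _ _ _ _ _ bd dE); apply: unifM => //; exact: unif_le R1.
exact: (step 2%N isT (step 1%N isT (step 0%N isT (conj bd Logic.I)))).
Qed.

Lemma Hf_bounds i : adm i -> continuous (Hf i) /\ forall x, Omega x -> `|Hf i x| <= B * nu i.
Proof. by move=> ai; apply: good_sup; exact: (reg_H _ _ _ ai). Qed.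

Lemma osc_expH1 L : List.In Hf L -> osc L nu one (fun i x => expR (Hf i x) - 1).
Proof.
move=> HL; have B0 := B_ge0; have B1' := B1.
apply: (osc_comp _ _ _ _ Hf (fun i => B * nu i) (fun _ _ u => expR u - 1)) => //; first exact: Hf_bounds.
exists (2 * B); split; first exact: mulr_ge0.
move=> i ai; split => // _ u v hu hv; have [r2 _] := reg_Bv _ _ _ ai; split.
  apply: le_trans (expR1_le u (le_trans hu r2)) _; lra.
apply: le_trans (expR1_lip u v (le_trans hu r2) (le_trans hv r2)) _.
by rewrite ler_wpM2r//; lra.
Qed.

(** [expR u - 1 - u] is quadratic at the origin, so its Lipschitz constant on the range of [H] is of
    order [nu]: the smallness sits in the fluctuation factor. *)
Lemma osc_expH2 L : List.In Hf L -> osc L nu nu (fun i x => expR (Hf i x) - 1 - Hf i x).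
Proof.
move=> HL; have B0 := B_ge0; have B1' := B1.
apply: (osc_comp _ _ _ _ Hf (fun i => B * nu i) (fun _ _ u => expR u - 1 - u)) => //; first exact: Hf_bounds.
exists (2 * B); split; first exact: mulr_ge0.
move=> i ai; split => [|_ u v hu hv]; first exact: reg_v0.
have [r2 _] := reg_Bv _ _ _ ai; split.
  apply: le_trans (expR2_le (B * nu i) u r2 hu) _.
  by have := mulr_ge0 B0 (reg_v0 i ai); lra.
apply: le_trans (expR2_lip (B * nu i) u v r2 hu hv) _.
by rewrite (mulrA 2 B).
Qed.

Lemma Cper_expH i : adm i -> Cper 2 (fun x => expR (Hf i x)).
Proof.
move=> ai; have [[Ch ph] _ _] := reg_H _ _ _ ai; split; first exact: Ck_comp smooth1_expR Ch.
by move=> x1 x2 x3; have [-> ->] := ph x1 x2 x3.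
Qed.

Lemma Cper_cst n (c : R) : Cper n (fun=> c : R).
Proof. by split; [exact: Ck_cst|]. Qed.

Lemma CperN n (f : R * (R * R) -> R) : Cper n f -> Cper n (fun x => - f x).
Proof. by move=> [cf pf]; split; [exact: CkN|move=> x1 x2 x3; have [-> ->] := pf x1 x2 x3]. Qed.

Lemma Cper_expH1 i : adm i -> Cper 2 (fun x => expR (Hf i x) - 1).
Proof. by move=> ai; exact: (CperD _ _ _ (Cper_expH i ai) (Cper_cst _ (-1))). Qed.

Lemma Cper_expH2 i : adm i -> Cper 2 (fun x => expR (Hf i x) - 1 - Hf i x).
Proof. by move=> ai; have [Ch _ _] := reg_H _ _ _ ai; exact: (CperD _ _ _ (Cper_expH1 i ai) (CperN _ _ Ch)). Qed.

Lemma pd_expH1 i k : adm i -> pd k (fun x => expR (Hf i x) - 1) = fun x => expR (Hf i x) * pd k (Hf i) x.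
Proof.
move=> ai; have [[Ch ph] _ _] := reg_H _ _ _ ai.
have dP (y : R) : hder (fun u => expR u - 1) y (expR y).
  by apply: hder_eq (dB _ _ _ _ _ (dexp _ _ _ (did y)) (dcst 1 y)) _; ring.
have [_ ->] := pd_comp k (fun u => expR u - 1) (Hf i) (fun x => Ck_der 1 _ k x Ch)
  (fun x => @ex_derive _ _ _ _ _ _ _ (dP _)).
by rewrite (hder_derive1E _ _ dP).
Qed.

Lemma pd_expH2 i k : adm i -> pd k (fun x => expR (Hf i x) - 1 - Hf i x) = fun x => (expR (Hf i x) - 1) * pd k (Hf i)
  x.
Proof.
move=> ai; have [[Ch ph] _ _] := reg_H _ _ _ ai.
have dP (y : R) : hder (fun u => expR u - 1 - u) y (expR y - 1).
  by apply: hder_eq (dB _ _ _ _ _ (dB _ _ _ _ _ (dexp _ _ _ (did y)) (dcst 1 y)) (did y)) _; ring.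
have [_ ->] := pd_comp k (fun u => expR u - 1 - u) (Hf i) (fun x => Ck_der 1 _ k x Ch)
  (fun x => @ex_derive _ _ _ _ _ _ _ (dP _)).
by rewrite (hder_derive1E _ _ dP).
Qed.

Definition Hfs : seq fam := [:: Hf].

Lemma H_In : List.In Hf (with_grad Hfs) /\ forall k, List.In (fun i => pd k (Hf i)) (with_grad Hfs).
Proof. exact: In_with_grad Hfs Hf (or_introl erefl). Qed.

Lemma osc1_H : osc1 (with_grad Hfs) nu one Hf.
Proof. by have [h1 h2] := H_In; apply: good_osc1 => // i ai; exact: (reg_H _ _ _ ai). Qed.

Lemma osc1_expH2 : osc1 (with_grad Hfs) nu nu (fun i x => expR (Hf i x) - 1 - Hf i x).
Proof.
have [h1 h2] := H_In; split; [by move=> i ai; apply: Cper_le (Cper_expH2 i ai)|exact: osc_expH2|].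
move=> k; apply: (osc_ext _ _ _ _ (fun i x => (expR (Hf i x) - 1) * pd k (Hf i) x)); first by move=> i ai; rewrite
  pd_expH2.
have [_ _ oH] := osc1_H.
apply: (osc_leC 2 _ _ _ _ _ _ _ _ (oscM _ _ _ _ _ _ _ _ (osc_expH1 _ h1) (oH k))) => // i ai.
have /andP[v0 v1] := reg_v _ _ _ ai; have : nu i * nu i <= 1 * nu i by rewrite ler_wpM2r.
by split; lra.
Qed.

Lemma osc1_expH1 : osc1 (with_grad Hfs) nu one (fun i x => expR (Hf i x) - 1).
Proof.
have [h1 h2] := H_In; split; [by move=> i ai; apply: Cper_le (Cper_expH1 i ai)|exact: osc_expH1|].
have [_ _ oH] := osc1_H.
move=> k; apply: (osc_ext _ _ _ _ (fun i x => (expR (Hf i x) - 1) * pd k (Hf i) x + pd k (Hf i) x)).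
  by move=> i ai; rewrite pd_expH1//; apply/funext => x; ring.
apply: oscD (oH k).
apply: (osc_leC 2 _ _ _ _ _ _ _ _ (oscM _ _ _ _ _ _ _ _ (osc_expH1 _ h1) (oH k))) => // i ai.
have /andP[v0 v1] := reg_v _ _ _ ai; have : nu i * nu i <= 1 * nu i by rewrite ler_wpM2r.
by split; lra.
Qed.

Lemma osc1_expE L : osc1 L one one (fun i x => expR (Ee i x.1)).
Proof. by apply: (osc1_unif false) (_ : U false 2 (fun i y => expR (Ee i y))) => //; exact: unif_le U_expE. Qed.

Lemma osc1_N2 : osc1 (with_grad Hfs) dn dn N2f.
Proof.
apply: (osc1_leC 2 _ _ _ _ _ _ _ _ (osc1M _ _ _ _ _ _ _ _ (osc1_expE _) osc1_expH2)) => // i ai.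
by have [] := dn_ge i ai; split; lra.
Qed.

Lemma Hf_Cper2 i : adm i -> Cper 2 (Hf i).
Proof. by move=> ai; have [] := reg_H _ _ _ ai. Qed.

Lemma N2_est1 : exists C : R, 0 <= C /\ forall i, adm i ->
  (Hnorm 1 [:: N2neq (c_s i) (c_W i) (c_F i) (c_t i)] <= (C * dn i)%:E *
    L2norm (grad [:: Hneq (c_s i) (c_W i) (c_F i) (c_t i)]))%E.
Proof.
pose gs (i : I) := [:: Hneq (c_s i) (c_W i) (c_F i) (c_t i)].
pose Q (i : I) := sumL2 (grad (gs i)).
have Hl f : List.In f Hfs -> ctrl Q f /\ forall i, adm i -> Cper 1 (f i).
  move=> [<-|//]; split; last by move=> i ai; apply: Cper_le (Hf_Cper2 i ai).
  by apply: ctrl_of; [exact: Hf_Cper2|move=> i ai k; apply: L2sq_grad; left].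
apply: (Hnorm_final 1 dn Q _ 1) => [//|i ai|i ai|]; [exact: dn0|exact: sumL2_ge0|].
have [C [C0 HC]] := osc1_Hsq1 _ _ _ _ (fun _ : unit => N2f) Q (fun _ => osc1_N2) dn0 (fun i _ => sumL2_ge0 _) Hl.
by exists C; split => // i ai f [<-|//]; exact: (HC i ai tt).
Qed.

Lemma Cper_N2 i : adm i -> Cper 2 (N2f i).
Proof.
move=> ai; apply: (CperM _ _ _ _ (Cper_expH2 i ai)); apply: (Cper_fst_sm 2 (fun y => expR (Ee i y))).
exact: (unif_sm _ _ _ _ _ _ ai U_expE).
Qed.

Lemma pd_N2 l i : adm i -> pd l (N2f i) = fun x =>
  pd l (fun x => expR (Ee i x.1)) x * (expR (Hf i x) - 1 - Hf i x) + (expR (Ee i x.1) * (expR (Hf i x) - 1)) * pd l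
    (Hf i) x.
Proof.
move=> ai; have sE : sm 2 (fun y => expR (Ee i y)) by exact: (unif_sm _ _ _ _ _ _ ai U_expE).
have [_ ->] := pdM l (fun x => expR (Ee i x.1)) _ (fun x => Ck_der 1 _ l x (Ck_fst_sm _ _ sE))
  (fun x => Ck_der 1 _ l x (Cper_expH2 i ai).1).
by rewrite pd_expH2//; apply/funext => x; rewrite mulrA.
Qed.

(** In [pd_N2] the gradient of [H] is multiplied by [expR Ee (expR H - 1)], of size [nu], which
    gives the small factor in front of second derivatives. *)
Lemma N2_est2 : exists C : R, 0 <= C /\ forall i, adm i ->
  (Hnorm 2 [:: N2neq (c_s i) (c_W i) (c_F i) (c_t i)] <= (C * dn i)%:E *
    Hnorm 1 (grad [:: Hneq (c_s i) (c_W i) (c_F i) (c_t i)]))%E.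
Proof.
pose gs (i : I) := [:: Hneq (c_s i) (c_W i) (c_F i) (c_t i)].
pose Q (i : I) := sumH1 (grad (gs i)).
have Q0 i : adm i -> (0 <= Q i)%E by move=> _; exact: sumH1_ge0.
have HI : List.In Hf Hfs by left.
have c2 : ctrl2 Q Hf by apply: ctrl2_sumH1; [exact: Hf_Cper2|move=> i ai; left].
have Hl f : List.In f Hfs -> ctrl Q f /\ forall i, adm i -> Cper 1 (f i).
  move=> [<-|//]; split; last by move=> i ai; apply: Cper_le (Hf_Cper2 i ai).
  by have [] := c2.
apply: (Hnorm_final 2 dn Q _ 1) => [//|i ai|//|]; first exact: dn0.
have v01 i : adm i -> nu i <= 1 by move=> /reg_v /andP[].
have oa : osc1 (with_grad Hfs) nu one (fun i x => expR (Ee i x.1) * (expR (Hf i x) - 1)).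
  apply: (osc1_leC 2 _ _ _ _ _ _ _ _ (osc1M _ _ _ _ _ _ _ _ (osc1_expE _) osc1_expH1)) => // i ai.
  by have [] := dn_ge i ai; have := v01 i ai; split; lra.
have oa0 : osc Hfs nu one (fun i x => expR (Ee i x.1) * (expR (Hf i x) - 1)).
  have [_ oE _] := osc1_expE Hfs.
  apply: (osc_leC 2 _ _ _ _ _ _ _ _ (oscM _ _ _ _ _ _ _ _ oE (osc_expH1 _ HI))) => // i ai.
  by have [] := dn_ge i ai; have := v01 i ai; split; lra.
have hs (j : unit) l m : pd_fluct m dn Q (fun i => pd l (N2f i)).
  apply: (pd_fluct_ext _ _ _ _ _ (fun i ai => esym (pd_N2 l i ai))); apply: pd_fluctD => //.
    have od := osc1_pd_fst false (with_grad Hfs) l one (fun i y => expR (Ee i y)) (fun _ _ => ler01) U_expE.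
    apply: (pd_fluct_osc1 Hfs dn dn) => //; last exact: dn0.
    apply: (osc1_leC 2 _ _ _ _ _ _ _ _ (osc1M _ _ _ _ _ _ _ _ od osc1_expH2)) => // i ai.
    by rewrite /weight; have [] := dn_ge i ai; have := v01 i ai; split; lra.
  apply: (pd_fluct_second Hfs nu one dn m l _ Hf Q oa oa0 HI (fun i ai => reg_H _ _ _ ai) Q0 _ _ Hl c2).
  - by move=> i ai; split => //; exact: reg_v0.
  - by exists 3; split => // i ai; have [] := dn_ge i ai; split; lra.
have [C [C0 HC]] := Hsq2_final Hfs dn dn _ (fun _ : unit => N2f) Q (fun _ => osc1_N2) (fun _ => Cper_N2) dn0 Q0 Hl hs.
by exists C; split => // i ai f [<-|//]; exact: (HC i ai tt).
Qed.

(** * The time derivative of [N2] *)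

Definition N2tf i x := expR (Ee i x.1) * ((expR (Hf i x) - 1) * Htf i x
  + (- c_s i * Ee1 i x.1) * (expR (Hf i x) - 1 - Hf i x)).

Definition HHt : seq fam := [:: Hf; Htf].

Lemma Htf_Cper2 i : adm i -> Cper 2 (Htf i).
Proof. by move=> ai; have [] := reg_Ht _ _ _ ai. Qed.

(** In the product of [expR H - 1] with [Htf], the fluctuation of either factor meets the size [nu]
    of the other. The profile part moves with the bounded speed [c_s] and multiplies a term whose
    fluctuation factor is already [nu]. *)
Lemma osc_N2t : osc (with_grad HHt) one dn N2tf.
Proof.
have [h1 _] := In_with_grad HHt Hf (or_introl erefl).
have [h2 _] := In_with_grad HHt Htf (or_intror (or_introl erefl)).
have [_ oE _] := osc1_expE (with_grad HHt).
have v01 i : adm i -> nu i <= 1 by move=> /reg_v /andP[].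
have ot : osc (with_grad HHt) nu one Htf.
  by apply: good_osc => // i ai; apply: good_sup; exact: (reg_Ht _ _ _ ai).
have oe : osc (with_grad HHt) one nu (fun i x => - c_s i * Ee1 i x.1).
  apply: (osc_unif false 4) (_ : U false 4 (fun i y => - c_s i * Ee1 i y)); first exact: reg_v0.
  apply: unifM; first by apply: unif_cst; exists B => i ai; rewrite normrN; exact: (reg_s _ _ _ ai).
  by apply: unif_weak; [exact: dl01|exact: U_Ee1].
have t1 := oscM _ _ _ _ _ _ _ _ (osc_expH1 _ h1) ot.
have t2 := oscM _ _ _ _ _ _ _ _ oe (osc_expH2 _ h1).
have vv i : adm i -> nu i * nu i <= nu i by move=> ai; have [_ v0] := dn_ge i ai; rewrite ler_piMr// v01.
have t1' : osc (with_grad HHt) one dn (fun i x => (expR (Hf i x) - 1) * Htf i x).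
  apply: (osc_leC 2 _ _ _ _ _ _ _ _ t1) => // i ai; have [] := dn_ge i ai; have := v01 i ai; have := vv i ai.
  by split; lra.
have t2' : osc (with_grad HHt) one dn (fun i x => (- c_s i * Ee1 i x.1) * (expR (Hf i x) - 1 - Hf i x)).
  apply: (osc_leC 2 _ _ _ _ _ _ _ _ t2) => // i ai; have [] := dn_ge i ai; have := v01 i ai; have := vv i ai.
  by split; lra.
have oE' : osc (with_grad HHt) one (fun=> 0) (fun i x => expR (Ee i x.1)).
  by apply: (osc_unif false 3) (_ : U false 3 (fun i y => expR (Ee i y))) => //; exact: U_expE.
have oN := oscM _ _ _ _ _ _ _ _ oE' (oscD _ _ _ _ _ _ t1' t2').
apply: (osc_leC 1 _ _ _ _ _ _ _ _ oN) => // i ai.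
by have [] := dn_ge i ai; split; lra.
Qed.

Lemma N2tf_cont i : adm i -> continuous (N2tf i).
Proof.
move=> ai; have cE : continuous (fun x : R * (R * R) => expR (Ee i x.1)).
  by apply: (Ck_cont 2); apply: (Ck_fst_sm 2 (fun y => expR (Ee i y))); exact: (unif_sm _ _ _ _ _ _ ai U_expE).
have cE1 : continuous (fun x : R * (R * R) => - c_s i * Ee1 i x.1).
  apply: (Ck_cont 2); apply: (Ck_fst_sm 2 (fun y => - c_s i * Ee1 i y)); apply: smZ.
  by apply: (sm_le 2 3) => //; exact: (unif_sm _ _ _ _ _ _ ai U_Ee1).
have c1 := Ck_cont _ _ (Cper_expH1 i ai).1; have c2 := Ck_cont _ _ (Cper_expH2 i ai).1.
have c3 := Ck_cont _ _ (Htf_Cper2 i ai).1.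
move=> x; apply: cvgM; first exact: cE.
by apply: cvgD; apply: cvgM; [exact: c1|exact: c3|exact: cE1|exact: c2].
Qed.

Lemma N2t_est : exists C : R, 0 <= C /\ forall i, adm i ->
  (L2norm [:: neq (N2tf i)] <= (C * dn i)%:E *
    L2norm (grad [:: Hneq (c_s i) (c_W i) (c_F i) (c_t i); Htneq (c_s i) (c_W i) (c_F i) (c_t i)]))%E.
Proof.
pose gs (i : I) := [:: Hneq (c_s i) (c_W i) (c_F i) (c_t i); Htneq (c_s i) (c_W i) (c_F i) (c_t i)].
pose Q (i : I) := sumL2 (grad (gs i)).
have Q0 i : adm i -> (0 <= Q i)%E by move=> _; exact: sumL2_ge0.
have Hl f : List.In f HHt -> ctrl Q f /\ forall i, adm i -> Cper 1 (f i).
  move=> [<-|[<-|//]]; split.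
  - by apply: ctrl_of; [exact: Hf_Cper2|move=> i ai k; apply: L2sq_grad; left].
  - by move=> i ai; apply: Cper_le (Hf_Cper2 i ai).
  - by apply: ctrl_of; [exact: Htf_Cper2|move=> i ai k; apply: L2sq_grad; right; left].
  - by move=> i ai; apply: Cper_le (Htf_Cper2 i ai).
apply: (L2norm_final dn Q _ 1) => [//|i ai|//|]; first exact: dn0.
have [HQ HD] := ctrl_lists _ _ Q0 Hl.
have [C [C0 HC]] := osc_L2 _ _ _ _ _ Q osc_N2t N2tf_cont dn0 HQ HD.
by exists C; split => // i ai f [<-|//]; exact: HC.
Qed.

End estimates.

(** * One-sided time derivatives *)

Section onesided.
Context {R : realType}.
Implicit Types (f g : R -> R) (t : R).

(** Nonzero increments tending to [0] that keep the time nonnegative: two-sided for positive [t],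
    one-sided at [t = 0]. *)
Definition side t : set_system R := within [set h | 0 <= t + h] (0 : R)^'.

Lemma near_side t (P : R -> Prop) :
  (\forall h \near side t, P h) <-> exists2 d : R, 0 < d & forall h, h != 0 -> 0 <= t + h -> `|h| < d -> P h.
Proof.
rewrite /side near_withinE; split.
  move=> /nbhs_ballP[d /= d0 H]; exists d => // h h0 th hd; apply: H => //=.
  by rewrite /ball /= sub0r normrN.
move=> [d d0 H]; apply/nbhs_ballP; exists d => //= h; rewrite /ball /= sub0r normrN => hd h0 th.
exact: H.
Qed.

Global Instance side_filter t : Filter (side t).
Proof. by rewrite /side; exact: within_filter. Qed.

Lemma side_proper t : 0 <= t -> ProperFilter (side t).
Proof.
move=> t0; apply: Build_ProperFilter_ex => P /near_side[d d0 H]; exists (d / 2); apply: H.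
- by rewrite gt_eqF// divr_gt0.
- by rewrite addr_ge0// ltW// divr_gt0.
- by rewrite gtr0_norm ?divr_gt0//; lra.
Qed.

Definition oder f t (a : R) : Prop := quott f t h @[h --> side t] --> a.

Lemma sideP t f (l : R) : f h @[h --> side t] --> l <->
  forall e : R, 0 < e -> exists2 d : R, 0 < d & forall h, h != 0 -> 0 <= t + h -> `|h| < d -> `|l - f h| < e.
Proof.
split=> [/cvgrPdist_lt H e e0|H]; first by apply/near_side; exact: H.
by apply/cvgrPdist_lt => e e0; apply/near_side; exact: H.
Qed.

Lemma side0 t (c : R) : c * h @[h --> side t] --> (0 : R).
Proof.
apply/sideP => e e0; exists (e / (`|c| + 1)).
  by rewrite divr_gt0// ltr_wpDl.
move=> h _ _; rewrite ltr_pdivlMr ?ltr_wpDl// => he.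
rewrite sub0r normrN normrM mulrC; apply: le_lt_trans he.
by rewrite ler_wpM2l// lerDl.
Qed.

Lemma side_eq t (f g : R -> R) (l : R) : (forall h, h != 0 -> 0 <= t + h -> f h = g h) ->
  f h @[h --> side t] --> l -> g h @[h --> side t] --> l.
Proof.
move=> E /sideP H; apply/sideP => e e0; have [d d0 Hd] := H e e0.
by exists d => // h h0 th hd; rewrite -E//; exact: Hd.
Qed.

Lemma oder_ext f g t a : (forall u, 0 <= u -> f u = g u) -> 0 <= t -> oder f t a -> oder g t a.
Proof. by move=> E t0; apply: side_eq => h h0 th; rewrite /quott !E. Qed.

Lemma oder_cont f t a : oder f t a -> f (t + h) @[h --> side t] --> f t.
Proof.
move=> H; have h1 : f t + quott f t h * h @[h --> side t] --> f t + a * 0.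
  apply: cvgD; first exact: cvg_cst.
  apply: cvgM => //; apply: (side_eq _ (fun h => 1 * h)); first by move=> h _ _; rewrite mul1r.
  exact: side0.
rewrite mulr0 addr0 in h1; apply: side_eq h1 => h h0 _.
by rewrite /quott divfK// addrC subrK.
Qed.

Lemma oderD f g t a b : oder f t a -> oder g t b -> oder (fun u => f u + g u) t (a + b).
Proof.
move=> ha hb; apply: (side_eq _ (fun h => quott f t h + quott g t h)); last exact: cvgD.
by move=> h h0 _; rewrite /quott; field.
Qed.

Lemma oderM f g t a b : oder f t a -> oder g t b -> oder (fun u => f u * g u) t (a * g t + f t * b).
Proof.
move=> ha hb; apply: (side_eq _ (fun h => quott f t h * g (t + h) + f t * quott g t h)).
  by move=> h h0 _; rewrite /quott; field.
apply: cvgD; apply: cvgM => //; [exact: oder_cont hb|exact: cvg_cst].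
Qed.

Lemma oder_cst (c : R) t : oder (fun=> c) t 0.
Proof.
apply: (side_eq _ (fun h => 0 * h)); last exact: side0.
by move=> h _ _; rewrite /quott subrr !mul0r.
Qed.

Lemma oderZ (c : R) f t a : oder f t a -> oder (fun u => c * f u) t (c * a).
Proof. by move=> h; have := oderM _ _ _ _ _ (oder_cst c t) h; rewrite mul0r add0r. Qed.

Lemma oder_hder f t a : hder f t a -> oder f t a.
Proof.
move=> h; have [df E] := h; have /= := df; rewrite /derivable => /cvg_ex[l hl].
have la : l = a by rewrite -E /derive; apply/esym/cvg_lim.
rewrite la in hl; move/cvgrPdist_lt: hl => hl; apply/sideP => e e0.
have [d /= d0 H] := hl e e0.
exists d => // u u0 _ ud; have := H u; rewrite /ball /= sub0r normrN => /(_ ud u0).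
by rewrite /quott [u *: 1]mulr1 [u + t]addrC [_^-1 *: _]mulrC.
Qed.

Lemma oder_interior f t a : 0 < t -> oder f t a -> hder f t a.
Proof.
move=> t0 /sideP H.
have hl : (fun h : R => h^-1 *: ((f \o shift t) (h *: (1 : R)) - f t)) @ 0^' --> a.
  apply/cvgrPdist_lt => e e0; have [d d0 Hd] := H e e0.
  apply/nbhs_ballP; exists (Num.min d t) => /=; first by rewrite lt_min d0.
  move=> u; rewrite /ball /= sub0r normrN lt_min => /andP[ud ut] u0.
  have := Hd u u0; rewrite /quott [u *: 1]mulr1 [u + t]addrC [_^-1 *: _]mulrC; apply => //.
  by move: ut; rewrite ltr_norml => /andP[h1 _]; lra.
apply: DeriveDef; first by apply/cvg_ex; exists a.
by rewrite /derive; apply/cvg_lim.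
Qed.

(** With [q] the quotient of [f], the remainder [(expR (q h) - 1 - q h) / h] is at most
    [2 |q| |q h|] for small [h], and this tends to [0] because [q] converges. *)
Lemma oder_exp f t a : oder f t a -> oder (fun u => expR (f u)) t (expR (f t) * a).
Proof.
move=> ha; pose q h := quott f t h; pose rem h := (expR (q h * h) - 1 - q h * h) / h.
apply: (side_eq _ (fun h => expR (f t) * (q h + rem h))).
  move=> h h0 _; rewrite /rem /quott; have -> : f (t + h) = f t + q h * h by rewrite /q /quott divfK//; ring.
  by rewrite expRD; field.
rewrite -[X in expR (f t) * X]addr0; apply: cvgM; first exact: cvg_cst.
apply: cvgD => //; have hq : q h * h @[h --> side t] --> (0 : R).
  rewrite -(mulr0 a); apply: cvgM => //; apply: (side_eq _ (fun h => 1 * h)); first by move=> h _ _; rewrite mul1r.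
  exact: side0.
have hq2 : 2 * (`|q h| * `|q h * h|) @[h --> side t] --> (0 : R).
  rewrite (_ : (0 : R) = 2 * (`|a| * `|0 : R|)); last by rewrite normr0 !mulr0.
  apply: cvgM; first exact: cvg_cst.
  by apply: cvgM; apply: cvg_norm.
move/sideP: hq2 => hq2; move/sideP: hq => hq; apply/sideP => e e0.
have [d1 d10 H1] := hq2 e e0; have [d2 d20 H2] := hq 2^-1 (ltac:(by rewrite invr_gt0)).
exists (Num.min d1 d2); first by rewrite lt_min d10.
move=> h h0 th; rewrite lt_min => /andP[hd1 hd2]; have := H1 h h0 th hd1; have := H2 h h0 th hd2.
rewrite !sub0r !normrN => k2 k1; apply: le_lt_trans k1.
rewrite [leRHS]ger0_norm ?mulr_ge0// /rem (normrM _ h^-1) normfV ler_pdivrMr ?normr_gt0//.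
have k3 : q h * h <= 2^-1 by apply: le_trans (ler_norm _) _; exact: ltW.
rewrite ger0_norm; last by have := expR_ge1Dx (q h * h); lra.
apply: le_trans (expR_quad _ k3) _.
have -> : (q h * h) ^+ 2 = `|q h| * `|q h * h| * `|h| by rewrite -real_normK ?num_real// expr2 {1}normrM; ring.
by rewrite !mulrA.
Qed.

Lemma oder_lim f t a : 0 <= t -> oder f t a -> lim (quott f t @ within [set h | 0 <= t + h] (0 : R)^') = a.
Proof. by move=> t0 h; have P := side_proper t t0; apply/cvg_lim. Qed.

Lemma derivable_t_oder f t : 0 <= t -> derivable_t f t ->
  oder f t (lim (quott f t @ within [set h | 0 <= t + h] (0 : R)^')).
Proof. by move=> t0; rewrite /derivable_t. Qed.

(** At positive times the derivative is two-sided and the mean value theorem applies; continuity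
    extends the bound to time [0]. *)
Lemma oder_lip f f' (K : R) : (forall t, 0 <= t -> oder f t (f' t)) -> (forall t, 0 <= t -> `|f' t| <= K) ->
  forall u v, 0 <= u -> 0 <= v -> `|f u - f v| <= K * `|u - v|.
Proof.
move=> Hf HK.
have pos u v : 0 < u -> u < v -> `|f v - f u| <= K * `|v - u|.
  move=> u0 uv; have [c [/andP[c1 c2] ->]] := MVT_seg f f' u v uv
    (fun x hx => oder_interior _ _ _ (lt_le_trans u0 (proj1 (andP hx))) (Hf x (le_trans (ltW u0) (proj1 (andP hx))))).
  by rewrite normrM ler_wpM2r// HK//; lra.
have zero v : 0 < v -> `|f v - f 0| <= K * `|v - 0|.
  move=> v0; have P := side_proper 0 (lexx 0).
  have c1 : `|f v - f (0 + h)| @[h --> side 0] --> `|f v - f 0|.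
    by apply: cvg_norm; apply: cvgB; [exact: cvg_cst|exact: oder_cont (Hf 0 (lexx 0))].
  have c2 : K * `|v - h| @[h --> side 0] --> K * `|v - 0|.
    apply: cvgM; first exact: cvg_cst.
    apply: cvg_norm; apply: cvgB; first exact: cvg_cst.
    by apply: (side_eq _ (fun h => 1 * h)); [move=> h _ _; rewrite mul1r|exact: side0].
  apply: (ler_cvg_to c1 c2); apply/near_side; exists v => // h h0 th hv.
  rewrite add0r in th *; have hp : 0 < h by rewrite lt_neqAle eq_sym h0.
  by apply: pos => //; apply: le_lt_trans hv; exact: ler_norm.
have lt u v : 0 <= u -> u < v -> `|f v - f u| <= K * `|v - u|.
  by rewrite le_eqVlt => /orP[/eqP <-|]; [exact: zero|exact: pos].
move=> u v u0 v0; have [->|uv] := eqVneq u v; first by rewrite !subrr normr0 mulr0.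
have [vu|vu] := ltP v u; first exact: lt.
by rewrite distrC (distrC u); apply: lt => //; rewrite lt_neqAle uv.
Qed.

(** A failure of convergence would provide increments below [1/(n+1)] along which [G] stays away
    from [l]. This brings dominated convergence, a statement on sequences, to the filter [side]. *)
Lemma side_seq t (G : R -> R) (l : R) :
  (forall hs : nat -> R, (forall n, hs n != 0 /\ 0 <= t + hs n) -> hs n @[n --> \oo] --> 0 -> G (hs n) @[n --> \oo]
    --> l) ->
  G h @[h --> side t] --> l.
Proof.
move=> H; apply/sideP => e e0; apply: contrapT => /forall2NP hn.
have hk n : exists h : R, [/\ h != 0, 0 <= t + h, `|h| < n.+1%:R^-1 & e <= `|l - G h|].
  have [n0|] := hn n.+1%:R^-1; first by case: n0; rewrite invr_gt0.
  move=> /existsNP[h] /not_implyP[h0] /not_implyP[th] /not_implyP[hd] /negP; rewrite -leNgt => hg.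
  by exists h.
have [hs Hs] := choice hk.
have c0 : hs n @[n --> \oo] --> 0.
  apply/cvgrPdist_lt => d d0; near=> n; rewrite sub0r normrN; have [_ _ h1 _] := Hs n; apply: lt_trans h1 _.
  by near: n; exact: near_infty_natSinv_lt (PosNum d0).
have := H hs (fun n => let: And4 a b _ _ := Hs n in conj a b) c0.
move=> /cvgrPdist_lt /(_ e e0)[N _ /(_ N (leqnn N))] /=.
by have [_ _ _] := Hs N; rewrite ltNge => ->.
Unshelve. all: by end_near.
Qed.

End onesided.

Section time_derivative.
Context {R : realType}.
Variables (rho_m B : R).
Hypothesis (B1 : 1 <= B).
Notation adm := (@regime R rho_m B).

Definition at_time (i : config R) (u : R) : config R :=
  Config R (c_d i) (c_v i) (c_s i) (c_W i) (c_F i) u.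

Lemma oder_tE (s : R) (W : wave R) x t : sm 2 (wE W) ->
  oder (fun u => tE s W u x) t (- s * derive1 (wE W) (x.1 - s * t)).
Proof.
move=> h; have [dE _] := sm_derive1 _ _ h; apply: oder_hder.
have h1 : hder (fun u => x.1 - s * u) t (0 - s * 1) by apply: dB; [exact: dcst|apply: dZ; exact: did].
by apply: hder_eq (dcomp _ _ _ _ _ (dE _) h1) _; ring.
Qed.

Lemma oder_H (s : R) (W : wave R) (F : flow R) x t : 0 <= t -> sm 2 (wE W) -> derivable_t (fE F ^~ x) t ->
  oder (fun u => H s W F u x) t (dt (fE F) t x + s * derive1 (wE W) (x.1 - s * t)).
Proof.
move=> t0 h d; have := oderD _ _ _ _ _ (derivable_t_oder _ _ t0 d) (oderZ (-1) _ _ _ (oder_tE s W x t h)).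
rewrite (_ : -1 * (- s * derive1 (wE W) (x.1 - s * t)) = s * derive1 (wE W) (x.1 - s * t)); last by ring.
by apply: oder_ext => // u _; rewrite /H mulN1r.
Qed.

Lemma HtE (s : R) (W : wave R) (F : flow R) x t : 0 <= t -> sm 2 (wE W) -> derivable_t (fE F ^~ x) t ->
  Ht s W F t x = dt (fE F) t x + s * derive1 (wE W) (x.1 - s * t).
Proof. by move=> t0 h d; apply: oder_lim => //; exact: oder_H. Qed.

Variable i : config R.
Hypothesis adm_t : forall u, 0 <= u -> adm (at_time i u).
Hypothesis der_t : forall u x, 0 <= u -> derivable_t (fE (c_F i) ^~ x) u.

Lemma oder_N2 x u : 0 <= u -> oder (fun u => N2f (at_time i u) x) u (N2tf (at_time i u) x).
Proof.
move=> u0; have [_ _ sE] := reg_sm _ _ _ (adm_t u u0).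
have sE2 : sm 2 (wE (c_W i)) by exact: (sm_le 2 5).
have hE := oder_exp _ _ _ (oder_tE (c_s i) (c_W i) x u sE2).
have hH := oder_H (c_s i) (c_W i) (c_F i) x u u0 sE2 (der_t u x u0).
rewrite -HtE// in hH; last exact: der_t.
have h1 := oderD _ _ _ _ _ (oderD _ _ _ _ _ (oder_exp _ _ _ hH) (oder_cst (-1) u)) (oderZ (-1) _ _ _ hH).
have h2 := oderM _ _ _ _ _ hE h1.
set a := (X in oder _ _ X) in h2.
have -> : N2tf (at_time i u) x = a.
  rewrite /a /N2tf /Ee /Ee1 /Hf /Htf /tE /=; ring.
apply: (oder_ext _ _ _ _ _ u0 h2) => v v0.
by rewrite /N2f /Hf /Ee /tE /= mulN1r.
Qed.

(** The constant of [osc_N2t] is uniform over configurations, hence over time; it will dominate the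
    difference quotients. *)
Lemma N2tf_bound : exists K : R, forall u x, 0 <= u -> Omega x -> `|N2tf (at_time i u) x| <= K.
Proof.
have [C [C0 HC]] := osc_N2t rho_m B B1; exists (C * 1) => u x u0 Ox.
by have [c Hc] := HC _ (adm_t u u0); have [] := Hc x Ox.
Qed.

Lemma N2f_cont u : 0 <= u -> continuous (N2f (at_time i u)).
Proof. by move=> u0; apply: (Ck_cont 2); exact: (Cper_N2 rho_m B _ (adm_t u u0)).1. Qed.

(** Dominated convergence, along sequences of increments: the difference quotients of [N2] are bounded on Omega. *)
Lemma dt_N2neq u : 0 <= u -> N2neqt (c_s i) (c_W i) (c_F i) u = neq (N2tf (at_time i u)).
Proof.
move=> u0; apply/funext => -[a x']; rewrite /N2neqt /dt; apply: oder_lim => //.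
have [K HK] := N2tf_bound.
have cG : continuous (N2tf (at_time i u)) by exact: (N2tf_cont _ _ _ (adm_t u u0)).
pose qf h (y : R * R) := quott (fun v => N2f (at_time i v) (a, y)) u h.
have cq h : 0 <= u + h -> continuous (qf h).
  move=> uh y; apply: cvgM; last exact: cvg_cst.
  by apply: cvgB; [exact: (continuous_pair1 _ _ (N2f_cont _ uh))|exact: (continuous_pair1 _ _ (N2f_cont _ u0))].
have qK h y : h != 0 -> 0 <= u + h -> T2 y -> `|qf h y| <= K.
  move=> h0 uh Ty; have := oder_lip _ _ K (fun v v0 => oder_N2 (a, y) v v0) (fun v v0 => HK v (a, y) v0 (conj Logic.I
    Ty)) (u + h) u uh u0.
  rewrite (_ : u + h - u = h); last by ring.
  by rewrite /qf /quott normrM normfV ler_pdivrMr ?normr_gt0.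
have mean_q : (fun h => \int[mu2]_(y in T2) qf h y) h @[h --> side u] --> \int[mu2]_(y in T2) N2tf (at_time i u) (a,
  y).
  apply: side_seq => hs Hs h0.
  have cs n : continuous (qf (hs n)) by apply: cq; exact: (Hs n).2.
  have cG2 : continuous (fun y => N2tf (at_time i u) (a, y)) by exact: continuous_pair1.
  have K0 : (mu2.-integrable T2 (EFin \o (fun _ : R * R => K))) by apply: integrable_T2 => y; exact: cvg_cst.
  have ptw y : (qf (hs n) y)%:E @[n --> \oo] --> (N2tf (at_time i u) (a, y))%:E.
    apply: cvg_EFin; first by apply: nearW.
    have /sideP H := oder_N2 (a, y) u u0.
    apply/cvgrPdist_lt => e e0; have [d d0 Hd] := H e e0.
    move/cvgrPdist_lt: h0 => /(_ d d0) [N _ HN]; exists N => // n /= Nn.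
    by have [n1 n2] := Hs n; have := HN n Nn; rewrite /= sub0r normrN => hd; exact: Hd.
  have mS (g : R * R -> R) : continuous g -> measurable_fun (T2 : set (measurableTypeR R * measurableTypeR R)) (EFin
    \o g).
    by move=> cg; apply/measurable_EFinP; apply: measurable_funTS; exact: continuous_measurable2.
  have [||_ _ dc] := @dominated_convergence _ _ _ (@mu2 R) T2 measurable_T2 (fun n => EFin \o qf (hs n))
    (EFin \o (fun y => N2tf (at_time i u) (a, y))) (EFin \o (fun=> K)) (fun n => mS _ (cs n)) (mS _ cG2) _ K0 _.
  - by apply/aeW => y _; exact: ptw.
  - by apply/aeW => y n Ty /=; rewrite lee_fin; have [n1 n2] := Hs n; exact: qK.
  move: dc; rewrite /= -(avgE _ cG2) => dc.
  have dc' : (\int[mu2]_(y in T2) qf (hs n) y)%:E @[n --> \oo] --> (\int[mu2]_(y in T2) N2tf (at_time i u) (a, y))%:E.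
    by apply: cvg_trans dc; apply: near_eq_cvg; apply: nearW => n; rewrite /= (avgE _ (cs n)).
  by have [_] := (fine_cvgP _ _).1 dc'.
have hq : qf h x' - \int[mu2]_(y in T2) qf h y @[h --> side u] -->
    N2tf (at_time i u) (a, x') - \int[mu2]_(y in T2) N2tf (at_time i u) (a, y).
  by apply: cvgB; [exact: (oder_N2 (a, x') u u0)|exact: mean_q].
apply: side_eq hq => h h0 uh; rewrite /qf /quott /= /N2neq /neq /=.
have c1 : continuous (fun y => N2f (at_time i (u + h)) (a, y)) by apply: continuous_pair1; exact: N2f_cont.
have c2 : continuous (fun y => N2f (at_time i u) (a, y)) by apply: continuous_pair1; exact: N2f_cont.
have -> : \int[mu2]_(y in T2) ((N2f (at_time i (u + h)) (a, y) - N2f (at_time i u) (a, y)) / h) =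
  (\int[mu2]_(y in T2) N2f (at_time i (u + h)) (a, y) - \int[mu2]_(y in T2) N2f (at_time i u) (a, y)) / h.
  rewrite -avgB// [RHS]mulrC -avgZ; last by move=> y; apply: cvgB; [exact: c1|exact: c2].
  by congr Rintegral; apply/funext => y; rewrite mulrC.
have r (p q m n : R) : (p - q) / h - (m - n) / h = (p - m - (q - n)) / h by field.
exact: r.
Qed.

End time_derivative.

(** * The regime of the theorem *)

Lemma Cper_shift {R : realType} n (g : R -> R) (c : R) : sm n g -> Cper n (fun x => g (x.1 - c)).
Proof. by move=> h; apply: (Cper_fst_sm n (fun y => g (y - c))); exact: sm_shift. Qed.

Lemma CperB {R : realType} n (f g : R * (R * R) -> R) : Cper n f -> Cper n g -> Cper n (fun x => f x - g x).
Proof. by move=> hf hg; exact: (CperD _ _ _ hf (CperN _ _ hg)). Qed.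

Lemma Cper_Cn {R : realType} n (f : R * (R * R) -> R) : Cn n f -> torus_periodic f -> Cper n f.
Proof. by move=> /CkP. Qed.

Lemma profile_sm {R : realType} (T : R) (Sh : shock R) (W : wave R) n : is_profile T Sh W ->
  [/\ sm n (wrho W), sm n (wu W) & sm n (wE W)].
Proof.
move=> [[sr sm_ sE r0] _ _ _ _]; split; [exact: smooth1_sm|apply: smM; first exact: smooth1_sm|exact: smooth1_sm].
by apply: sm_inv => //; exact: smooth1_sm.
Qed.

Lemma dt_periodic {R : realType} (E : R -> R * (R * R) -> R) (t : R) : 0 <= t ->
  (forall u, 0 <= u -> torus_periodic (E u)) -> (forall x, derivable_t (E ^~ x) t) -> torus_periodic (dt E t).
Proof.
move=> t0 pE dE x1 x2 x3; split; rewrite {1}/dt; apply: oder_lim => //.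
  by apply: (oder_ext (E ^~ (x1, (x2, x3)))) => // [u u0|]; [have [-> _] := pE u u0 x1 x2 x3|exact: derivable_t_oder].
by apply: (oder_ext (E ^~ (x1, (x2, x3)))) => // [u u0|]; [have [_ ->] := pE u u0 x1 x2 x3|exact: derivable_t_oder].
Qed.

Lemma sqrte_le_sqr {R : realType} (x : \bar R) (y : R) : (0 <= x)%E -> (sqrte x <= y%:E)%E -> (x <= (y ^+ 2)%:E)%E.
Proof.
case: x => [r| |]//=; rewrite !lee_fin => r0 h.
by rewrite -[leLHS](sqr_sqrtr r0) lerXn2r ?nnegrE ?sqrtr_ge0//; exact: le_trans h.
Qed.

Lemma Hnorm_weak {R : realType} k (fs : seq (R * (R * R) -> R)) (v : R) f s : (Hnorm k fs <= v%:E)%E ->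
  List.In f fs -> (size s <= k)%N -> (weak_derivsq s f <= (v ^+ 2)%:E)%E.
Proof.
move=> h fI sk; apply: le_trans (weak_derivsq_le_Hsq k s f sk) _.
apply: le_trans (sume_ge_In fs (Hsq k) f (Hsq_ge0 k) fI) _.
by apply: sqrte_le_sqr h; apply: sume_ge0 => g _; exact: Hsq_ge0.
Qed.

(** The embedding asks for a positive bound whereas [v] may vanish: it is applied to [v + e / Cs]
    with [e] arbitrary. *)
Lemma good_of_weak {R : realType} (Cs B v : R) (f : R * (R * R) -> R) : 0 < Cs ->
  (forall (f : R * (R * R) -> R) (M : R), Cper 1 f -> 0 < M ->
    (forall s, (size s <= 4)%N -> (weak_derivsq s f <= (M ^+ 2)%:E)%E) ->
    forall x, Omega x -> `|f x| <= Cs * M /\ forall i, `|pd i f x| <= Cs * M) ->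
  Cs <= B -> 0 <= v -> Cper 2 f -> (forall s, (size s <= 4)%N -> (weak_derivsq s f <= (v ^+ 2)%:E)%E) -> good B v f.
Proof.
move=> Cs0 HS CsB v0 Cf Hf.
have key x e : Omega x -> 0 < e -> `|f x| <= Cs * v + e /\ forall k, `|pd k f x| <= Cs * v + e.
  move=> Ox e0; have ec : 0 < e / Cs by rewrite divr_gt0.
  have -> : Cs * v + e = Cs * (v + e / Cs) by field; rewrite gt_eqF.
  apply: HS => //; [exact: Cper_le Cf|by rewrite ltr_wpDl|].
  move=> s s4; apply: le_trans (Hf s s4) _; rewrite lee_fin lerXn2r ?nnegrE//; last by rewrite lerDl ltW.
  by rewrite addr_ge0// ltW.
have CB : Cs * v <= B * v by rewrite ler_wpM2r.
split => //.
- move=> x Ox; split=> [|k]; apply: le_trans CB; apply/ler_addgt0Pr => e e0; have [h1 h2] := key x e Ox e0; [exact: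
  h1|exact: h2].
- move=> k l; have <- : weak_derivsq [:: k; l] f = L2sq (pd l (pd k f)) by rewrite weak_derivsqE.
  exact: Hf.
Qed.

Lemma NN_le {R : realType} (s : R) (W : wave R) (F : flow R) (t v : R) : 0 <= t -> (NN s W F t <= v%:E)%E ->
  [/\ (0 <= v)%R, Hnorm 4 (z s W F t :: rcons (comps (w s W F t)) (Ht s W F t)) <= v%:E & Hnorm 5 [:: H s W F t] <=
    v%:E]%E.
Proof.
move=> t0 h; have le : (L2norm1 [:: Z s W F t; Rr s W F t] + Hnorm 4 (z s W F t :: rcons (comps (w s W F t)) (Ht s W
  F t))
    + Hnorm 5 [:: H s W F t] <= v%:E)%E.
  by apply: le_trans h; apply: ereal_sup_ubound; exists t => //=; rewrite in_itv /= t0 lexx.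
have a0 : (0 <= L2norm1 [:: Z s W F t; Rr s W F t])%E by exact: sqrte_ge0.
have b0 : (0 <= Hnorm 4 (z s W F t :: rcons (comps (w s W F t)) (Ht s W F t)))%E by exact: sqrte_ge0.
have c0 : (0 <= Hnorm 5 [:: H s W F t])%E by exact: sqrte_ge0.
split.
- by rewrite -lee_fin; apply: le_trans le; rewrite !adde_ge0.
- by apply: le_trans le; apply: le_trans (leeDl _ c0); exact: leeDr.
- by apply: le_trans le; apply: leeDr; exact: adde_ge0.
Qed.

Lemma In_rcons {T : Type} (x y : T) (s : seq T) : List.In x (rcons s y) <-> List.In x s \/ x = y.
Proof.
elim: s => [|a s IH] /=; first by split => [[->|//]|[//|->]]; [right|left].
rewrite IH; split => [[->|[h|->]]|[[->|h]|->]]; [by left; left|by left; right|by right|by left|by right; left|by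
  right; right].
Qed.

Lemma regime_of {R : realType} (T rho_m C0 Cs B delta nu : R) (Sh : shock R) (W : wave R) (F : flow R) (t : R) :
  0 < Cs ->
  (forall (f : R * (R * R) -> R) (M : R), Cper 1 f -> 0 < M ->
    (forall s, (size s <= 4)%N -> (weak_derivsq s f <= (M ^+ 2)%:E)%E) ->
    forall x, Omega x -> `|f x| <= Cs * M /\ forall i, `|pd i f x| <= Cs * M) ->
  C0 <= B -> Cs <= B -> 0 < delta <= 1 -> 0 <= nu <= 1 -> B * nu <= 2^-1 -> B * nu <= rho_m / 4 ->
  [/\ `|speed Sh| <= C0, forall y, rho_m / 2 <= wrho W y <= 2 * rho_m,
   forall k y, (k <= 4)%N -> `|derive1n k (derive1 (wrho W)) y| <= C0 * delta,
   forall k y, (k <= 5)%N -> `|derive1n k (wu W) y| <= C0 * delta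
   & (forall y, `|wE W y| <= C0) /\ forall k y, (k <= 4)%N -> `|derive1n k (derive1 (wE W)) y| <= C0 * delta] ->
  is_profile T Sh W -> is_solution T F -> (forall u : R, 0 <= u -> (NN (speed Sh) W F u <= (nu / 2)%:E)%E) ->
  0 <= t -> regime rho_m B (Config R delta nu (speed Sh) W F t).
Proof.
move=> Cs0 HS C0B CsB d01 v01 Bv1 Bv2 [hs hr hdr hu [hE hdE]] hW hF hN t0.
have /andP[d0 d1] := d01; have /andP[v0 v1] := v01.
have CdB : C0 * delta <= B * delta by rewrite ler_wpM2r// ltW.
have [sr su sE] := profile_sm _ _ _ 5 hW.
have [[pr pE pu] [cr cE cdE cu] pos _] := hF t t0.
have [v2 n4 n5] := NN_le _ _ _ _ _ t0 (hN t t0).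
have v2v : (nu / 2) ^+ 2 <= nu ^+ 2 by rewrite lerXn2r ?nnegrE//; lra.
have G f : Cper 2 f -> (exists k fs, [/\ (4 <= k)%N, (Hnorm k fs <= (nu / 2)%:E)%E & List.In f fs]) -> good B nu f.
  move=> Cf [k [fs [k4 hn fI]]]; apply: (good_of_weak Cs) => // s s4.
  by apply: le_trans (Hnorm_weak _ _ _ _ _ hn fI (leq_trans s4 k4)) _; rewrite lee_fin.
have dH x : derivable_t (fE F ^~ x) t by have [] := pos x.
have sE2 : sm 2 (wE W) by exact: (sm_le 2 5).
split; rewrite /c_d /c_v /c_s /c_W /c_F /c_t.
- exact: d01.
- exact: v01.
- by split.
- exact: le_trans hs C0B.
- by split.
- exact: hr.
- by move=> k y k4; apply: le_trans (hdr k y k4) CdB.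
- by move=> k y k4; apply: le_trans (hu k y k4) CdB.
- by move=> y; apply: le_trans (hE y) C0B.
- by move=> k y k4; apply: le_trans (hdE k y k4) CdB.
- by split; [exact: pr|move=> x; have [] := pos x].
- apply: G; last by exists 4%N; eexists; split; [|exact: n4|left].
  by apply: CperB; [exact: (Cper_Cn _ _ cr pr)|apply: (Cper_shift 2 (wrho W)); exact: (sm_le 2 5)].
- move=> j; apply: G.
    apply: (CperB 2 (fu F t j)); first exact: (Cper_Cn _ _ (cu j) (pu j)).
    rewrite /tu; case: (j == 0); last exact: Cper_cst.
    by apply: (Cper_shift 2 (wu W)); exact: (sm_le 2 5).
  exists 4%N; eexists; split; [by []|exact: n4|right].
  by apply/In_rcons; left; exact: (In_comps (w (speed Sh) W F t)).
- apply: G; last by exists 5%N; eexists; split; [|exact: n5|left].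
  by apply: CperB; [exact: (Cper_Cn _ _ cE pE)|apply: (Cper_shift 2 (wE W)); exact: (sm_le 2 5)].
- apply: G; last by exists 4%N; eexists; split; [|exact: n4|right; apply/In_rcons; right].
  (* [Ht] is the time derivative of the full potential, whose regularity in [x] belongs to the
     notion of solution, plus a smooth term from the moving profile. *)
  rewrite /Htf /=; have -> : Ht (speed Sh) W F t = fun x => dt (fE F) t x + speed Sh * derive1 (wE W) (x.1 - speed Sh
    * t).
    by apply/funext => x; exact: HtE.
  apply: CperD; first apply: Cper_Cn => //.
    by apply: dt_periodic => // u u0; have [[]] := hF u u0.
  apply: (Cper_shift 2 (fun y => speed Sh * derive1 (wE W) y)); apply: smZ.
  by have [_ h] := sm_derive1 _ _ sE; exact: (sm_le 2 4).
Qed.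

Lemma le_cst_mule {R : realType} (C D w : R) (X Q : \bar R) : 0 <= w -> C <= D -> (0 <= Q)%E ->
  (X <= (C * w)%:E * Q)%E -> (X <= (D * w)%:E * Q)%E.
Proof. by move=> w0 CD Q0 h; apply: le_trans h _; rewrite lee_wpmul2r// lee_fin ler_wpM2r. Qed.

Theorem lemma6p1 (R : realType) (T rho_m c0 c1 : R)
    (T_gt0 : 0 < T) (rho_m_gt0 : 0 < rho_m) (c0_gt0 : 0 < c0) (c1_gt0 : 0 < c1) :
  exists C delta0 nu_star : R, [/\ 0 < C, 0 < delta0, 0 < nu_star
  & forall (delta nu1 nu : R) (Sh : shock R) (W : wave R) (F : flow R),
    0 < delta <= delta0 -> 0 < nu1 <= nu_star ->
    is_shock T Sh -> rhom Sh = rho_m -> `|rhop Sh - rhom Sh| <= delta ->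
    is_profile T Sh W ->
    is_solution T F -> is_perturbation (speed Sh) W F ->
    zero_mass (speed Sh) W F ->
    (nu0 (speed Sh) W F <= nu1%:E)%E ->
    (NN (speed Sh) W F 0 <= c0%:E * nu0 (speed Sh) W F)%E ->
    nu%:E = (c1%:E * NN (speed Sh) W F 0)%E ->
    (forall t : R, 0 <= t -> (NN (speed Sh) W F t <= (nu / 2)%:E)%E) ->
    forall t : R, 0 <= t ->
    let zn := zneq (speed Sh) W F t in
    let wn := comps (wneq (speed Sh) W F t) in
    let Hn := Hneq (speed Sh) W F t in
    let Htn := Htneq (speed Sh) W F t in
    let h1n := comps (h1neq (speed Sh) W F t) in
    let h2n := comps (h2neq T (speed Sh) W F t) in
    let N2n := N2neq (speed Sh) W F t in
    let N2nt := N2neqt (speed Sh) W F t in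
    [/\ (Hnorm 1 (comps (J1 (speed Sh) W F t))
           <= (C * (delta + nu))%:E * L2norm (grad (zn :: wn)))%E,
        (L2norm h1n <= (C * (delta + nu))%:E * L2norm (grad wn))%E /\
        (Hnorm 1 h1n
           <= (C * (delta + nu))%:E * L2norm (grad wn ++ grad (grad wn)))%E,
        (Hnorm 1 h2n <= (C * delta)%:E * L2norm (grad (zn :: wn)))%E /\
        (Hnorm 2 h2n <= (C * delta)%:E * Hnorm 1 (grad (zn :: wn)))%E,
        (Hnorm 1 [:: N2n] <= (C * (delta + nu))%:E * L2norm (grad [:: Hn]))%E /\
        (Hnorm 2 [:: N2n] <= (C * (delta + nu))%:E * Hnorm 1 (grad [:: Hn]))%E
      & (L2norm [:: N2nt]
           <= (C * (delta + nu))%:E * L2norm (grad [:: Hn; Htn]))%E]].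

Proof.
have [C0 [d0 [C00 d00 d01 HP]]] := profile_bounds T rho_m T_gt0 rho_m_gt0.
have [Cs [Cs0 HS]] := @sobolev_sup R.
pose B := 1 + C0 + Cs.
have B1 : 1 <= B by rewrite /B; lra.
have B0 : 0 < B by lra.
have C0B : C0 <= B by rewrite /B; lra.
have CsB : Cs <= B by rewrite /B; lra.
have [A1 [A10 E1]] := J1_est rho_m B B1.
have [A2 [A20 E2]] := h1_est0 rho_m B B1.
have [A3 [A30 E3]] := h1_est1 rho_m B B1.
have [A4 [A40 E4]] := h2_est1 T rho_m B rho_m_gt0 B1.
have [A5 [A50 E5]] := h2_est2 T rho_m B rho_m_gt0 B1.
have [A6 [A60 E6]] := N2_est1 rho_m B B1.
have [A7 [A70 E7]] := N2_est2 rho_m B B1.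
have [A8 [A80 E8]] := N2t_est rho_m B B1.
pose A := 1 + A1 + A2 + A3 + A4 + A5 + A6 + A7 + A8.
have [g1 g2 g3 g4 [g5 g6 g7 g8 gA]] : [/\ A1 <= A, A2 <= A, A3 <= A, A4 <= A & [/\ A5 <= A, A6 <= A, A7 <= A, A8 <= A
  & 0 < A]].
  by rewrite /A; clear -A10 A20 A30 A40 A50 A60 A70 A80; split; [lra..|split; lra].
(* [nu D <= 1] yields at once [nu <= 1], [B nu <= 1/2] and [B nu <= rho_m / 4], one from each
   summand. *)
pose D := 1 + 2 * B + 4 * B / rho_m.
have q0 : 0 < 4 * B / rho_m by rewrite divr_gt0// mulr_gt0.
have D0 : 0 < D by rewrite /D; lra.
have c0c1 : 0 < c0 * c1 by rewrite mulr_gt0.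
(* [nu] is [c1] times the initial size, itself at most [c0 nu1]; dividing by [c0 c1] gives
   [nu <= D^-1]. *)
exists A, d0, (D^-1 / (c0 * c1)); split => //; [by rewrite divr_gt0// invr_gt0|].
move=> delta nu1 nu Sh W F hd hnu1 hS hrm hrp hW hF hP hz hn0 hN0 hnu hN t t0.
have /andP[dp dd0] := hd.
have [nu2 _ _] := NN_le _ _ _ _ _ (lexx 0) (hN 0 (lexx 0)).
have nu_ge0 : 0 <= nu by move: nu2; lra.
have nuD : nu <= D^-1.
  have h : (nu%:E <= (c1 * (c0 * nu1))%:E)%E.
    rewrite hnu !EFinM; apply: lee_wpmul2l; first by rewrite lee_fin ltW.
    by apply: le_trans hN0 _; apply: lee_wpmul2l => //; rewrite lee_fin ltW.
  rewrite lee_fin in h; apply: le_trans h _.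
  have /andP[_ h] := hnu1; rewrite (_ : D^-1 = c1 * (c0 * (D^-1 / (c0 * c1)))).
    by rewrite !ler_pM2l.
  by field; rewrite !gt_eqF.
have Dm : nu * D <= 1 by rewrite -ler_pdivlMr// div1r.
have nuB : 0 <= nu * B by rewrite mulr_ge0// ltW.
have nuBq : 0 <= nu * (4 * B / rho_m) by rewrite mulr_ge0// ltW.
have DE : nu * D = nu + 2 * (nu * B) + nu * (4 * B / rho_m) by rewrite /D; ring.
have adm_t u : 0 <= u -> regime rho_m B (Config R delta nu (speed Sh) W F u).
  move=> u0; apply: (regime_of T rho_m C0 Cs B delta nu Sh W F u) => //.
  - by apply/andP; split => //; exact: le_trans d01.
  - by apply/andP; split => //; clear -DE Dm nuB nuBq; lra.
  - by rewrite mulrC; clear -DE Dm nu_ge0 nuBq; lra.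
  - have h : nu * (4 * B / rho_m) <= 1 by clear -DE Dm nu_ge0 nuB; lra.
    have := ler_wpM2r (ltW rho_m_gt0) h.
    have -> : nu * (4 * B / rho_m) * rho_m = 4 * (B * nu) by field; rewrite gt_eqF.
    by clear; lra.
  - by apply: HP => //; rewrite dp.
have ai := adm_t t t0.
have der u x : 0 <= u -> derivable_t (fE F ^~ x) u by move=> u0; have [_ _ h _] := hF u u0; have [] := h x.
have dn_ge0 : 0 <= delta + nu by rewrite addr_ge0// ltW.
have NE := dt_N2neq rho_m B B1 (Config R delta nu (speed Sh) W F t) adm_t der t t0.
split.
- by apply: (le_cst_mule A1) (E1 _ ai) => //; exact: sqrte_ge0.
- by split; [apply: (le_cst_mule A2) (E2 _ ai)|apply: (le_cst_mule A3) (E3 _ ai)] => //; exact: sqrte_ge0.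
- by split; [apply: (le_cst_mule A4) (E4 _ ai)|apply: (le_cst_mule A5) (E5 _ ai)] => //; [exact: ltW|exact:
  sqrte_ge0|exact: ltW|exact: sqrte_ge0].
- by split; [apply: (le_cst_mule A6) (E6 _ ai)|apply: (le_cst_mule A7) (E7 _ ai)] => //; exact: sqrte_ge0.
- cbv zeta; rewrite [N2neqt _ _ _ _]NE.
  by apply: (le_cst_mule A8) (E8 _ ai) => //; exact: sqrte_ge0.
Qed.
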